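(* Let $n\ge2$, $1\le p<n/(n-1)$, $f\in L^p(\mathbb{R}^n)$, and $F=Pf$. Let $\ell$ be an integer with $\ell=n-1$ if $n$ is even, and $\ell>n-1$ arbitrary if $n$ is odd. Define $$g(x)=\pi^{1-n}\int_{\mathbb{R}^{n-1}}F(z',\,x_n-2z'\cdot x'+|z'|^2)\,\frac{dz'}{(1+4|z'|^2)^{(n-1)/2}},\qquad x=(x',x_n)\in\mathbb{R}^n.$$ Then $f$ can be reconstructed from $F$ by the formula $$f(x)=\frac{1}{d_{n,\ell}(n-1)}\int_{\mathbb{R}^n}\frac{(\Delta_y^\ell g)(x',\,x_n+|x'|^2)}{|y|^{2n-1}}\,dy,$$ where the integral means the limit $\lim_{\varepsilon\to0}\int_{|y|>\varepsilon}$ of the truncated integrals $$\int_{|y|>\varepsilon}\frac{(\Delta_y^\ell g)(u)}{|y|^{2n-1}}\,dy,\qquad u\in\mathbb{R}^n,$$ evaluated at $u=(x',x_n+|x'|^2)$. This limit, as a limit of functions of $u$, exists in the $L^p(\mathbb{R}^n)$-norm and almost everywhere; if the function $\psi(u)=f(u',u_n-|u'|^2)$ belongs to $C_0(\mathbb{R}^n)\cap L^p(\mathbb{R}^n)$, it also exists in the sup-norm.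
   Context: Points of $\mathbb{R}^n$ are written $x=(x',x_n)$, $x'\in\mathbb{R}^{n-1}$. The parabolic Radon transform is $$(Pf)(x)=\int_{\mathbb{R}^{n-1}}f(x'-y',\,x_n-|y'|^2)\,dy',\qquad x\in\mathbb{R}^n.$$ The finite difference of order $\ell$ with step $y\in\mathbb{R}^n$ is $(\Delta_y^\ell g)(x)=\sum_{j=0}^{\ell}\binom{\ell}{j}(-1)^j g(x-jy)$. The normalizing constant is $$d_{n,\ell}(n-1)=\int_{\mathbb{R}^n}\frac{(1-e^{iy_1})^\ell}{|y|^{2n-1}}\,dy,$$ where $y_1$ is the first coordinate of $y$ and the integral is understood as $\lim_{\varepsilon\to0}\int_{|y|>\varepsilon}$. $C_0(\mathbb{R}^n)$ is the space of continuous functions on $\mathbb{R}^n$ tending to $0$ as $|x|\to\infty$. *)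

(* Defs.v *)
From HB Require Import structures.
From mathcomp Require Import all_boot all_order all_algebra complex.
From mathcomp Require Import all_classical all_reals all_analysis.

Set Implicit Arguments.
Unset Strict Implicit.
Unset Printing Implicit Defensive.
Import Order.TTheory GRing.Theory Num.Theory.
Import numFieldNormedType.Exports.
Local Open Scope classical_set_scope.
Local Open Scope ring_scope.
Local Open Scope complex_scope.

(* The [numFieldType] form of [R[i]]: it is on (the sort of) a numFieldType
   that the library puts the norm topology. *)
Definition Cplx (R : realType) : numFieldType := R[i].

(* The product sigma-algebra on 'rV[R]_n, generated by the coordinate
   functions, i.e. the Borel sigma-algebra of R^n. *)
Definition measure_rV_display : measure_display.
Proof. exact: default_measure_display. Qed.

Section measurable_rV.
Context {R : realType} {n : nat}.

Let coors : 'I_n -> 'rV[R]_n -> R := fun i x => x 0 i.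

Let rV_set0 : g_sigma_preimage coors set0.
Proof. exact: sigma_algebra0. Qed.

Let rV_setC A : g_sigma_preimage coors A -> g_sigma_preimage coors (~` A).
Proof. exact: sigma_algebraC. Qed.

Let rV_bigcup (F : _^nat) : (forall i, g_sigma_preimage coors (F i)) ->
  g_sigma_preimage coors (\bigcup_i (F i)).
Proof. exact: sigma_algebra_bigcup. Qed.

HB.instance Definition _ := @isMeasurable.Build measure_rV_display
  'rV[R]_n (g_sigma_preimage coors) rV_set0 rV_setC rV_bigcup.

End measurable_rV.

Section coordinates.
Context {R : realType}.

Lemma measurable_coord_rV n (i : 'I_n) :
  measurable_fun [set: 'rV[R]_n] (fun x => x 0 i).
Proof.
move=> _ Y mY; rewrite setTI; apply: sub_sigma_algebra => /=.
rewrite -bigcup_seq/=; exists i => /=; first by rewrite mem_index_enum.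
by exists Y => //; rewrite setTI.
Qed.

Lemma measurable_fun_rV d (T : measurableType d) n (f : T -> 'rV[R]_n) :
  (forall i, measurable_fun setT (fun x => f x 0 i)) -> measurable_fun setT f.
Proof.
move=> mf _ A mA; rewrite setTI.
suff : g_sigma_preimage (fun (i : 'I_n) (x : 'rV[R]_n) => x 0 i)
    `<=` [set B | measurable (f @^-1` B)] by apply.
apply: smallest_sub.
  split => /=.
  - by rewrite preimage_set0.
  - by move=> B mB; rewrite setTD preimage_setC; exact: measurableC.
  - by move=> F mF; rewrite preimage_bigcup; exact: bigcup_measurable.
rewrite -bigcup_seq; apply: bigcup_sub => i _ B [C mC <-] /=.
by rewrite setTI -comp_preimage -[_ @^-1` _]setTI; exact: mf.
Qed.

(* x = (x', x_n) *)
Definition pt m (x' : 'rV[R]_m) (t : R) : 'rV[R]_m.+1 :=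
  \row_(i < m.+1) if unlift ord_max i is Some j then x' 0 j else t.
Definition hd m (x : 'rV[R]_m.+1) : 'rV[R]_m := col' ord_max x.
Definition lst m (x : 'rV[R]_m.+1) : R := x 0 ord_max.

Definition dotv n (x y : 'rV[R]_n) : R := \sum_(i < n) x 0 i * y 0 i.
(* Euclidean norm: the library norm `|x| on 'rV[R]_n is the sup norm. *)
Definition enorm n (x : 'rV[R]_n) : R := Num.sqrt (dotv x x).

Lemma pt_hd_lst m (x : 'rV[R]_m.+1) : pt (hd x) (lst x) = x.
Proof.
apply/rowP => i; rewrite !mxE; case: unliftP => [j ->|->] //.
by rewrite mxE.
Qed.

Lemma measurable_pt m :
  measurable_fun setT (fun z : 'rV[R]_m * R => pt z.1 z.2).
Proof.
apply: measurable_fun_rV => i; rewrite /pt.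
case E : (unlift ord_max i) => [j|].
- rewrite (_ : (fun _ => _) = (fun x : 'rV[R]_m => x 0 j) \o fst).
    exact: measurableT_comp (measurable_coord_rV j) measurable_fst.
  by apply/funext => z /=; rewrite mxE E.
- rewrite (_ : (fun _ => _) = snd); first exact: measurable_snd.
  by apply/funext => z /=; rewrite mxE E.
Qed.

End coordinates.

(* Lebesgue measure on R^n: the product of n copies of [lebesgue_measure],
   transported along (x', t) |-> pt x' t. *)
Fixpoint leb {R : realType} (n : nat) : set 'rV[R]_n -> \bar R :=
  match n with
  | 0 => \d_(0 : 'rV[R]_0)
  | m.+1 => pushforward (leb (n := m) \x (@lebesgue_measure R))%E
                        (fun z : 'rV[R]_m * R => pt z.1 z.2)
  end.
Arguments leb {R} n _.

Section leb_measure.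
Context {R : realType}.

Lemma lebE n : exists mu : {measure set 'rV[R]_n -> \bar R}, leb n = mu.
Proof.
elim: n => [|m [mu lebm]]; first by exists \d_(0 : 'rV[R]_0).
exists (measure_function_pushforward__canonical__measure_function_Measure
  (mu \x (@lebesgue_measure R))%E (@measurable_pt R m)).
by rewrite /= lebm.
Qed.

Let leb0 n : @leb R n set0 = 0%E.
Proof. by have [mu ->] := lebE n. Qed.

Let leb_ge0 n A : (0 <= @leb R n A)%E.
Proof. by have [mu ->] := lebE n. Qed.

Let leb_sigma_additive n : semi_sigma_additive (@leb R n).
Proof. by have [mu ->] := lebE n; exact: measure_semi_sigma_additive. Qed.

HB.instance Definition _ n := isMeasure.Build _ _ _ (@leb R n)
  (leb0 n) (@leb_ge0 n) (@leb_sigma_additive n).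

End leb_measure.

Section complex_functions.
Context {R : realType}.

Definition integrableC n (D : set 'rV[R]_n) (f : 'rV[R]_n -> Cplx R) : Prop :=
  (leb n).-integrable D (EFin \o (fun x => complex.Re (f x))) /\
  (leb n).-integrable D (EFin \o (fun x => complex.Im (f x))).

(* Only meaningful under [integrableC D f]. *)
Definition integralC n (D : set 'rV[R]_n) (f : 'rV[R]_n -> Cplx R) : Cplx R :=
  (\int[leb n]_(x in D) complex.Re (f x))%R +i*
  (\int[leb n]_(x in D) complex.Im (f x))%R.

Definition normC (z : Cplx R) : R := ComplexField.Normc.normc z.

Definition LnormC n (p : R) (f : 'rV[R]_n -> Cplx R) : \bar R :=
  Lnorm (leb n) p%:E (fun x => (normC (f x))%:E).

Definition in_Lp n (p : R) (f : 'rV[R]_n -> Cplx R) : Prop :=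
  [/\ measurable_fun setT (fun x => complex.Re (f x)),
      measurable_fun setT (fun x => complex.Im (f x)) &
      (LnormC p f < +oo)%E].

Definition in_C0 n (f : 'rV[R]_n -> Cplx R) : Prop :=
  continuous f /\
  forall e : R, 0 < e ->
    exists M : R, forall x, M < enorm x -> normC (f x) < e.

End complex_functions.

Section parabolic_radon.
Context {R : realType}.
(* The ambient dimension is n = m.+1, so that m = n - 1. *)
Implicit Types (m n l : nat).

Definition parabolic_radon m (f : 'rV[R]_m.+1 -> Cplx R) (x : 'rV[R]_m.+1)
    : Cplx R :=
  integralC [set: 'rV[R]_m]
    (fun y => f (pt (hd x - y) (lst x - enorm y ^+ 2))).

Definition back_transform m (F : 'rV[R]_m.+1 -> Cplx R) (x : 'rV[R]_m.+1)
    : Cplx R :=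
  (pi ^- m)%:C * integralC [set: 'rV[R]_m]
    (fun z => F (pt z (lst x - 2 * dotv z (hd x) + enorm z ^+ 2)) *
              (((1 + 4 * enorm z ^+ 2) `^ (m%:R / 2))^-1)%:C).

Definition findiff n l (y : 'rV[R]_n) (g : 'rV[R]_n -> Cplx R) (x : 'rV[R]_n)
    : Cplx R :=
  \sum_(j < l.+1) 'C(l, j)%:R * (-1) ^+ j * g (x - j%:R *: y).

Definition outside n (e : R) : set 'rV[R]_n := [set y | e < enorm y].

Definition expi (t : R) : Cplx R := cos t +i* sin t.

(* The constant d_{n,l}(n-1). *)
Definition dconst m l : Cplx R :=
  lim (integralC (@outside m.+1 e)
    (fun y => (1 - expi (y 0 ord0)) ^+ l *
              ((enorm y ^+ (2 * m.+1 - 1))^-1)%:C) @[e --> 0^'+]).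

Definition hyper_integrand m l (g : 'rV[R]_m.+1 -> Cplx R) (u y : 'rV[R]_m.+1)
    : Cplx R :=
  findiff l y g u * ((enorm y ^+ (2 * m.+1 - 1))^-1)%:C.

Definition hyper_trunc m l (g : 'rV[R]_m.+1 -> Cplx R) (e : R)
    (u : 'rV[R]_m.+1) : Cplx R :=
  integralC (outside e) (hyper_integrand l g u).

(* The three modes of convergence, as e -> 0+, of the truncated integrals; each
   includes the existence of the truncated integrals themselves. *)
Definition Lp_limit m l (p : R) (g h : 'rV[R]_m.+1 -> Cplx R) : Prop :=
  [/\ in_Lp p h,
      forall e : R, 0 < e -> in_Lp p (hyper_trunc l g e) &
      LnormC p (fun u => hyper_trunc l g e u - h u) @[e --> 0^'+] --> 0%E].

Definition ae_limit m l (g h : 'rV[R]_m.+1 -> Cplx R) : Prop :=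
  {ae leb m.+1, forall u,
    (forall e : R, 0 < e -> integrableC (outside e) (hyper_integrand l g u)) /\
    hyper_trunc l g e u @[e --> 0^'+] --> h u}.

Definition sup_limit m l (g h : 'rV[R]_m.+1 -> Cplx R) : Prop :=
  (forall u (e : R), 0 < e ->
    integrableC (outside e) (hyper_integrand l g u)) /\
  ereal_sup (range (fun u => (normC (hyper_trunc l g e u - h u))%:E))
    @[e --> 0^'+] --> 0%E.

End parabolic_radon.

(* Main.v *)
(* Write psi for f composed with the shear u |-> (u', u_n - |u'|^2). The shear
   turns the paraboloids into hyperplanes, and the back-projection of the
   transform becomes a multiple of the Riesz potential of order n - 1:
   g(x) = kappa \int psi(x + y) / |y| dy, for almost every x. By Fubini the
   integral over |y| > e of the difference quotient of g is then the
   convolution of psi with e^-n K(z / e), where K(z) is the integral over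
   |y| > 1 of (Delta_y^l 1/|.|)(z) / |y|^(2n-1). The key point is that K is
   O(|z|^(-n-1)) at infinity: it decays like the Taylor remainder minus the
   integral over the whole space of the same differences, and that integral
   vanishes, as testing against Gaussians shows. The Gaussian test also gives
   kappa \int K = d_{n,l}(n-1), and sign arguments show that this constant is
   not 0. Convergence in L^p and in the sup-norm are the usual properties of
   approximate identities; convergence almost everywhere follows from the
   density of Lipschitz functions and a weak-type (1,1) maximal inequality,
   proved with Vitali's covering lemma. *)
Require Import Defs.
From HB Require Import structures.
From mathcomp Require Import all_boot all_order all_algebra complex.
From mathcomp Require Import all_classical all_reals all_analysis.
From mathcomp Require Import measurable_realfun ring lra.

Set Implicit Arguments.
Unset Strict Implicit.
Unset Printing Implicit Defensive.
Import Order.TTheory GRing.Theory Num.Theory.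
Import numFieldNormedType.Exports.
Local Open Scope classical_set_scope.
Local Open Scope ring_scope.

(** The weight |y|^-(2n-1) forces the difference of 1/|.| to vanish to order n at y = 0, so every
    degree up to m = n - 1 has to go. For odd n, l > m annihilates all of them. For even n, l = m
    leaves degree m, which is odd: the symmetrization in y removes it. The same parity split decides
    that the constant is not 0. For even n it is the moment of order m of the difference, which is
    not 0, times an integral of one sign. For odd n that moment vanishes, and the dilates of a
    cut-off leave a sum over j of multiples of j^m ln j, an l-th difference of x^m ln x. The
    Gaussian stands in for the Fourier transform of homogeneous distributions: its potential is an
    explicit superposition of cosines, on which differences act by multiplication. The bound p <
    n/(n-1) says that the conjugate exponent exceeds n, so that 1/|y| is in the dual space at
    infinity and the potential converges almost everywhere. K is of size 1/|z| at 0, hence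
    unbounded: the maximal estimate splits its majorant into balls of all radii. Rotations and
    dilations determine all radial constants; no surface measure is constructed. *)

Notation mfun f := (measurable_fun setT f).

(** * Measurability by recursion on the syntax *)

Section measurability.
Context {R : realType} d {T : measurableType d}.

Lemma mf_EFin (f : T -> R) : mfun f -> mfun (fun x => (f x)%:E).
Proof. by move/measurable_EFinP. Qed.

Lemma mf_comp d2 d3 (T2 : measurableType d2) (T3 : measurableType d3)
  (f : T2 -> T3) (g : T -> T2) : mfun f -> mfun g -> mfun (fun x => f (g x)).
Proof. by move=> mf mg; exact: measurableT_comp mf mg. Qed.

Lemma mf_pair d2 d3 (T2 : measurableType d2) (T3 : measurableType d3)
  (f : T -> T2) (g : T -> T3) : mfun f -> mfun g -> mfun (fun x => (f x, g x)).
Proof. by move=> mf mg; apply: measurable_fun_pair. Qed.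

Lemma mf_comp2 d2 d3 d4 (T2 : measurableType d2) (T3 : measurableType d3)
  (T4 : measurableType d4) (f : T2 * T3 -> T4) (g : T -> T2) (h : T -> T3) :
  mfun f -> mfun g -> mfun h -> mfun (fun x => f (g x, h x)).
Proof. by move=> mf mg mh; apply: (mf_comp mf); exact: mf_pair. Qed.

Lemma mf_coord n (f : T -> 'rV[R]_n) i : mfun f -> mfun (fun x => f x 0 i).
Proof. exact: measurableT_comp (measurable_coord_rV i). Qed.

Lemma mf_addr (f g : T -> R) : mfun f -> mfun g -> mfun (fun x => f x + g x).
Proof. exact: measurable_funD. Qed.

Lemma mf_oppr (f : T -> R) : mfun f -> mfun (fun x => - f x).
Proof. exact: measurableT_comp. Qed.

Lemma mf_mulr (f g : T -> R) : mfun f -> mfun g -> mfun (fun x => f x * g x).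
Proof. exact: measurable_funM. Qed.

Lemma mf_expr (f : T -> R) k : mfun f -> mfun (fun x => f x ^+ k).
Proof. by move=> mf; apply: measurable_funX. Qed.

Lemma mf_normr (f : T -> R) : mfun f -> mfun (fun x => `|f x|).
Proof. exact: measurableT_comp. Qed.

Lemma mf_invr (f : T -> R) : mfun f -> mfun (fun x => (f x)^-1).
Proof.
move=> mf; apply: (mf_comp (f := fun y : R => y^-1) _ mf).
rewrite -(setUv [set 0 : R]); apply/measurable_funU => //.
  exact: measurableC.
split; first exact: measurable_fun_set1.
apply: open_continuous_measurable_fun => //.
  by rewrite openC; exact: closed_eq.
by move=> x /[!inE] x0; apply: inv_continuous; apply/eqP.
Qed.

Lemma mf_sqrtr (f : T -> R) : mfun f -> mfun (fun x => Num.sqrt (f x)).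
Proof.
move=> mf; apply: (mf_comp (f := fun y : R => Num.sqrt y) _ mf).
by apply: continuous_measurable_fun; exact: sqrt_continuous.
Qed.

Lemma mf_expR (f : T -> R) : mfun f -> mfun (fun x => expR (f x)).
Proof. exact: measurableT_comp. Qed.

Lemma mf_cos (f : T -> R) : mfun f -> mfun (fun x => cos (f x)).
Proof.
move=> mf; apply: (mf_comp (f := fun y : R => cos y) _ mf).
by apply: continuous_measurable_fun; exact: continuous_cos.
Qed.

Lemma mf_sin (f : T -> R) : mfun f -> mfun (fun x => sin (f x)).
Proof.
move=> mf; apply: (mf_comp (f := fun y : R => sin y) _ mf).
by apply: continuous_measurable_fun; exact: continuous_sin.
Qed.

Lemma mf_powR (f : T -> R) p : mfun f -> mfun (fun x => f x `^ p).
Proof. by move=> mf; exact: (measurableT_comp (measurable_powR p)). Qed.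

Lemma mf_sumr (I : Type) (r : seq I) (f : I -> T -> R) :
  (forall i, mfun (f i)) -> mfun (fun x => \sum_(i <- r) f i x).
Proof. by move=> mf; apply: measurable_sum. Qed.

Lemma mf_addv n (f g : T -> 'rV[R]_n) :
  mfun f -> mfun g -> mfun (fun x => f x + g x).
Proof.
move=> mf mg; apply: measurable_fun_rV => i.
under eq_fun do rewrite mxE.
by apply: mf_addr; exact: mf_coord.
Qed.

Lemma mf_scalev n (a : T -> R) (f : T -> 'rV[R]_n) :
  mfun a -> mfun f -> mfun (fun x => a x *: f x).
Proof.
move=> ma mf; apply: measurable_fun_rV => i.
under eq_fun do rewrite mxE.
by apply: mf_mulr => //; exact: mf_coord.
Qed.

Lemma mf_oppv n (f : T -> 'rV[R]_n) : mfun f -> mfun (fun x => - f x).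
Proof.
move=> mf; apply: measurable_fun_rV => i.
under eq_fun do rewrite mxE.
by apply: mf_oppr => //; exact: mf_coord.
Qed.

Lemma mf_mulmxv n k (A : 'M[R]_(n, k)) (f : T -> 'rV[R]_n) :
  mfun f -> mfun (fun x => f x *m A).
Proof.
move=> mf; apply: measurable_fun_rV => i.
under eq_fun do rewrite mxE.
by apply: mf_sumr => j; apply: mf_mulr => //; exact: mf_coord.
Qed.

Lemma mf_dotv n (f g : T -> 'rV[R]_n) :
  mfun f -> mfun g -> mfun (fun x => dotv (f x) (g x)).
Proof.
by move=> mf mg; apply: mf_sumr => i; apply: mf_mulr; exact: mf_coord.
Qed.

Lemma mf_enorm n (f : T -> 'rV[R]_n) : mfun f -> mfun (fun x => enorm (f x)).
Proof. by move=> mf; apply: mf_sqrtr; exact: mf_dotv. Qed.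

Lemma mf_hd n (f : T -> 'rV[R]_n.+1) : mfun f -> mfun (fun x => hd (f x)).
Proof.
move=> mf; apply: measurable_fun_rV => i.
under eq_fun do rewrite mxE.
exact: mf_coord.
Qed.

Lemma mf_lst n (f : T -> 'rV[R]_n.+1) : mfun f -> mfun (fun x => lst (f x)).
Proof. exact: mf_coord. Qed.

Lemma mf_pt n (f : T -> 'rV[R]_n) (t : T -> R) :
  mfun f -> mfun t -> mfun (fun x => pt (f x) (t x)).
Proof.
by move=> mf mt; exact: (mf_comp (@measurable_pt R n) (mf_pair mf mt)).
Qed.

Lemma mf_indic (A : set T) : measurable A -> mfun (\1_A : T -> R).
Proof. by move=> mA; exact: measurable_indic. Qed.

Lemma mf_fine (f : T -> \bar R) : mfun f -> mfun (fun x => fine (f x)).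
Proof. exact: measurableT_comp. Qed.

Lemma mf_muleE (f g : T -> \bar R) :
  mfun f -> mfun g -> mfun (fun x => f x * g x)%E.
Proof. by move=> mf mg; exact: emeasurable_funM. Qed.

Lemma mf_addeE (f g : T -> \bar R) :
  mfun f -> mfun g -> mfun (fun x => f x + g x)%E.
Proof. by move=> mf mg; exact: emeasurable_funD. Qed.

Lemma mf_absE (f : T -> \bar R) : mfun f -> mfun (fun x => `|f x|)%E.
Proof. by move=> mf; exact: measurableT_comp. Qed.

Lemma mf_ltr (f g : T -> R) : mfun f -> mfun g -> mfun (fun x => f x < g x).
Proof. exact: measurable_fun_ltr. Qed.

Lemma mf_ler (f g : T -> R) : mfun f -> mfun g -> mfun (fun x => f x <= g x).
Proof. exact: measurable_fun_ler. Qed.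

Lemma mf_nat_bool (P : T -> bool) : mfun P -> mfun (fun x => (P x)%:R : R).
Proof.
move=> mP; apply: (mf_comp (f := fun b : bool => b%:R : R)) => //.
Qed.

Lemma mset_ltr (f g : T -> R) :
  mfun f -> mfun g -> measurable [set x | f x < g x].
Proof.
move=> mf mg; have /(_ measurableT [set true]) := mf_ltr mf mg.
by rewrite setTI; exact.
Qed.

Lemma mset_ler (f g : T -> R) :
  mfun f -> mfun g -> measurable [set x | f x <= g x].
Proof.
move=> mf mg; have /(_ measurableT [set true]) := mf_ler mf mg.
by rewrite setTI; exact.
Qed.

End measurability.

(** Hypotheses on the head function come before the structural rules, so a local function is covered
    as soon as its measurability is in the context. A bare function symbol is eta-expanded to match
    the other cases. *)
Ltac mt1 :=
  lazymatch goal with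
  | |- measurable_fun _ (fun x => x) => exact: measurable_id
  | |- measurable_fun _ fst => exact: measurable_fst
  | |- measurable_fun _ snd => exact: measurable_snd
  | |- measurable_fun _ (fun x => x.1) => exact: measurable_fst
  | |- measurable_fun _ (fun x => x.2) => exact: measurable_snd
  | H : measurable_fun setT ?f |- measurable_fun _ ?f => exact: H
  | H : measurable_fun setT ?f |- measurable_fun _ (fun x => ?f x) => exact: H
  | |- measurable_fun _ (fun _ => ?c) => exact: measurable_cst
  | H : measurable_fun setT ?f |- measurable_fun _ (fun x => ?f (@?g x, @?h x))
      => apply: (mf_comp2 H)
  | H : measurable_fun setT ?f |- measurable_fun _ (fun x => ?f (@?g x))
      => apply: (mf_comp H)
  | |- measurable_fun _ (fun x => (_)%:E) => apply: mf_EFin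
  | |- measurable_fun _ (fun x => (_ * _)%E) => apply: mf_muleE
  | |- measurable_fun _ (fun x => (`|_|)%E) => apply: mf_absE
  | |- measurable_fun _ (fun x => (_ + _)%R) =>
      first [apply: mf_addr | apply: mf_addv | apply: mf_addeE]
  | |- measurable_fun _ (fun x => (- _)%R) =>
      first [apply: mf_oppr | apply: mf_oppv]
  | |- measurable_fun _ (fun x => (_ ^+ _)%R) => apply: mf_expr
  | |- measurable_fun _ (fun x => (_ * _)%R) => apply: mf_mulr
  | |- measurable_fun _ (fun x => (_ ^-1)%R) => apply: mf_invr
  | |- measurable_fun _ (fun x => (_ *: _)%R) => apply: mf_scalev
  | |- measurable_fun _ (fun x => (_ *m _)%R) => apply: mf_mulmxv
  | |- measurable_fun _ (fun x => (`|_|)%R) => apply: mf_normr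
  | |- measurable_fun _ (fun x => Num.sqrt _) => apply: mf_sqrtr
  | |- measurable_fun _ (fun x => expR _) => apply: mf_expR
  | |- measurable_fun _ (fun x => cos _) => apply: mf_cos
  | |- measurable_fun _ (fun x => sin _) => apply: mf_sin
  | |- measurable_fun _ (fun x => powR _ _) => apply: mf_powR
  | |- measurable_fun _ (fun x => enorm _) => apply: mf_enorm
  | |- measurable_fun _ (fun x => dotv _ _) => apply: mf_dotv
  | |- measurable_fun _ (fun x => hd _) => apply: mf_hd
  | |- measurable_fun _ (fun x => lst _) => apply: mf_lst
  | |- measurable_fun _ (fun x => pt _ _) => apply: mf_pt
  | |- measurable_fun _ (fun x => fine _) => apply: mf_fine
  | |- measurable_fun _ (fun x => (_ < _)%R) => apply: mf_ltr
  | |- measurable_fun _ (fun x => (_ <= _)%R) => apply: mf_ler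
  | |- measurable_fun _ (fun x => (nat_of_bool _)%:R) => apply: mf_nat_bool
  | |- measurable_fun _ (fun x => bigop _ _ _) => apply: mf_sumr => ?
  | |- measurable_fun _ (fun x => fun_of_matrix _ _ _) => apply: mf_coord
  | |- measurable_fun _ (fun x => (_, _)) => apply: mf_pair
  | |- measurable_fun _ (fun x => fst _) => apply: (mf_comp measurable_fst)
  | |- measurable_fun _ (fun x => snd _) => apply: (mf_comp measurable_snd)
  | |- measurable_fun _ EFin => exact: (mf_EFin (@measurable_id _ _ setT))
  | |- measurable_fun _ (@enorm _ _) => exact: (mf_enorm (@measurable_id _ _ setT))
  | |- measurable_fun _ expR => exact: (mf_expR (@measurable_id _ _ setT))
  | |- measurable_fun _ cos => exact: (mf_cos (@measurable_id _ _ setT))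
  | |- measurable_fun ?D ?f =>
      lazymatch f with
      | (fun _ => _) => fail
      | _ => change (measurable_fun D (fun x => f x))
      end
  | |- measurable [set x | is_true (_ < _)%R] => apply: mset_ltr
  | |- measurable [set x | is_true (_ <= _)%R] => apply: mset_ler
  end.
Ltac mt := repeat mt1.

(** * Euclidean geometry *)

Section euclid.
Context {R : realType}.
Implicit Types n : nat.

Lemma dotvC n (x y : 'rV[R]_n) : dotv x y = dotv y x.
Proof. by apply: eq_bigr => i _; rewrite mulrC. Qed.

Lemma dotvDl n (x y z : 'rV[R]_n) : dotv (x + y) z = dotv x z + dotv y z.
Proof. by rewrite -big_split; apply: eq_bigr => i _; rewrite mxE mulrDl. Qed.

Lemma dotvZl n a (x y : 'rV[R]_n) : dotv (a *: x) y = a * dotv x y.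
Proof. by rewrite mulr_sumr; apply: eq_bigr => i _; rewrite mxE mulrA. Qed.

Lemma dotvNl n (x y : 'rV[R]_n) : dotv (- x) y = - dotv x y.
Proof. by rewrite -scaleN1r dotvZl mulN1r. Qed.

Lemma dotvDr n (x y z : 'rV[R]_n) : dotv z (x + y) = dotv z x + dotv z y.
Proof. by rewrite dotvC dotvDl !(dotvC _ z). Qed.

Lemma dotvZr n a (x y : 'rV[R]_n) : dotv x (a *: y) = a * dotv x y.
Proof. by rewrite dotvC dotvZl dotvC. Qed.

Lemma dotvNr n (x y : 'rV[R]_n) : dotv x (- y) = - dotv x y.
Proof. by rewrite dotvC dotvNl dotvC. Qed.

Lemma dotv_ge0 n (x : 'rV[R]_n) : 0 <= dotv x x.
Proof. by apply: sumr_ge0 => i _; exact: sqr_ge0. Qed.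

Lemma dotv0l n (x : 'rV[R]_n) : dotv 0 x = 0.
Proof. by rewrite -(scale0r x) dotvZl mul0r. Qed.

Lemma dotv_eq0 n (x : 'rV[R]_n) : (dotv x x == 0) = (x == 0).
Proof.
apply/eqP/eqP => [|->]; last by rewrite dotv0l.
move=> /eqP; rewrite psumr_eq0 => [/allP h|i _]; last exact: sqr_ge0.
apply/rowP => i; rewrite mxE; apply/eqP.
by have := h i (mem_index_enum _); rewrite mulf_eq0 orbb.
Qed.

Lemma enorm_ge0 n (x : 'rV[R]_n) : 0 <= enorm x.
Proof. exact: sqrtr_ge0. Qed.

Lemma enormE n (x : 'rV[R]_n) : enorm x ^+ 2 = dotv x x.
Proof. by rewrite sqr_sqrtr// dotv_ge0. Qed.

Lemma enorm_eq0 n (x : 'rV[R]_n) : (enorm x == 0) = (x == 0).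
Proof. by rewrite -dotv_eq0 -enormE sqrf_eq0. Qed.

Lemma enorm0 n : enorm (0 : 'rV[R]_n) = 0.
Proof. by apply/eqP; rewrite enorm_eq0. Qed.

Lemma enorm_gt0 n (x : 'rV[R]_n) : (0 < enorm x) = (x != 0).
Proof. by rewrite lt_def enorm_ge0 andbT enorm_eq0. Qed.

Lemma enormZ n a (x : 'rV[R]_n) : enorm (a *: x) = `|a| * enorm x.
Proof.
by rewrite /enorm dotvZl dotvZr mulrA -expr2 sqrtrM ?sqr_ge0// sqrtr_sqr.
Qed.

Lemma enormN n (x : 'rV[R]_n) : enorm (- x) = enorm x.
Proof. by rewrite -scaleN1r enormZ normrN1 mul1r. Qed.

Lemma enorm_distC n (x y : 'rV[R]_n) : enorm (x - y) = enorm (y - x).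
Proof. by rewrite -enormN opprB. Qed.

(** Cauchy-Schwarz, by expanding the square of [enorm y *: x - enorm x *: y] and cancelling
    [enorm x * enorm y], whence the two degenerate cases first. *)
Lemma dotv_le n (x y : 'rV[R]_n) : dotv x y <= enorm x * enorm y.
Proof.
have [->|x0] := eqVneq x 0; first by rewrite dotv0l enorm0 mul0r.
have [->|y0] := eqVneq y 0; first by rewrite dotvC dotv0l enorm0 mulr0.
have ab : 0 < enorm x * enorm y by rewrite mulr_gt0// enorm_gt0.
have := dotv_ge0 (enorm y *: x - enorm x *: y).
rewrite dotvDl !dotvDr !dotvNl !dotvNr !dotvZl !dotvZr -!enormE (dotvC y x).
move=> h; rewrite -(ler_pM2l ab) -subr_ge0.
by move: h; lra.
Qed.

Lemma normr_dotv_le n (x y : 'rV[R]_n) : `|dotv x y| <= enorm x * enorm y.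
Proof.
rewrite ler_norml dotv_le andbT lerNl -dotvNl.
by rewrite (le_trans (dotv_le _ _))// enormN.
Qed.

Lemma ler_enormD n (x y : 'rV[R]_n) : enorm (x + y) <= enorm x + enorm y.
Proof.
have h := dotv_le x y.
rewrite -(ler_pXn2r (n := 2))// ?nnegrE ?addr_ge0 ?enorm_ge0//.
rewrite enormE dotvDl !dotvDr (dotvC y x) -!enormE sqrrD.
by move: h; lra.
Qed.

Lemma ler_enormB n (x y : 'rV[R]_n) : enorm (x - y) <= enorm x + enorm y.
Proof. by rewrite (le_trans (ler_enormD _ _))// enormN. Qed.

Lemma ler_enorm_dist n (x y : 'rV[R]_n) : enorm x - enorm y <= enorm (x - y).
Proof.
by rewrite lerBlDr (le_trans _ (ler_enormD (x - y) y))// subrK.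
Qed.

Lemma coord_le_enorm n (x : 'rV[R]_n) i : `|x 0 i| <= enorm x.
Proof.
rewrite -(ler_pXn2r (n := 2))// ?nnegrE ?enorm_ge0// enormE /dotv real_normK ?num_real//.
rewrite (bigD1 i)//= -expr2 lerDl; apply: sumr_ge0 => j _.
by rewrite -expr2 sqr_ge0.
Qed.

Lemma hd_pt n (x : 'rV[R]_n) t : hd (pt x t) = x.
Proof. by apply/rowP => i; rewrite !mxE liftK. Qed.

Lemma lst_pt n (x : 'rV[R]_n) t : lst (pt x t) = t.
Proof. by rewrite /lst mxE unlift_none. Qed.

Lemma ptD n (x y : 'rV[R]_n) s t : pt (x + y) (s + t) = pt x s + pt y t.
Proof. by apply/rowP => i; rewrite !mxE; case: unlift => // j; rewrite mxE. Qed.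

Lemma ptZ n a (x : 'rV[R]_n) t : pt (a *: x) (a * t) = a *: pt x t.
Proof. by apply/rowP => i; rewrite !mxE; case: unlift => // j; rewrite mxE. Qed.

Lemma dotv_pt n (x y : 'rV[R]_n) s t : dotv (pt x s) (pt y t) = dotv x y + s * t.
Proof.
rewrite /dotv big_ord_recr/=; congr (_ + _); last first.
  by rewrite !mxE; case: unliftP => // j /eqP; rewrite (negbTE (neq_lift _ _)).
apply: eq_bigr => i _; have -> : widen_ord (leqnSn n) i = lift ord_max i.
  by apply/val_inj; rewrite /= /bump leqNgt ltn_ord.
by rewrite !mxE liftK.
Qed.

Lemma enorm_pt n (x : 'rV[R]_n) t : enorm (pt x t) ^+ 2 = enorm x ^+ 2 + t ^+ 2.
Proof. by rewrite !enormE dotv_pt expr2. Qed.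

Lemma dotv_mulmx n (x y : 'rV[R]_n) : (dotv x y)%:M = x *m y^T.
Proof.
apply/matrixP => i j; rewrite !ord1 !mxE eqxx mulr1n.
by apply: eq_bigr => k _; rewrite mxE.
Qed.

Definition orth n (A : 'M[R]_n) := A *m A^T = 1%:M.

Lemma orth_tr n (A : 'M[R]_n) : orth A -> A^T *m A = 1%:M.
Proof. exact: mulmx1C. Qed.

Lemma dotv_orth n (A : 'M[R]_n) (x y : 'rV[R]_n) : orth A ->
  dotv (x *m A) (y *m A) = dotv x y.
Proof.
move=> oA; suff : (dotv (x *m A) (y *m A))%:M = (dotv x y)%:M :> 'M[R]_1.
  by move=> /matrixP /(_ 0 0); rewrite !mxE eqxx !mulr1n.
by rewrite !dotv_mulmx trmx_mul mulmxA -(mulmxA x) oA mulmx1.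
Qed.

Lemma enorm_orth n (A : 'M[R]_n) (x : 'rV[R]_n) : orth A ->
  enorm (x *m A) = enorm x.
Proof. by move=> oA; rewrite /enorm dotv_orth. Qed.

(* Householder reflection *)
Lemma orth_exists n (x y : 'rV[R]_n) : enorm x = enorm y ->
  exists2 A : 'M[R]_n, orth A & x *m A = y.
Proof.
move=> xy; have [->|nxy] := eqVneq x y.
  by exists 1%:M; rewrite /orth ?trmx1 ?mulmx1.
pose w := x - y; have w0 : dotv w w != 0 by rewrite dotv_eq0 subr_eq0.
have ww : w *m w^T = (dotv w w)%:M by rewrite dotv_mulmx.
exists (1%:M - (2 / dotv w w) *: (w^T *m w)).
  rewrite /orth.
  have -> : (1%:M - (2 / dotv w w) *: (w^T *m w))^T =
      1%:M - (2 / dotv w w) *: (w^T *m w).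
    apply/matrixP => i j; rewrite !mxE eq_sym; congr (_ - _ * _).
    by apply: eq_bigr => k _; rewrite !mxE mulrC.
  have PP : (w^T *m w) *m (w^T *m w) = dotv w w *: (w^T *m w).
    by rewrite mulmxA -(mulmxA w^T) ww mul_mx_scalar scalemxAl.
  move: (w^T *m w) PP => P PP.
  rewrite mulmxBl mul1mx -scalemxAl mulmxBr mulmx1 -scalemxAr PP.
  by apply/matrixP => i j; rewrite !mxE; field.
rewrite mulmxBr mulmx1 -scalemxAr mulmxA -dotv_mulmx mul_scalar_mx scalerA.
(* The equality of norms enters here; it makes the reflection move x by exactly [- w]. *)
have e : dotv w w = 2 * dotv x w.
  have := congr1 (fun t => t ^+ 2) xy; rewrite /= !enormE => e.
  rewrite /w dotvDl !dotvDr !dotvNl !dotvNr (dotvC y x).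
  by rewrite -e; ring.
have -> : 2 / dotv w w * dotv x w = 1.
  by rewrite e in w0 *; field; move: w0; rewrite mulf_eq0 negb_or => /andP[].
by rewrite scale1r /w opprB addrC subrK.
Qed.

End euclid.

Ltac pos1 :=
  lazymatch goal with
  | H : forall x, is_true (Order.le _ (?f x)) |- is_true (Order.le _ (?f _)) => exact: H
  | H : forall x y, is_true (Order.le _ (?f x y)) |- is_true (Order.le _ (?f _ _)) => exact: H
  | |- is_true (Order.le _ (EFin _)) => rewrite lee_fin
  | |- is_true (Order.le _ (_ * _)%E) => apply: mule_ge0
  | |- is_true (Order.le _ (`|_|)%E) => exact: abse_ge0
  | |- is_true (Order.le _ (integral _ _ _)) => apply: integral_ge0 => ? _
  | |- is_true (Order.le _ (_ * _)%R) => apply: mulr_ge0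
  | |- is_true (Order.le _ (_ + _)%R) => first [apply: addr_ge0 | apply: adde_ge0]
  | |- is_true (Order.le _ (_ ^+ _)%R) => apply: exprn_ge0
  | |- is_true (Order.le _ (_ ^-1)%R) => rewrite invr_ge0
  | |- is_true (Order.le _ (enorm _)) => exact: enorm_ge0
  | |- is_true (Order.le _ (powR _ _)) => exact: powR_ge0
  | |- is_true (Order.le _ (expR _)) => exact: expR_ge0
  | |- is_true (Order.le _ (`|_|)%R) => exact: normr_ge0
  | |- is_true (Order.le _ (_%:R)%R) => exact: ler0n
  | |- is_true (Order.le _ (Num.sqrt _)) => exact: sqrtr_ge0
  | |- is_true (Order.le _ pi) => exact: pi_ge0
  | |- is_true (Order.le _ (bigop _ _ _)) => apply: sumr_ge0 => ? _
  end.
Ltac pos := repeat pos1; try done; try by apply: ltW.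
Ltac sd := solve [by mt | by move=> *; pos].

(** * Integrals of nonnegative functions and affine substitutions on the line *)

Section total_integral.
Context {R : realType} d {T : measurableType d} (mu : {measure set T -> \bar R}).
Local Open Scope ereal_scope.

Lemma ge0_intZl k (f : T -> \bar R) : mfun f -> (forall x, 0 <= f x) ->
  0 <= k -> \int[mu]_x (k * f x) = k * \int[mu]_x f x.
Proof. by move=> mf f0 k0; rewrite ge0_integralZl. Qed.

Lemma ge0_intZr k (f : T -> \bar R) : mfun f -> (forall x, 0 <= f x) ->
  0 <= k -> \int[mu]_x (f x * k) = (\int[mu]_x f x) * k.
Proof. by move=> mf f0 k0; rewrite ge0_integralZr. Qed.

Lemma ge0_intD (f g : T -> \bar R) : mfun f -> (forall x, 0 <= f x) ->
  mfun g -> (forall x, 0 <= g x) ->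
  \int[mu]_x (f x + g x) = \int[mu]_x f x + \int[mu]_x g x.
Proof. by move=> mf f0 mg g0; rewrite ge0_integralD. Qed.

Lemma ge0_int_le (f g : T -> \bar R) : mfun f -> (forall x, 0 <= f x) ->
  mfun g -> (forall x, f x <= g x) ->
  \int[mu]_x f x <= \int[mu]_x g x.
Proof. by move=> mf f0 mg fg; apply: ge0_le_integral. Qed.

End total_integral.

Section lebesgue_line.
Context {R : realType}.
Local Notation mu := (@lebesgue_measure R).
Local Open Scope ereal_scope.

(** Both sides are measures in A, so the uniqueness of Lebesgue measure leaves only half-open
    intervals to compare. *)
Lemma lebesgue_affine_measure (c a : R) (A : set R) : (0 < c)%R ->
  measurable A ->
  mu A = c%:E * mu ((fun t : R => (c * t + a)%R) @^-1` A).
Proof.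
move=> c0 mA.
have mphi0 : measurable_fun [set: R] (fun t : R => (c * t + a)%R) by mt.
have mphi : measurable_fun [set: measurableTypeR R]
  (fun t : R => (c * t + a)%R : measurableTypeR R) by exact: mphi0.
pose nu : {measure set (measurableTypeR R) -> \bar R} :=
  measure_function_pushforward__canonical__measure_function_Measure mu mphi.
pose nu' := mscale (NngNum (ltW c0)) nu.
suff : mu A = nu' A by [].
apply: lebesgue_measure_unique => //= _ [[x y]] _ <-.
rewrite /nu' /mscale/= /pushforward.
have -> : (fun t : R => (c * t + a)%R) @^-1` `]x, y]%classic =
    `]((x - a) / c)%R, ((y - a) / c)%R]%classic.
  apply/seteqP; split => t /=; rewrite !in_itv/= ltr_pdivrMr// ler_pdivlMr//;
    by rewrite ltrBlDr lerBrDr (mulrC t).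
rewrite !lebesgue_measure_itv/= !lte_fin ltr_pM2r ?invr_gt0// ltrD2r.
case: ifPn => _; last by rewrite mule0.
by rewrite -!EFinD -EFinM; congr EFin; field; rewrite gt_eqF.
Qed.

Lemma ge0_integral_affine (c a : R) (f : R -> \bar R) : (0 < c)%R ->
  mfun f -> (forall x, 0 <= f x) ->
  \int[mu]_t f t = c%:E * \int[mu]_t f (c * t + a)%R.
Proof.
move=> c0 mf f0.
have mphi0 : measurable_fun [set: R] (fun t : R => (c * t + a)%R) by mt.
have mphi : measurable_fun [set: measurableTypeR R]
  (fun t : R => (c * t + a)%R : measurableTypeR R) by exact: mphi0.
pose nu : {measure set (measurableTypeR R) -> \bar R} :=
  measure_function_pushforward__canonical__measure_function_Measure mu mphi.
transitivity (\int[mscale (NngNum (ltW c0)) nu]_t f t).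
  by apply: eq_measure_integral => //= A mA _; exact: lebesgue_affine_measure.
rewrite ge0_integral_mscale//=; congr (_ * _).
by rewrite ge0_integral_pushforward.
Qed.

Lemma ge0_integral_shift (a : R) (f : R -> \bar R) :
  mfun f -> (forall x, 0 <= f x) ->
  \int[mu]_t f (t + a)%R = \int[mu]_t f t.
Proof.
move=> mf f0; rewrite [RHS](@ge0_integral_affine 1%R a)// mul1e.
by apply: eq_integral => t _; rewrite mul1r.
Qed.

Lemma ge0_integral_oppr (f : R -> \bar R) :
  mfun f -> (forall x, 0 <= f x) ->
  \int[mu]_t f (- t)%R = \int[mu]_t f t.
Proof.
move=> mf f0.
transitivity (\int[pushforward mu (-%R : R -> measurableTypeR R)]_t f t).
  by rewrite ge0_integral_pushforward.
by apply: eq_measure_integral => A mA _; exact: lebesgue_measureN.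
Qed.

Lemma ge0_integral_scaler (c : R) (f : R -> \bar R) : c != 0%R ->
  mfun f -> (forall x, 0 <= f x) ->
  \int[mu]_t f t = `|c|%:E * \int[mu]_t f (c * t)%R.
Proof.
move=> c0 mf f0.
rewrite (@ge0_integral_affine `|c|%R 0) ?normr_gt0//; congr (_ * _).
have [c1|c1] := ger0P c; first by apply: eq_integral => t _; rewrite addr0.
rewrite -[RHS]ge0_integral_oppr//; last by mt.
by apply: eq_integral => t _; rewrite addr0 mulrN mulNr.
Qed.

End lebesgue_line.

(** * The Lebesgue measure of R^n *)

Definition cube {R : realType} n (r : R) : set 'rV[R]_n :=
  [set x | forall i, `|x 0 i| <= r].
Arguments cube {R} n r _.

Definition eball {R : realType} n (r : R) : set 'rV[R]_n :=
  [set x | enorm x < r].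
Arguments eball {R} n r _.

Section leb_space.
Context {R : realType}.
Local Notation mu := (@lebesgue_measure R).
Local Open Scope ereal_scope.

Lemma measurable_cube n (r : R) : measurable (cube n r).
Proof.
rewrite (_ : cube n r = \bigcap_(i in [set: 'I_n])
    [set x : 'rV[R]_n | `|x 0%R i| <= r]%R); last first.
  by apply/seteqP; split => [x /= h i _|x /= h i]; [exact: h|exact: (h i)].
by apply: fin_bigcap_measurable => // i _; mt.
Qed.

Lemma cube_pt n (r : R) (x : 'rV[R]_n) t :
  cube n.+1 r (pt x t) <-> cube n r x /\ (`|t| <= r)%R.
Proof.
split=> [h|[h ht] i]; last by rewrite mxE; case: unliftP.
split => [i|]; last by have := h ord_max; rewrite mxE unlift_none.
by have := h (lift ord_max i); rewrite mxE liftK.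
Qed.

Lemma leb_cube n (r : R) : (0 <= r)%R -> leb n (cube n r) = ((2 * r) ^+ n)%:E.
Proof.
move=> r0; elim: n => [|n IH].
  rewrite /= expr0 diracE mem_set//.
  by case.
rewrite /= /pushforward.
have -> : (fun z : 'rV[R]_n * R => pt z.1 z.2) @^-1` cube n.+1 r =
    cube n r `*` `[(- r)%R, r]%classic.
  apply/seteqP; split => -[x t] /=; rewrite in_itv/= -ler_norml;
    by move=> /cube_pt.
rewrite product_measure1E ?[X in X * _]IH//; last exact: measurable_cube.
transitivity (((2 * r) ^+ n)%:E * mu `[(- r)%R, r]%classic) => //.
rewrite lebesgue_measure_itv/= lte_fin.
case: ifPn => [_|]; first by rewrite -EFinD opprK -EFinM exprS; congr EFin; ring.
rewrite -leNgt => rr; have -> : r = 0%R by move: r0 rr; lra.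
by rewrite mule0 mulr0 expr0n.
Qed.

Lemma leb_sigma_finite n : sigma_finite setT (@leb R n).
Proof.
exists (fun k => cube n k%:R).
  apply/seteqP; split => // x _.
  have [k _ xk] : exists2 k : nat, True & (\sum_i `|x 0%R i| <= k%:R)%R.
    exists (Num.truncn (\sum_i `|x 0%R i|)%R).+1 => //.
    by rewrite ltW// truncnS_gt.
  exists k => // i; apply: le_trans xk.
  by rewrite (bigD1 i)//= lerDl sumr_ge0.
move=> k; split; first exact: measurable_cube.
by rewrite leb_cube// ltry.
Qed.

HB.instance Definition _ n :=
  Measure_isSigmaFinite.Build _ _ _ (@leb R n) (leb_sigma_finite n).

(** Tonelli for one step of the recursion that defines [leb]. Translations and dilations of R^n
    reduce through it to those of the line. *)
Lemma ge0_integral_lebS n (f : 'rV[R]_n.+1 -> \bar R) : mfun f ->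
  (forall x, 0 <= f x) ->
  \int[leb n.+1]_x f x = \int[leb n]_x \int[mu]_t f (pt x t).
Proof.
move=> mf f0.
transitivity (\int[pushforward (leb n \x mu)
    (fun z : 'rV[R]_n * R => pt z.1 z.2)]_x f x) => //.
rewrite ge0_integral_pushforward//; last exact: measurable_pt.
rewrite preimage_setT fubini_tonelli1//.
  by apply: (measurableT_comp mf); exact: measurable_pt.
by move=> z; exact: f0.
Qed.

Lemma mf_integral_pt n (f : 'rV[R]_n.+1 -> \bar R) : mfun f ->
  (forall x, 0 <= f x) -> mfun (fun x => \int[mu]_t f (pt x t)).
Proof.
move=> mf f0.
apply: (@measurable_fun_fubini_tonelli_F _ _ _ _ _ mu
  (fun z : 'rV[R]_n * R => f (pt z.1 z.2)));
  solve [by mt | by move=> z; exact: f0].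
Qed.

Lemma rV0 (x y : 'rV[R]_0) : x = y.
Proof. by rewrite !thinmx0. Qed.

Lemma ge0_integral_leb0 (f : 'rV[R]_0 -> \bar R) : mfun f ->
  (forall x, 0 <= f x) -> \int[leb 0]_x f x = f 0%R.
Proof. by move=> mf f0; rewrite integral_dirac// diracT mul1e. Qed.

Lemma ge0_integral_shiftv n a (f : 'rV[R]_n -> \bar R) : mfun f ->
  (forall x, 0 <= f x) -> \int[leb n]_x f (x + a)%R = \int[leb n]_x f x.
Proof.
elim: n a f => [|n IH] a f mf f0.
  by apply: eq_integral => x _; congr f; exact: rV0.
have mfa : mfun (fun x : 'rV[R]_n.+1 => f (x + a)%R) by mt.
rewrite (ge0_integral_lebS mfa (fun x => f0 _)) (ge0_integral_lebS mf f0).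
rewrite -[RHS](IH (hd a) _ (mf_integral_pt mf f0)); last first.
  by move=> x; exact: integral_ge0.
apply: eq_integral => x _.
have mfx : mfun (fun t : R => f (pt (x + hd a)%R t)) by mt.
rewrite -[RHS](ge0_integral_shift (lst a) mfx (fun t => f0 _)).
by apply: eq_integral => t _; rewrite ptD pt_hd_lst.
Qed.

Lemma ge0_integral_scalev n (c : R) (f : 'rV[R]_n -> \bar R) : c != 0%R ->
  mfun f -> (forall x, 0 <= f x) ->
  \int[leb n]_x f x = (`|c| ^+ n)%:E * \int[leb n]_x f (c *: x)%R.
Proof.
move=> c0; elim: n f => [|n IH] f mf f0.
  by rewrite expr0 mul1e; apply: eq_integral => x _; congr f; exact: rV0.
rewrite !ge0_integral_lebS//; last by mt.
rewrite (IH (fun x => \int[mu]_t f (pt x t))); last 2 first.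
- exact: mf_integral_pt.
- by move=> x; exact: integral_ge0.
rewrite exprSr EFinM -muleA; congr (_ * _).
rewrite -ge0_integralZl_EFin//; last 2 first.
- by move=> x _; exact: integral_ge0.
- by apply: (mf_integral_pt (f := fun y => f (c *: y)%R)) => //; mt.
apply: eq_integral => x _.
rewrite (@ge0_integral_scaler _ c)//; last by mt.
by congr (_ * _); apply: eq_integral => t _; rewrite ptZ.
Qed.

Lemma measurable_eball n (r : R) : measurable (eball n r).
Proof. by rewrite /eball; mt. Qed.

Lemma eball_sub_cube n (r : R) : eball n r `<=` cube n r.
Proof. by move=> x xr i; rewrite (le_trans (coord_le_enorm x i))// ltW. Qed.

(** The factor [n.+1] is a crude bound for the sharp sqrt n: it avoids roots, stays positive for n =
    0 and makes the inclusion in the open ball strict. *)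
Lemma cube_sub_eball n (r : R) : (0 < r)%R -> cube n r `<=` eball n (n.+1%:R * r).
Proof.
move=> r0 x xr; rewrite /eball/=.
have r1 : (0 <= n.+1%:R * r)%R by rewrite mulr_ge0// ltW.
rewrite -(ltr_pXn2r (n := 2))// ?nnegrE ?enorm_ge0//.
rewrite enormE (@le_lt_trans _ _ (\sum_(i < n) r ^+ 2)%R)//.
  apply: ler_sum => i _; rewrite -expr2 -real_normK ?num_real//.
  by rewrite ler_pXn2r// nnegrE ltW.
rewrite sumr_const card_ord -[X in (X < _)%R]mulr_natl exprMn ltr_pM2r ?exprn_gt0//.
rewrite -natrX ltr_nat expnS expn1 (leq_trans (ltnSn n))// leq_pmull//.
Qed.

Lemma leb_eball_lty n (r : R) : leb n (eball n r) < +oo.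
Proof.
apply: (@le_lt_trans _ _ (leb n (cube n (Num.max 0 r)%R))).
  apply: le_measure; rewrite ?inE; [exact: measurable_eball|exact: measurable_cube|].
  apply: subset_trans (@eball_sub_cube n r) _ => x h i.
  by rewrite (le_trans (h i))// le_max lexx orbT.
by rewrite leb_cube ?ltry// le_max lexx.
Qed.

Lemma leb_eball_gt0 n (r : R) : (0 < r)%R -> 0 < leb n (eball n r).
Proof.
move=> r0; have r1 : (0 < r / n.+1%:R)%R by rewrite divr_gt0.
have := @cube_sub_eball n _ r1.
have -> : (n.+1%:R * (r / n.+1%:R) = r)%R by field.
move=> h.
apply: (@lt_le_trans _ _ (leb n (cube n (r / n.+1%:R)%R))).
  by rewrite leb_cube ?ltW// lte_fin exprn_gt0// mulr_gt0.
by apply: le_measure; rewrite ?inE; [exact: measurable_cube|exact: measurable_eball|].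
Qed.

Lemma mule_Ir (x y : \bar R) (c : R) : c != 0%R ->
  x * c%:E = y * c%:E -> x = y.
Proof.
move=> c0 /(congr1 (fun t => t * c^-1%:E)).
by rewrite -!muleA -!EFinM divff// !mule1.
Qed.

(* Unicity of Haar measure for the image of [leb] under [A]: integrate
   [f (x A + y) h y] over [x] and [y], with [h] the indicator of a ball. *)
Lemma ge0_integral_orth n (A : 'M[R]_n) (f : 'rV[R]_n -> \bar R) : orth A ->
  mfun f -> (forall x, 0 <= f x) ->
  \int[leb n]_x f (x *m A)%R = \int[leb n]_x f x.
Proof.
move=> oA mf f0.
pose h (x : 'rV[R]_n) : \bar R := ((enorm x < 1)%R%:R : R)%:E.
have h0 x : 0 <= h x by rewrite lee_fin.
have mh : mfun h by rewrite /h; mt.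
have hE : \int[leb n]_x h x = leb n (eball n 1).
  rewrite -[eball n 1]setIT -integral_indic ?setIT//; last exact: measurable_eball.
  apply: eq_integral => x _; rewrite /h indicE.
  case: ltP => xr; first by rewrite mem_set.
  by rewrite memNset//=; apply/negP; rewrite -leNgt.
have c0 := @leb_eball_gt0 n _ (ltr01 : (0 < 1 :> R)%R).
have cy := @leb_eball_lty n 1.
suff : (\int[leb n]_x f (x *m A)%R) * \int[leb n]_x h x =
    (\int[leb n]_x f x) * \int[leb n]_x h x.
  rewrite hE -(@fineK _ (leb n _)) ?ge0_fin_numE//; apply: mule_Ir.
  by rewrite gt_eqF// fine_gt0// c0.
have If0 g : 0 <= \int[leb n]_x f (g x) by exact: integral_ge0.
rewrite -ge0_integralZl//.
(* Translating x by [y *m A^T] adds y to [x *m A], because [A^T *m A = 1]. *)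
transitivity (\int[leb n]_y \int[leb n]_x (h y * f (x *m A + y)%R)).
  apply: eq_integral => y _; rewrite ge0_integralZl//; last by mt.
  rewrite muleC; congr (_ * _).
  rewrite -(@ge0_integral_shiftv _ (y *m A^T)%R)//; last by mt.
  apply: eq_integral => x _; rewrite mulmxDl -mulmxA.
  by rewrite (orth_tr oA) mulmx1.
rewrite (fubini_tonelli (fun z : 'rV[R]_n * 'rV[R]_n =>
  h z.1 * f (z.2 *m A + z.1)%R)); last 2 first.
- by mt.
- by move=> z; exact: mule_ge0.
transitivity (\int[leb n]_x \int[leb n]_y (h (y - x *m A)%R * f y)).
  apply: eq_integral => x _ /=.
  rewrite -[RHS](@ge0_integral_shiftv _ (x *m A)%R); last 2 first.
  - by mt.
  - by move=> z; exact: mule_ge0.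
  by apply: eq_integral => y _; rewrite addrK addrC.
rewrite -(fubini_tonelli (fun z : 'rV[R]_n * 'rV[R]_n =>
  h (z.1 - z.2 *m A)%R * f z.1)); last 2 first.
- by mt.
- by move=> z; exact: mule_ge0.
rewrite muleC -ge0_integralZl//; last by exact: integral_ge0.
apply: eq_integral => y _ /=.
(* As h is radial, it takes the same value at [y - x *m A] and at [x - y *m A^T]; the integral of
   the latter in x depends neither on y nor on A. *)
transitivity ((\int[leb n]_x h (x - y *m A^T)%R) * f y); last first.
  by congr (_ * _); rewrite (ge0_integral_shiftv _ mh).
have mhy : mfun (fun x : 'rV[R]_n => h (x - y *m A^T)%R) by mt.
rewrite -(ge0_intZr _ mhy (fun x => h0 _) (f0 y)).
apply: eq_integral => x _; congr (_ * _).
rewrite /h; congr (((_ < _)%R)%:R)%:E.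
rewrite -(enorm_orth (x - _) oA) mulmxBl -(mulmxA y) (orth_tr oA) mulmx1.
exact: enorm_distC.
Qed.

Lemma ge0_integral_oppv n (f : 'rV[R]_n -> \bar R) : mfun f ->
  (forall x, 0 <= f x) -> \int[leb n]_x f (- x)%R = \int[leb n]_x f x.
Proof.
move=> mf f0; rewrite [RHS](@ge0_integral_scalev _ (-1)%R) ?oppr_eq0 ?oner_eq0//.
rewrite normrN1 expr1n mul1e.
by apply: eq_integral => x _; rewrite scaleN1r.
Qed.

Lemma tonelliR n (f : 'rV[R]_n -> R -> \bar R) :
  mfun (fun z : 'rV[R]_n * R => f z.1 z.2) -> (forall x y, 0 <= f x y) ->
  \int[leb n]_x \int[mu]_y f x y = \int[mu]_y \int[leb n]_x f x y.
Proof.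
by move=> mf f0; exact: (@fubini_tonelli _ _ _ _ _ (leb n) mu
  (fun z : 'rV[R]_n * R => f z.1 z.2)).
Qed.

Lemma tonelliV n k (f : 'rV[R]_n -> 'rV[R]_k -> \bar R) :
  mfun (fun z : 'rV[R]_n * 'rV[R]_k => f z.1 z.2) -> (forall x y, 0 <= f x y) ->
  \int[leb n]_x \int[leb k]_y f x y = \int[leb k]_y \int[leb n]_x f x y.
Proof.
by move=> mf f0; exact: (@fubini_tonelli _ _ _ _ _ (leb n) (leb k)
  (fun z : 'rV[R]_n * 'rV[R]_k => f z.1 z.2)).
Qed.

Lemma mf_intR d (T : measurableType d) (f : T -> R -> \bar R) :
  mfun (fun z : T * R => f z.1 z.2) -> (forall x y, 0 <= f x y) ->
  mfun (fun x => \int[mu]_y f x y).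
Proof.
by move=> mf f0; exact: (@measurable_fun_fubini_tonelli_F _ _ _ _ _ mu
  (fun z : T * R => f z.1 z.2)).
Qed.

Lemma mf_intV d (T : measurableType d) n (f : T -> 'rV[R]_n -> \bar R) :
  mfun (fun z : T * 'rV[R]_n => f z.1 z.2) -> (forall x y, 0 <= f x y) ->
  mfun (fun x => \int[leb n]_y f x y).
Proof.
by move=> mf f0; exact: (@measurable_fun_fubini_tonelli_F _ _ _ _ _ (leb n)
  (fun z : T * 'rV[R]_n => f z.1 z.2)).
Qed.

End leb_space.

(** * Polar coordinates and radial integrals *)

Section polar.
Context {R : realType}.
Local Notation mu := (@lebesgue_measure R).
Local Open Scope ereal_scope.

(** Monotone convergence along balls of integer radius. It serves to bound an integral not yet known
    to be finite by an argument that needs finiteness, applied to each truncation. *)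
Lemma int_ball_exhaust n (f : 'rV[R]_n -> \bar R) M : mfun f ->
  (forall x, 0 <= f x) ->
  (forall N : nat, \int[leb n]_x (f x * ((enorm x <= N%:R)%R%:R)%:E) <= M) ->
  \int[leb n]_x f x <= M.
Proof.
move=> mf f0 fM.
pose F N := [set x : 'rV[R]_n | (enorm x <= N%:R)%R].
have mF N : measurable (F N) by rewrite /F; mt.
have FT : \bigcup_N F N = setT.
  apply/seteqP; split => // x _.
  by exists (Num.truncn (enorm x)).+1 => //; rewrite /F /= ltW// truncnS_gt.
have := @ge0_nondecreasing_set_cvg_integral _ _ R F f (leb n).
rewrite FT => /(_ _ mF _ _) h.
have {}h : \int[leb n]_(x in F i) f x @[i --> \oo] --> \int[leb n]_x f x.
  apply: h.
  - move=> i j ij; apply/subsetPset => x; rewrite /F /= => /le_trans; apply.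
    by rewrite ler_nat.
  - by move=> i; exact: measurable_funTS.
  - by move=> i x _.
rewrite -(cvg_lim _ h)//; apply: lime_le; first by apply/cvg_ex; eexists; exact: h.
apply: nearW => N; apply: le_trans (fM N); rewrite integral_mkcond.
apply: ge0_int_le => [|x||x].
- exact: (measurable_restrictT f (mF N)).1 (measurable_funTS mf).
- by rewrite patchE; case: ifP.
- by mt.
- rewrite patchE; case: ifPn => [|_]; last first.
    by apply: mule_ge0; rewrite ?lee_fin.
  by rewrite inE /F/= => ->; rewrite mule1.
Qed.

(** The invariant measure dr / r of the multiplicative group of positive reals, as a density on the
    whole line. *)
Definition haar (r : R) : \bar R := ((0 < r)%R%:R / r)%:E.

Lemma haar_ge0 r : 0 <= haar r.
Proof.
rewrite lee_fin; case: ltP => [r0|_]; last by rewrite mul0r.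
by rewrite mulr_ge0// invr_ge0 ltW.
Qed.

Lemma mf_haar : mfun haar.
Proof. by rewrite /haar; mt. Qed.

Lemma haar_scale (c r : R) : (0 < c)%R -> c%:E * haar (c * r) = haar r.
Proof.
move=> c0; rewrite -EFinM; congr EFin; rewrite pmulr_rgt0//.
case: (ltP 0%R r) => [r0|_]; last by rewrite !mul0r mulr0.
by field; rewrite !gt_eqF.
Qed.

Lemma haar_invar (c : R) (f : R -> \bar R) : (0 < c)%R -> mfun f ->
  (forall x, 0 <= f x) ->
  \int[mu]_r (haar r * f (c * r)%R) = \int[mu]_r (haar r * f r).
Proof.
move=> c0 mf f0; have mh := mf_haar.
rewrite [RHS](@ge0_integral_affine _ c 0%R)//; last 2 first.
- by mt.
- by move=> x; rewrite mule_ge0// haar_ge0.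
have g0 (x : R) : 0 <= haar (c * x + 0)%R * f (c * x + 0)%R.
  by rewrite mule_ge0// haar_ge0.
have mg : mfun (fun x : R => haar (c * x + 0)%R * f (c * x + 0)%R) by mt.
transitivity (\int[mu]_r (c%:E * (haar (c * r + 0)%R * f (c * r + 0)%R))).
  apply: eq_integral => r _; rewrite muleA !addr0 haar_scale//.
by rewrite (ge0_intZl mu mg g0) ?lee_fin ?ltW//.
Qed.

Definition shell_ind (r : R) : \bar R := ((1 < r)%R%:R * (r < 2)%R%:R)%:E.
Local Notation h := shell_ind.

Let h0 (r : R) : 0 <= h r. Proof. by rewrite lee_fin mulr_ge0. Qed.

Let mh : mfun h. Proof. by rewrite /shell_ind; mt. Qed.

(** This is ln 2; the bounds 1/2 and 1 of [shell_bounds] suffice for a factor that will be divided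
    out. *)
Definition shell : R := fine (\int[mu]_r (haar r * h r)).

Let itv12E : \int[mu]_r h r = 1.
Proof.
transitivity (mu `]1%R, 2%R[%classic); last first.
  rewrite lebesgue_measure_itv/= lte_fin ifT; last by lra.
  by rewrite -EFinD; congr EFin; ring.
rewrite -[X in mu X]setIT -integral_indic ?setIT//.
by apply: eq_integral => r _; rewrite /shell_ind indicE -natrM mulnb mem_setE in_itv.
Qed.

Lemma shell_bounds : \int[mu]_r (haar r * h r) = shell%:E /\ (0 < shell)%R.
Proof.
have mhh := mf_haar.
have hh0 r : 0 <= haar r * h r by rewrite mule_ge0// haar_ge0.
have mhh' : mfun (fun r => haar r * h r) by mt.
have u : \int[mu]_r (haar r * h r) <= 1.
  rewrite -itv12E; apply: ge0_int_le => // r.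
  rewrite /haar /shell_ind -EFinM lee_fin; case: (ltP 1%R r) => r1; last by rewrite !(mul0r, mulr0).
  rewrite (lt_trans _ r1)// !mul1r ler_piMl//.
  by rewrite invf_le1 ?(lt_trans _ r1)// ltW.
have l : (2^-1)%:E <= \int[mu]_r (haar r * h r).
  rewrite -[leLHS]mule1 -itv12E -ge0_intZl ?lee_fin//.
  apply: ge0_int_le => //; [by mt|by move=> r; rewrite mule_ge0 ?lee_fin|] => r.
  rewrite /haar /shell_ind -!EFinM lee_fin; case: (ltP 1%R r) => r1; last by rewrite !(mul0r, mulr0).
  case: (ltP r 2%R) => r2; last by rewrite !(mul0r, mulr0).
  rewrite (lt_trans _ r1)// !mul1r !mulr1 lef_pV2 ?ltW// posrE//.
  by rewrite (lt_trans _ r1).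
have f : \int[mu]_r (haar r * h r) \is a fin_num.
  by rewrite ge0_fin_numE ?(le_lt_trans u) ?ltry// (le_trans _ l)// lee_fin.
split; first by rewrite /shell fineK.
by rewrite -lte_fin /shell fineK// (lt_le_trans _ l)// lte_fin.
Qed.

(** For w homogeneous of degree -n this is ln 2 times the integral of w over the unit sphere; it
    takes the place of the surface measure. *)
Definition shell_mass n (w : 'rV[R]_n -> \bar R) :=
  \int[leb n]_y (w y * h (enorm y)^-1).

(* Polar coordinates for a weight homogeneous of degree -n, by integrating
   [F |y| w y h (r / |y|) dr / r] in both orders, [h] the indicator of ]1, 2[. *)
Lemma polar n (w : 'rV[R]_n -> \bar R) (F : R -> \bar R) :
  mfun w -> (forall y, 0 <= w y) -> w 0%R = 0 ->
  (forall r y, (0 < r)%R -> (r ^+ n)%:E * w (r *: y)%R = w y) ->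
  mfun F -> (forall r, 0 <= F r) ->
  (\int[leb n]_y (F (enorm y) * w y)) * shell%:E =
  shell_mass w * \int[mu]_r (haar r * F r).
Proof.
move=> mw w0 w00 wh mF F0; have mha := mf_haar; have ha0 := haar_ge0.
have [<- _] := shell_bounds.
have Ih0 : 0 <= \int[mu]_r (haar r * h r) by apply: integral_ge0 => r _; exact: mule_ge0.
rewrite -ge0_intZr//; last 2 first.
- by mt.
- by move=> y; exact: mule_ge0.
transitivity (\int[leb n]_y \int[mu]_r
    (haar r * (F (enorm y) * w y * h (r / enorm y)%R))).
  apply: eq_integral => y _.
  have [->|y0] := eqVneq y 0%R.
    rewrite w00 mule0 mul0e integral0_eq// => r _.
    by rewrite mul0e mule0.
  have ny : (0 < (enorm y)^-1)%R by rewrite invr_gt0 enorm_gt0.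
  rewrite -(@haar_invar (enorm y)^-1%R h)//.
  rewrite -ge0_intZl//; [|by mt|by move=> r; exact: mule_ge0|exact: mule_ge0].
  by apply: eq_integral => r _; rewrite muleCA (mulrC r).
rewrite (@tonelliR _ _ (fun y r =>
  haar r * (F (enorm y) * w y * h (r / enorm y)%R))); last 2 first.
- by mt.
- by move=> *; rewrite !mule_ge0.
(* Substituting y by r y produces the Jacobian r^n, which the homogeneity of w absorbs. *)
transitivity (\int[mu]_r \int[leb n]_y
    (haar r * (F (r * enorm y)%R * w y * h (enorm y)^-1%R))).
  apply: eq_integral => r _.
  have [r0|r0] := leP r 0%R.
    by rewrite /haar ltNge r0/= mul0r !integral0_eq// => y _; rewrite mul0e.
  rewrite (@ge0_integral_scalev _ _ r); [|by rewrite gt_eqF| |]; last 2 first.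
  - by mt.
  - by move=> z; rewrite !mule_ge0.
  rewrite -ge0_intZl; last 3 first.
  - by mt.
  - by move=> z; rewrite !mule_ge0.
  - by rewrite lee_fin exprn_ge0.
  apply: eq_integral => y _; rewrite muleCA; congr (_ * _).
  rewrite gtr0_norm// -(wh r y)// enormZ gtr0_norm// muleA (muleCA (F _)).
  by congr (_ * _ * h _); rewrite invfM mulrA divff ?mul1r// gt_eqF.
rewrite -(@tonelliR _ _ (fun y r =>
  haar r * (F (r * enorm y)%R * w y * h (enorm y)^-1%R))); last 2 first.
- by mt.
- by move=> *; rewrite !mule_ge0.
rewrite /shell_mass -ge0_intZr; last 3 first.
- by mt.
- by move=> y; rewrite mule_ge0.
- by apply: integral_ge0 => r _; exact: mule_ge0.
apply: eq_integral => y _.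
have [->|y0] := eqVneq y 0%R.
  rewrite w00 mul0e mul0e integral0_eq// => r _.
  by rewrite mule0 mul0e mule0.
have ny : (0 < enorm y)%R by rewrite enorm_gt0.
rewrite -[X in _ = _ * X](haar_invar ny mF F0).
rewrite -ge0_intZl; last 3 first.
- by mt.
- by move=> r; rewrite mule_ge0.
- by rewrite mule_ge0.
by apply: eq_integral => r _; rewrite (mulrC r) [RHS]muleCA -muleA [X in _ * X]muleC.
Qed.

End polar.

Section radial.
Context {R : realType}.
Local Notation mu := (@lebesgue_measure R).
Local Open Scope ereal_scope.

Lemma int_eballE n (r : R) :
  \int[@leb R n]_y ((enorm y < r)%R%:R : R)%:E = leb n (eball n r).
Proof.
rewrite -[eball n r]setIT -integral_indic ?setIT//; last exact: measurable_eball.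
apply: eq_integral => x _; rewrite indicE.
case: ltP => xr; first by rewrite mem_set.
by rewrite memNset//=; apply/negP; rewrite -leNgt.
Qed.

(** Doubling argument: the part |y| < 2 has mass at most c, and the dilation by 2 bounds the part
    |y| >= 2 by [lam] times the whole, where [lam = 2 ^ (n - q) < 1]. The resulting
    [A <= c + lam * A] can be solved because the truncation to |y| <= N makes A finite. *)
Lemma rad_out n (q : R) : (n%:R < q)%R ->
  \int[@leb R n]_y ((1 <= enorm y)%R%:R * enorm y `^ (- q))%:E < +oo.
Proof.
move=> nq.
pose lam : R := (2 `^ (n%:R - q))%R.
have lam0 : (0 < lam)%R by rewrite powR_gt0.
have lam1 : (lam < 1)%R.
  rewrite lt_neqAle powR_eq1 subr_eq0 (lt_eqF nq) orbF negb_or.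
  rewrite pnatr_eq1/= -leNgt ler0n/=.
  by rewrite -[leRHS](powRr0 2) ler_powR ?ler1n// subr_le0 ltW.
have q0 : (0 < q)%R by rewrite (le_lt_trans _ nq).
pose c := leb n (eball n (2 : R)%R).
have cfin : c \is a fin_num by rewrite /c ge0_fin_numE// leb_eball_lty.
apply: (@le_lt_trans _ _ ((fine c / (1 - lam))%:E)); last by rewrite ltry.
apply: int_ball_exhaust => [|y|N].
- by mt.
- by rewrite lee_fin mulr_ge0// powR_ge0.
set A := (X in X <= _).
pose g (y : 'rV[R]_n) := ((1 <= enorm y)%R%:R * enorm y `^ (- q) *
   (enorm y <= N%:R)%R%:R)%R.
have g0 y : (0 <= g y)%R by rewrite !mulr_ge0// powR_ge0.
have mg : mfun g by rewrite /g; mt.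
have AE : A = \int[@leb R n]_y (g y)%:E by apply: eq_integral => y _; rewrite -EFinM.
have g1 y : (g y <= (enorm y < N%:R + 1)%R%:R)%R.
  rewrite /g; case: (leP 1%R (enorm y)) => y1; last by rewrite !mul0r.
  case: (leP (enorm y) N%:R) => yN; last by rewrite mulr0.
  rewrite (le_lt_trans yN) ?ltrDl// !mulr1 mul1r.
  by rewrite -(powRr0 (enorm y)) ler_powR// oppr_le0 ltW.
have Afin : A \is a fin_num.
  have A0 : 0 <= A by rewrite AE; apply: integral_ge0 => y _; rewrite lee_fin.
  rewrite ge0_fin_numE// AE (le_lt_trans _ (leb_eball_lty n (N%:R + 1)))//.
  rewrite -int_eballE; apply: ge0_int_le => [|y||y].
  - by mt.
  - by rewrite lee_fin.
  - by mt.
  - by rewrite lee_fin.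
have step : A <= c + lam%:E * A.
  have -> : c = \int[@leb R n]_y ((enorm y < 2)%R%:R : R)%:E by rewrite int_eballE.
  rewrite AE -ge0_intZl; try sd.
  apply: (@le_trans _ _ (\int[@leb R n]_y (((enorm y < 2)%R%:R : R)%:E +
     ((2 <= enorm y)%R%:R * g y)%:E))).
    apply: ge0_int_le => [|y||y].
    - by mt.
    - by rewrite lee_fin.
    - by mt.
    - rewrite -EFinD lee_fin; case: (leP 2%R (enorm y)) => y2.
        by rewrite mul1r lerDr.
      rewrite mul0r addr0 (le_trans (g1 y))// ler_nat.
      by case: (_ < _)%R.
  rewrite ge0_intD; try sd.
  rewrite leeD2l//.
  rewrite (@ge0_integral_scalev _ _ 2%R) ?pnatr_eq0//; try sd.
  rewrite -ge0_intZl; try sd.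
  apply: ge0_int_le; try sd.
  - move=> y; rewrite -!EFinM lee_fin /g enormZ ger0_norm//.
    case: (leP 2%R _) => y2; last by rewrite mul0r mulr0; pos.
    have y1 : (1 <= enorm y)%R by move: y2; lra.
    have y1' : (1 <= 2 * enorm y)%R by move: y2; lra.
    rewrite y1 y1' !mul1r powRM ?enorm_ge0//.
    have -> : lam = (2 ^+ n * 2 `^ (- q))%R.
      by rewrite -powR_mulrn// -powRD ?pnatr_eq0 ?implybT.
    rewrite -!mulrA !(ler_wpM2l) ?exprn_ge0 ?powR_ge0//.
    case: (leP (2 * enorm y)%R N%:R) => h; last by rewrite ler0n.
    by have -> : (enorm y <= N%:R)%R by move: h y2; lra.
move: step; rewrite -(fineK Afin) -(fineK cfin) -EFinM -EFinD !lee_fin => step.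
by rewrite ler_pdivlMr ?subr_gt0//; move: step; lra.
Qed.

Lemma rad_out_nat n k : (n < k)%N ->
  \int[@leb R n]_y ((1 <= enorm y)%R%:R / enorm y ^+ k)%:E < +oo.
Proof.
move=> nk; have := @rad_out n k%:R; rewrite ltr_nat => /(_ nk).
congr (_ < _); apply: eq_integral => y _; congr EFin.
case: (leP 1%R (enorm y)) => y1; last by rewrite !mul0r.
by rewrite powRN powR_mulrn// enorm_ge0.
Qed.

Definition invnorm n k (y : 'rV[R]_n) : \bar R := ((enorm y ^+ k)^-1)%:E.

Lemma invnorm_ge0 n k (y : 'rV[R]_n) : 0 <= invnorm k y.
Proof. by rewrite lee_fin invr_ge0 exprn_ge0// enorm_ge0. Qed.

Lemma mf_invnorm n k : mfun (@invnorm n k).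
Proof. by rewrite /invnorm; mt. Qed.

Lemma invnorm0 n k : (0 < k)%N -> invnorm k (0 : 'rV[R]_n) = 0.
Proof. by case: k => // k _; rewrite /invnorm enorm0 expr0n invr0. Qed.

Lemma invnorm_scale n k r (y : 'rV[R]_n) : (0 < r)%R ->
  (r ^+ k)%:E * invnorm k (r *: y)%R = invnorm k y.
Proof.
move=> r0; rewrite -EFinM enormZ gtr0_norm// exprMn; congr EFin.
by rewrite invfM mulrA divff ?mul1r// expf_neq0// gt_eqF.
Qed.

(* [shell_mass] only sees the shell 1/2 < |y| < 1. *)
Lemma shell_mass_le n (w : 'rV[R]_n -> \bar R) (c : R) : mfun w ->
  (forall y, 0 <= w y) -> (0 <= c)%R ->
  (forall y, w y <= c%:E * invnorm n y) ->
  shell_mass w <= (c * 2 ^+ n)%:E * @leb R n (eball n (1 : R)%R).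
Proof.
move=> mw w0 c0 wc.
rewrite -int_eballE -ge0_intZl ?lee_fin ?mulr_ge0 ?exprn_ge0//; try sd.
rewrite /shell_mass /shell_ind; apply: ge0_int_le => [|y||y].
- by mt.
- by rewrite mule_ge0// lee_fin mulr_ge0.
- by mt.
case: (ltP 1%R ((enorm y)^-1)%R) => y1; last by rewrite mul0r mule0 -EFinM lee_fin !mulr_ge0 ?exprn_ge0.
case: (ltP ((enorm y)^-1)%R 2%R) => y2; last by rewrite mulr0 mule0 -EFinM lee_fin !mulr_ge0 ?exprn_ge0.
have y0 : (0 < enorm y)%R by rewrite -invr_gt0 (lt_trans _ y1).
have -> : (enorm y < 1)%R by rewrite -(invf_gt1 y0).
rewrite mulr1 !mule1.
apply: (le_trans (wc y)); rewrite -EFinM lee_fin ler_wpM2l//.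
by rewrite -exprVn lerXn2r ?nnegrE ?invr_ge0 ?ltW.
Qed.

(** Polar coordinates with the weight |y|^-n: the radial factor is r^(n - k) on r < 1, and its
    integral against dr / r is at most 1 since k < n. The exponent 0 is treated apart. *)
Lemma rad_in n k : (k < n)%N ->
  \int[@leb R n]_y ((enorm y < 1)%R%:R / enorm y ^+ k)%:E < +oo.
Proof.
move=> kn.
case: k kn => [|k] kn.
  under eq_integral do rewrite expr0 divr1.
  by rewrite int_eballE leb_eball_lty.
have n0 : (0 < n)%N by exact: leq_trans kn.
pose F (r : R) : \bar R := ((r < 1)%R%:R * `|r| ^+ (n - k.+1))%:E.
have F0 r : 0 <= F r by rewrite lee_fin mulr_ge0.
have mF : mfun F by rewrite /F; mt.
have := @polar _ n _ _ (@mf_invnorm n n) (@invnorm_ge0 n n) (@invnorm0 n n n0)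
  (fun r y r0 => @invnorm_scale n n r y r0) mF F0.
have -> : \int[@leb R n]_y (F (enorm y) * invnorm n y) =
    \int[@leb R n]_y ((enorm y < 1)%R%:R / enorm y ^+ k.+1)%:E.
  apply: eq_integral => y _; rewrite /F -EFinM -mulrA; congr (_ * _)%:E.
  have [->|y0] := eqVneq y 0%R; first by rewrite enorm0 !expr0n/= invr0 -(subnKC n0) invr0 mulr0.
  rewrite -[X in (_ / _ ^+ X)%R](subnKC (ltnW kn)) exprD invfM mulrCA.
  rewrite ger0_norm ?enorm_ge0// divff ?mulr1//.
  by rewrite expf_neq0// enorm_eq0.
move=> e.
have [s0 s1] := @shell_bounds R.
have C1 : shell_mass (@invnorm n n) < +oo.
  rewrite (le_lt_trans (@shell_mass_le n _ 1%R (@mf_invnorm n n) (@invnorm_ge0 n n) ler01 _))//.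
    by move=> y; rewrite mul1e.
  by rewrite lte_mul_pinfty ?lee_fin ?mulr_ge0 ?exprn_ge0// leb_eball_lty.
have C0 : 0 <= shell_mass (@invnorm n n).
  by apply: integral_ge0 => y _; rewrite mule_ge0 ?invnorm_ge0// lee_fin mulr_ge0.
have I1 : \int[mu]_r (haar r * F r) <= 1.
  apply: (@le_trans _ _ (mu `]0%R, 1%R[%classic)); last first.
    by rewrite lebesgue_measure_itv/= lte_fin ltr01 -EFinD subr0.
  rewrite -[X in mu X]setIT -integral_indic ?setIT//.
  have mh := @mf_haar R.
  apply: ge0_int_le => [|r||r].
  - by mt.
  - by rewrite mule_ge0 ?haar_ge0.
  - by apply: mf_EFin; apply: mf_indic.
  rewrite indicE mem_setE in_itv/= /haar /F -EFinM lee_fin.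
  case: (ltP 0%R r) => r0; last by rewrite !mul0r.
  case: (ltP r 1%R) => r1; last by rewrite mul0r mulr0.
  rewrite !mul1r ger0_norm ?(ltW r0)// -(@subnSK k.+1 n)// exprS mulrA mulVf ?gt_eqF// mul1r.
  by apply: exprn_ile1; exact: ltW.
have : (\int[@leb R n]_y ((enorm y < 1)%R%:R / enorm y ^+ k.+1)%:E) * (@shell R)%:E < +oo.
  rewrite e (@le_lt_trans _ _ (shell_mass (@invnorm n n) * 1))//.
    by rewrite lee_wpmul2l.
  by rewrite mule1.
rewrite !ltey; apply: contra => /eqP ->.
by rewrite gt0_mulye// lte_fin.
Qed.

(** The origin lies in balls of radius r, whose measure is r^n times that of the unit ball. *)
Lemma leb0_null n : (0 < n)%N -> leb n [set 0%R : 'rV[R]_n] = 0.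
Proof.
move=> n0.
have sub (r : R) : (0 < r)%R -> leb n [set 0%R : 'rV[R]_n] <= (r ^+ n)%:E * @leb R n (eball n (1 : R)%R).
  move=> r0.
  have -> : (r ^+ n)%:E * @leb R n (eball n (1 : R)%R) = leb n (eball n r).
    rewrite -!int_eballE.
    rewrite [RHS](@ge0_integral_scalev _ _ r) ?gt_eqF//; try sd.
    rewrite gtr0_norm//; congr (_ * _).
    by apply: eq_integral => y _; rewrite enormZ gtr0_norm// gtr_pMr.
  have e : [set 0%R : 'rV[R]_n] = [set y | (enorm y <= 0)%R].
    by apply/seteqP; split => y /=; rewrite ?le_eqVlt ltNge enorm_ge0 orbF enorm_eq0 => /eqP.
  apply: le_measure; rewrite ?inE ?e; [by mt|exact: measurable_eball|].
  by move=> y /= /le_lt_trans; apply.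
have bfin : @leb R n (eball n (1 : R)%R) \is a fin_num by rewrite ge0_fin_numE// leb_eball_lty.
apply/eqP; rewrite eq_le measure_ge0 andbT; apply/lee_addgt0Pr => e e0; rewrite add0e.
pose b := fine (@leb R n (eball n (1 : R)%R)).
have b0 : (0 <= b)%R by rewrite fine_ge0.
(* From r <= 1 and n > 0 follows r^n <= r; the [b + 1] keeps the denominator positive. *)
pose r := (Num.min 1 (e / (b + 1)))%R.
have r0 : (0 < r)%R by rewrite lt_min ltr01 divr_gt0// ltr_wpDl.
apply: (le_trans (sub r r0)); rewrite -(fineK bfin) -EFinM lee_fin.
apply: (@le_trans _ _ (r * (b + 1))%R).
  apply: ler_pM; rewrite ?exprn_ge0 ?(ltW r0) ?lerDl//.
  rewrite -(prednK n0) exprS ler_piMr ?(ltW r0)//.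
  by apply: exprn_ile1; rewrite ?(ltW r0)// ge_min lexx.
by rewrite -ler_pdivlMr ?ltr_wpDl// ge_min lexx orbT.
Qed.

End radial.

(** * Signed integrals, Fubini and changes of variables *)

Section transfer.
Context {R : realType}.
Local Open Scope ereal_scope.

(** Positive and negative parts separately. As c is positive and finite, the identity also survives
    when one or both parts are infinite, so measurability of f is all that is assumed. *)
Lemma integral_transfer d1 d2 (T1 : measurableType d1) (T2 : measurableType d2)
  (m1 : {measure set T1 -> \bar R}) (m2 : {measure set T2 -> \bar R})
  (phi : T1 -> T2) (c : R) : (0 < c)%R ->
  (forall f : T2 -> \bar R, mfun f -> (forall x, 0 <= f x) ->
    \int[m2]_x f x = c%:E * \int[m1]_x f (phi x)) ->
  forall f : T2 -> \bar R, mfun f ->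
    \int[m2]_x f x = c%:E * \int[m1]_x f (phi x).
Proof.
move=> c0 h f mf; rewrite integralE [in RHS]integralE.
have e1 : \int[m1]_x (fun x => f (phi x))^\+ x = \int[m1]_x f^\+ (phi x).
  by apply: eq_integral => x _; rewrite !funeposE.
have e2 : \int[m1]_x (fun x => f (phi x))^\- x = \int[m1]_x f^\- (phi x).
  by apply: eq_integral => x _; rewrite !funenegE.
rewrite e1 e2 (h f^\+) ?(h f^\-)//; [|exact: measurable_funeneg|exact: measurable_funepos].
have : 0 <= \int[m1]_x f^\+ (phi x) by apply: integral_ge0.
have : 0 <= \int[m1]_x f^\- (phi x) by apply: integral_ge0.
case: (\int[m1]_x f^\+ (phi x)) => [a||]; case: (\int[m1]_x f^\- (phi x)) => [b||]// _ _.
- by rewrite -[RHS]/((c * (a - b))%R%:E) mulrBr.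
- by rewrite /= addeNy mulrNy mulry gtr0_sg// !mul1e.
- by rewrite /= addye// mulry gtr0_sg// mul1e.
- by rewrite /= mulry mulrNy gtr0_sg// !mul1e.
Qed.

Lemma integral_shiftv n a (f : 'rV[R]_n -> \bar R) : mfun f ->
  \int[leb n]_x f (x + a)%R = \int[leb n]_x f x.
Proof.
move=> mf; rewrite [RHS](@integral_transfer _ _ _ _ (leb n) (leb n) (fun x => x + a)%R 1%R) ?mul1e//.
by move=> g mg g0; rewrite mul1e ge0_integral_shiftv.
Qed.

Lemma integral_oppv n (f : 'rV[R]_n -> \bar R) : mfun f ->
  \int[leb n]_x f (- x)%R = \int[leb n]_x f x.
Proof.
move=> mf; rewrite [RHS](@integral_transfer _ _ _ _ (leb n) (leb n) (fun x => - x)%R 1%R) ?mul1e//.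
by move=> g mg g0; rewrite mul1e ge0_integral_oppv.
Qed.

Lemma integral_orth n (A : 'M[R]_n) (f : 'rV[R]_n -> \bar R) : orth A -> mfun f ->
  \int[leb n]_x f (x *m A)%R = \int[leb n]_x f x.
Proof.
move=> oA mf; rewrite [RHS](@integral_transfer _ _ _ _ (leb n) (leb n) (fun x => x *m A)%R 1%R) ?mul1e//.
by move=> g mg g0; rewrite mul1e ge0_integral_orth.
Qed.

Lemma integral_scalev n (c : R) (f : 'rV[R]_n -> \bar R) : c != 0%R -> mfun f ->
  \int[leb n]_x f x = (`|c| ^+ n)%:E * \int[leb n]_x f (c *: x)%R.
Proof.
move=> c0; apply: integral_transfer; first by rewrite exprn_gt0// normr_gt0.
by move=> g mg g0; exact: ge0_integral_scalev.
Qed.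

End transfer.

Section integrability.
Context {R : realType} d {T : measurableType d} (mu : {measure set T -> \bar R}).
Local Open Scope ereal_scope.

(** Absolute integrability detached from measurability, which the tactic [mt] provides on its
    own. *)
Definition finint (f : T -> R) := \int[mu]_x (`|f x|)%:E < +oo.

Lemma finint_integrable (f : T -> R) : mfun f -> finint f ->
  mu.-integrable setT (EFin \o f).
Proof. by move=> mf ff; apply/integrableP; split => //; exact/measurable_EFinP. Qed.

Lemma finint_le (f g : T -> R) : mfun f -> mfun g -> finint g ->
  (forall x, `|f x| <= `|g x|)%R -> finint f.
Proof.
rewrite /finint => mf mg gf fg; apply: le_lt_trans gf.
by apply: ge0_int_le; try sd; move=> x; rewrite lee_fin.
Qed.

Lemma finintD (f g : T -> R) : mfun f -> mfun g -> finint f -> finint g ->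
  finint (fun x => f x + g x)%R.
Proof.
move=> mf mg ff fg; have := lte_add_pinfty ff fg; rewrite -ge0_intD; try sd.
apply: le_lt_trans; apply: ge0_int_le; try sd.
by move=> x; rewrite -EFinD lee_fin ler_normD.
Qed.

Lemma finintZ (k : R) (f : T -> R) : mfun f -> finint f -> finint (fun x => k * f x)%R.
Proof.
move=> mf ff; rewrite /finint.
rewrite (eq_integral (fun x => `|k|%:E * `|f x|%:E)); last first.
  by move=> x _; rewrite normrM EFinM.
by rewrite ge0_intZl; try sd; rewrite lte_mul_pinfty// lee_fin.
Qed.

Lemma finint_sum (I : Type) (r : seq I) (f : I -> T -> R) :
  (forall i, mfun (f i)) -> (forall i, finint (f i)) ->
  finint (fun x => \sum_(i <- r) f i x)%R.
Proof.
move=> mf ff; elim: r => [|i r IH].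
  rewrite /finint (eq_integral (cst 0)) ?integral0//.
  by move=> x _; rewrite big_nil normr0.
rewrite (_ : (fun _ => _) = (fun x => f i x + \sum_(i <- r) f i x)%R).
  by apply: finintD => //; mt.
by apply/funext => x; rewrite big_cons.
Qed.

Lemma RintZ (k : R) (f : T -> R) : mfun f -> finint f ->
  (\int[mu]_x (k * f x) = k * \int[mu]_x f x)%R.
Proof. by move=> mf ff; rewrite RintegralZl//; exact: finint_integrable. Qed.

Lemma RintD (f g : T -> R) : mfun f -> finint f -> mfun g -> finint g ->
  (\int[mu]_x (f x + g x) = \int[mu]_x f x + \int[mu]_x g x)%R.
Proof. by move=> mf ff mg fg; rewrite RintegralD//; exact: finint_integrable. Qed.

Lemma RintB (f g : T -> R) : mfun f -> finint f -> mfun g -> finint g ->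
  (\int[mu]_x (f x - g x) = \int[mu]_x f x - \int[mu]_x g x)%R.
Proof. by move=> mf ff mg fg; rewrite RintegralB//; exact: finint_integrable. Qed.

Lemma Rint_sum (I : Type) (r : seq I) (f : I -> T -> R) :
  (forall i, mfun (f i)) -> (forall i, finint (f i)) ->
  (\int[mu]_x (\sum_(i <- r) f i x) = \sum_(i <- r) \int[mu]_x f i x)%R.
Proof.
move=> mf ff; elim: r => [|i r IH].
  rewrite big_nil /Rintegral (eq_integral (cst 0)) ?integral0// => x _.
  by rewrite big_nil.
rewrite big_cons -IH -RintD//; [|by mt|exact: finint_sum].
by apply: eq_Rintegral => x _; rewrite big_cons.
Qed.

Lemma norm_Rint_le (f : T -> R) : mfun f -> finint f ->
  (`|\int[mu]_x f x| <= fine (\int[mu]_x (`|f x|)%:E))%R.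
Proof. by move=> mf ff; apply: le_normr_Rintegral => //; exact: finint_integrable. Qed.

(** The extended-real form allows an infinite right-hand side, so that a bound can be stated before
    integrability is known. *)
Lemma norm_Rint_leE (f : T -> R) : mfun f ->
  (`|\int[mu]_x f x|)%:E <= \int[mu]_x (`|f x|)%:E.
Proof.
move=> mf; have [ff|] := boolP (\int[mu]_x (`|f x|)%:E < +oo).
  rewrite -[leRHS]fineK; first by rewrite lee_fin norm_Rint_le.
  by rewrite ge0_fin_numE//; apply: integral_ge0 => x _; rewrite lee_fin.
by rewrite ltey negbK => /eqP ->; rewrite leey.
Qed.

Lemma RintE (f : T -> R) : mfun f -> finint f ->
  (\int[mu]_x f x)%R%:E = \int[mu]_x (f x)%:E.
Proof.
by move=> mf ff; rewrite /Rintegral fineK//; apply: integrable_fin_num => //; exact: finint_integrable.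
Qed.

Lemma Rint_ge0E (f : T -> R) : mfun f -> (forall x, 0 <= f x)%R -> finint f ->
  \int[mu]_x (`|f x|)%:E = (\int[mu]_x f x)%R%:E.
Proof.
move=> mf f0 ff; rewrite RintE//; apply: eq_integral => x _.
by rewrite ger0_norm.
Qed.

Lemma ae_Rint_eq (f g : T -> R) : mfun f -> mfun g ->
  {ae mu, forall x, f x = g x} -> (\int[mu]_x f x = \int[mu]_x g x)%R.
Proof.
move=> mf mg fg; rewrite /Rintegral; congr fine.
apply: ae_eq_integral => //; [by mt|by mt|].
by apply: filterS fg => x /= ->.
Qed.

Lemma finint_ae (f g : T -> R) : mfun f -> mfun g ->
  {ae mu, forall x, f x = g x} -> finint f -> finint g.
Proof.
move=> mf mg fg; rewrite /finint; congr (_ < _).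
apply: ae_eq_integral => //; [by mt|by mt|].
by apply: filterS fg => x /= ->.
Qed.

Lemma ae_fin (f : T -> \bar R) : mfun f -> (forall x, 0 <= f x) ->
  \int[mu]_x f x < +oo -> {ae mu, forall x, f x < +oo}.
Proof.
move=> mf f0 ff.
have : mu.-integrable setT f.
  apply/integrableP; split => //; apply: le_lt_trans ff.
  by apply: ge0_int_le; try sd; move=> x; rewrite gee0_abs.
move=> /integrable_ae => /(_ measurableT); apply: filterS => x /(_ I).
by rewrite fin_numE => /andP[_]; rewrite ltey.
Qed.

End integrability.

Section fubini_real.
Context {R : realType} d1 d2 {T1 : measurableType d1} {T2 : measurableType d2}
  (m1 : {sigma_finite_measure set T1 -> \bar R})
  (m2 : {sigma_finite_measure set T2 -> \bar R}).
Local Open Scope ereal_scope.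

Lemma mf_ae_inner (f : T1 -> T2 -> R) :
  mfun (fun z : T1 * T2 => f z.1 z.2) ->
  \int[m1]_x \int[m2]_y (`|f x y|)%:E < +oo ->
  {ae m1, forall x, finint m2 (f x)}.
Proof.
move=> mf ff; apply: ae_fin => //.
- apply: (@measurable_fun_fubini_tonelli_F _ _ _ _ _ m2
    (fun z : T1 * T2 => (`|f z.1 z.2|)%:E)); sd.
- by move=> x; apply: integral_ge0 => y _; rewrite lee_fin.
Qed.

(** Tonelli gives the measurability in x of the integrals of the positive and of the negative part;
    subtraction and [fine] preserve it. *)
Lemma mf_Rint (f : T1 -> T2 -> R) : mfun (fun z : T1 * T2 => f z.1 z.2) ->
  mfun (fun x => \int[m2]_y f x y)%R.
Proof.
move=> mf; rewrite /Rintegral; apply: mf_fine.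
under eq_fun do rewrite integralE.
apply: emeasurable_funB.
- rewrite (_ : (fun _ => _) = (fun x => \int[m2]_y
      ((fun z : T1 * T2 => (f z.1 z.2)%:E)^\+ (x, y)))); last first.
    by apply/funext => x; apply: eq_integral => y _; rewrite !funeposE.
  apply: (@measurable_fun_fubini_tonelli_F _ _ _ _ _ m2
    ((fun z : T1 * T2 => (f z.1 z.2)%:E)^\+)) => //.
  by apply: measurable_funepos; mt.
- rewrite (_ : (fun _ => _) = (fun x => \int[m2]_y
      ((fun z : T1 * T2 => (f z.1 z.2)%:E)^\- (x, y)))); last first.
    by apply/funext => x; apply: eq_integral => y _; rewrite !funenegE.
  apply: (@measurable_fun_fubini_tonelli_F _ _ _ _ _ m2
    ((fun z : T1 * T2 => (f z.1 z.2)%:E)^\-)) => //.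
  by apply: measurable_funeneg; mt.
Qed.

Lemma finint_Rint (f : T1 -> T2 -> R) :
  mfun (fun z : T1 * T2 => f z.1 z.2) ->
  \int[m1]_x \int[m2]_y (`|f x y|)%:E < +oo ->
  finint m1 (fun x => \int[m2]_y f x y)%R.
Proof.
move=> mf; apply: le_lt_trans.
have mfx x : mfun (f x) by apply: (mf_comp2 mf); mt.
apply: ge0_int_le.
- by apply: mf_EFin; apply: mf_normr; exact: mf_Rint.
- by sd.
- apply: (@measurable_fun_fubini_tonelli_F _ _ _ _ _ m2
    (fun z : T1 * T2 => (`|f z.1 z.2|)%:E)); sd.
- by move=> x; exact: norm_Rint_leE.
Qed.

(** The inner real integral agrees with the extended-real one only where the slice is integrable,
    and [fine] returns a default elsewhere. Hence the two passages through almost-everywhere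
    equality around the extended-real Fubini theorem. *)
Lemma fubini_R (f : T1 -> T2 -> R) :
  mfun (fun z : T1 * T2 => f z.1 z.2) ->
  \int[m1]_x \int[m2]_y (`|f x y|)%:E < +oo ->
  (\int[m1]_x \int[m2]_y f x y = \int[m2]_y \int[m1]_x f x y)%R.
Proof.
move=> mf ff.
have mfx x : mfun (f x) by apply: (mf_comp2 mf); mt.
have mfy y : mfun (f^~ y) by apply: (mf_comp2 mf); mt.
have ff' : \int[m2]_y \int[m1]_x (`|f x y|)%:E < +oo.
  rewrite -(@fubini_tonelli _ _ _ _ _ m1 m2 (fun z => (`|f z.1 z.2|)%:E))//; sd.
have ms : mfun (fun z : T2 * T1 => f z.2 z.1).
  by apply: (mf_comp2 mf); mt.
have fp : (m1 \x m2).-integrable setT (fun z => (f z.1 z.2)%:E).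
  by apply/integrable12ltyP => //; mt.
have := Fubini fp; rewrite /fubini_F /fubini_G /= => e.
rewrite {1}/Rintegral [RHS]/Rintegral; congr fine.
have Fm := measurable_fubini_F fp; have Gm := measurable_fubini_G fp.
rewrite /fubini_F /fubini_G /= in Fm Gm.
transitivity (\int[m1]_x \int[m2]_y (f x y)%:E).
  apply: ae_eq_integral => //.
    by apply: mf_EFin; exact: mf_Rint.
  by apply: filterS (mf_ae_inner mf ff) => x fx _; rewrite RintE.
rewrite e; apply: ae_eq_integral => //.
  apply: mf_EFin; rewrite /Rintegral; apply: mf_fine; exact: Gm.
have : {ae m2, forall y, finint m1 (f^~ y)}.
  apply: ae_fin => //.
  - apply: (@measurable_fun_fubini_tonelli_F _ _ _ _ _ m1
      (fun z : T2 * T1 => (`|f z.2 z.1|)%:E)); sd.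
  - by move=> x; apply: integral_ge0 => y _; rewrite lee_fin.
by apply: filterS => y fy _; rewrite -RintE.
Qed.

End fubini_real.

Section change_of_variable_R.
Context {R : realType}.
Implicit Types n : nat.

Lemma Rint_shiftv n a (f : 'rV[R]_n -> R) : mfun f ->
  \int[leb n]_x f (x + a) = \int[leb n]_x f x.
Proof.
move=> mf; congr fine; apply: (integral_shiftv a (f := fun x => (f x)%:E)).
by mt.
Qed.

Lemma Rint_oppv n (f : 'rV[R]_n -> R) : mfun f ->
  \int[leb n]_x f (- x) = \int[leb n]_x f x.
Proof.
move=> mf; congr fine; apply: (integral_oppv (f := fun x => (f x)%:E)).
by mt.
Qed.

Lemma Rint_orth n (A : 'M[R]_n) (f : 'rV[R]_n -> R) : orth A -> mfun f ->
  \int[leb n]_x f (x *m A) = \int[leb n]_x f x.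
Proof.
move=> oA mf; congr fine; apply: (integral_orth (f := fun x => (f x)%:E)) => //.
by mt.
Qed.

(** If the integral is infinite, [fine] returns 0 on both sides. *)
Lemma Rint_scalev n (c : R) (f : 'rV[R]_n -> R) : c != 0 -> mfun f ->
  \int[leb n]_x f x = `|c| ^+ n * \int[leb n]_x f (c *: x).
Proof.
move=> c0 mf; rewrite /Rintegral.
rewrite (integral_scalev c0 (f := fun x => (f x)%:E)); last by mt.
have : 0 < `|c| ^+ n by rewrite exprn_gt0// normr_gt0.
move: (`|c| ^+ n) => k k0; case: (\int[leb n]_x _)%E => [r||]//=.
- by rewrite mulry gtr0_sg// mul1e/= mulr0.
- by rewrite mulrNy gtr0_sg// mul1e/= mulr0.
Qed.

Lemma finint_shiftv n a (f : 'rV[R]_n -> R) : mfun f ->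
  finint (leb n) f -> finint (leb n) (fun x => f (x + a)).
Proof.
by move=> mf; rewrite /finint (ge0_integral_shiftv a (f := fun x => (`|f x|)%:E)); try sd.
Qed.

Lemma finint_oppv n (f : 'rV[R]_n -> R) : mfun f ->
  finint (leb n) f -> finint (leb n) (fun x => f (- x)).
Proof.
by move=> mf; rewrite /finint (ge0_integral_oppv (f := fun x => (`|f x|)%:E)); try sd.
Qed.

Lemma finint_scalev n (c : R) (f : 'rV[R]_n -> R) : c != 0 -> mfun f ->
  finint (leb n) f -> finint (leb n) (fun x => f (c *: x)).
Proof.
move=> c0 mf; rewrite /finint (ge0_integral_scalev c0 (f := fun x => (`|f x|)%:E)); try sd.
have : (0 <= \int[leb n]_x (`|f (c *: x)|)%:E)%E by apply: integral_ge0 => x _; rewrite lee_fin.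
case: (\int[leb n]_x _)%E => [r _ _| _|//]; first by rewrite ltry.
by rewrite mulry gtr0_sg ?mul1e// exprn_gt0// normr_gt0.
Qed.

End change_of_variable_R.

(** * Derivatives and finite differences *)

Notation isd x f d := (is_derive (x : _) (1 : _) f d).

Section derivation_rules.
Context {R : realType}.
Implicit Types (f g : R -> R) (x a b : R).

Lemma isd_eq f x a b : isd x f a -> a = b -> isd x f b.
Proof. by move=> h <-. Qed.

Lemma isd_cst (c : R) x : isd x (fun=> c) (0 : R).
Proof. exact: is_derive_cst. Qed.

Lemma isd_id x : isd x (fun t : R => t) (1 : R).
Proof. exact: is_derive_id. Qed.

Lemma isd_add f g x a b : isd x f a -> isd x g b ->
  isd x (fun t => f t + g t) (a + b).
Proof. by move=> h1 h2; exact: is_deriveD. Qed.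

Lemma isd_sub f g x a b : isd x f a -> isd x g b ->
  isd x (fun t => f t - g t) (a - b).
Proof. by move=> h1 h2; exact: is_deriveB. Qed.

Lemma isd_mul f g x a b : isd x f a -> isd x g b ->
  isd x (fun t => f t * g t) (a * g x + f x * b).
Proof.
move=> h1 h2; have h := is_deriveM h1 h2.
rewrite (_ : (fun t => f t * g t) = f * g)//; apply: (isd_eq h).
by rewrite /GRing.scale/= addrC (mulrC (g x)).
Qed.

Lemma isd_scale f x a (c : R) : isd x f a -> isd x (fun t => c * f t) (c * a).
Proof. by move=> h; exact: (is_deriveZ c h). Qed.

Lemma isd_comp f g x a b : isd (g x) f a -> isd x g b ->
  isd x (fun t => f (g t)) (a * b).
Proof. by move=> h1 h2; exact: (is_derive1_comp h1 h2). Qed.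

Lemma isd_pow f x a (k : nat) : isd x f a ->
  isd x (fun t => f t ^+ k) (k%:R * f x ^+ k.-1 * a).
Proof.
move=> h; have := @is_deriveX _ _ f k x 1 a h.
rewrite (_ : f ^+ k = (fun t => f t ^+ k))//.
by apply/funext => t; rewrite fctE.
Qed.

Lemma isd_inv f x a : f x != 0 -> isd x f a ->
  isd x (fun t => (f t)^-1) (- (f x ^- 2) * a).
Proof. by move=> fx h; exact: (is_deriveV fx h). Qed.

Lemma isd_sum (n : nat) (f : nat -> R -> R) (a : nat -> R) x :
  (forall i, isd x (f i) (a i)) ->
  isd x (fun t => \sum_(i < n) f i t) (\sum_(i < n) a i).
Proof.
move=> h; elim: n => [|n IH].
  by under eq_fun do rewrite big_ord0; rewrite big_ord0; exact: isd_cst.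
under eq_fun do rewrite big_ord_recr/=; rewrite big_ord_recr/=.
exact: (isd_add IH (h n)).
Qed.

Lemma isd_continuous f x a : isd x f a -> {for x, continuous f}.
Proof.
move=> [d _]; apply: differentiable_continuous; exact/derivable1_diffP.
Qed.

Lemma isd_derivable f x a : isd x f a -> derivable f x 1.
Proof. by case. Qed.

Lemma mean_value f (f' : R -> R) (a b : R) : a < b ->
  (forall x, a <= x -> isd x f (f' x)) ->
  exists2 c, a < c < b & f b - f a = f' c * (b - a).
Proof.
move=> ab df; have [||c /[!in_itv]/= ? ?] := @MVT _ f f' a b ab; last by exists c.
- by move=> x /[!in_itv]/=/andP[/ltW ax _]; exact: df.
- apply: derivable_within_continuous => x /[!in_itv]/=/andP[ax _].
  exact: isd_derivable (df x ax).
Qed.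

End derivation_rules.

Section finite_difference.
Context {R : realType}.
Implicit Types (f : R -> R) (l j k : nat).

Definition cf l j : R := 'C(l, j)%:R * (-1) ^+ j.

Definition fdiff f (x : R) : R := f x - f (x + 1).

(** Pascal's rule. In the iterated form each difference can be traded for a derivative by the mean
    value theorem. *)
Lemma fdiff_iter l f (x : R) :
  \sum_(j < l.+1) cf l j * f (x + j%:R) = iter l fdiff f x.
Proof.
elim: l f x => [|l IH] f x.
  by rewrite big_ord1 /cf bin0 expr0 !mul1r addr0.
rewrite iterSr -IH big_ord_recl /cf bin0 expr0 !mul1r addr0.
under [RHS]eq_bigr do rewrite /fdiff mulrBr.
rewrite [RHS]big_split/= [X in _ = X + _]big_ord_recl.
have e : \sum_(i < l.+1) 'C(l, i.+1)%:R * (-1) ^+ i.+1 * f (x + i.+1%:R) =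
    \sum_(i < l) 'C(l, i.+1)%:R * (-1) ^+ i.+1 * f (x + i.+1%:R) :> R.
  by rewrite big_ord_recr/= bin_small// !mul0r addr0.
rewrite bin0 expr0 !mul1r addr0 -addrA; congr (_ + _).
have -> : \sum_(i < l) 'C(l, lift ord0 i)%:R * (-1) ^+ lift ord0 i * f (x + (lift ord0 i)%:R) =
  \sum_(i < l.+1) 'C(l, i.+1)%:R * (-1) ^+ i.+1 * f (x + i.+1%:R) :> R.
  by rewrite e.
rewrite -big_split/=; apply: eq_bigr => i _.
by rewrite /bump/= !add1n binS natrD exprS -[x + i%:R + 1]addrA natr1; ring.
Qed.

Lemma is_derive_fdiff_iter l (f f' : R -> R) :
  (forall x : R, 0 < x -> isd x f (f' x)) ->
  forall x : R, 0 < x -> isd x (iter l fdiff f) (iter l fdiff f' x).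
Proof.
move=> df; elim: l => [//|l IH] x x0 /=.
have h2 : isd (x + 1) (iter l fdiff f) (iter l fdiff f' (x + 1)).
  by apply: IH; rewrite addr_gt0.
have h3 : isd x (fun t : R => t + 1) (1 + 0) := isd_add (isd_id x) (isd_cst 1 x).
by have := isd_sub (IH x x0) (@isd_comp _ (iter l fdiff f) (fun t => t + 1) x _ _ h2 h3);
  rewrite addr0 mulr1.
Qed.

(** The mean value theorem, l times: [g i] plays the i-th derivative, and each step moves the
    evaluation point to the right with a factor -1. *)
Lemma fdiff_mean l (g : nat -> R -> R) (a : R) : 0 < a ->
  (forall i (x : R), (i < l)%N -> 0 < x -> isd x (g i) (g i.+1 x)) ->
  exists2 t : R, 0 < t & iter l fdiff (g 0%N) a = (-1) ^+ l * g l t.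
Proof.
elim: l g a => [|l IH] g a a0 dg; first by exists a => //; rewrite expr0 mul1r.
have d0 : forall x : R, 0 < x -> isd x (iter l fdiff (g 0%N)) (iter l fdiff (g 1%N) x).
  by apply: is_derive_fdiff_iter => x x0; exact: dg.
have [||c /andP[ac _] e] :=
  @mean_value _ (iter l fdiff (g 0%N)) (iter l fdiff (g 1%N)) a (a + 1).
- by rewrite ltrDl.
- by move=> x ax; apply: d0; exact: lt_le_trans ax.
have [||t t0 et] := IH (fun i => g i.+1) c.
- exact: lt_trans ac.
- by move=> i x il x0; exact: dg.
exists t => //; rewrite /= /fdiff -opprB e addrAC subrr add0r mulr1 et exprS.
by rewrite mulN1r mulNr.
Qed.

(** Variant that starts at the end point 0, where only continuity is assumed: the first mean value
    theorem, on [0, 1], moves the point into the open half-line. This admits x^m ln x. *)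
Lemma fdiff_mean0 l (g : nat -> R -> R) : continuous (g 0%N) ->
  (forall i (x : R), (i < l.+1)%N -> 0 < x -> isd x (g i) (g i.+1 x)) ->
  exists2 t : R, 0 < t & iter l.+1 fdiff (g 0%N) 0 = (-1) ^+ l.+1 * g l.+1 t.
Proof.
move=> cg dg.
have d0 : forall x : R, 0 < x -> isd x (iter l fdiff (g 0%N)) (iter l fdiff (g 1%N) x).
  by apply: is_derive_fdiff_iter => x x0; exact: dg.
have c0 : continuous (iter l fdiff (g 0%N)).
  elim: (l) => [//|k IH] x /=; apply: cvgB; first exact: IH.
  apply: (@continuous_comp _ _ _ (fun t : R => t + 1)); last exact: IH.
  by apply: cvgD; [exact: cvg_id|exact: cvg_cst].
have [|||c /[!in_itv]/=/andP[ac _] e] :=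
  @MVT _ (iter l fdiff (g 0%N)) (iter l fdiff (g 1%N)) 0 1.
- exact: ltr01.
- by move=> x /[!in_itv]/=/andP[ax _]; apply: d0.
- exact: continuous_subspaceT.
have [||t t0 et] := @fdiff_mean l (fun i => g i.+1) c.
- exact: ac.
- by move=> i x il x0; exact: dg.
exists t => //; rewrite /= /fdiff add0r -opprB e subr0 mulr1 et exprS.
by rewrite mulN1r mulNr.
Qed.

(** The moment is the l-th difference of x^k at 0, hence the l-th derivative at some point, up to
    sign: 0 for k < l and l! for k = l. *)
Lemma sum_cf_expr l k : (0 < l)%N -> (k <= l)%N ->
  \sum_(j < l.+1) cf l j * j%:R ^+ k = if k == l then (-1) ^+ l * l`!%:R else 0.
Proof.
case: l => // l _ kl.
have := @fdiff_iter l.+1 (fun x => x ^+ k) 0.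
under eq_bigr do rewrite add0r.
move=> ->.
rewrite (_ : (fun x => x ^+ k) = (fun x => (k ^_ 0)%:R * x ^+ (k - 0))); last first.
  by apply/funext => x; rewrite ffactn0 mul1r subn0.
have [||t t0 ->] := @fdiff_mean0 l (fun i x => (k ^_ i)%:R * x ^+ (k - i)).
- move=> x; exact: isd_continuous (isd_scale _ (isd_pow _ (isd_id x))).
- move=> i x il x0; apply: (isd_eq (isd_scale _ (isd_pow _ (isd_id x)))).
  by rewrite /= mulr1 mulrA -natrM ffactnSr -subnS.
have [->|kl'] := eqVneq k l.+1; first by rewrite subnn expr0 mulr1 ffactnn.
by rewrite ffact_small ?mul0r ?mulr0// ltn_neqAle kl'.
Qed.

Lemma sum_cf_expr0 l k : (k < l)%N -> \sum_(j < l.+1) cf l j * j%:R ^+ k = 0.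
Proof.
move=> kl; rewrite sum_cf_expr ?(leq_ltn_trans _ kl)//; last exact: ltnW.
by rewrite ltn_eqF.
Qed.

End finite_difference.

Section power_log.
Context {R : realType}.
Implicit Types m i : nat.

(* x^m ln x has i-th derivative x^(m-i) (a_i ln x + b_i), with a_m constant *)
Fixpoint plog_coef m i : R * R :=
  if i is i'.+1 then
    let: (a, b) := plog_coef m i' in
    ((m - i')%:R * a, (m - i')%:R * b + a)
  else (1, 0).

(** Past order m the logarithm has disappeared and the derivatives are those of a multiple of 1/x,
    which explains the second branch. *)
Definition plog m i (x : R) : R :=
  if (i <= m)%N then
    x ^+ (m - i) * ((plog_coef m i).1 * ln x + (plog_coef m i).2)
  else (plog_coef m m).1 * (-1) ^+ (i - m.+1) * (i - m.+1)`!%:R * x ^- (i - m).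

Lemma plog_coef1_gt0 m i : (i <= m)%N -> 0 < (plog_coef m i).1.
Proof.
elim: i => [|i IH] im /=; first exact: ltr01.
have := IH (ltnW im); case: (plog_coef m i) => a b /= a0.
by rewrite mulr_gt0// ltr0n subn_gt0.
Qed.

Lemma is_derive_plog m i (x : R) : 0 < x -> isd x (plog m i) (plog m i.+1 x).
Proof.
move=> x0; have xN0 : x != 0 by rewrite gt_eqF.
have [im|im|->] := ltngtP i m.
- rewrite /plog (ltnW im) im /=; case: (plog_coef m i) => a b /=.
  apply: (isd_eq (isd_mul (isd_pow _ (isd_id x))
    (isd_add (isd_scale a (is_derive1_ln x0)) (isd_cst b x)))).
  rewrite -(@subnSK i m im)/=; set k := (m - i.+1)%N.
  by rewrite exprS; field.
- rewrite /plog leqNgt im/= leqNgt (leqW im)/=.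
  pose k := (i - m.+1)%N.
  have e1 : (i - m = k.+1)%N by rewrite /k subnSK.
  have e2 : (i.+1 - m.+1 = k.+1)%N by rewrite subSS.
  have e3 : (i.+1 - m = k.+2)%N by rewrite subSn ?(ltnW im)// e1.
  rewrite e1 e2 e3 -/k.
  have xk : (fun t : R => t ^+ k.+1) x != 0 by rewrite expf_neq0.
  apply: (isd_eq (isd_scale _ (@isd_inv _ (fun t : R => t ^+ k.+1) x _ xk
    (isd_pow _ (isd_id x))))).
  rewrite factS natrM /= !exprS.
  by field; rewrite xN0 expf_neq0.
- rewrite /plog leqnn ltnn subnn subSnn expr1 subnn !expr0 fact0 !mulr1.
  case: (plog_coef m m) => a b /=.
  apply: (isd_eq (isd_scale 1
    (isd_add (isd_scale a (is_derive1_ln x0)) (isd_cst b x)))).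
  by rewrite mul1r addr0.
Qed.

(** [ln] vanishes on nonpositive reals by convention. To the right of 0, [|ln t| <= 1 / t] gives
    [t ^ m * |ln t| <= t] for m > 1 and t <= 1. *)
Lemma continuous_plog m : (1 < m)%N -> continuous (plog m 0).
Proof.
move=> m1 x; have e : plog m 0 = fun t => t ^+ m * ln t.
  by apply/funext => t; rewrite /plog/= subn0 mul1r addr0.
have [x0|x0|->] := ltgtP x 0.
- have e2 : \forall t \near x, (0 : R) = plog m 0 t.
    near=> t; rewrite e ln0 ?mulr0// ltW//.
    by near: t; exact: lt_nbhsl.
  have e3 : plog m 0 x = 0 by rewrite e ln0 ?mulr0// ltW.
  rewrite /continuous_at e3; apply: cvg_trans; first exact: (near_eq_cvg e2).
  exact: cvg_cst.
- exact: isd_continuous (is_derive_plog m 0 x0).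
- have e3 : plog m 0 0 = 0 by rewrite e expr0n; case: m m1 {e} => // m _; rewrite mul0r.
  rewrite /continuous_at e3; apply/cvgrPdist_le => /= eps eps0.
  exists (Num.min 1 eps) => /=; first by rewrite lt_min ltr01.
  move=> t; rewrite /ball_/= !sub0r !normrN lt_min e => /andP[/ltW t1 /ltW te].
  apply: le_trans te; have [t0|t0] := leP t 0; first by rewrite ln0// mulr0 normr0.
  rewrite (gtr0_norm t0) in t1 *.
  have lt : `|ln t| <= t^-1.
    rewrite ler0_norm ?ln_le0// -lnV//.
    have e4 : 1 + (t^-1 - 1) = t^-1 by rewrite addrC subrK.
    have := @le_ln1Dx R (t^-1 - 1); rewrite e4 => h.
    apply: (@le_trans _ _ (t^-1 - 1)); last by rewrite gerBl.
    by apply: h; rewrite ltrBrDl subrr invr_gt0.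
  rewrite normrM normrX gtr0_norm//.
  case: m m1 {e e3} => [//|[//|m]] _.
  apply: (@le_trans _ _ (t ^+ m.+2 * t^-1)).
    by apply: ler_wpM2l => //; rewrite exprn_ge0// (ltW t0).
  rewrite exprS mulrAC divff ?gt_eqF// mul1r exprS ler_piMr ?(ltW t0)//.
  by apply: exprn_ile1; rewrite ?(ltW t0).
Unshelve. all: by end_near. Qed.

(** The l-th derivative of x^m ln x with l > m is a nonzero multiple of x^(m - l), so it has no zero
    on the open half-line, wherever the mean value theorem puts the point. *)
Lemma sum_cf_plog_neq0 l m : (1 < m)%N -> (m < l)%N ->
  \sum_(j < l.+1) cf l j * (j%:R ^+ m * ln j%:R) != 0 :> R.
Proof.
move=> m1 ml; have l0 : (0 < l)%N by exact: leq_ltn_trans ml.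
have := @fdiff_iter R l (plog m 0) 0.
have -> : \sum_(j < l.+1) cf l j * plog m 0 (0 + j%:R) =
    \sum_(j < l.+1) cf l j * (j%:R ^+ m * ln j%:R) :> R.
  by apply: eq_bigr => j _; rewrite add0r /plog/= subn0 mul1r addr0.
move=> ->; rewrite -(prednK l0).
have [|t t0 ->] := @fdiff_mean0 R l.-1 (plog m) (continuous_plog m1).
  by move=> i x _ x0; exact: is_derive_plog.
rewrite prednK// /plog leqNgt ml/= !mulf_neq0 ?signr_eq0//.
- by rewrite gt_eqF// plog_coef1_gt0.
- by rewrite invr_eq0 expf_neq0// gt_eqF.
Qed.

End power_log.

(** * Taylor remainders of the cosine *)

Section cos_taylor.
Context {R : realType}.

Definition cosT N (u : R) := \sum_(k < N) (-1) ^+ k * (u ^+ k.*2 / k.*2`!%:R).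
Definition sinT N (u : R) := \sum_(k < N) (-1) ^+ k * (u ^+ k.*2.+1 / k.*2.+1`!%:R).

Lemma is_derive_sinT N (u : R) : isd u (sinT N) (cosT N u).
Proof.
apply: (@isd_sum _ N (fun k t => (-1) ^+ k * (t ^+ k.*2.+1 / k.*2.+1`!%:R))
  (fun k => (-1) ^+ k * (u ^+ k.*2 / k.*2`!%:R))) => k.
apply: (isd_eq (isd_scale _ (isd_mul (isd_pow _ (isd_id u)) (isd_cst _ u)))).
by rewrite factS natrM /= mulr0 addr0 mulr1 invfM mulrACA divff ?mul1r// pnatr_eq0.
Qed.

Lemma is_derive_cosT N (u : R) : isd u (cosT N.+1) (- sinT N u).
Proof.
have e : cosT N.+1 = fun t => 1 + (-1) * \sum_(k < N) (-1) ^+ k * (t ^+ k.*2.+2 / k.*2.+2`!%:R) :> R.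
  apply/funext => t; rewrite /cosT big_ord_recl/= !expr0 divr1 mulr1; congr (_ + _).
  rewrite mulr_sumr; apply: eq_bigr => k _.
  by rewrite /bump/= add1n doubleS exprS mulrA.
have h : isd u (fun t => \sum_(k < N) (-1) ^+ k * (t ^+ k.*2.+2 / k.*2.+2`!%:R)) (sinT N u).
  apply: (@isd_sum _ N (fun k t => (-1) ^+ k * (t ^+ k.*2.+2 / k.*2.+2`!%:R))
    (fun k => (-1) ^+ k * (u ^+ k.*2.+1 / k.*2.+1`!%:R))) => k.
  apply: (isd_eq (isd_scale _ (isd_mul (isd_pow _ (isd_id u)) (isd_cst _ u)))).
  by rewrite factS natrM /= mulr0 addr0 mulr1 invfM mulrACA divff ?mul1r// pnatr_eq0.
rewrite e; apply: (isd_eq (isd_add (isd_cst 1 u) (isd_scale (-1) h))).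
by rewrite add0r mulN1r.
Qed.

Lemma ge0_of_derive (f f' : R -> R) : f 0 = 0 ->
  (forall x : R, isd x f (f' x)) -> (forall x, 0 <= x -> 0 <= f' x) ->
  forall x, 0 <= x -> 0 <= f x.
Proof.
move=> f0 df f'0 x; rewrite le_eqVlt => /predU1P[<-|x0]; first by rewrite f0.
have [c /andP[c0 _]] := @mean_value _ f f' 0 x x0 (fun y _ => df y).
by rewrite f0 !subr0 => ->; rewrite mulr_ge0 ?f'0 ?ltW.
Qed.

(* The remainders have alternating signs: integrate twice from 0. *)
Lemma cosT_ge0 N (u : R) : 0 <= (-1) ^+ N.+1 * (cos u - cosT N.+1 u).
Proof.
have even (v : R) : (-1) ^+ N.+1 * (cos (- v) - cosT N.+1 (- v)) =
    (-1) ^+ N.+1 * (cos v - cosT N.+1 v).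
  rewrite cosN; congr (_ * (_ - _)); apply: eq_bigr => k _.
  by rewrite -mul2n !exprM sqrrN.
wlog u0 : u / 0 <= u.
  by move=> h; have [/h//|/ltW u0] := leP 0 u; rewrite -even h// oppr_ge0.
elim: N {even} u u0 => [|N IH] u u0.
  by rewrite /cosT big_ord1/= !expr0 divr1 mulr1 expr1 mulN1r opprB subr_ge0 cos_le1.
apply: (@ge0_of_derive (fun v => (-1) ^+ N.+2 * (cos v - cosT N.+2 v))
  (fun v => (-1) ^+ N.+1 * (sin v - sinT N.+1 v)) _ _ _ u u0).
- rewrite cos0 /cosT big_ord_recl/= !expr0 divr1 mulr1 big1 ?addr0 ?subrr ?mulr0//.
  by move=> i _; rewrite expr0n/= mul0r mulr0.
- move=> v; apply: (isd_eq (isd_scale _ (isd_sub (is_derive_cos v) (is_derive_cosT N.+1 v)))).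
  by rewrite [in LHS]exprS; ring.
move=> v v0.
apply: (@ge0_of_derive (fun v => (-1) ^+ N.+1 * (sin v - sinT N.+1 v)) _ _ _ IH v v0).
- rewrite sin0 /sinT big1 ?subrr ?mulr0//.
  by move=> i _; rewrite expr0n/= mul0r mulr0.
- by move=> w; exact: (isd_scale _ (isd_sub (is_derive_sin w) (is_derive_sinT N.+1 w))).
Qed.

Lemma cosT_recr N (u : R) :
  (-1) ^+ N.+2 * (cos u - cosT N.+2 u) =
  u ^+ N.+1.*2 / N.+1.*2`!%:R - (-1) ^+ N.+1 * (cos u - cosT N.+1 u).
Proof.
rewrite {1}/cosT big_ord_recr/= -/(cosT _ _).
set T := cosT _ _; set c := u ^+ _ / _.
have e : (-1) ^+ N.+1 * (-1) ^+ N.+1 = 1 :> R by rewrite -expr2 sqrr_sign.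
rewrite exprS; transitivity (((-1) ^+ N.+1 * (-1) ^+ N.+1) * c - (-1) ^+ N.+1 * (cos u - T)).
  by ring.
by rewrite e mul1r.
Qed.

(** Consecutive remainders have opposite signs, so each is at most the term that separates them. *)
Lemma cosT_le N (u : R) : `|cos u - cosT N.+1 u| <= u ^+ N.+1.*2 / N.+1.*2`!%:R.
Proof.
have h1 := cosT_ge0 N u; have := cosT_ge0 N.+1 u; rewrite cosT_recr subr_ge0.
by rewrite -(ger0_norm h1) normrM normrX normrN1 expr1n mul1r.
Qed.

(** The signed remainder is its first term minus the next signed remainder, and for |u| <= 1 the
    latter is at most the next term, which is strictly smaller. *)
Lemma cosT_gt0 N (u : R) : 0 < `|u| <= 1 ->
  0 < (-1) ^+ N.+1 * (cos u - cosT N.+1 u).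
Proof.
move=> /andP[u0 u1].
have e k : u ^+ k.*2 = `|u| ^+ k.*2 by rewrite -mul2n !exprM real_normK ?num_real.
have h := cosT_ge0 N.+1 u; have := cosT_le N.+1 u.
have -> : `|cos u - cosT N.+2 u| = (-1) ^+ N.+2 * (cos u - cosT N.+2 u).
  by rewrite -(ger0_norm h) normrM normrX normrN1 expr1n mul1r.
rewrite cosT_recr !e lerBlDr addrC -lerBlDr; apply: lt_le_trans.
rewrite subr_gt0; have v0 : 0 < `|u| ^+ N.+1.*2 by rewrite exprn_gt0.
have f0 : 0 < N.+1.*2`!%:R :> R by rewrite ltr0n fact_gt0.
apply: (@le_lt_trans _ _ (`|u| ^+ N.+1.*2 / N.+2.*2`!%:R)).
  rewrite ler_pM2r ?invr_gt0 ?ltr0n ?fact_gt0//.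
  by apply: ler_wiXn2l; rewrite ?leq_double ?(ltW u0).
rewrite ltr_pM2l// ltf_pV2 ?posrE ?ltr0n ?fact_gt0// ltr_nat.
have hk k : (k`! < k.+2`!)%N by rewrite !factS mulnA ltn_Pmull ?fact_gt0//
  (@leq_trans k.+2)// leq_pmulr.
exact: hk.
Qed.

End cos_taylor.

(** * The normalizing constant *)

(** The exponent 2n - 1 is n + m: a factor of degree m turns [pw] into a weight of degree -n, the
    scale-invariant one of [polar]. *)
Definition pw {R : realType} m (y : 'rV[R]_m.+1) : R :=
  (enorm y ^+ (2 * m.+1 - 1))^-1.

(** The real part of [(1 - expi s) ^+ l]. The imaginary part is odd in s and integrates to 0 against
    [pw]. *)
Definition cosum {R : realType} l (s : R) : R :=
  \sum_(j < l.+1) cf l j * cos (j%:R * s).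

Section weight.
Context {R : realType} (m : nat).
Hypothesis m0 : (0 < m)%N.
Implicit Types y : 'rV[R]_m.+1.

Lemma pw_ge0 y : 0 <= pw y.
Proof. by rewrite invr_ge0 exprn_ge0// enorm_ge0. Qed.

Lemma mf_pw : mfun (@pw R m).
Proof. by rewrite /pw; mt. Qed.

Lemma pw_exp : (2 * m.+1 - 1 = m.+1 + m)%N.
Proof. by rewrite mul2n -addnn addnS subn1. Qed.

Lemma pw_scale (c : R) y : pw (c *: y) = (`|c| ^+ (m.+1 + m))^-1 * pw y.
Proof. by rewrite /pw enormZ exprMn pw_exp invfM. Qed.

Lemma pwN y : pw (- y) = pw y.
Proof. by rewrite /pw enormN. Qed.

Lemma pw_orth (A : 'M[R]_m.+1) y : orth A -> pw (y *m A) = pw y.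
Proof. by move=> oA; rewrite /pw enorm_orth. Qed.

(** Near 0 the product is of order |y|^-m, which is integrable as m < n; at infinity it is of order
    |y|^-(n+1). The two allowed growths, m + 1 and m - 1, recur throughout. *)
Lemma finint_pw (b : 'rV[R]_m.+1 -> R) (C : R) : mfun b -> 0 <= C ->
  (forall y, enorm y < 1 -> `|b y| <= C * enorm y ^+ m.+1) ->
  (forall y, 1 <= enorm y -> `|b y| <= C * enorm y ^+ m.-1) ->
  finint (leb m.+1) (fun y => pw y * b y).
Proof.
move=> mb C0 b1 b2; have mp := mf_pw.
pose g y := C * ((enorm y < 1)%R%:R / enorm y ^+ m) + C * ((1 <= enorm y)%R%:R / enorm y ^+ m.+2).
have mg1 : mfun (fun y => (enorm y < 1)%R%:R / enorm y ^+ m : R) by mt.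
have mg2 : mfun (fun y => (1 <= enorm y)%R%:R / enorm y ^+ m.+2 : R) by mt.
have fg : finint (leb m.+1) g.
  apply: finintD; [by mt|by mt| |].
    apply: finintZ => //; rewrite /finint.
    rewrite (eq_integral (fun y => ((enorm y < 1)%R%:R / enorm y ^+ m)%:E)).
      exact: rad_in.
    by move=> y _; rewrite ger0_norm//; pos.
  apply: finintZ => //; rewrite /finint.
  rewrite (eq_integral (fun y => ((1 <= enorm y)%R%:R / enorm y ^+ m.+2)%:E)).
    exact: rad_out_nat.
  by move=> y _; rewrite ger0_norm//; pos.
have mg : mfun g by rewrite /g; mt.
apply: (finint_le _ mg fg); first by mt.
move=> y.
have g0 : 0 <= g y by rewrite /g; pos.
rewrite normrM (ger0_norm (pw_ge0 y)) (ger0_norm g0).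
rewrite /g; have [->|y0] := eqVneq y 0.
  by rewrite /pw enorm0 expr0n pw_exp/= invr0 mul0r; pos.
have ey : enorm y != 0 by rewrite enorm_eq0.
case: (ltP (enorm y) 1) => y1.
  rewrite mul0r mulr0 addr0 mul1r.
  apply: (@le_trans _ _ (pw y * (C * enorm y ^+ m.+1))).
    by rewrite ler_wpM2l ?pw_ge0// b1.
  rewrite /pw pw_exp exprD invfM mulrCA ler_wpM2l//.
  by rewrite mulrAC mulVf ?mul1r// expf_neq0.
rewrite mul0r mulr0 add0r mul1r.
apply: (@le_trans _ _ (pw y * (C * enorm y ^+ m.-1))).
  by rewrite ler_wpM2l ?pw_ge0// b2.
rewrite /pw pw_exp mulrCA ler_wpM2l//.
rewrite (_ : (m.+1 + m = m.+2 + m.-1)%N); last by rewrite -{2}(prednK m0); rewrite !addSn addnS.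
by rewrite exprD invfM -mulrA mulVf ?mulr1// expf_neq0.
Qed.

Lemma Rint_pw_scale (b : 'rV[R]_m.+1 -> R) (c : R) : mfun b -> 0 < c ->
  finint (leb m.+1) (fun y => pw y * b y) ->
  \int[leb m.+1]_y (pw y * b (c *: y)) = c ^+ m * \int[leb m.+1]_y (pw y * b y).
Proof.
move=> mb c0 fb; have mp := mf_pw; have cN0 : c != 0 by rewrite gt_eqF.
have mpb : mfun (fun y => pw y * b (c *: y)) by mt.
have mpb' : mfun (fun y => pw y * b y) by mt.
rewrite (@Rint_scalev _ _ c^-1 _ _ mpb) ?invr_eq0// normfV (gtr0_norm c0).
rewrite (_ : (fun y => pw (c^-1 *: y) * b (c *: (c^-1 *: y))) =
  (fun y => c ^+ (m.+1 + m) * (pw y * b y))); last first.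
  apply/funext => y; rewrite scalerA divff// scale1r pw_scale normfV (gtr0_norm c0).
  by rewrite exprVn invrK mulrA.
rewrite RintZ// mulrA exprVn; congr (_ * _).
by rewrite exprD mulrA mulVf ?mul1r// expf_neq0.
Qed.

End weight.

Section positivity.
Context {R : realType}.

Lemma int_gt0 n (f : 'rV[R]_n -> R) (a : 'rV[R]_n) (r : R) : mfun f ->
  (forall y, 0 <= f y) -> 0 < r -> (forall y, enorm (y - a) < r -> 0 < f y) ->
  (0 < \int[leb n]_y (f y)%:E)%E.
Proof.
move=> mf f0 r0 fa; rewrite lt_neqAle integral_ge0 ?andbT; last by move=> y _; rewrite lee_fin.
apply/eqP => e.
have : (\int[leb n]_y `|(f y)%:E| = 0)%E.
  by rewrite [RHS]e; apply: eq_integral => y _; rewrite gee0_abs// lee_fin.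
move=> /(ae_eq_integral_abs (leb n) measurableT (mf_EFin mf)) [N [mN N0 sN]].
have : (leb n [set y | (enorm (y - a) < r)%R] <= leb n N)%E.
  apply: le_measure; rewrite ?inE//; first by mt.
  move=> y ya; apply: sN => /= /(_ I) [] fy0.
  by have := fa y ya; rewrite fy0 ltxx.
rewrite N0 leNgt => /negP; apply.
have mB : measurable [set y : 'rV[R]_n | enorm (y - a) < r] by mt.
rewrite -[X in leb n X]setIT -integral_indic//.
have := leb_eball_gt0 n r0; rewrite -int_eballE => h.
rewrite (_ : (\int[leb n]_x _)%E = (\int[leb n]_y ((enorm y < r)%R%:R)%:E)%E)//.
have mi : mfun (fun y : 'rV[R]_n => ((enorm y < r)%R%:R : R)%:E) by mt.
rewrite -[RHS](ge0_integral_shiftv (- a) mi); last by move=> y; rewrite lee_fin.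
apply: eq_integral => y _; rewrite indicE.
case: ltP => yr; first by rewrite mem_set.
by rewrite memNset//=; apply/negP; rewrite -leNgt.
Qed.

Definition axis m (t : R) : 'rV[R]_m.+1 := t *: delta_mx 0 ord0.

Lemma enorm_axis m t : enorm (axis m t) = `|t|.
Proof.
rewrite enormZ (_ : enorm _ = 1) ?mulr1//; apply/eqP.
rewrite -(eqrXn2 (n := 2))// ?enorm_ge0// enormE expr1n /dotv.
rewrite (bigD1 ord0)//= big1 ?addr0 ?mxE ?eqxx ?mulr1// => i i0.
by rewrite mxE eqxx (negbTE i0) mulr0.
Qed.

Lemma near_axis m t r (y : 'rV[R]_m.+1) : enorm (y - axis m t) < r ->
  t - r < y 0 ord0 < t + r /\ `|t| - r < enorm y < `|t| + r.
Proof.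
move=> yr; split.
  rewrite -ltr_distl; apply: le_lt_trans yr; have := coord_le_enorm (y - axis m t) ord0.
  by rewrite !mxE !eqxx mulr1.
have h1 := ler_enorm_dist (axis m t) y; have h2 := ler_enorm_dist y (axis m t).
rewrite enorm_distC in h1; rewrite !enorm_axis in h1 h2.
by apply/andP; split; move: h1 h2 yr; lra.
Qed.

End positivity.

Section cosine_sum.
Context {R : realType}.

Lemma cosT_bound N (u r : R) : `|u| <= r -> 1 <= r ->
  `|cosT N.+1 u| <= N.+1%:R * r ^+ N.*2.
Proof.
move=> ur r1; have r0 : 0 <= r by exact: le_trans r1.
apply: le_trans (ler_norm_sum _ _ _) _.
rewrite mulr_natl -[N.+1 in leRHS]card_ord -sumr_const; apply: ler_sum => k _.
rewrite normrM normrX normrN1 expr1n mul1r normrM normrX.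
rewrite (ger0_norm (_ : 0 <= _^-1)) ?invr_ge0 ?ler0n// ler_pdivrMr ?ltr0n ?fact_gt0//.
apply: (@le_trans _ _ (r ^+ N.*2)).
  apply: (@le_trans _ _ (r ^+ k.*2)); first by rewrite lerXn2r// nnegrE.
  by rewrite ler_weXn2l// leq_double -ltnS.
by rewrite ler_peMr ?exprn_ge0// ler1n fact_gt0.
Qed.

(** The moments of order below l vanish, and [cosT N] has degree at most 2N - 2 < l. *)
Lemma cosum_sub l N (s : R) : (N.*2 < l.+2)%N ->
  cosum l s = \sum_(j < l.+1) cf l j * (cos (j%:R * s) - cosT N (j%:R * s)).
Proof.
move=> Nl; under [RHS]eq_bigr do rewrite mulrBr.
rewrite sumrB (_ : \sum_(j < l.+1) cf l j * cosT N (j%:R * s) = 0) ?subr0//.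
under eq_bigr do rewrite mulr_sumr.
rewrite exchange_big/= big1// => k _.
rewrite (eq_bigr (fun j : 'I_l.+1 => (cf l j * j%:R ^+ k.*2) *
    ((-1) ^+ k * (s ^+ k.*2 / k.*2`!%:R)))); last first.
  by move=> j _; rewrite exprMn; ring.
rewrite -mulr_suml sum_cf_expr0 ?mul0r//.
by rewrite -ltnS -ltnS (leq_trans _ Nl)// -doubleS ltnS leq_double.
Qed.

(** The cosine is even, so only the even moments up to m have to vanish; this is why l = m is enough
    for odd m. With N = m./2 the remainder is of order 2N + 2 >= m + 1 at 0, and at infinity the sum
    is bounded. *)
Lemma cosum_bound m l : (m./2.*2 < l)%N ->
  exists2 C : R, 0 <= C & forall s : R,
    `|cosum l s| <= C /\ `|cosum l s| <= C * `|s| ^+ m.+1.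
Proof.
move=> ml; set N := m./2 in ml.
pose C1 := \sum_(j < l.+1) `|cf l j| : R.
pose C2 := \sum_(j < l.+1) `|cf l j| * j%:R ^+ N.+1.*2 : R.
have C10 : 0 <= C1 by rewrite /C1; pos.
have C20 : 0 <= C2 by rewrite /C2; pos.
have b1 s : `|cosum l s| <= C1.
  apply: le_trans (ler_norm_sum _ _ _) _; apply: ler_sum => j _.
  by rewrite normrM ler_piMr// ler_norml cos_geN1 cos_le1.
have b2 s : `|cosum l s| <= C2 * `|s| ^+ N.+1.*2.
  rewrite (@cosum_sub l N.+1); last by rewrite doubleS !ltnS.
  apply: le_trans (ler_norm_sum _ _ _) _; rewrite mulr_suml; apply: ler_sum => j _.
  rewrite normrM -mulrA ler_wpM2l//; apply: le_trans (cosT_le _ _) _.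
  rewrite exprMn -[s ^+ _]ger0_norm; last by rewrite -mul2n exprM exprn_ge0// sqr_ge0.
  rewrite normrX ler_piMr; [by []|by pos|].
  by rewrite invf_le1 ?ltr0n ?fact_gt0// ler1n fact_gt0.
exists (C1 + C2); first exact: addr_ge0.
move=> s; split; first by rewrite (le_trans (b1 s))// lerDl.
have [s1|s1] := leP `|s| 1; last first.
  apply: (@le_trans _ _ (C1 + C2)); first by rewrite (le_trans (b1 s))// lerDl.
  by rewrite ler_peMr ?addr_ge0// exprn_ege1// ltW.
apply: (le_trans (b2 s)); apply: ler_pM; rewrite ?exprn_ge0 ?lerDr//.
apply: ler_wiXn2l => //.
by rewrite doubleS -{1}(odd_double_half m) -/N; case: odd; rewrite ?addSn ltnS.
Qed.

End cosine_sum.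

(** The interval from 1/j to 1 has mass ln j under dr / r. The logarithms of [sum_cf_plog_neq0]
    enter the constant here. *)
Lemma haar_log {R : realType} (j : nat) : (0 < j)%N ->
  (\int[@lebesgue_measure R]_r (haar r * ((r < 1)%R%:R * (1 <= j%:R * r)%R%:R)%:E) =
  (ln j%:R)%:E)%E.
Proof.
move=> j0; have j1 : (0 : R) < j%:R by rewrite ltr0n.
pose a : R := j%:R^-1.
have a0 : 0 < a by rewrite invr_gt0.
transitivity (\int[@lebesgue_measure R]_(x in `[a, 1%R[) (x^-1)%:E)%E.
  rewrite [RHS]integral_mkcond; apply: eq_integral => r _; rewrite patchE mem_setE in_itv/=.
  rewrite /haar -EFinM mulrC.
  have -> : (1 <= j%:R * r) = (a <= r) by rewrite /a -div1r ler_pdivrMr// mulrC.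
  have [ar|ra] := leP a r; last by rewrite !(mulr0, mul0r).
  by rewrite (lt_le_trans a0 ar) mulr1; case: (r < 1)%R; rewrite ?mul1r ?mul0r.
have [jE|jN1] := eqVneq j 1%N.
  rewrite /a jE invr1 set_itvco0// integral_set0 ln1//.
have a1 : a < 1 by rewrite invf_lt1// ltr1n ltn_neqAle eq_sym jN1.
have cinv : forall x : R, 0 < x -> {for x, continuous (fun t : R => t^-1)}.
  by move=> x x0; apply: inv_continuous; rewrite gt_eqF.
rewrite integral_itv_bndo_bndc; last first.
  by apply/measurable_EFinP; apply: measurable_funTS; mt.
rewrite (@continuous_FTC2 _ (fun t : R => t^-1) (@ln R))//.
- by rewrite ln1 /a lnV ?posrE// -EFinD sub0r opprK.
- apply: continuous_in_subspaceT => x /[!inE]/=/[!in_itv]/=/andP[ax _].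
  by apply: cinv; exact: lt_le_trans ax.
- split.
  + move=> x /[!in_itv]/=/andP[ax _].
    exact: isd_derivable (is_derive1_ln (lt_trans a0 ax)).
  + apply: cvg_at_right_filter; exact: isd_continuous (is_derive1_ln a0).
  + apply: cvg_at_left_filter; exact: isd_continuous (is_derive1_ln ltr01).
- move=> x /[!in_itv]/=/andP[ax _]; rewrite derive1E.
  by have [_ ->] := is_derive1_ln (lt_trans a0 ax).
Qed.

(** The absolutely convergent form of [dconst m l]; [dconstE] proves that they agree. *)
Definition Dc {R : realType} m l : R :=
  \int[leb m.+1]_y (pw y * cosum l (y 0 ord0)).

Section nonvanishing.
Context {R : realType} (m l : nat).
Hypothesis m0 : (0 < m)%N.
Hypothesis l_even : ~~ odd m.+1 -> l = m.
Hypothesis l_odd : odd m.+1 -> (m < l)%N.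
Implicit Types y : 'rV[R]_m.+1.

(** Common consequence of the two parity hypotheses: the largest even number up to m is below l. *)
Lemma half_lt : (m./2.*2 < l)%N.
Proof.
have := odd_double_half m; move: l_even l_odd => /=.
case: (odd m) => /= h1 h2; last by rewrite add0n => ->; exact: h2.
by rewrite h1// => {2}<-; rewrite add1n.
Qed.

Lemma l_gt0 : (0 < l)%N. Proof. exact: leq_ltn_trans half_lt. Qed.

Lemma mf_cosum d (T : measurableType d) (f : T -> R) : mfun f ->
  mfun (fun x => cosum l (f x)).
Proof. by move=> mf; rewrite /cosum; mt. Qed.

Lemma mf_cosT N d (T : measurableType d) (f : T -> R) : mfun f ->
  mfun (fun x => cosT N (f x)).
Proof. by move=> mf; rewrite /cosT; mt. Qed.

Lemma finint_cosum : finint (leb m.+1) (fun y => pw y * cosum l (y 0 ord0)).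
Proof.
have [C C0 hC] := @cosum_bound R m l half_lt.
apply: (finint_pw m0 _ C0) => [|y y1|y y1].
- by apply: mf_cosum; mt.
- have [_ h] := hC (y 0 ord0); apply: (le_trans h).
  by rewrite ler_wpM2l// lerXn2r// ?nnegrE// ?enorm_ge0// coord_le_enorm.
- have [h _] := hC (y 0 ord0); apply: (le_trans h).
  by rewrite ler_peMr// exprn_ege1.
Qed.

(* Substituting [b] by [b (j y)] multiplies its integral by [j^m]. *)
Lemma Rint_pw_sum (b : 'rV[R]_m.+1 -> R) : mfun b -> b 0 = 0 ->
  finint (leb m.+1) (fun y => pw y * b y) ->
  finint (leb m.+1) (fun y => pw y * \sum_(j < l.+1) cf l j * b (j%:R *: y)) /\
  \int[leb m.+1]_y (pw y * \sum_(j < l.+1) cf l j * b (j%:R *: y)) =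
  (\sum_(j < l.+1) cf l j * j%:R ^+ m) * \int[leb m.+1]_y (pw y * b y).
Proof.
move=> mb b0 fb; have mp := @mf_pw R m.
pose F (j : nat) y := cf l j * (pw y * b (j%:R *: y)).
have mFj (j : nat) : mfun (fun y => pw y * b (j%:R *: y)) by mt.
have mF j : mfun (F j) by rewrite /F; mt.
have fFj (j : nat) : finint (leb m.+1) (fun y => pw y * b (j%:R *: y)).
  have [->|j0] := eqVneq j 0%N.
    rewrite (_ : (fun _ => _) = (fun=> 0)).
      by rewrite /finint (eq_integral (cst 0%E)) ?integral0// => y _; rewrite normr0.
    by apply/funext => y; rewrite scale0r b0 mulr0.
  have j1 : (0 : R) < j%:R by rewrite ltr0n lt0n.
  have mpb : mfun (fun y => pw y * b y) by mt.
  have := finintZ (j%:R ^+ (m.+1 + m)) (mf_comp mpb (mf_scalev (measurable_cst (j%:R : R)) (@measurable_id _ _ setT)))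
    (finint_scalev (negbT (gt_eqF j1)) mpb fb).
  congr (finint _ _); apply/funext => y; rewrite pw_scale ger0_norm ?ler0n//.
  by rewrite mulrA mulrA divff ?mul1r// expf_neq0// gt_eqF.
have fF j : finint (leb m.+1) (F j) by apply: finintZ.
have e : (fun y => pw y * \sum_(j < l.+1) cf l j * b (j%:R *: y)) =
    (fun y => \sum_(j <- index_enum 'I_l.+1) F j y).
  by apply/funext => y; rewrite mulr_sumr; apply: eq_bigr => j _; rewrite mulrCA.
split; first by rewrite e; apply: finint_sum => j.
rewrite e Rint_sum; [|by move=> j|by move=> j].
rewrite mulr_suml; apply: eq_bigr => j _; rewrite /F RintZ// -mulrA; congr (_ * _).
have [->|j0] := eqVneq (j : nat) 0%N.
  rewrite expr0n (gtn_eqF m0) mul0r /Rintegral (eq_integral (cst 0%E)) ?integral0//.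
  by move=> y _; rewrite scale0r b0 mulr0.
by rewrite Rint_pw_scale// ltr0n lt0n.
Qed.

Let small_norm N y : `|y 0 ord0| ^+ N <= enorm y ^+ N.
Proof. by rewrite lerXn2r// ?nnegrE// ?enorm_ge0// coord_le_enorm. Qed.

(** Here l = m and 2N = m - 1. The remainder [rho] of the cosine is of order m + 1 at 0 and m - 1 at
    infinity, as [finint_pw] asks, and [cosum] is the difference of its dilates. By [Rint_pw_sum]
    the constant is the m-th moment, plus or minus m!, times the integral of [pw * rho], whose
    integrand has constant sign. *)
Lemma Dc_neq0_odd : odd m -> Dc m l != 0 :> R.
Proof.
move=> om; have lm : l = m by apply: l_even; rewrite /= om.
pose N := m./2; have mN : (N.+1.*2 = m.+1)%N by rewrite doubleS -[in RHS](odd_double_half m) om.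
pose rho (u : R) := cos u - cosT N.+1 u.
have rho0 : rho 0 = 0.
  have := @cosT_le R N 0; rewrite expr0n double_eq0/= mul0r normr_le0 => /eqP; exact.
have mrho : mfun (fun y => rho (y 0 ord0)).
  by apply: mf_addr; [mt|apply: mf_oppr; apply: mf_cosT; mt].
have frho : finint (leb m.+1) (fun y => pw y * rho (y 0 ord0)).
  have C0 : 0 <= 1 + N.+1%:R :> R by rewrite addr_ge0.
  apply: (finint_pw m0 mrho C0) => y y1.
    apply: (le_trans (cosT_le _ _)); rewrite mN.
    apply: (@le_trans _ _ (`|y 0 ord0| ^+ m.+1)).
      rewrite (le_trans (ler_norm _))// normrM normrX ler_piMr ?exprn_ge0//.
      by rewrite ger0_norm ?invr_ge0// invf_le1 ?ltr0n ?fact_gt0// ler1n fact_gt0.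
    by rewrite (le_trans (small_norm _ _))// ler_peMl ?exprn_ge0 ?enorm_ge0// lerDl.
  apply: (le_trans (ler_normB _ _)); rewrite mulrDl mul1r.
  have e2 : (m.-1 = N.*2)%N by apply: succn_inj; rewrite prednK// -[in LHS](odd_double_half m) om.
  apply: lerD.
    by rewrite (@le_trans _ _ 1)// ?exprn_ege1// ler_norml cos_geN1 cos_le1.
  by rewrite e2; apply: cosT_bound => //; exact: coord_le_enorm.
have rho0' : rho ((0 : 'rV[R]_m.+1) 0 ord0) = 0 by rewrite mxE.
have [_ e] := Rint_pw_sum mrho rho0' frho.
have -> : Dc m l = (\sum_(j < l.+1) cf l j * j%:R ^+ m) * \int[leb m.+1]_y (pw y * rho (y 0 ord0)).
  rewrite -e; apply: eq_Rintegral => y _; congr (_ * _).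
  rewrite (@cosum_sub _ l N.+1); first by apply: eq_bigr => j _; rewrite mxE.
  by rewrite mN lm.
rewrite mulf_neq0//.
  rewrite lm sum_cf_expr// eqxx mulf_neq0 ?signr_eq0//.
pose f y := (-1) ^+ N.+1 * (pw y * rho (y 0 ord0)).
have mp := @mf_pw R m.
have mpr : mfun (fun y => pw y * rho (y 0 ord0)) by mt.
have mf : mfun f by rewrite /f; mt.
have f0 y : 0 <= f y by rewrite /f mulrCA mulr_ge0 ?pw_ge0// cosT_ge0.
suff : (0 < \int[leb m.+1]_y (f y)%:E)%E.
  rewrite -RintE//; last exact: finintZ.
  rewrite lte_fin /f RintZ//; apply: contraTneq => ->.
  by rewrite mulr0 ltxx.
(* On this ball 1/4 < y_1 < 3/4, within the range of [cosT_gt0]. *)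
apply: (@int_gt0 _ _ _ (axis m 2^-1) 4^-1) => //.
move=> y /near_axis[/andP[y1 y2] /andP[ny1 _]].
rewrite /f mulrCA mulr_gt0//.
  rewrite /pw invr_gt0 exprn_gt0// (lt_trans _ ny1)//.
  by rewrite ger0_norm ?invr_ge0//; lra.
apply: cosT_gt0; apply/andP; split.
  by rewrite normr_gt0 gt_eqF//; move: y1; lra.
by rewrite ler_norml; apply/andP; split; move: y1 y2; lra.
Qed.


(** The Taylor term of degree m = 2N is an obstacle: kept, it spoils integrability at 0; subtracted
    everywhere, it spoils it at infinity. It is subtracted on the unit ball only. Since l > m, the
    m-th moment is 0 and the dilates of [sig] contribute nothing. What remains is that the unit
    balls do not match after dilation: for each j the shell 1/j <= |y| < 1 contributes a multiple of
    ln j. *)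
Lemma Dc_neq0_even : ~~ odd m -> Dc m l != 0 :> R.
Proof.
move=> em; have ml : (m < l)%N by apply: l_odd; rewrite /= em.
have m1 : (1 < m)%N by case: (m) m0 em => [|[]].
pose N := m./2; have mN : (N.*2 = m)%N by rewrite -[in RHS](odd_double_half m) (negbTE em).
have N0 : (0 < N)%N by rewrite -double_gt0 mN.
pose tau : R := (-1) ^+ N / m`!%:R.
have tau0 : tau != 0 by rewrite mulf_neq0 ?signr_eq0// invr_eq0 pnatr_eq0 -lt0n fact_gt0.
pose sig y := cos (y 0 ord0) - cosT N (y 0 ord0) - tau * (y 0 ord0) ^+ m * (enorm y < 1)%R%:R.
have cTS (u : R) : cosT N.+1 u = cosT N u + tau * u ^+ m.
  by rewrite /cosT big_ord_recr/= mN mulrA mulrAC.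
have sig0 : sig 0 = 0.
  rewrite /sig mxE expr0n (gtn_eqF m0) mulr0 mul0r subr0.
  have := @cosT_le R N.-1 0; rewrite prednK// expr0n double_eq0/= (gtn_eqF N0).
  by rewrite mul0r normr_le0 => /eqP.
have mp := @mf_pw R m.
have msig : mfun sig.
  apply: mf_addr; last by mt.
  by apply: mf_addr; [mt|apply: mf_oppr; apply: mf_cosT; mt].
have C0 : 0 <= 1 + N%:R :> R by rewrite addr_ge0.
have fsig : finint (leb m.+1) (fun y => pw y * sig y).
  apply: (finint_pw m0 msig C0) => y y1.
    rewrite /sig y1 mulr1 -addrA -opprD -cTS.
    apply: (le_trans (cosT_le _ _)); rewrite doubleS mN.
    apply: (@le_trans _ _ (`|y 0 ord0| ^+ m.+1)).
      rewrite (le_trans (ler_norm _))// normrM normrX exprSr -mulrA ler_piMr ?exprn_ge0//.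
      rewrite mulr_ile1//; first by rewrite (le_trans (coord_le_enorm _ _))// ltW.
      by rewrite ger0_norm ?invr_ge0// invf_le1 ?ltr0n ?fact_gt0// ler1n fact_gt0.
    by rewrite (le_trans (small_norm _ _))// ler_peMl ?exprn_ge0 ?enorm_ge0// lerDl.
  rewrite /sig ltNge y1 mulr0 subr0.
  apply: (le_trans (ler_normB _ _)); rewrite mulrDl mul1r; apply: lerD.
    by rewrite (@le_trans _ _ 1)// ?exprn_ege1// ler_norml cos_geN1 cos_le1.
  have := @cosT_bound R N.-1 (y 0 ord0) _ (coord_le_enorm _ _) y1.
  rewrite prednK// => h; apply: (le_trans h); rewrite ler_wpM2l//.
  by rewrite ler_weXn2l// -mN -(prednK N0) doubleS/=.
have [fs es] := Rint_pw_sum msig sig0 fsig.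
rewrite sum_cf_expr0// mul0r in es.
(* Homogeneous of degree -n, so that [polar] applies, and nonnegative because m is even. *)
pose w y := pw y * (y 0 ord0) ^+ m.
have mw : mfun w by rewrite /w; mt.
have w0 y : 0 <= w y.
  have em0 (u : R) : 0 <= u ^+ m by rewrite -mN -mul2n exprM exprn_ge0// sqr_ge0.
  by rewrite mulr_ge0 ?pw_ge0.
pose F (j : nat) (r : R) : R := (r < 1)%R%:R * (1 <= j%:R * r)%R%:R.
have mF j : mfun (F j) by rewrite /F; mt.
have F0 j r : 0 <= F j r by rewrite /F; pos.
have hw r y : 0 < r -> ((r ^+ m.+1)%:E * (w (r *: y))%:E = (w y)%:E)%E.
  move=> r0; rewrite -EFinM; congr EFin; rewrite /w pw_scale mxE exprMn gtr0_norm//.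
  by rewrite exprD; field; rewrite !expf_neq0// gt_eqF.
have w00 : (w 0)%:E = 0%E by rewrite /w mxE expr0n (gtn_eqF m0) mulr0.
have pol (j : nat) := @polar R m.+1 (fun y => (w y)%:E) (fun r => (F j r)%:E)
  (mf_EFin mw) (fun y => w0 y) w00 (fun r y => @hw r y) (mf_EFin (mF j)) (fun r => F0 j r).
have [s0 s1] := @shell_bounds R.
have smfin : shell_mass (fun y => (w y)%:E) \is a fin_num.
  rewrite ge0_fin_numE; last first.
    by apply: integral_ge0 => y _; apply: mule_ge0; [rewrite lee_fin; exact: w0|rewrite /shell_ind; pos].
  apply: (le_lt_trans (@shell_mass_le R m.+1 _ 1 (mf_EFin mw) (fun y => w0 y) ler01 _)).
    move=> y; rewrite mul1e lee_fin /w.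
    have [->|y0] := eqVneq y 0.
      by rewrite mxE expr0n (gtn_eqF m0) mulr0; pos.
    have ey : enorm y != 0 by rewrite enorm_eq0.
    apply: (@le_trans _ _ (pw y * enorm y ^+ m)).
      by rewrite ler_wpM2l ?pw_ge0// (le_trans (ler_norm _))// normrX small_norm.
    by rewrite /pw pw_exp exprD invfM -mulrA mulVf ?mulr1// expf_neq0.
  by rewrite lte_mul_pinfty ?lee_fin ?mulr_ge0 ?exprn_ge0// leb_eball_lty.
have smpos : 0 < fine (shell_mass (fun y => (w y)%:E)).
  rewrite -lte_fin fineK//.
  pose fw y := w y * ((1 < (enorm y)^-1)%R%:R * ((enorm y)^-1 < 2)%R%:R) : R.
  have mfw : mfun fw by rewrite /fw; mt.
  (* This ball satisfies 5/8 < |y| < 7/8, inside the shell 1/2 < |y| < 1 that [shell_mass] sees. *)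
  have := @int_gt0 R m.+1 fw (axis m (3 / 4)) 8^-1 mfw.
  apply.
  - by move=> y; rewrite /fw; apply: mulr_ge0; [exact: w0|pos].
  - by rewrite invr_gt0.
  - move=> y /near_axis[/andP[y1 y2]].
    rewrite ger0_norm ?divr_ge0// => /andP[ny1 ny2].
    have ny0 : 0 < enorm y by move: ny1; lra.
    have i1 : 1 < (enorm y)^-1 by rewrite invf_gt1//; move: ny2; lra.
    have i2 : (enorm y)^-1 < 2 by rewrite -div1r ltr_pdivrMr//; move: ny1; lra.
    rewrite /fw i1 i2 !mulr1 /w mulr_gt0 ?invr_gt0 ?exprn_gt0//.
    by move: y1; lra.
have intF (j : nat) : (0 < j)%N ->
    finint (leb m.+1) (fun y => F j (enorm y) * w y) /\
    \int[leb m.+1]_y (F j (enorm y) * w y) * shell =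
    fine (shell_mass (fun y => (w y)%:E)) * ln j%:R.
  move=> j0; have := pol j.
  rewrite (_ : (\int[lebesgue_measure]_r _)%E = (ln j%:R : R)%:E); last exact: haar_log.
  rewrite -(fineK smfin) -EFinM => e.
  have mFw : mfun (fun y => F j (enorm y) * w y) by rewrite /F; mt.
  have Fw0 y : 0 <= F j (enorm y) * w y by rewrite mulr_ge0.
  have e' : ((\int[leb m.+1]_y (F j (enorm y) * w y)%:E) * (@shell R)%:E =
     (fine (shell_mass (fun y => (w y)%:E)) * ln j%:R)%:E)%E.
    by rewrite -e; congr (_ * _)%E; apply: eq_integral => y _; rewrite EFinM.
  have ff : finint (leb m.+1) (fun y => F j (enorm y) * w y).
    rewrite /finint (eq_integral (fun y => (F j (enorm y) * w y)%:E)).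
      rewrite ltey; apply/eqP => ey; move: e'; rewrite ey gt0_mulye ?lte_fin//.
    by move=> y _; rewrite ger0_norm.
  split=> //; apply: EFin_inj; rewrite EFinM RintE//.
pose S (j : nat) := cf l j * j%:R ^+ m : R.
have sumS : \sum_(j < l.+1) S j = 0 by exact: sum_cf_expr0.
have S0 : S 0%N = 0 by rewrite /S expr0n (gtn_eqF m0) mulr0.
have ptw y : pw y * cosum l (y 0 ord0) =
    pw y * (\sum_(j < l.+1) cf l j * sig (j%:R *: y)) -
    tau * \sum_(j <- index_enum 'I_l.+1) S j * (F j (enorm y) * w y).
  rewrite (@cosum_sub _ l N); last by rewrite mN ltnW// ltnS ltnW.
  have -> : \sum_(j < l.+1) cf l j * (cos (j%:R * y 0 ord0) - cosT N (j%:R * y 0 ord0)) =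
    \sum_(j < l.+1) cf l j * sig (j%:R *: y) +
    tau * (y 0 ord0) ^+ m * \sum_(j < l.+1) S j * (j%:R * enorm y < 1)%R%:R.
    rewrite mulr_sumr -big_split/=; apply: eq_bigr => j _.
    by rewrite /sig /S mxE enormZ ger0_norm// exprMn; ring.
  (* The [S j] sum to 0, so the indicator of the unit ball may be subtracted from every dilated
     indicator; the difference is minus the indicator of the shell. *)
  have -> : \sum_(j < l.+1) S j * (j%:R * enorm y < 1)%R%:R =
     - \sum_(j < l.+1) S j * F j (enorm y).
    transitivity (\sum_(j < l.+1) S j * (j%:R * enorm y < 1)%R%:R -
       \sum_(j < l.+1) S j * (enorm y < 1)%R%:R).
      by rewrite -[X in _ = _ - X]mulr_suml sumS mul0r subr0.
    rewrite -sumrB -sumrN.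
    apply: eq_bigr => j _; have [->|j0] := eqVneq (j : nat) 0%N; first by rewrite S0 !mul0r subr0 oppr0.
    rewrite -mulrBr -mulrN; congr (_ * _); rewrite /F.
    case: (ltP (enorm y) 1) => y1; case: (ltP (j%:R * enorm y) 1) => y2; rewrite ?(mulr0, mul0r, mulr1, subr0, subrr, oppr0)//.
    - by rewrite sub0r.
    - suff : (1 : R) < 1 by rewrite ltxx.
      apply: le_lt_trans y2; rewrite (le_trans y1)// ler_peMl ?enorm_ge0// ler1n lt0n//.
  have -> : \sum_(j <- index_enum 'I_l.+1) S j * (F j (enorm y) * w y) =
      (\sum_(j < l.+1) S j * F j (enorm y)) * w y.
    by rewrite mulr_suml; apply: eq_bigr => j _; rewrite mulrA.
  by rewrite /w; ring.
have mFw j : mfun (fun y => S j * (F j (enorm y) * w y)) by rewrite /F; mt.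
have fFw j : finint (leb m.+1) (fun y => S j * (F j (enorm y) * w y)).
  have mFw' : mfun (fun y => F j (enorm y) * w y) by rewrite /F; mt.
  have [->|j0] := posnP j; last by apply: finintZ => //; exact: (intF j j0).1.
  rewrite /finint (eq_integral (cst 0%E)) ?integral0// => y _.
  by rewrite S0 mul0r normr0.
have msum : mfun (fun y => \sum_(j <- index_enum 'I_l.+1) S j * (F j (enorm y) * w y)).
  by apply: mf_sumr => j.
have fsum : finint (leb m.+1) (fun y => \sum_(j <- index_enum 'I_l.+1) S j * (F j (enorm y) * w y)).
  by apply: finint_sum => j.
have -> : Dc m l = - (tau * \sum_(j <- index_enum 'I_l.+1) \int[leb m.+1]_y (S j * (F j (enorm y) * w y))).
  rewrite -Rint_sum// -RintZ//.
  transitivity (\int[leb m.+1]_y (pw y * \sum_(j < l.+1) cf l j * sig (j%:R *: y)) -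
     \int[leb m.+1]_y (tau * \sum_(j <- index_enum 'I_l.+1) S j * (F j (enorm y) * w y))).
    rewrite -RintB//; [|by mt|by mt|exact: finintZ].
    by apply: eq_Rintegral => y _; rewrite ptw.
  by rewrite es add0r.
rewrite oppr_eq0 mulf_neq0//.
pose lam := fine (shell_mass (fun y => (w y)%:E)) / shell.
have -> : \sum_(j <- index_enum 'I_l.+1) \int[leb m.+1]_y (S j * (F j (enorm y) * w y)) =
    lam * \sum_(j < l.+1) cf l j * (j%:R ^+ m * ln j%:R).
  rewrite mulr_sumr; apply: eq_bigr => j _.
  have [j0|j0] := posnP j.
    rewrite j0 ln0// !mulr0 /Rintegral (eq_integral (cst 0%E)) ?integral0//.
    by move=> y _; rewrite S0 mul0r.
  have mFw' : mfun (fun y => F j (enorm y) * w y) by rewrite /F; mt.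
  have [ff ef] := intF j j0.
  rewrite RintZ// /S; apply: (@mulIf _ shell); first by rewrite gt_eqF.
  rewrite -!mulrA ef /lam; field; by rewrite gt_eqF.
rewrite mulf_neq0//; last exact: sum_cf_plog_neq0.
by rewrite mulf_neq0 ?invr_eq0 ?gt_eqF.
Qed.

Lemma Dc_neq0 : Dc m l != 0 :> R.
Proof. by case: (boolP (odd m)) => [/Dc_neq0_odd|/Dc_neq0_even]. Qed.

End nonvanishing.

(** * Gaussian integrals of cosines *)

Section gaussian_line.
Context {R : realType}.
Local Notation mu := (@lebesgue_measure R).
Implicit Types (a b w : R).

Lemma finint_leR (f g : R -> R) : mfun f -> mfun g -> finint mu g ->
  (forall w, `|f w| <= `|g w|) -> finint mu f.
Proof. move=> mf mg; exact: finint_le. Qed.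

Lemma finintZR k (f : R -> R) : mfun f -> finint mu f -> finint mu (fun w => k * f w).
Proof. exact: (@finintZ R _ _ mu k f). Qed.

Lemma RintZR k (f : R -> R) : mfun f -> finint mu f ->
  \int[mu]_w (k * f w) = k * \int[mu]_w f w.
Proof. exact: (@RintZ R _ _ mu k f). Qed.

Lemma RintDR (f g : R -> R) : mfun f -> finint mu f -> mfun g -> finint mu g ->
  \int[mu]_w (f w + g w) = \int[mu]_w f w + \int[mu]_w g w.
Proof. exact: (@RintD R _ _ mu f g). Qed.

Lemma finint_gauss (s : R) : 0 < s -> finint mu (fun w => expR (- (s * w ^+ 2))).
Proof.
move=> s0; pose c := Num.sqrt s.
have c0 : 0 < c by rewrite sqrtr_gt0.
have mg : mfun (fun w : R => (expR (- w ^+ 2))%:E) by mt.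
have := @integralT_gauss R; rewrite /gauss_fun.
have g0 (w : R) : (0 <= (expR (- w ^+ 2))%:E)%E by rewrite lee_fin expR_ge0.
rewrite (@ge0_integral_scaler R c _ (negbT (gt_eqF c0)) mg g0) => e.
rewrite /finint.
have -> : (\int[mu]_w (`|expR (- (s * w ^+ 2))|%R)%:E = \int[mu]_w (expR (- (c * w) ^+ 2))%:E)%E.
  by apply: eq_integral => w _; rewrite ger0_norm ?expR_ge0// exprMn sqr_sqrtr// ltW.
move: e; case: (\int[_]_w _)%E => [r||]//=; first by rewrite ltry.
  by rewrite mulry gtr0_sg ?normr_gt0 ?gt_eqF// mul1e.
Qed.

(** From [|w| <= 1 + w^2 / 2 <= expR (w^2 / 2)]. *)
Lemma norm_gauss_le w : `|w| * expR (- w ^+ 2) <= expR (- (2^-1 * w ^+ 2)).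
Proof.
have h : `|w| <= expR (2^-1 * w ^+ 2).
  apply: le_trans (expR_ge1Dx _).
  have := sqr_ge0 (`|w| - 1); rewrite -(real_normK (num_real w)); lra.
apply: (@le_trans _ _ (expR (2^-1 * w ^+ 2) * expR (- w ^+ 2))).
  by rewrite ler_wpM2r// expR_ge0.
by rewrite -expRD ler_expR; lra.
Qed.

Lemma Rint_shiftr a (f : R -> R) : mfun f -> \int[mu]_w f (w + a) = \int[mu]_w f w.
Proof.
move=> mf; rewrite /Rintegral; congr fine.
rewrite [RHS](@integral_transfer R _ _ _ _ mu mu (fun x : R => (x + a)%R) 1%R)%E ?mul1e//; last by mt.
by move=> g mg g0; rewrite mul1e ge0_integral_shift.
Qed.

Lemma finint_shiftr a (f : R -> R) : mfun f -> finint mu f -> finint mu (fun w => f (w + a)).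
Proof.
move=> mf; rewrite /finint.
have mg : mfun (fun w => (`|f w|)%:E) by mt.
by rewrite (@ge0_integral_shift R a _ mg)// => x; rewrite lee_fin.
Qed.


Lemma isd_Rint (f f' : R -> R -> R) (G : R -> R) a :
  (forall x, mfun (f x)) -> (forall x, finint mu (f x)) ->
  (forall x w : R, isd x (f ^~ w) (f' x w)) -> mfun G -> finint mu G ->
  (forall x w, a - 1 < x < a + 1 -> `|f' x w| <= G w) ->
  isd a (fun x : R => \int[mu]_w f x w) (\int[mu]_w f' a w).
Proof.
move=> mf ff df mG fG fG'.
have Ia : `]a - 1, a + 1[%classic a by rewrite /= in_itv/= ltrBlDr ltrDl ltr01.
have Ii x : `]a - 1, a + 1[%classic x -> mu.-integrable setT (EFin \o f x).
  by move=> _; apply: finint_integrable; [exact: mf|exact: ff].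
have Id x w : `]a - 1, a + 1[%classic x -> setT w -> derivable (f ^~ w) x 1.
  by move=> _ _; have [] := df x w.
have aG w : 0 <= `|G w| by [].
have iG : mu.-integrable setT (EFin \o (fun w => `|G w|)).
  have mG' : mfun (fun w => `|G w|) by mt.
  apply: finint_integrable; first exact: mG'.
  by apply: (finint_leR mG' mG fG) => w; rewrite normr_id.
have e1 x w : partial1of2 f x w = f' x w by rewrite partial1of2E; have [_ ->] := df x w.
have Gu x w : `]a - 1, a + 1[%classic x -> setT w -> `|partial1of2 f x w| <= `|G w|.
  by rewrite e1/= in_itv/= => /fG' h _; apply: le_trans (h w) (ler_norm _).
have h1 := derivable_under_integral measurableT Ia Ii Id aG iG Gu.
have h2 := differentiation_under_integral measurableT Ia Ii Id aG iG Gu.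
split; first exact: h1.
by rewrite -derive1E h2; congr fine; apply: eq_integral => w _ /=; rewrite e1.
Qed.

(* The translation-invariant integral of F (w + x) in w has derivative 0 in x. *)
Lemma Rint_derivative (F F' G : R -> R) : mfun F -> finint mu F ->
  (forall w, isd w F (F' w)) -> mfun G -> finint mu G ->
  (forall x w, -1 < x < 1 -> `|F' (w + x)| <= G w) ->
  \int[mu]_w F' w = 0.
Proof.
move=> mF fF dF mG fG FG.
have df (x w : R) : isd x (fun t : R => F (w + t)) (F' (w + x)).
  have h1 : isd x (fun t : R => w + t) (0 + 1) := isd_add (isd_cst w x) (isd_id x).
  by have := @isd_comp _ F (fun t => w + t) x _ _ (dF (w + x)) h1; rewrite add0r mulr1.
have m1 (x : R) : mfun (fun w : R => F (w + x)) by mt.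
have := @isd_Rint (fun x w => F (w + x)) (fun x w => F' (w + x)) G 0 m1
  (fun x => finint_shiftr x mF fF) df mG fG.
rewrite sub0r add0r => /(_ FG)[_].
rewrite (_ : (fun x : R => \int[mu]_w F (w + x)) = (fun=> \int[mu]_w F w)); last first.
  by apply/funext => x; rewrite Rint_shiftr.
rewrite derive_cst => e; rewrite [RHS]e.
by congr fine; apply: eq_integral => w _ /=; rewrite addr0.
Qed.

Lemma isd_gauss w : isd w (fun v : R => expR (- v ^+ 2)) (- (2 * w * expR (- w ^+ 2))).
Proof.
have h1 : isd w (fun v : R => - v ^+ 2) (- (2 * w)).
  by have := isd_scale (-1) (isd_pow 2 (isd_id w)); rewrite /= !mulN1r expr1 mulr1 mulr_natl; under eq_fun do rewrite mulN1r.
by have := isd_comp (is_derive_expR _) h1; rewrite mulrN mulrC.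
Qed.

Lemma isd_affine a b w : isd w (fun v : R => a * v + b) a.
Proof. by apply: (isd_eq (isd_add (isd_scale a (isd_id w)) (isd_cst b w))); rewrite mulr1 addr0. Qed.

Lemma sin_le1n (t : R) : `|sin t| <= 1.
Proof. by rewrite ler_norml sin_geN1 sin_le1. Qed.

Lemma cos_le1n (t : R) : `|cos t| <= 1.
Proof. by rewrite ler_norml cos_geN1 cos_le1. Qed.

Lemma finint_gauss_cos a b (k : R) : 0 < k ->
  finint mu (fun w => expR (- (k * w ^+ 2)) * cos (a * w + b)).
Proof.
move=> k0; apply: (finint_le _ _ (finint_gauss k0)); [by mt|by mt|].
move=> w; rewrite [leRHS]ger0_norm ?expR_ge0//.
by rewrite normrM (ger0_norm (expR_ge0 _)) ler_piMr ?cos_le1n ?expR_ge0.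
Qed.

(** As a function of a, the integral I satisfies I' = -(a / 2) I: integrate the derivative of
    [expR (- w^2) * sin (a * w + b)]. Hence [expR (a^2 / 4) * I] is constant, and its value at a = 0
    is the Gaussian integral. The phase b is kept for the induction on the dimension, which stores
    the other coordinates in it. *)
Lemma gauss_cos_line a b :
  \int[mu]_w (expR (- w ^+ 2) * cos (a * w + b)) =
  Num.sqrt pi * expR (- a ^+ 2 / 4) * cos b.
Proof.
have h2 : 0 < (2^-1 : R) by rewrite invr_gt0.
have h4 : 0 < (4^-1 : R) by rewrite invr_gt0.
pose f (x w : R) := expR (- w ^+ 2) * cos (x * w + b).
pose f' (x w : R) := - (w * expR (- w ^+ 2) * sin (x * w + b)).
have ff x : finint mu (f x).
  by have := finint_gauss_cos x b ltr01; rewrite /finint; under eq_fun do rewrite mul1r.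
have mf x : mfun (f x) by rewrite /f; mt.
have mf' x : mfun (f' x) by rewrite /f'; mt.
have bf' x w : `|f' x w| <= expR (- (2^-1 * w ^+ 2)).
  rewrite normrN normrM; apply: le_trans (norm_gauss_le w).
  by rewrite normrM (ger0_norm (expR_ge0 _)) ler_piMr ?sin_le1n// mulr_ge0 ?expR_ge0.
have ff' x : finint mu (f' x).
  apply: (finint_leR (mf' x) _ (finint_gauss h2)) => [|w]; first by mt.
  by rewrite (ger0_norm (expR_ge0 _)).
have dPhi (x : R) : isd x (fun x : R => \int[mu]_w f x w) (\int[mu]_w f' x w).
  apply: (isd_Rint mf ff _ _ (finint_gauss h2)) => [y w||y w _]; [|by mt|exact: bf'].
  have := isd_scale (expR (- w ^+ 2)) (isd_comp (is_derive_cos _) (isd_affine w b y)).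
  rewrite /f /f' [y * w]mulrC => /isd_eq h.
  by under eq_fun do rewrite [_ * w]mulrC; apply: h; ring.
have ode x : \int[mu]_w f' x w = - (x / 2) * \int[mu]_w f x w.
  have : \int[mu]_w (2 * f' x w + x * f x w) = 0.
    apply: (@Rint_derivative (fun w => expR (- w ^+ 2) * sin (x * w + b)) _
       (fun w => (2 + `|x|) * expR 1 * expR (- (4^-1 * w ^+ 2)))).
    - by mt.
    - apply: (finint_le _ _ (finint_gauss (@ltr01 R))); [by mt|by mt|].
      by move=> w; rewrite mul1r normrM ler_piMr ?sin_le1n.
    - move=> w; apply: (isd_eq (isd_mul (isd_gauss w) (isd_comp (is_derive_sin _) (isd_affine x b w)))).
      by rewrite /f /f'; ring.
    - by mt.
    - by apply: finintZ (finint_gauss h4); mt.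
    move=> y w /andP[y1 y2].
    have k1 : expR (- (w + y) ^+ 2) <= expR (- (2^-1 * (w + y) ^+ 2)).
      by rewrite ler_expR; have := sqr_ge0 (w + y); lra.
    (* For |y| < 1 one has [(w + y)^2 / 2 >= w^2 / 4 - 1], the origin of the factor [expR 1] and of
       the halved exponent. *)
    have k2 : expR (- (2^-1 * (w + y) ^+ 2)) <= expR 1 * expR (- (4^-1 * w ^+ 2)).
      rewrite -expRD ler_expR.
      have : y ^+ 2 <= 1 by nra.
      by have := sqr_ge0 (w + 2 * y); nra.
    apply: le_trans (_ : (2 + `|x|) * expR (- (2^-1 * (w + y) ^+ 2)) <= _); last first.
      by rewrite -mulrA ler_wpM2l// addr_ge0.
    rewrite (mulrDl 2 `|x|); apply: le_trans (ler_normD _ _) _; apply: lerD.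
      by rewrite normrM ger0_norm// ler_wpM2l.
    rewrite normrM ler_wpM2l// normrM; apply: le_trans k1.
    by rewrite (ger0_norm (expR_ge0 _)) ler_piMr ?expR_ge0 ?cos_le1n.
  have m2 : mfun (fun w => 2 * f' x w) by mt.
  have m3 : mfun (fun w => x * f x w) by mt.
  rewrite (RintDR m2 (finintZR 2 (mf' x) (ff' x)) m3 (finintZR x (mf x) (ff x))).
  rewrite (RintZR 2 (mf' x) (ff' x)) (RintZR x (mf x) (ff x)).
  by move=> h; lra.
have d0 (x : R) : isd x (fun x : R => expR (4^-1 * x ^+ 2) * \int[mu]_w f x w) 0.
  have h : isd x (fun v : R => 4^-1 * v ^+ 2) (2^-1 * x).
    by apply: (isd_eq (isd_scale _ (isd_pow 2 (isd_id x)))) => /=; field.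
  by apply: (isd_eq (isd_mul (isd_comp (is_derive_expR _) h) (dPhi x))); rewrite ode; field.
have := is_derive_0_is_cst a 0 d0.
have -> : \int[mu]_w f 0 w = Num.sqrt pi * cos b.
  rewrite -[in RHS](_ : \int[mu]_w gauss_fun w = Num.sqrt pi); last first.
    by rewrite /Rintegral integralT_gauss.
  have fg : finint mu (@gauss_fun R).
    by have := finint_gauss (@ltr01 R); rewrite /finint; under eq_fun do rewrite mul1r.
  have mg : mfun (@gauss_fun R) by rewrite /gauss_fun; mt.
  rewrite [RHS]mulrC -(RintZR _ mg fg).
  by congr fine; apply: eq_integral => w _; rewrite /f mul0r add0r mulrC.
rewrite expr0n/= mulr0 expR0 mul1r => e.
rewrite -/(f a) (_ : expR (- a ^+ 2 / 4) = (expR (4^-1 * a ^+ 2))^-1); last first.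
  by rewrite -expRN; congr expR; field.
have : \int[mu]_w f a w = (expR (4^-1 * a ^+ 2))^-1 * (Num.sqrt pi * cos b).
  by rewrite -e mulKf// gt_eqF// expR_gt0.
by move=> ->; ring.
Qed.

End gaussian_line.

Section gaussian_space.
Context {R : realType}.
Local Notation mu := (@lebesgue_measure R).

Lemma Rint_lebS n (f : 'rV[R]_n.+1 -> R) : mfun f -> finint (leb n.+1) f ->
  \int[leb n.+1]_x f x = \int[leb n]_x \int[mu]_t f (pt x t).
Proof.
move=> mf ff.
have mp : mfun (fun z : 'rV[R]_n * R => f (pt z.1 z.2)) by mt.
have ff2 : (\int[leb n]_x \int[mu]_t (`|f (pt x t)|)%:E < +oo)%E.
  by move: ff; rewrite /finint ge0_integral_lebS//; mt.
have fp : (leb n \x mu)%E.-integrable setT (fun z => (f (pt z.1 z.2))%:E).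
  by apply/integrable12ltyP => //; mt.
rewrite /Rintegral; congr fine.
rewrite (@integral_transfer R _ _ _ _ (leb n \x mu)%E (leb n.+1) (fun z => pt z.1 z.2) 1%R)%E//; last 2 first.
- move=> g mg g0; rewrite mul1e ge0_integral_lebS// fubini_tonelli1//; mt.
- by mt.
rewrite mul1e -(integral12_prod_meas1 fp).
have Fm := measurable_fubini_F fp; rewrite /fubini_F /= in Fm.
apply: ae_eq_integral => //.
  by apply: mf_EFin; exact: (@mf_Rint R _ _ _ _ mu (fun x t => f (pt x t)) mp).
apply: filterS (@mf_ae_inner R _ _ _ _ (leb n) mu (fun x t => f (pt x t)) mp ff2).
move=> x fx _; rewrite /fubini_F /=.
have fx' : mfun (fun t : R => f (pt x t)) by mt.
exact: esym (@RintE R _ _ mu _ fx' fx).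
Qed.

Lemma finint_gauss_space n : finint (leb n) (fun w : 'rV[R]_n => expR (- enorm w ^+ 2)).
Proof.
elim: n => [|n IH]; first by rewrite /finint ge0_integral_leb0 ?ltry//; mt.
have g1 := finint_gauss (@ltr01 R).
rewrite /finint ge0_integral_lebS//; last by mt.
rewrite (eq_integral (fun x => (`|expR (- enorm x ^+ 2)|)%:E *
  \int[mu]_t (`|expR (- (1 * t ^+ 2))|)%:E)%E) => [|x _].
  rewrite ge0_intZr//; [|by mt|by apply: integral_ge0].
  apply: lte_mul_pinfty => //; [exact: integral_ge0|].
  by rewrite ge0_fin_numE//; exact: integral_ge0.
rewrite -ge0_intZl//; last by mt.
apply: eq_integral => t _; rewrite -EFinM -normrM -expRD; congr (`|expR _|%:E).
by rewrite enorm_pt; ring.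
Qed.

Lemma gauss_cos_space n (a : 'rV[R]_n) b :
  \int[leb n]_w (expR (- enorm w ^+ 2) * cos (dotv a w + b)) =
  Num.sqrt pi ^+ n * expR (- enorm a ^+ 2 / 4) * cos b.
Proof.
elim: n a b => [|n IH] a b.
  rewrite /Rintegral (eq_integral (cst (cos b)%:E)) => [|w _].
    have h1 : (@leb R 0 setT = 1)%E by exact: diracT.
    by rewrite integral_cst// [X in (_ * X)%E]h1 mule1 /= expr0 (rV0 a 0) enorm0 expr0n/= oppr0 mul0r expR0 !mul1r.
  by rewrite (rV0 w 0) enorm0 /dotv big_ord0 add0r expr0n/= oppr0 expR0 mul1r.
have fg : finint (leb n.+1) (fun w => expR (- enorm w ^+ 2) * cos (dotv a w + b)).
  apply: (finint_le _ _ (finint_gauss_space n.+1)); [by mt|by mt|].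
  by move=> w; rewrite normrM ler_piMr ?cos_le1n.
rewrite Rint_lebS//; last by mt.
rewrite -(pt_hd_lst a); move: (hd a) (lst a) => a' s {fg}.
transitivity (\int[leb n]_x (Num.sqrt pi * expR (- s ^+ 2 / 4) * (expR (- enorm x ^+ 2) * cos (dotv a' x + b)))).
  congr fine; apply: eq_integral => x _; congr EFin.
  transitivity (\int[mu]_t (expR (- enorm x ^+ 2) * (expR (- t ^+ 2) * cos (s * t + (dotv a' x + b))))).
    congr fine; apply: eq_integral => t _; congr EFin.
    rewrite mulrA -expRD dotv_pt enorm_pt; congr (expR _ * cos _); ring.
  rewrite RintZR; [|by mt|]; last first.
    by have := finint_gauss_cos s (dotv a' x + b) ltr01; rewrite /finint; under eq_fun do rewrite mul1r.
  by rewrite gauss_cos_line; ring.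
rewrite RintZ; [|by mt|].
  rewrite IH enorm_pt (exprS _ n).
  rewrite (_ : - (enorm a' ^+ 2 + s ^+ 2) / 4 = - s ^+ 2 / 4 + - enorm a' ^+ 2 / 4); last by ring.
  by rewrite expRD; ring.
apply: (finint_le _ _ (finint_gauss_space n)); [by mt|by mt|].
by move=> w; rewrite normrM ler_piMr ?cos_le1n.
Qed.

End gaussian_space.

(** * The back-projection of the parabolic transform is a Riesz potential *)

Section back_projection.
Context {R : realType}.
Local Notation mu := (@lebesgue_measure R).
Implicit Types (m k : nat).

Definition bweight m n (z : 'rV[R]_n) : R := ((1 + 4 * enorm z ^+ 2) `^ (m%:R / 2))^-1.

Arguments bweight m {n} z.

Lemma bweight_base n (z : 'rV[R]_n) : 0 < 1 + 4 * enorm z ^+ 2.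
Proof. by rewrite ltr_wpDr// mulr_ge0// sqr_ge0. Qed.

Lemma bweight_gt0 m n (z : 'rV[R]_n) : 0 < bweight m z.
Proof. by rewrite invr_gt0 powR_gt0// bweight_base. Qed.

Lemma bweight_ge0 m n (z : 'rV[R]_n) : 0 <= bweight m z.
Proof. exact: ltW (bweight_gt0 m z). Qed.

Lemma mf_bweight m n : mfun (bweight m : 'rV[R]_n -> R).
Proof. by rewrite /bweight; mt. Qed.

Lemma powR_half m (c : R) : 0 <= c -> (c ^+ 2) `^ (m%:R / 2) = c ^+ m.
Proof.
move=> c0; rewrite -powR_mulrn// -powRrM -powR_mulrn//; congr (_ `^ _).
by field.
Qed.

Lemma bweight_orth m n (A : 'M[R]_n) z : orth A -> bweight m (z *m A) = bweight m z.
Proof. by move=> oA; rewrite /bweight enorm_orth. Qed.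

(** By [1 + 4 (c^2 |z|^2 + s^2) = c^2 (1 + 4 |z|^2)]: all horizontal slices of the weight are
    dilates of one profile. *)
Lemma bweight_pt m n (z : 'rV[R]_n) s (c := Num.sqrt (1 + 4 * s ^+ 2)) :
  bweight m (pt (c *: z) s) = c ^- m * bweight m z.
Proof.
have c1 : 0 <= 1 + 4 * s ^+ 2 by have := sqr_ge0 s; lra.
rewrite /bweight enorm_pt enormZ exprMn -normrX ger0_norm ?sqr_ge0// -invfM.
congr (_^-1); rewrite -(@powR_half m c) ?sqrtr_ge0// -powRM ?sqr_ge0//; last exact: ltW (bweight_base _).
by congr (_ `^ _); rewrite /c sqr_sqrtr//; ring.
Qed.

Lemma bweight_le1 m n (z : 'rV[R]_n) : bweight m z <= 1.
Proof.
rewrite invf_le1 ?powR_gt0 ?bweight_base// .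
apply: (@le_trans _ _ ((1 : R) `^ (m%:R / 2))); first by rewrite powR1.
by rewrite ge0_ler_powR ?nnegrE ?divr_ge0// ?(ltW (bweight_base _))// lerDl mulr_ge0// sqr_ge0.
Qed.

Lemma bweight_le m n (z : 'rV[R]_n) : z != 0 -> bweight m z <= enorm z ^- m.
Proof.
move=> z0; have e0 : 0 < enorm z by rewrite enorm_gt0.
rewrite /bweight lef_pV2 ?posrE ?powR_gt0 ?exprn_gt0 ?bweight_base//.
rewrite -powR_half ?enorm_ge0// ge0_ler_powR ?nnegrE ?divr_ge0// ?sqr_ge0 ?(ltW (bweight_base _))//.
by have := sqr_ge0 (enorm z); lra.
Qed.

(** The constant kappa up to a power of pi: the mass of a slice of the weight, halved by the
    Jacobian of t = 2 s |v| in [bweight_fiber]. *)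
Definition bconst k : R := 2^-1 * \int[leb k]_z bweight k.+1 z.

Lemma finint_bweight k q : (k < q)%N -> finint (leb k) (bweight q).
Proof.
move=> kq.
have f1 : finint (leb k) (fun z : 'rV[R]_k => (enorm z < 1)%R%:R : R).
  have := leb_eball_lty k (1 : R); rewrite -int_eballE /finint.
  by under [X in (_ -> X < _)%E]eq_integral do rewrite normr_nat.
have f2 : finint (leb k) (fun z : 'rV[R]_k => (1 <= enorm z)%R%:R / enorm z ^+ q).
  rewrite /finint; have := @rad_out_nat R k q kq.
  by under [X in (_ -> X < _)%E]eq_integral => z _ do (rewrite ger0_norm; last by pos).
have m1 : mfun (fun z : 'rV[R]_k => (enorm z < 1)%R%:R : R) by mt.
have m2 : mfun (fun z : 'rV[R]_k => (1 <= enorm z)%R%:R / enorm z ^+ q) by mt.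
have m3 := mf_addr m1 m2.
apply: (finint_le (@mf_bweight _ _) m3 (finintD m1 m2 f1 f2)).
move=> z; rewrite !ger0_norm ?bweight_ge0 ?addr_ge0//; try pos.
case: (ltP (enorm z) 1) => z1 /=; first by rewrite mul0r addr0 bweight_le1.
by rewrite add0r mul1r bweight_le// -enorm_gt0 (lt_le_trans ltr01).
Qed.

Lemma bconst_gt0 k : 0 < bconst k.
Proof.
rewrite mulr_gt0 ?invr_gt0//.
have := @int_gt0 R k (bweight k.+1) 0 1 (@mf_bweight _ _) (@bweight_ge0 _ _) ltr01 (fun y _ => bweight_gt0 _ y).
by rewrite -RintE ?lte_fin//; [exact: mf_bweight|exact: finint_bweight].
Qed.

Lemma int_bweight_fiber k s (c := Num.sqrt (1 + 4 * s ^+ 2)) :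
  (\int[leb k]_z (bweight k.+1 (pt z s))%:E = (2 * bconst k / c)%:E)%E.
Proof.
have c0 : 0 < c by rewrite sqrtr_gt0 ltr_wpDr// mulr_ge0// sqr_ge0.
have mb n : mfun (@bweight k.+1 n) := @mf_bweight _ _.
have mb1 := mb k.+1.
rewrite (@ge0_integral_scalev _ k c) ?gt_eqF//; last 2 first.
- by apply: mf_EFin; apply: (mf_comp (mb _)); mt.
- by move=> z; rewrite lee_fin bweight_ge0.
under eq_integral do rewrite bweight_pt EFinM.
rewrite ge0_intZl; [|by apply: mf_EFin; exact: mb|by move=> z; rewrite lee_fin bweight_ge0|by rewrite lee_fin invr_ge0 exprn_ge0 ?sqrtr_ge0].
rewrite -RintE; [|exact: mb|exact: finint_bweight].
rewrite -/c -!EFinM gtr0_norm// mulrA; congr EFin.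
have ck : c ^+ k != 0 by rewrite expf_neq0// gt_eqF.
have c1 : c != 0 by rewrite gt_eqF.
by rewrite /bconst [c ^+ k.+1]exprS; field; rewrite c1 ck.
Qed.

(** Rotate v to the last axis: only the last coordinate s of z enters H, and the slice over the
    others has mass [2 * bconst k / sqrt (1 + 4 s^2)]. The substitution t = 2 s |v| turns |v| sqrt
    (1 + 4 s^2) into the norm of (v, t). *)
Lemma bweight_fiber k (v : 'rV[R]_k.+1) (H : R -> \bar R) : v != 0 -> mfun H ->
  (forall t, 0 <= H t)%E ->
  (\int[leb k.+1]_z ((bweight k.+1 z)%:E * H (2 * dotv z v)%R) =
   (bconst k)%:E * \int[mu]_t (H t * ((enorm (pt v t))^-1)%:E))%E.
Proof.
move=> v0 mH H0; have mb n : mfun (@bweight k.+1 n) := @mf_bweight _ _.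
have mb1 := mb k.+1.
have ev : 0 < enorm v by rewrite lt_neqAle enorm_ge0 andbT eq_sym enorm_eq0.
have [A oA vA] : exists2 A, orth A & v *m A = pt 0 (enorm v).
  by apply: orth_exists; apply/eqP; rewrite -(@eqrXn2 _ 2)// ?enorm_ge0// enorm_pt enorm0 expr0n add0r.
have cH s : (0 <= (bconst k)%:E)%E by rewrite lee_fin ltW// bconst_gt0.
have oT : orth A^T by rewrite /orth trmxK; exact: orth_tr.
rewrite -(@ge0_integral_orth _ _ A^T (fun z => (bweight k.+1 z)%:E * H (2 * dotv z v)%R)%E); last 3 first.
- by rewrite /orth trmxK; exact: orth_tr.
- by mt.
- by move=> z; rewrite mule_ge0// lee_fin bweight_ge0.
transitivity (\int[leb k.+1]_z ((bweight k.+1 z)%:E * H (2 * (lst z * enorm v))%R))%E.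
  apply: eq_integral => z _; rewrite bweight_orth; last exact: oT.
  congr (_ * H (2 * _)%R)%E.
  rewrite -(dotv_orth _ v oA) vA -mulmxA; have := mulmx1C oA => ->.
  by rewrite mulmx1 -{1}(pt_hd_lst z) dotv_pt /dotv big1 ?add0r// => i _; rewrite [X in _ * X]mxE mulr0.
rewrite ge0_integral_lebS; [|by mt|by move=> z; rewrite mule_ge0// lee_fin bweight_ge0].
under eq_integral => z _ do under eq_integral => s _ do rewrite lst_pt.
rewrite tonelliR; [|by mt|by move=> z s; rewrite mule_ge0// lee_fin bweight_ge0].
transitivity (\int[mu]_s ((2 * bconst k / Num.sqrt (1 + 4 * s ^+ 2))%:E * H (2 * (s * enorm v))%R))%E.
  apply: eq_integral => s _; rewrite ge0_intZr//; last by move=> z; rewrite lee_fin bweight_ge0.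
    by rewrite int_bweight_fiber.
  by mt.
have ne : (2 * enorm v)%R != 0%R by rewrite mulf_neq0// gt_eqF.
rewrite [in RHS](@ge0_integral_scaler _ (2 * enorm v)%R _ ne); last 2 first.
- by mt.
- by move=> t; rewrite mule_ge0// lee_fin invr_ge0 enorm_ge0.
rewrite muleA -EFinM -ge0_intZl; last 3 first.
- by mt.
- by move=> t; rewrite mule_ge0// lee_fin invr_ge0 enorm_ge0.
- by rewrite lee_fin mulr_ge0// ltW// bconst_gt0.
apply: eq_integral => s _.
have c0 : 0 < Num.sqrt (1 + 4 * s ^+ 2) by rewrite sqrtr_gt0 ltr_wpDr// mulr_ge0// sqr_ge0.
have -> : enorm (pt v (2 * enorm v * s)) = enorm v * Num.sqrt (1 + 4 * s ^+ 2).
  apply/eqP; rewrite -(@eqrXn2 _ 2)// ?mulr_ge0 ?enorm_ge0 ?sqrtr_ge0//.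
  rewrite enorm_pt !exprMn (@sqr_sqrtr _ (1 + 4 * s ^+ 2)); last by rewrite addr_ge0// mulr_ge0// sqr_ge0.
  by apply/eqP; ring.
rewrite muleCA -EFinM [LHS]muleC (_ : 2 * enorm v * s = 2 * (s * enorm v)); last by ring.
congr (_ * _%:E)%E; rewrite gtr0_norm ?mulr_gt0//; field; rewrite !gt_eqF//.
Qed.

(** Centre the hyperplanes at x and exchange the slope z with the base point v. For fixed v <> 0 the
    slopes sweep the vertical line over v, with the density computed in [bweight_fiber]; v = 0 is a
    null set. *)
Lemma back_projection k (psi : 'rV[R]_k.+2 -> \bar R) x : mfun psi -> (forall y, 0 <= psi y)%E ->
  (\int[leb k.+1]_z ((bweight k.+1 z)%:E *
      \int[leb k.+1]_w psi (pt w (lst x + 2 * dotv z (w - hd x))%R)) =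
   (bconst k)%:E * \int[leb k.+2]_y (psi (x + y)%R * ((enorm y)^-1)%:E))%E.
Proof.
move=> mpsi psi0; have mb n : mfun (@bweight k.+1 n) := @mf_bweight _ _.
have mb1 := mb k.+1.
have b0 (z : 'rV[R]_k.+1) : (0 <= (bweight k.+1 z)%:E)%E by rewrite lee_fin bweight_ge0.
transitivity (\int[leb k.+1]_z \int[leb k.+1]_v ((bweight k.+1 z)%:E * psi (x + pt v (2 * dotv z v))%R))%E.
  apply: eq_integral => z _; rewrite ge0_intZl//; last by mt.
  congr (_ * _)%E; rewrite -(@ge0_integral_shiftv _ _ (hd x))//; last by mt.
  apply: eq_integral => v _; congr psi.
  by rewrite -[in RHS](pt_hd_lst x) -ptD addrK [v + _]addrC.
rewrite tonelliV; [|by mt|by move=> *; rewrite mule_ge0].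
have mF : mfun (fun v : 'rV[R]_k.+1 => \int[mu]_t (psi (x + pt v t)%R * ((enorm (pt v t))^-1)%:E))%E.
  apply: (@mf_intR R _ _ (fun v t => psi (x + pt v t)%R * ((enorm (pt v t))^-1)%:E)%E); [by mt|].
  by move=> v t; rewrite mule_ge0// lee_fin invr_ge0 enorm_ge0.
transitivity (\int[leb k.+1]_v ((bconst k)%:E * \int[mu]_t (psi (x + pt v t)%R * ((enorm (pt v t))^-1)%:E)))%E.
  apply: ae_eq_integral => //.
  - apply: (@mf_intV R _ _ _ (fun v z => (bweight k.+1 z)%:E * psi (x + pt v (2 * dotv z v))%R)%E); [by mt|by move=> *; rewrite mule_ge0].
  - by mt; exact: mF.
  exists [set 0]; split; [|exact: leb0_null|].
    rewrite (_ : [set 0] = [set y : 'rV[R]_k.+1 | enorm y <= 0]); first by mt.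
    by apply/seteqP; split => y /=; rewrite ?le_eqVlt ltNge enorm_ge0 orbF enorm_eq0 => /eqP.
  move=> v /= h; apply: contrapT => v0; apply: h => _.
  rewrite (@bweight_fiber k v (fun t => psi (x + pt v t)%R))//; [exact/eqP|by mt].
rewrite ge0_intZl; last 3 first.
- exact: mF.
- move=> v; apply: integral_ge0 => t _; rewrite mule_ge0// lee_fin invr_ge0 enorm_ge0//.
- by rewrite lee_fin ltW// bconst_gt0.
rewrite [in RHS]ge0_integral_lebS//; first by mt.
by move=> y; rewrite mule_ge0// lee_fin invr_ge0 enorm_ge0.
Qed.


(** The Fourier transform at 2x of the Gaussian divided by |e|^(n-1), up to normalization; it is
    real by symmetry. *)
Definition fourier_kernel k (x : 'rV[R]_k.+2) : R :=
  \int[leb k.+2]_e (expR (- enorm e ^+ 2) / enorm e ^+ k.+1 * cos (2 * dotv e x)).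

Lemma finint_gauss_pow n q : (q < n)%N ->
  finint (leb n) (fun e : 'rV[R]_n => expR (- enorm e ^+ 2) / enorm e ^+ q).
Proof.
move=> qn.
have f1 : finint (leb n) (fun z : 'rV[R]_n => (enorm z < 1)%R%:R / enorm z ^+ q).
  rewrite /finint; have := @rad_in R n q qn.
  by under [X in (_ -> X < _)%E]eq_integral => z _ do (rewrite ger0_norm; last by pos).
have m1 : mfun (fun z : 'rV[R]_n => (enorm z < 1)%R%:R / enorm z ^+ q) by mt.
have m2 : mfun (fun e : 'rV[R]_n => expR (- enorm e ^+ 2)) by mt.
apply: (finint_le _ (mf_addr m1 m2) (finintD m1 m2 f1 (finint_gauss_space n))); first by mt.
move=> z.
have g0 : 0 <= expR (- enorm z ^+ 2) / enorm z ^+ q by apply: mulr_ge0; [exact: expR_ge0|pos].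
rewrite (ger0_norm g0) [leRHS]ger0_norm; last by apply: addr_ge0; [pos|exact: expR_ge0].
case: (ltP (enorm z) 1) => z1 /=.
  rewrite mul1r ler_wpDr ?expR_ge0// ler_piMl//; first by pos.
  by rewrite -expR0 ler_expR oppr_le0 sqr_ge0.
by rewrite mul0r add0r ler_piMr ?expR_ge0// invf_le1 ?exprn_ege1// exprn_gt0// (lt_le_trans ltr01).
Qed.

(* Substitution e = r (-2z, 1) in R^m+1. *)
Lemma int_cone k (phi : 'rV[R]_k.+2 -> \bar R) : mfun phi -> (forall y, 0 <= phi y)%E ->
  (\int[leb k.+1]_z ((bweight k.+1 z)%:E * \int[mu]_r phi (r *: pt (- 2 *: z) 1)%R) =
   (2 ^- k.+1)%:E * \int[leb k.+2]_e (phi e * ((enorm e ^+ k.+1)^-1)%:E))%E.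
Proof.
move=> mphi phi0; have mb1 : mfun (@bweight k.+1 k.+1) := @mf_bweight _ _.
have b0 (z : 'rV[R]_k.+1) : (0 <= (bweight k.+1 z)%:E)%E by rewrite lee_fin bweight_ge0.
transitivity (\int[leb k.+1]_z \int[mu]_r ((bweight k.+1 z)%:E * phi (r *: pt (- 2 *: z) 1)%R))%E.
  by apply: eq_integral => z _; rewrite ge0_intZl//; mt.
rewrite tonelliR; [|by mt|by move=> *; rewrite mule_ge0].
have e0 (y : 'rV[R]_k.+2) : (0 <= phi y * ((enorm y ^+ k.+1)^-1)%:E)%E.
  by rewrite mule_ge0// lee_fin invr_ge0 exprn_ge0// enorm_ge0.
rewrite ge0_integral_lebS//; last by mt.
rewrite tonelliR; [|by mt|by move=> *; exact: e0].
rewrite -ge0_intZl; last 3 first.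
- apply: (@mf_intV R _ (measurableTypeR R) _ (fun r x => phi (pt x r) * ((enorm (pt x r) ^+ k.+1)^-1)%:E)%E); [by mt|by move=> *].
- by move=> r; apply: integral_ge0 => z _.
- by rewrite lee_fin invr_ge0 exprn_ge0.
apply: ae_eq_integral => //.
- apply: (@mf_intV R _ (measurableTypeR R) _ (fun r z => (bweight k.+1 z)%:E * phi (r *: pt (- 2 *: z) 1)%R)%E); [by mt|by move=> *; rewrite mule_ge0].
- apply: mf_muleE; first by mt.
  apply: (@mf_intV R _ (measurableTypeR R) _ (fun r x => phi (pt x r) * ((enorm (pt x r) ^+ k.+1)^-1)%:E)%E); [by mt|by move=> *].
exists [set 0 : R]; split; [exact: measurable_set1|exact: lebesgue_measure_set1|].
move=> r h; apply: contrapT => r0; apply: h => _.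
have r0' : r != 0 by apply/eqP.
have c0 : - 2 * r != 0 by rewrite mulf_neq0// oppr_eq0.
rewrite [in RHS](@ge0_integral_scalev _ _ (- 2 * r) _ c0); [|by mt|by move=> *; exact: e0].
rewrite muleA -EFinM -ge0_intZl; last 3 first.
- by mt.
- by move=> z; exact: e0.
- by rewrite lee_fin mulr_ge0// ?invr_ge0 ?exprn_ge0.
apply: eq_integral => z _.
have -> : r *: pt (- 2 *: z) 1 = pt (- 2 * r *: z) r.
  by rewrite -ptZ mulr1 scalerA [r * _]mulrC.
rewrite [RHS]muleC -muleA [LHS]muleC; congr (_ * _)%E; rewrite -EFinM; congr EFin.
have -> : enorm (pt (- 2 * r *: z) r) = `|r| * Num.sqrt (1 + 4 * enorm z ^+ 2).
  apply/eqP; rewrite -(@eqrXn2 _ 2)// ?mulr_ge0 ?enorm_ge0 ?sqrtr_ge0//.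
  rewrite enorm_pt enormZ !exprMn !real_normK ?num_real// (@sqr_sqrtr _ (1 + _)); last exact: ltW (bweight_base _).
  by apply/eqP; ring.
have s0 : 0 < Num.sqrt (1 + 4 * enorm z ^+ 2) by rewrite sqrtr_gt0 bweight_base.
rewrite /bweight -{1}(@sqr_sqrtr _ (1 + _)) ?(ltW (bweight_base _))// powR_half ?(ltW s0)//.
rewrite normrM normrN (ger0_norm (ler0n _ _)) !exprMn.
have r1 : `|r| ^+ k.+1 != 0 by rewrite expf_neq0// normr_eq0.
have s1 : Num.sqrt (1 + 4 * enorm z ^+ 2) ^+ k.+1 != 0 by rewrite expf_neq0// gt_eqF.
have t1 : (2 : R) ^+ k.+1 != 0 by rewrite expf_neq0.
by move: r1 s1 t1; move: (_ ^+ k.+1) (_ ^+ k.+1) (2 ^+ k.+1) => a b c a0 b0' c0'; field; rewrite a0 b0' c0'.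
Qed.

End back_projection.

(** * The potential of the Gaussian as a superposition of cosines *)

Section gaussian_potential.
Context {R : realType}.
Local Notation mu := (@lebesgue_measure R).
Implicit Types (k : nat).

Lemma finint_gauss_inv k (x : 'rV[R]_k.+2) (s : R) : 0 < s ->
  finint (leb k.+2) (fun y => expR (- (s * enorm (x + y) ^+ 2)) / enorm y).
Proof.
move=> s0.
have f1 : finint (leb k.+2) (fun z : 'rV[R]_k.+2 => (enorm z < 1)%R%:R / enorm z ^+ 1).
  rewrite /finint; have := @rad_in R k.+2 1 isT.
  by under [X in (_ -> X < _)%E]eq_integral => z _ do (rewrite ger0_norm; last by pos).
have m1 : mfun (fun z : 'rV[R]_k.+2 => (enorm z < 1)%R%:R / enorm z ^+ 1) by mt.
have m2 : mfun (fun y : 'rV[R]_k.+2 => expR (- (s * enorm (x + y) ^+ 2))) by mt.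
have f2 : finint (leb k.+2) (fun y : 'rV[R]_k.+2 => expR (- (s * enorm (x + y) ^+ 2))).
  have q0 : Num.sqrt s != 0 by rewrite gt_eqF// sqrtr_gt0.
  have m3 : mfun (fun y : 'rV[R]_k.+2 => expR (- enorm y ^+ 2)) by mt.
  have m4 : mfun (fun y : 'rV[R]_k.+2 => expR (- enorm (Num.sqrt s *: y) ^+ 2)) by mt.
  have := finint_shiftv x m4 (finint_scalev q0 m3 (finint_gauss_space k.+2)).
  rewrite /finint; under eq_integral do rewrite enormZ exprMn real_normK ?num_real// sqr_sqrtr ?(ltW s0)//.
  by under eq_integral do rewrite [_ + x]addrC.
apply: (finint_le _ (mf_addr m1 m2) (finintD m1 m2 f1 f2)); first by mt.
move=> z.
rewrite !ger0_norm ?addr_ge0 ?divr_ge0 ?expR_ge0 ?enorm_ge0 ?exprn_ge0 ?enorm_ge0//.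
case: (ltP (enorm z) 1) => z1 /=.
  rewrite mul1r expr1 ler_wpDr ?expR_ge0// ler_piMl ?invr_ge0 ?enorm_ge0//.
  by rewrite -expR0 ler_expR oppr_le0 mulr_ge0 ?sqr_ge0 ?ltW.
by rewrite mul0r add0r ler_piMr ?expR_ge0// invf_le1// (lt_le_trans ltr01).
Qed.

(** Fourier slice identity for a Gaussian: its integral over the hyperplane of slope 2z is an
    integral along the normal direction (-2z, 1). The height factor [expR (- S^2)] is written as a
    Gaussian average of [cos (2 S r)]; after exchanging the integrals, that over w is another
    Gaussian transform. *)
Lemma cone_slice k (x : 'rV[R]_k.+2) (z : 'rV[R]_k.+1) :
  \int[leb k.+1]_w (expR (- enorm (pt w (lst x + 2 * dotv z (w - hd x))) ^+ 2)) =
  Num.sqrt pi ^+ k * \int[mu]_r (expR (- enorm (r *: pt (- 2 *: z) 1) ^+ 2)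
     * cos (2 * dotv (r *: pt (- 2 *: z) 1) x)).
Proof.
pose S (w : 'rV[R]_k.+1) := lst x + 2 * dotv z (w - hd x).
have p0 : 0 < Num.sqrt (pi : R) by rewrite sqrtr_gt0 pi_gt0.
have mS : mfun S by rewrite /S; mt.
pose F (w : 'rV[R]_k.+1) (r : R) := expR (- enorm w ^+ 2) * (expR (- r ^+ 2) * cos (2 * S w * r + 0)).
have mF : mfun (fun u : 'rV[R]_k.+1 * R => F u.1 u.2) by rewrite /F; mt.
have g1 : finint mu (fun r => expR (- r ^+ 2)).
  by have := finint_gauss (@ltr01 R); rewrite /finint; under eq_fun do rewrite mul1r.
have fF : (\int[leb k.+1]_w \int[mu]_r (`|F w r|)%:E < +oo)%E.
  apply: (@le_lt_trans _ _ (\int[leb k.+1]_w ((`|expR (- enorm w ^+ 2)|)%:E * \int[mu]_r (`|expR (- r ^+ 2)|)%:E))%E).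
    apply: ge0_int_le.
    - by apply: (@mf_intR R _ _ (fun w r => (`|F w r|)%:E)); [mt|].
    - by move=> w; apply: integral_ge0.
    - by mt.
    move=> w; rewrite -ge0_intZl//; last by mt.
    have mFw : mfun (F w) by rewrite /F; mt.
    apply: ge0_int_le => //; [by mt|by mt|].
    move=> r; rewrite -EFinM lee_fin /F !normrM ler_wpM2l// ler_piMr// cos_le1n//.
  rewrite ge0_intZr//; [|by mt|by apply: integral_ge0].
  apply: lte_mul_pinfty; [exact: integral_ge0| |exact: g1].
  by rewrite ge0_fin_numE; [exact: finint_gauss_space|exact: integral_ge0].
transitivity ((Num.sqrt pi)^-1 * \int[leb k.+1]_w \int[mu]_r F w r).
  have mI := @mf_Rint R _ _ _ _ mu F mF.
  rewrite -RintZ; [|exact: mI|exact: (@finint_Rint R _ _ _ _ (leb k.+1) mu F mF fF)].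
  congr fine; apply: eq_integral => w _; congr EFin.
  rewrite /F RintZR; [|by mt|]; last first.
    by have := finint_gauss_cos (2 * S w) 0 ltr01; rewrite /finint; under eq_fun do rewrite mul1r.
  rewrite gauss_cos_line cos0 enorm_pt opprD expRD -/(S w).
  rewrite (_ : - (2 * S w) ^+ 2 / 4 = - S w ^+ 2); last by field.
  by field; rewrite gt_eqF.
rewrite (@fubini_R R _ _ _ _ (leb k.+1) mu F mF fF).
pose E (r : R) := expR (- enorm (r *: pt (- 2 *: z) 1) ^+ 2)
     * cos (2 * dotv (r *: pt (- 2 *: z) 1) x).
have eE (r : R) : \int[leb k.+1]_w F w r = Num.sqrt pi ^+ k.+1 * E r.
  transitivity (\int[leb k.+1]_w (expR (- r ^+ 2) * (expR (- enorm w ^+ 2) * cos (dotv (4 * r *: z) w + 2 * r * (lst x - 2 * dotv z (hd x)))))).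
    congr fine; apply: eq_integral => w _; congr EFin; rewrite /F /S.
    rewrite mulrCA; congr (_ * (_ * cos _)).
    by rewrite dotvDr dotvNr dotvZl; ring.
  rewrite RintZ; [|by mt|]; last first.
    apply: (finint_le _ _ (finint_gauss_space k.+1)); [by mt|by mt|].
    by move=> w; rewrite normrM ler_piMr ?cos_le1n.
  have h1 : dotv (r *: pt (- 2 *: z) 1) x = r * (lst x - 2 * dotv z (hd x)).
    by rewrite -{1}(pt_hd_lst x) dotvZl dotv_pt dotvZl; ring.
  have h2 : enorm (r *: pt (- 2 *: z) 1) ^+ 2 = r ^+ 2 + (4 * r) ^+ 2 * enorm z ^+ 2 / 4.
    by rewrite [in LHS]enormZ exprMn real_normK ?num_real// enorm_pt enormZ exprMn real_normK ?num_real//; field.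
  rewrite gauss_cos_space /E h1 h2 opprD expRD enormZ exprMn (real_normK (num_real (4 * r))).
  by rewrite mulNr !mulrA [expR _ * _]mulrC; congr (_ * cos _); rewrite -!mulrA; congr (_ * _).
transitivity ((Num.sqrt pi)^-1 * \int[mu]_r (Num.sqrt pi ^+ k.+1 * E r)).
  by congr (_ * fine _); apply: eq_integral => r _; rewrite eE.
rewrite RintZR; first by rewrite exprS mulrA mulKf ?gt_eqF.
- by rewrite /E; mt.
apply: (finint_leR _ _ g1); [by rewrite /E; mt|by mt|].
move=> r; rewrite /E normrM !(ger0_norm (expR_ge0 _)).
apply: le_trans (ler_piMr _ (cos_le1n _)) _; first exact: expR_ge0.
rewrite ler_expR lerN2 enormZ exprMn enorm_pt real_normK ?num_real// ler_peMr ?sqr_ge0//.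
by rewrite expr1n lerDr sqr_ge0.
Qed.


Lemma finint_cone_slice k (z : 'rV[R]_k.+1) (phi : 'rV[R]_k.+2 -> R) : mfun phi ->
  (forall e, `|phi e| <= expR (- enorm e ^+ 2)) ->
  finint mu (fun r => phi (r *: pt (- 2 *: z) 1)).
Proof.
move=> mphi b; have g1 : finint mu (fun r => expR (- r ^+ 2)).
  by have := finint_gauss (@ltr01 R); rewrite /finint; under eq_fun do rewrite mul1r.
apply: (finint_leR _ _ g1); [by mt|by mt|] => r.
apply: le_trans (b _) _; rewrite ger0_norm ?expR_ge0//.
rewrite ler_expR lerN2 enormZ exprMn enorm_pt real_normK ?num_real// ler_peMr ?sqr_ge0//.
by rewrite expr1n lerDr sqr_ge0.
Qed.

Lemma Rint_cone0 k (phi : 'rV[R]_k.+2 -> R) : mfun phi ->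
  (forall e, 0 <= phi e <= expR (- enorm e ^+ 2)) ->
  finint (leb k.+1) (fun z => bweight k.+1 z * \int[mu]_r phi (r *: pt (- 2 *: z) 1)) /\
  \int[leb k.+1]_z (bweight k.+1 z * \int[mu]_r phi (r *: pt (- 2 *: z) 1)) =
  2 ^- k.+1 * \int[leb k.+2]_e (phi e / enorm e ^+ k.+1).
Proof.
move=> mphi b; have b0 e : 0 <= phi e by have /andP[] := b e.
have nb e : `|phi e| <= expR (- enorm e ^+ 2) by rewrite ger0_norm//; have /andP[] := b e.
have mE : mfun (fun e : 'rV[R]_k.+2 => (phi e)%:E) by mt.
have fE : finint (leb k.+2) (fun e => phi e / enorm e ^+ k.+1).
  apply: (finint_le _ _ (finint_gauss_pow (ltnSn k.+1))); [by mt|by mt|].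
  move=> e; rewrite !normrM ler_wpM2r//.
  by rewrite (ger0_norm (expR_ge0 _)).
have E : (\int[leb k.+1]_z (bweight k.+1 z * \int[mu]_r phi (r *: pt (- 2 *: z) 1))%:E =
    (2 ^- k.+1 * \int[leb k.+2]_e (phi e / enorm e ^+ k.+1))%:E)%E.
  rewrite EFinM RintE//; last by mt.
  have := int_cone mE (fun y => b0 y : (0 <= (phi y)%:E)%E) => <-.
  apply: eq_integral => z _; rewrite EFinM; congr (_ * _)%E.
  by apply: RintE; [mt|exact: finint_cone_slice].
split; last by rewrite /Rintegral E.
rewrite /finint; under eq_integral => z _.
  rewrite ger0_norm; first over.
  by rewrite mulr_ge0 ?bweight_ge0//; apply: Rintegral_ge0.
by rewrite E ltry.
Qed.

Lemma Rint_cone k (phi : 'rV[R]_k.+2 -> R) : mfun phi ->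
  (forall e, `|phi e| <= expR (- enorm e ^+ 2)) ->
  finint (leb k.+1) (fun z => bweight k.+1 z * \int[mu]_r phi (r *: pt (- 2 *: z) 1)) /\
  \int[leb k.+1]_z (bweight k.+1 z * \int[mu]_r phi (r *: pt (- 2 *: z) 1)) =
  2 ^- k.+1 * \int[leb k.+2]_e (phi e / enorm e ^+ k.+1).
Proof.
move=> mphi nb.
(* [p1] and [p2] lie between 0 and this Gaussian and have difference phi, which reduces the signed
   case to the nonnegative one. *)
pose g (e : 'rV[R]_k.+2) := expR (- enorm e ^+ 2).
have mg : mfun g by rewrite /g; mt.
pose p1 e := (g e + phi e) / 2; pose p2 e := (g e - phi e) / 2.
have m1 : mfun p1 by rewrite /p1; mt.
have m2 : mfun p2 by rewrite /p2; mt.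
have b1 e : 0 <= p1 e <= g e by have := nb e; rewrite ler_norml -/(g e) /p1 => /andP[]; lra.
have b2 e : 0 <= p2 e <= g e by have := nb e; rewrite ler_norml -/(g e) /p2 => /andP[]; lra.
have pE e : phi e = p1 e - p2 e by rewrite /p1 /p2; lra.
have n1 e : `|p1 e| <= g e by have /andP[h ?] := b1 e; rewrite ger0_norm.
have n2 e : `|p2 e| <= g e by have /andP[h ?] := b2 e; rewrite ger0_norm.
have [f1 e1] := Rint_cone0 m1 b1; have [f2 e2] := Rint_cone0 m2 b2.
have ms (p : 'rV[R]_k.+2 -> R) : mfun p ->
    mfun (fun z : 'rV[R]_k.+1 => bweight k.+1 z * \int[mu]_r p (r *: pt (- 2 *: z) 1)).
  move=> mp; have mb1 : mfun (@bweight R k.+1 k.+1) := @mf_bweight _ _ _.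
  apply: mf_mulr; first exact: mb1.
  by apply: (@mf_Rint R _ _ _ _ mu (fun (z : 'rV[R]_k.+1) (r : measurableTypeR R) => p (r *: pt (- 2 *: z) 1))); mt.
have E (z : 'rV[R]_k.+1) : bweight k.+1 z * \int[mu]_r phi (r *: pt (- 2 *: z) 1) =
   bweight k.+1 z * \int[mu]_r p1 (r *: pt (- 2 *: z) 1) +
   (-1) * (bweight k.+1 z * \int[mu]_r p2 (r *: pt (- 2 *: z) 1)).
  rewrite mulN1r -mulrBr; congr (_ * _).
  rewrite -(@RintB R _ _ mu); [|by mt|exact: finint_cone_slice|by mt|exact: finint_cone_slice].
  by congr fine; apply: eq_integral => r _; rewrite pE.
have f2' := finintZ (-1) (ms _ m2) f2.
have m2' : mfun (fun z : 'rV[R]_k.+1 => -1 * (bweight k.+1 z * \int[mu]_r p2 (r *: pt (- 2 *: z) 1))).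
  by apply: mf_mulr; [mt|exact: ms].
have -> : (fun z : 'rV[R]_k.+1 => bweight k.+1 z * \int[mu]_r phi (r *: pt (- 2 *: z) 1)) =
  (fun z => bweight k.+1 z * \int[mu]_r p1 (r *: pt (- 2 *: z) 1) +
   (-1) * (bweight k.+1 z * \int[mu]_r p2 (r *: pt (- 2 *: z) 1))).
  by apply/funext => z; rewrite E.
split; first exact: (finintD (ms _ m1) m2' f1 f2').
rewrite (RintD (ms _ m1) f1 m2' f2') (RintZ _ (ms _ m2) f2) e1 e2 mulN1r -mulrBr; congr (_ * _).
have fE (p : 'rV[R]_k.+2 -> R) : mfun p -> (forall e, `|p e| <= g e) ->
    finint (leb k.+2) (fun e => p e / enorm e ^+ k.+1).
  move=> mp np; apply: (finint_le _ _ (finint_gauss_pow (ltnSn k.+1))); [by mt|by mt|].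
  by move=> e; rewrite !normrM ler_wpM2r// (ger0_norm (expR_ge0 _)).
rewrite -RintB; [|by mt|exact: fE|by mt|exact: fE].
by congr fine; apply: eq_integral => e _; rewrite pE mulrBl.
Qed.

(** [back_projection] makes the potential an average of slice integrals over all slopes,
    [cone_slice] turns each into an integral over a line through 0, and [Rint_cone] assembles the
    lines into R^n. The latter two supply the factors [Num.sqrt pi ^+ k] and [2 ^- k.+1]. *)
Lemma gauss_potential k (x : 'rV[R]_k.+2) :
  bconst k * \int[leb k.+2]_y (expR (- enorm (x + y) ^+ 2) / enorm y) =
  Num.sqrt pi ^+ k / 2 ^+ k.+1 * fourier_kernel x.
Proof.
have mpsi : mfun (fun y : 'rV[R]_k.+2 => (expR (- enorm y ^+ 2))%:E) by mt.
have psi0 (y : 'rV[R]_k.+2) : (0 <= (expR (- enorm y ^+ 2))%:E)%E by rewrite lee_fin expR_ge0.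
have := back_projection x mpsi psi0.
have f0 : finint (leb k.+2) (fun y => expR (- enorm (x + y) ^+ 2) / enorm y).
  by have := finint_gauss_inv x ltr01; rewrite /finint; under eq_integral do rewrite mul1r.
under [X in _ = (_ * X)%E -> _]eq_integral do rewrite -EFinM.
rewrite -RintE//; last by mt.
rewrite -EFinM => bp; rewrite -[LHS]/(fine (_)%:E) -bp.
pose phi (e : 'rV[R]_k.+2) := expR (- enorm e ^+ 2) * cos (2 * dotv e x).
have mphi : mfun phi by rewrite /phi; mt.
have nphi e : `|phi e| <= expR (- enorm e ^+ 2).
  by rewrite /phi normrM (ger0_norm (expR_ge0 _)) ler_piMr ?expR_ge0 ?cos_le1n.
have [fc ec] := Rint_cone mphi nphi.
transitivity (Num.sqrt pi ^+ k * \int[leb k.+1]_z (bweight k.+1 z * \int[mu]_r phi (r *: pt (- 2 *: z) 1))).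
  rewrite -RintZ//; last first.
    apply: mf_mulr; first exact: (@mf_bweight R k.+1 k.+1).
    apply: (@mf_Rint R _ _ _ _ mu (fun (z : 'rV[R]_k.+1) (r : measurableTypeR R) => phi (r *: pt (- 2 *: z) 1))).
    by rewrite /phi; mt.
  congr fine; apply: eq_integral => z _.
  rewrite -RintE; first by rewrite cone_slice -EFinM mulrCA.
    by mt.
  apply: (finint_le _ _ (finint_gauss_space k.+1)); [by mt|by mt|].
  by move=> w; rewrite !ger0_norm ?expR_ge0// ler_expR lerN2 enorm_pt lerDl sqr_ge0.
rewrite ec [LHS]mulrA; congr (_ * _); congr fine.
by apply: eq_integral => e _; rewrite /phi mulrAC.
Qed.

End gaussian_potential.

(** * Polynomial approximation of 1 / sqrt (1 - w) *)

Section taylor.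
Context {R : realType}.
Implicit Types (p r : {poly R}) (w : R).

Lemma poly_bound r : exists2 C : R, 0 <= C & forall w, `|w| <= 1 -> `|r.[w]| <= C.
Proof.
exists (\sum_(i < size r) `|r`_i|) => [|w w1]; first exact: sumr_ge0.
rewrite horner_coef; apply: le_trans (ler_norm_sum _ _ _) _; apply: ler_sum => i _.
by rewrite normrM ler_piMr// normrX exprn_ile1.
Qed.

(* Newton iteration for p^2 (1 - X) = 1 in R[[X]]. *)
Lemma invsqrt_poly N : exists p r : {poly R},
  p.[0] = 1 /\ p ^+ 2 * (1 - 'X) = 1 + 'X ^+ N.+1 * r.
Proof.
elim: N => [|N [p [r [p0 e]]]].
  by exists 1, (-1); split; [rewrite hornerE|rewrite expr1n mul1r expr1 mulrN1].
(* Chosen to cancel the constant term of q, which is then divisible by X. *)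
pose c := r.[0] / 2.
pose q := r - c%:P * 2%:R * p * (1 - 'X) + (c%:P) ^+ 2 * 'X ^+ N.+1 * (1 - 'X).
have /factor_theorem[r' eq'] : root q 0.
  rewrite /root /q !hornerE /= p0 ?expr0n ?horner_exp ?hornerX ?hornerE/= ?expr0n/=.
  by rewrite /c; apply/eqP; field.
exists (p - c%:P * 'X ^+ N.+1), r'; split.
  by rewrite !hornerE/= exprS mul0r mulr0 subr0.
have -> : (p - c%:P * 'X ^+ N.+1) ^+ 2 * (1 - 'X) = 1 + 'X ^+ N.+1 * q.
  transitivity (p ^+ 2 * (1 - 'X) + 'X ^+ N.+1 * (q - r)); last by rewrite e; ring.
  by rewrite /q; ring.
by rewrite eq' subr0 [r' * _]mulrC mulrA -exprSr.
Qed.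

(** With s = sqrt (1 - w), the polynomial identity controls [s^2 p^2 - 1]; dividing by [s (1 + s p)]
    passes to [1 / s - p]. This needs p >= 0 near 0, which p(0) = 1 ensures. *)
Lemma invsqrt_taylor N : exists (p : {poly R}) (C d : R),
  [/\ 0 <= C, 0 < d, d <= 2^-1 &
    forall w, `|w| <= d -> `|(Num.sqrt (1 - w))^-1 - p.[w]| <= C * `|w| ^+ N.+1].
Proof.
have [p [r [p0 e]]] := invsqrt_poly N.
have [C C0 bC] := poly_bound r.
have /factor_theorem[q eq'] : root (p - 1) 0 by rewrite /root !hornerE p0 subrr.
have [D D0 bD] := poly_bound q.
have D1 : 0 < 2 * (D + 1) by lra.
(* D bounds (p - 1) / w on the unit ball, so this radius gives |p - 1| <= 1/2. The factor 2 in
   [2 * C] comes from s >= 1/2. *)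
exists p, (2 * C), (2 * (D + 1))^-1; split=> [|||w hw]; [by rewrite mulr_ge0|by rewrite invr_gt0| |].
  by rewrite lef_pV2 ?posrE//; lra.
have w2 : `|w| <= 2^-1 by apply: le_trans hw _; rewrite lef_pV2 ?posrE//; lra.
have w1 : `|w| <= 1 by lra.
have pw0 : 0 <= p.[w].
  have -> : p.[w] = 1 + q.[w] * w.
    by have := congr1 (horner^~ w) eq'; rewrite /= !hornerE subr0 => <-; rewrite addrC subrK.
  have : `|q.[w] * w| <= 2^-1.
    rewrite normrM; apply: le_trans (ler_pM _ _ (bD _ w1) hw) _ => //.
    by rewrite ler_pdivrMr//; lra.
  by rewrite ler_norml => /andP[]; lra.
have w3 : 2^-1 <= 1 - w by move: w2; rewrite ler_norml => /andP[]; lra.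
have w4 : 1 - w <= 3 / 2 by move: w2; rewrite ler_norml => /andP[]; lra.
set s := Num.sqrt (1 - w).
have s0 : 0 < s by rewrite sqrtr_gt0; lra.
have s2 : s ^+ 2 = 1 - w by rewrite sqr_sqrtr//; lra.
have ew : p.[w] ^+ 2 * s ^+ 2 = 1 + w ^+ N.+1 * r.[w].
  rewrite s2; have := congr1 (horner^~ w) e.
  by rewrite hornerM horner_exp !(hornerD, hornerN, hornerM, horner_exp, hornerX, hornerC).
have sp : 1 <= 1 + s * p.[w] by rewrite lerDl mulr_ge0// ltW.
have -> : s^-1 - p.[w] = - (w ^+ N.+1 * r.[w]) / (s * (1 + s * p.[w])).
  have -> : w ^+ N.+1 * r.[w] = p.[w] ^+ 2 * s ^+ 2 - 1 by rewrite ew; ring.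
  by field; rewrite !gt_eqF//; lra.
have s1 : 2^-1 <= s by nra.
rewrite normrM normrN normrM normrX normfV [`|s * _|]ger0_norm; last by rewrite mulr_ge0// ?ltW//; lra.
rewrite (_ : 2 * C * _ = `|w| ^+ N.+1 * C * 2); last by ring.
have q0 : 0 <= (s * (1 + s * p.[w]))^-1 by rewrite invr_ge0 mulr_ge0 ?(ltW s0)//; lra.
apply: ler_pM; rewrite ?mulr_ge0 ?exprn_ge0//; first by rewrite ler_wpM2l ?exprn_ge0// bC.
by rewrite -[leRHS]invrK lef_pV2 ?posrE ?mulr_gt0//; nra.
Qed.

End taylor.

(** * The kernel of the truncated integrals *)

Section difference_kernel.
Context {R : realType}.
Implicit Types (n m l : nat).

Definition Sy l n (x y : 'rV[R]_n) : R := \sum_(j < l.+1) cf l j * (enorm (x - j%:R *: y))^-1.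
(* symmetrized in y, so that the odd Taylor terms at y = 0 cancel *)
Definition Ss l n (x y : 'rV[R]_n) : R := (Sy l x y + Sy l x (- y)) / 2.

Lemma enorm_sub_unit n (e y : 'rV[R]_n) (j : R) : enorm e = 1 ->
  enorm (e - j *: y) = Num.sqrt (1 - (2 * j * dotv e y - j ^+ 2 * enorm y ^+ 2)).
Proof.
move=> e1; rewrite [LHS]/enorm; congr Num.sqrt.
rewrite !(dotvDl, dotvDr, dotvNl, dotvNr, dotvZl, dotvZr) -!enormE e1 (dotvC y e); ring.
Qed.

(** Coefficient of j^(k + i) after the binomial expansion of the k-th power. The last factor is 1
    for even k - i and 0 otherwise, by symmetrization; since k + i has the parity of k - i, only
    even moments in j survive. *)
Definition tcoef (p : {poly R}) (s r : R) (k i : nat) : R :=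
  p`_k * ('C(k, i)%:R * (-1) ^+ i * 2 ^+ (k - i) * s ^+ (k - i) * r ^+ i.*2 *
    ((1 + (-1) ^+ (k - i)) / 2)).

Lemma even_horner (p : {poly R}) (s r j : R) :
  (p.[2 * j * s - j ^+ 2 * r ^+ 2] + p.[2 * j * - s - j ^+ 2 * r ^+ 2]) / 2 =
  \sum_(k < size p) \sum_(i < k.+1) tcoef p s r k i * j ^+ (k + i).
Proof.
rewrite !horner_coef -big_split /= mulr_suml; apply: eq_bigr => k _.
rewrite -mulrDr -mulrA !exprDn -big_split /= mulr_suml mulr_sumr; apply: eq_bigr => i _.
rewrite /tcoef -[RHS]mulrA; congr (_ * _).
have ik : (i <= k)%N by rewrite -ltnS.
have h0 : j ^+ (k + i) = j ^+ (k - i) * (j ^+ i * j ^+ i) by rewrite -!exprD addnA subnK.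
have h1 t : (2 * j * t) ^+ (k - i) = 2 ^+ (k - i) * j ^+ (k - i) * t ^+ (k - i) by rewrite !exprMn.
have h2 : (- (j ^+ 2 * r ^+ 2)) ^+ i = (-1) ^+ i * (j ^+ i * j ^+ i) * r ^+ i.*2.
  rewrite -(mulN1r (_ * _)) (exprMn _ (-1)) (exprMn _ (j ^+ 2)) -!exprM !mul2n mulrA; congr (_ * _ * _).
  by rewrite -exprD addnn.
have h3 : (- s) ^+ (k - i) = (-1) ^+ (k - i) * s ^+ (k - i).
  by rewrite -(mulN1r s) exprMn.
rewrite h0 !h1 h2 h3 -mulrnDl -mulr_natl; ring.
Qed.

(** For |e| = 1, 1/|e - j y| is a polynomial in [2 j s - j^2 r^2] up to order m + 1. The monomials
    with k + i <= m vanish, the odd ones by symmetrization and the even ones because the moment of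
    order k + i < l is 0; the others are already O(r^(m+1)). The assumption on l holds for both
    parities of n. *)
Lemma Ss_taylor m l : (forall k, (k <= m)%N -> ~~ odd k -> (k < l)%N) ->
  exists B d : R, [/\ 0 <= B, 0 < d, d <= 1 & forall n (e y : 'rV[R]_n),
    enorm e = 1 -> enorm y <= d -> `|Ss l e y| <= B * enorm y ^+ m.+1].
Proof.
move=> hl; have [p [C [d0 [C0 d00 d01 hp]]]] := @invsqrt_taylor R m.
(* M bounds |2 j t - j^2 r^2| / r for all j <= l and |t| <= r <= 1, so the radius [d0 / M] keeps
   every argument in the range of the approximation. *)
pose L : R := l%:R; pose M := 2 * L + L ^+ 2 + 1.
have L0 : 0 <= L by [].
have M1 : 1 <= M by rewrite /M lerDr; have := sqr_ge0 L; lra.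
pose A k := \sum_(j < l.+1) `|cf l j| * (j%:R : R) ^+ k.
have A0 k : 0 <= A k by apply: sumr_ge0 => j _; rewrite mulr_ge0// exprn_ge0.
pose B1 := \sum_(k < size p) \sum_(i < k.+1) `|p`_k| * 'C(k, i)%:R * 2 ^+ (k - i) * A (k + i)%N.
pose B2 := A 0%N * (C * M ^+ m.+1).
have B10 : 0 <= B1.
  by apply: sumr_ge0 => k _; apply: sumr_ge0 => i _; rewrite !mulr_ge0// exprn_ge0.
have B20 : 0 <= B2 by rewrite !mulr_ge0// exprn_ge0// (le_trans ler01).
have M0 : 0 < M by apply: lt_le_trans M1.
exists (B1 + B2), (d0 / M); split=> [|||n e y e1 yd]; first by rewrite addr_ge0.
- by rewrite divr_gt0.
- by rewrite ler_pdivrMr// mul1r; lra.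
set r := enorm y in yd *; have r0 : 0 <= r by exact: enorm_ge0.
have r1 : r <= 1 by apply: le_trans yd _; rewrite ler_pdivrMr// mul1r; lra.
pose s := dotv e y.
have sr : `|s| <= r by have := normr_dotv_le e y; rewrite e1 mul1r.
pose w (j : nat) (t : R) : R := 2 * j%:R * t - j%:R ^+ 2 * r ^+ 2.
have hw (j : nat) (t : R) : (j <= l)%N -> `|t| <= r -> `|w j t| <= M * r.
  move=> jl tr; have jL : (j%:R : R) <= L by rewrite ler_nat.
  apply: le_trans (ler_normB _ _) _; rewrite (normrM _ t) (normrM 2) (normrM (j%:R ^+ 2)) !normrX !normr_nat (ger0_norm r0).
  apply: (@le_trans _ _ (2 * L * r + L ^+ 2 * r)); last by rewrite /M; nra.
  apply: lerD; first by apply: ler_pM => //; rewrite ler_wpM2l.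
  apply: ler_pM; rewrite ?exprn_ge0//; first by rewrite ler_sqr// nnegrE.
  by rewrite expr2 ler_piMl.
pose er (j : nat) (t : R) := (Num.sqrt (1 - w j t))^-1 - p.[w j t].
have her (j : nat) (t : R) : (j <= l)%N -> `|t| <= r -> `|er j t| <= C * M ^+ m.+1 * r ^+ m.+1.
  move=> jl tr; apply: le_trans (hp _ _) _.
    by apply: le_trans (hw _ _ jl tr) _; rewrite mulrC -ler_pdivlMr.
  by rewrite -mulrA -exprMn ler_wpM2l// ler_pXn2r ?nnegrE ?mulr_ge0 ?hw// ltW.
have E : Ss l e y = \sum_(j < l.+1) cf l j * ((p.[w j s] + p.[w j (- s)]) / 2) +
    \sum_(j < l.+1) cf l j * ((er j s + er j (- s)) / 2).
  rewrite /Ss /Sy -!big_split/= mulr_suml; apply: eq_bigr => j _.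
  rewrite !enorm_sub_unit// dotvNr enormN -/r -/s -/(w j s) -/(w j (- s)) /er; ring.
rewrite E; apply: le_trans (ler_normD _ _) _; rewrite mulrDl; apply: lerD; last first.
  apply: le_trans (ler_norm_sum _ _ _) _; rewrite /B2 /A -mulrA mulr_suml; apply: ler_sum => j _.
  rewrite normrM expr0 mulr1 ler_wpM2l// normrM.
  have jl : (j <= l)%N by rewrite -ltnS.
  rewrite (ger0_norm (_ : 0 <= 2^-1)) ?invr_ge0// ler_pdivrMr//; apply: le_trans (ler_normD _ _) _.
  have := her j s jl sr; have := her j (- s) jl; rewrite normrN => /(_ sr); lra.
have -> : \sum_(j < l.+1) cf l j * ((p.[w j s] + p.[w j (- s)]) / 2) =
    \sum_(k < size p) \sum_(i < k.+1) tcoef p s r k i * \sum_(j < l.+1) cf l j * j%:R ^+ (k + i).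
  under eq_bigr do rewrite even_horner mulr_sumr.
  rewrite exchange_big /=; apply: eq_bigr => k _.
  under eq_bigr do rewrite mulr_sumr.
  rewrite exchange_big /=; apply: eq_bigr => i _.
  by rewrite mulr_sumr; apply: eq_bigr => j _; rewrite mulrCA.
apply: le_trans (ler_norm_sum _ _ _) _; rewrite /B1 mulr_suml; apply: ler_sum => k _.
apply: le_trans (ler_norm_sum _ _ _) _; rewrite mulr_suml; apply: ler_sum => i _.
have ik : (i <= k)%N by rewrite -ltnS.
have rhs0 : 0 <= `|p`_k| * 'C(k, i)%:R * 2 ^+ (k - i) * A (k + i)%N * r ^+ m.+1.
  by rewrite !mulr_ge0// exprn_ge0.
case: (leqP (k + i) m) => kim.
  case oki : (odd (k - i)).
    by rewrite /tcoef -(signr_odd _ (k - i)) oki expr1 subrr mul0r !mulr0 mul0r normr0.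
  rewrite sum_cf_expr0 ?mulr0 ?normr0//; apply: hl => //.
  by move: oki; rewrite oddB// oddD; case: (odd k) (odd i) => [] [].
have t1 : `|tcoef p s r k i| <= `|p`_k| * 'C(k, i)%:R * 2 ^+ (k - i) * r ^+ m.+1.
  rewrite /tcoef normrM -[in leRHS]mulrA -[leRHS]mulrA ler_wpM2l// normrM.
  have h1 : `|(1 + (-1) ^+ (k - i)) / 2| <= 1 :> R.
    by rewrite -signr_odd; case: odd; rewrite ?expr1 ?expr0 ?subrr ?mul0r ?normr0// divff// normr1.
  apply: le_trans (ler_piMr _ h1) _ => //.
  rewrite -!mulrA normrM normr_nat ler_wpM2l// normrM normrX normrN normr1 expr1n mul1r.
  rewrite normrM normrX normr_nat ler_wpM2l ?exprn_ge0// normrM !normrX (ger0_norm r0).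
  apply: (@le_trans _ _ (r ^+ (k - i) * r ^+ i.*2)).
    by rewrite ler_wpM2r ?exprn_ge0// lerXn2r ?nnegrE.
  by rewrite -exprD ler_wiXn2l// -addnn addnA subnK.
have s1 : `|\sum_(j < l.+1) cf l j * j%:R ^+ (k + i)| <= A (k + i)%N.
  apply: le_trans (ler_norm_sum _ _ _) _; apply: ler_sum => j _.
  by rewrite normrM ler_wpM2l// normrX normr_nat.
rewrite normrM mulrAC; apply: ler_pM => //.
Qed.

End difference_kernel.

Section kernel_bounds.
Context {R : realType}.
Variables (m l : nat).
Hypothesis m0 : (0 < m)%N.
Local Notation V := 'rV[R]_m.+1.
Implicit Types (x y : V) (a : R).

Definition Sabs x y : R := \sum_(j < l.+1) `|cf l j| * (enorm (x - j%:R *: y))^-1.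
Definition Kabs a x : \bar R := (\int[leb m.+1]_y ((a < enorm y)%R%:R * pw y * Sabs x y)%:E)%E.

(** P and Q are integrable bounds for [pw] away from 0 and for the inverse norm near 0; for Q this
    requires n >= 2. *)
Let P y : R := (1 <= enorm y)%R%:R / enorm y ^+ (2 * m.+1 - 1).
Let Q y : R := (enorm y < 1)%R%:R / enorm y ^+ 1.

Let P0 y : 0 <= P y. Proof. by rewrite /P; pos. Qed.
Let Q0 y : 0 <= Q y. Proof. by rewrite /Q; pos. Qed.
Let mP : mfun P. Proof. by rewrite /P; mt. Qed.
Let mQ : mfun Q. Proof. by rewrite /Q; mt. Qed.

Let intPQ : exists2 H : R, 0 <= H & (\int[leb m.+1]_y (P y + Q y)%:E <= H%:E)%E.
Proof.
have h : (\int[leb m.+1]_y (P y + Q y)%:E < +oo)%E.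
  under eq_integral do rewrite EFinD.
  rewrite ge0_intD; try sd.
  apply: lte_add_pinfty; first by apply: rad_out_nat; rewrite pw_exp -[X in (X < _)%N](addn0 m.+1) ltn_add2l.
  by apply: rad_in; rewrite ltnS.
exists (fine (\int[leb m.+1]_y (P y + Q y)%:E)%E).
  by rewrite fine_ge0// integral_ge0// => y _; rewrite lee_fin addr_ge0.
by rewrite fineK// ge0_fin_numE// integral_ge0// => y _; rewrite lee_fin addr_ge0.
Qed.

Lemma Sabs_ge0 x y : 0 <= Sabs x y.
Proof. by apply: sumr_ge0 => j _; rewrite mulr_ge0// invr_ge0 enorm_ge0. Qed.

Lemma mf_Sabs d (T : measurableType d) (f g : T -> V) : mfun f -> mfun g ->
  mfun (fun t => Sabs (f t) (g t)).
Proof. by move=> mf mg; rewrite /Sabs; mt. Qed.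

(** Write b = |x - j y|. From |x| <= b + j |y| the product splits into [pw y] and j times
    [pw y * |y| / b]. If b < 1, the latter is at most 1 / b. If b >= 1, it is at most [pw] at the
    smaller of |y| and b. *)
Let young x y (j : nat) :
  enorm x * ((1 < enorm y)%R%:R * pw y * (enorm (x - j%:R *: y))^-1) <=
  P y + j%:R * (P y + (P (x - j%:R *: y) + Q (x - j%:R *: y))).
Proof.
case: (ltP 1 (enorm y)) => y1 /=; last first.
  by rewrite !mul0r mulr0 addr_ge0// mulr_ge0// addr_ge0// addr_ge0.
have Py : P y = pw y by rewrite /P /pw (ltW y1) mul1r.
rewrite mul1r; set b := enorm (x - j%:R *: y).
have b0 : 0 <= b by exact: enorm_ge0.
have pw0 := pw_ge0 y.
have xb : enorm x <= b + j%:R * enorm y.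
  rewrite -{1}(subrK (j%:R *: y) x); apply: le_trans (ler_enormD _ _) _.
  by rewrite enormZ normr_nat.
have xb2 : enorm x * b^-1 <= 1 + j%:R * (enorm y * b^-1).
  apply: le_trans (ler_wpM2r _ xb) _; first by rewrite invr_ge0.
  rewrite mulrDl mulrA lerD2r; have [->|b1] := eqVneq b 0; first by rewrite mul0r.
  by rewrite divff.
have -> : enorm x * (pw y * b^-1) = pw y * (enorm x * b^-1) by ring.
apply: le_trans (ler_wpM2l pw0 xb2) _.
rewrite mulrDr mulr1 Py lerD2l mulrCA ler_wpM2l//.
have y0 : 0 < enorm y by apply: lt_trans y1.
rewrite /P /Q -/b pw_exp; case: (ltP b 1) => b1 /=.
  rewrite mul0r add0r mul1r expr1.
  have : pw y * enorm y <= 1.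
    rewrite /pw pw_exp addSn exprS invfM mulrAC mulVf ?gt_eqF// mul1r.
    by rewrite invf_le1 ?exprn_gt0// exprn_ege1// ltW.
  move=> h; rewrite mulrA; apply: le_trans (ler_wpM2r _ h) _; first by rewrite invr_ge0.
  by rewrite mul1r lerDr.
rewrite mul1r mul0r addr0 /pw pw_exp.
have bp : 0 < b by apply: lt_le_trans b1.
have [yb|/ltW by1] := leP (enorm y) b.
  apply: (@le_trans _ _ (enorm y ^- (m.+1 + m))); last by rewrite lerDl; pos.
  rewrite ler_piMr//; first by pos.
  by rewrite ler_pdivrMr// mul1r.
apply: (@le_trans _ _ (b ^- (m.+1 + m))); last by rewrite lerDr; pos.
have yN : enorm y ^+ (m + m) != 0 by rewrite expf_neq0// gt_eqF.
have bN : b ^+ (m + m) != 0 by rewrite expf_neq0// gt_eqF.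
rewrite addSn !exprS.
have -> : (enorm y * enorm y ^+ (m + m))^-1 * (enorm y / b) = (enorm y ^+ (m + m))^-1 / b.
  by field; rewrite ?yN ?gt_eqF.
have yb : b ^+ (m + m) <= enorm y ^+ (m + m) by rewrite lerXn2r ?nnegrE// ltW.
by rewrite invfM [b^-1 * _]mulrC ler_wpM2r ?invr_ge0// lef_pV2 ?posrE ?exprn_gt0.
Qed.

(** Integrate [young] in y. The substitution x - j y costs j^-n <= 1 for j >= 1, and j = 0 carries
    the weight 0. This estimate without cancellation settles the singularity at 0; integrability at
    infinity needs more. *)
Lemma Kabs_bound : exists2 A : R, 0 <= A & forall x, x != 0 -> (Kabs 1 x <= (A / enorm x)%:E)%E.
Proof.
have [H H0 hH] := intPQ.
have hP : (\int[leb m.+1]_y (P y)%:E <= H%:E)%E.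
  apply: le_trans hH; apply: ge0_int_le; [by mt|by move=> y; rewrite lee_fin|by mt|].
  by move=> y; rewrite lee_fin lerDl.
have mPQ : mfun (fun y => (P y + Q y)%:E) by mt.
have hj x (j : nat) : (\int[leb m.+1]_y (P y + j%:R * (P y + (P (x - j%:R *: y) + Q (x - j%:R *: y))))%:E
    <= (H + j%:R * (H + H))%:E)%E.
  have g1 y : 0 <= P (x - j%:R *: y) + Q (x - j%:R *: y) by rewrite addr_ge0.
  rewrite (eq_integral (fun y => (P y)%:E + j%:R%:E * ((P y)%:E + (P (x - j%:R *: y) + Q (x - j%:R *: y))%:E))%E)//.
  have m1 : mfun (fun y => ((P y)%:E + (P (x - j%:R *: y) + Q (x - j%:R *: y))%:E)%E) by mt.
  rewrite ge0_intD; [|by mt|by move=> y; rewrite lee_fin|by mt|]; last first.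
    by move=> y; rewrite mule_ge0// ?lee_fin ?addr_ge0.
  rewrite EFinD EFinM; apply: leeD => //.
  rewrite ge0_intZl//; last by move=> y; rewrite -EFinD lee_fin addr_ge0.
  case: j g1 m1 => [|j] g1 m1; first by rewrite !mul0e.
  apply: lee_wpmul2l; first by rewrite lee_fin.
  rewrite ge0_intD; [|by mt|by move=> y; rewrite lee_fin|by mt|by move=> y; rewrite lee_fin].
  rewrite EFinD; apply: leeD => //.
  have j0 : - j.+1%:R != 0 :> R by rewrite oppr_eq0.
  apply: le_trans hH.
  rewrite -[leRHS](@ge0_integral_shiftv _ _ x (fun y => (P y + Q y)%:E))//; last first.
    by move=> y; rewrite lee_fin addr_ge0.
  rewrite [leRHS](@ge0_integral_scalev _ _ _ _ j0); last 2 first.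
  - by mt.
  - by move=> y; rewrite lee_fin addr_ge0.
  rewrite (eq_integral (fun y => (P (- j.+1%:R *: y + x) + Q (- j.+1%:R *: y + x))%:E)); last first.
    by move=> y _; rewrite scaleNr [- _ + x]addrC.
  rewrite -[leLHS]mul1e; apply: lee_wpmul2r.
    by apply: integral_ge0 => y _; rewrite lee_fin addr_ge0.
  by rewrite lee_fin normrN normr_nat exprn_ege1// ler1n.
pose A := \sum_(j < l.+1) `|cf l j| * (H + j%:R * (H + H)) : R.
exists A => [|x x0]; first by apply: sumr_ge0 => j _; rewrite mulr_ge0// !(addr_ge0, mulr_ge0).
have ex : 0 < enorm x by rewrite enorm_gt0.
have m1 : mfun (fun y => ((1 < enorm y)%R%:R * pw y * Sabs x y)%:E).
  have mS : mfun (Sabs x) := mf_Sabs (@measurable_cst _ _ _ _ setT x) (@measurable_id _ V setT).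
  by rewrite /pw; mt.
have n1 y : (0 <= ((1 < enorm y)%R%:R * pw y * Sabs x y)%:E)%E.
  by rewrite lee_fin !mulr_ge0 ?pw_ge0 ?Sabs_ge0.
rewrite mulrC EFinM lee_pdivlMl// /Kabs -ge0_intZl//; last by rewrite lee_fin ltW.
pose g (j : 'I_l.+1) y := (`|cf l j| * (P y + j%:R * (P y + (P (x - j%:R *: y) + Q (x - j%:R *: y)))))%:E.
have mg j : mfun (g j) by rewrite /g; mt.
have g0 j y : (0 <= g j y)%E.
  by rewrite lee_fin mulr_ge0// addr_ge0// mulr_ge0// addr_ge0// addr_ge0.
apply: (@le_trans _ _ (\int[leb m.+1]_y (\sum_(j < l.+1) g j y))%E).
  apply: ge0_int_le; [by mt|by move=> y; rewrite mule_ge0// lee_fin ltW| |].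
    by apply: emeasurable_sum => j; exact: mg.
  move=> y; rewrite sumEFin -EFinM lee_fin /Sabs mulr_sumr mulr_sumr; apply: ler_sum => j _.
  apply: le_trans (ler_wpM2l (normr_ge0 _) (young x y j)).
  by rewrite le_eqVlt; apply/orP; left; apply/eqP; ring.
rewrite ge0_integral_sum//.
rewrite /A -sumEFin; apply: lee_sum => j _.
rewrite /g; under eq_integral do rewrite EFinM.
rewrite ge0_intZl//; [|by mt|]; last by move=> y; rewrite lee_fin addr_ge0// mulr_ge0// addr_ge0// addr_ge0.
by rewrite EFinM; apply: lee_wpmul2l => //; rewrite lee_fin.
Qed.

Lemma Sabs_scale (c : R) x y : 0 < c -> Sabs (c *: x) (c *: y) = c^-1 * Sabs x y.
Proof.
move=> c0; rewrite /Sabs mulr_sumr; apply: eq_bigr => j _.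
have -> : c *: x - j%:R *: (c *: y) = c *: (x - j%:R *: y) by rewrite scalerBr !scalerA mulrC.
by rewrite enormZ (gtr0_norm c0) invfM; ring.
Qed.

Lemma Kabs_scale a x : 0 < a -> Kabs a x = ((a ^- m.+1)%:E * Kabs 1 (a^-1 *: x))%E.
Proof.
move=> a0; rewrite /Kabs.
have mF b z : mfun (fun y => ((b < enorm y)%R%:R * pw y * Sabs z y)%:E).
  have mS : mfun (Sabs z) := mf_Sabs (@measurable_cst _ _ _ _ setT z) (@measurable_id _ V setT).
  by rewrite /pw; mt.
have F0 b z y : (0 <= ((b < enorm y)%R%:R * pw y * Sabs z y)%:E)%E.
  by rewrite lee_fin !mulr_ge0 ?pw_ge0 ?Sabs_ge0.
have an0 : (0 <= (a ^- m.+1)%:E)%E by rewrite lee_fin invr_ge0 exprn_ge0// ltW.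
have an1 : (0 <= (`|a| ^+ m.+1)%:E)%E by rewrite lee_fin exprn_ge0.
rewrite -(ge0_intZl (leb m.+1) (mF 1 (a^-1 *: x)) (F0 1 (a^-1 *: x)) an0).
rewrite (@ge0_integral_scalev _ _ a _ (lt0r_neq0 a0) (mF a x) (F0 a x)).
have mFa : mfun (fun y => ((a < enorm (a *: y))%R%:R * pw (a *: y) * Sabs x (a *: y))%:E).
  by apply: (mf_comp (mF a x)); mt.
rewrite -(ge0_intZl (leb m.+1) mFa (fun y => F0 a x (a *: y)) an1).
apply: eq_integral => y _; rewrite -!EFinM; congr EFin.
have -> : (a < enorm (a *: y)) = (1 < enorm y) by rewrite enormZ (gtr0_norm a0) ltr_pMr.
rewrite pw_scale (gtr0_norm a0).
rewrite -{1}(@scale1r _ _ x) -(divff (lt0r_neq0 a0)) -scalerA Sabs_scale// exprD.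
by rewrite exprS; field; rewrite ?expf_neq0 ?gt_eqF.
Qed.

End kernel_bounds.

Lemma eq_ler {R : realType} (a b : R) : a = b -> a <= b.
Proof. by move=> ->. Qed.

Section symmetric_kernel.
Context {R : realType}.
Variables (m l : nat).
Hypothesis m0 : (0 < m)%N.
Hypothesis hl : forall k, (k <= m)%N -> ~~ odd k -> (k < l)%N.
Local Notation V := 'rV[R]_m.+1.
Implicit Types (x y : V) (a : R).

Lemma mf_Sy d (T : measurableType d) (f g : T -> V) : mfun f -> mfun g ->
  mfun (fun t => Sy l (f t) (g t)).
Proof. by move=> mf mg; rewrite /Sy; mt. Qed.

Lemma mf_Ss d (T : measurableType d) (f g : T -> V) : mfun f -> mfun g ->
  mfun (fun t => Ss l (f t) (g t)).
Proof.
move=> mf mg; have h1 := mf_Sy mf mg; have h2 := mf_Sy mf (mf_oppv mg).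
by rewrite /Ss; mt.
Qed.

Lemma mf_Syr x : mfun (fun y => Sy l x y).
Proof. by apply: mf_Sy; mt. Qed.

Lemma mf_Ssr x : mfun (fun y => Ss l x y).
Proof. by apply: mf_Ss; mt. Qed.

Lemma mf_Sabsr x : mfun (fun y => Sabs l x y).
Proof. by apply: mf_Sabs; mt. Qed.

Lemma norm_Sy x y : `|Sy l x y| <= Sabs l x y.
Proof.
apply: le_trans (ler_norm_sum _ _ _) _; apply: ler_sum => j _.
by rewrite normrM [X in _ * X]ger0_norm// invr_ge0 enorm_ge0.
Qed.

Lemma norm_Ss x y : `|Ss l x y| <= (Sabs l x y + Sabs l x (- y)) / 2.
Proof.
rewrite /Ss normrM [X in _ * X]ger0_norm ?invr_ge0// ler_wpM2r ?invr_ge0//.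
by apply: le_trans (ler_normD _ _) _; rewrite lerD// norm_Sy.
Qed.

Lemma Sy_scale (c : R) x y : 0 < c -> Sy l (c *: x) (c *: y) = c^-1 * Sy l x y.
Proof.
move=> c0; rewrite /Sy mulr_sumr; apply: eq_bigr => j _.
have -> : c *: x - j%:R *: (c *: y) = c *: (x - j%:R *: y) by rewrite scalerBr !scalerA mulrC.
by rewrite enormZ (gtr0_norm c0) invfM; ring.
Qed.

Lemma Ss_scale (c : R) x y : 0 < c -> Ss l (c *: x) (c *: y) = c^-1 * Ss l x y.
Proof. by move=> c0; rewrite /Ss -scalerN !Sy_scale// -mulrDr mulrA. Qed.

Lemma Ss_orth (A : 'M[R]_m.+1) x y : orth A -> Ss l (x *m A) (y *m A) = Ss l x y.
Proof.
move=> oA; rewrite /Ss -mulNmx; congr ((_ + _) / 2); rewrite /Sy; apply: eq_bigr => j _.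
  by rewrite scalemxAl -mulmxBl enorm_orth.
by rewrite scalemxAl -mulmxBl enorm_orth.
Qed.

Lemma unit_dir x : x != 0 -> enorm ((enorm x)^-1 *: x) = 1.
Proof.
move=> x0; have e0 : 0 < enorm x by rewrite enorm_gt0.
by rewrite enormZ gtr0_norm ?invr_gt0// mulVf ?gt_eqF.
Qed.

Lemma Ss_dir x y : x != 0 -> Ss l x y = (enorm x)^-1 * Ss l ((enorm x)^-1 *: x) ((enorm x)^-1 *: y).
Proof.
move=> x0; have e0 : 0 < enorm x by rewrite enorm_gt0.
by rewrite Ss_scale ?invr_gt0// invrK mulKf ?gt_eqF.
Qed.

Let Z := (\int[@leb R m.+1]_y ((enorm y < 1)%R%:R / enorm y ^+ m)%:E)%E.
Let Z_fin : Z \is a fin_num.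
Proof.
rewrite ge0_fin_numE; first exact: rad_in.
by apply: integral_ge0 => y _; rewrite lee_fin; pos.
Qed.
Let Z_ge0 : 0 <= fine Z.
Proof. by apply: fine_ge0; apply: integral_ge0 => y _; rewrite lee_fin; pos. Qed.

Let pw_near y : pw y * enorm y ^+ m.+1 <= (enorm y ^+ m)^-1.
Proof.
have [y0|y0] := eqVneq (enorm y) 0.
  by rewrite y0 exprS mul0r mulr0 invr_ge0 exprn_ge0.
by rewrite /pw pw_exp exprD invfM mulrAC mulVf ?mul1r// expf_neq0.
Qed.

(** By homogeneity x may be a unit vector. For |y| <= d / 2 the order m + 1 of [Ss_taylor] leaves
    |y|^-m, which is integrable; for larger |y| the bound [Kabs] applies. *)
Lemma Ss_int_bound : exists2 C : R, 0 <= C & forall x, x != 0 ->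
  (\int[leb m.+1]_y (pw y * `|Ss l x y|)%:E <= (C / enorm x ^+ m.+1)%:E)%E.
Proof.
have [A A0 hA] := @Kabs_bound R m l m0.
have [B [d [B0 d0 d1 hB]]] := @Ss_taylor R m l hl.
pose C := B * fine Z + (d / 2) ^- m.+1 * (A * (d / 2)).
have d20 : 0 < d / 2 by rewrite divr_gt0.
have C0 : 0 <= C.
  apply: addr_ge0; first exact: mulr_ge0.
  apply: mulr_ge0; first by rewrite invr_ge0 exprn_ge0// ltW.
  by apply: mulr_ge0 => //; exact: ltW.
have unit e : enorm e = 1 -> (\int[@leb R m.+1]_y (pw y * `|Ss l e y|)%:E <= C%:E)%E.
  move=> e1.
  pose F y := (d / 2 < enorm y)%R%:R * pw y * Sabs l e y.
  have mF : mfun F by have mS := mf_Sabsr e; rewrite /F /pw; mt.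
  have F0 y : 0 <= F y by rewrite /F !mulr_ge0 ?pw_ge0 ?Sabs_ge0.
  have mFE : mfun (fun y => (F y)%:E) by mt.
  pose G y := (B * ((enorm y < 1)%R%:R / enorm y ^+ m)).
  have mG : mfun G by rewrite /G; mt.
  have G0 y : 0 <= G y by rewrite /G mulr_ge0//; pos.
  have mS := mf_Ssr e.
  apply: (@le_trans _ _ (\int[leb m.+1]_y ((G y)%:E + (2^-1%:E * ((F y)%:E + (F (- y))%:E))))%E).
    apply: ge0_int_le; [by rewrite /pw; mt|by move=> y; rewrite lee_fin mulr_ge0 ?pw_ge0|by mt|].
    move=> y; rewrite -[leRHS]/((G y + 2^-1 * (F y + F (- y)))%:E) lee_fin /F pwN enormN.
    have [yd|yd] := leP (enorm y) (d / 2); rewrite /=.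
      rewrite !mul0r addr0 mulr0 addr0 /G.
      have -> : enorm y < 1 by apply: le_lt_trans yd _; lra.
      rewrite mul1r; apply: (@le_trans _ _ (pw y * (B * enorm y ^+ m.+1))).
        by rewrite ler_wpM2l ?pw_ge0// hB//; apply: le_trans yd _; lra.
      by rewrite mulrCA ler_wpM2l// pw_near.
    apply: (@le_trans _ _ (pw y * ((Sabs l e y + Sabs l e (- y)) / 2))).
      by rewrite ler_wpM2l ?pw_ge0// norm_Ss.
    by rewrite !mul1r -[leLHS]add0r lerD//; apply: eq_ler; ring.
  have mFN : mfun (fun y => (F (- y))%:E) by mt.
  have mFF : mfun (fun y => ((F y)%:E + (F (- y))%:E)%E) by mt.
  have FF0 y : (0 <= (F y)%:E + (F (- y))%:E)%E by rewrite -EFinD lee_fin addr_ge0.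
  rewrite ge0_intD//; [|by mt|by mt|by move=> y; rewrite mule_ge0].
  have h20 : (0 <= 2^-1%:E :> \bar R)%E by rewrite lee_fin.
  have F0E y : (0 <= (F y)%:E)%E by rewrite lee_fin.
  rewrite (ge0_intZl (leb m.+1) mFF FF0 h20) (ge0_intD (leb m.+1) mFE F0E mFN (fun y => F0E (- y))).
  rewrite (@ge0_integral_oppv _ _ (fun y => (F y)%:E) mFE F0E).
  have -> : (2^-1%:E * (\int[leb m.+1]_y (F y)%:E + \int[leb m.+1]_y (F y)%:E) = Kabs l (d / 2) e :> \bar R)%E.
    rewrite -/(Kabs l (d / 2) e); move: (Kabs _ _ _) => X.
    rewrite -[X in (_ * (X + X))%E]mul1e -ge0_muleDl// muleA.
    by rewrite -EFinD -EFinM (_ : 2^-1 * (1 + 1) = 1) ?mul1e//; lra.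
  rewrite Kabs_scale// /C EFinD; apply: leeD.
    rewrite /G; under eq_integral do rewrite EFinM.
    rewrite ge0_intZl//; [by rewrite EFinM fineK|by mt|by move=> y; rewrite lee_fin; pos].
  rewrite EFinM; apply: lee_wpmul2l; first by rewrite lee_fin invr_ge0 exprn_ge0 ?ltW.
  apply: le_trans (hA _ _) _.
    by rewrite -enorm_eq0 enormZ e1 mulr1 gtr0_norm ?invr_gt0// gt_eqF ?invr_gt0.
  by rewrite enormZ e1 mulr1 gtr0_norm ?invr_gt0// invrK.
exists C => // x x0; have e0 : 0 < enorm x by rewrite enorm_gt0.
have mS := mf_Ssr x.
have h1 := @ge0_integral_scalev R m.+1 (enorm x) (fun y => (pw y * `|Ss l x y|)%:E) (lt0r_neq0 e0).
rewrite h1; [|by rewrite /pw; mt|by move=> y; rewrite lee_fin mulr_ge0 ?pw_ge0].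
have mS1 := mf_Ssr ((enorm x)^-1 *: x).
rewrite (eq_integral (fun y => ((enorm x ^+ (m.+1 + m))^-1 * (enorm x)^-1)%:E * (pw y * `|Ss l ((enorm x)^-1 *: x) y|)%:E)%E); last first.
  move=> y _; rewrite -EFinM; congr EFin.
  rewrite pw_scale Ss_dir// scalerA mulVf ?gt_eqF// scale1r normrM (gtr0_norm e0).
  by rewrite [`|_^-1|]gtr0_norm ?invr_gt0//; ring.
rewrite ge0_intZl//; last 3 first.
- by rewrite /pw; mt.
- by move=> y; rewrite lee_fin mulr_ge0 ?pw_ge0.
- by rewrite lee_fin mulr_ge0// invr_ge0 ?exprn_ge0 ?enorm_ge0.
rewrite muleA -EFinM (gtr0_norm e0).
apply: le_trans (lee_wpmul2l _ (unit _ (unit_dir x0))) _.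
  by rewrite lee_fin !mulr_ge0 ?invr_ge0 ?exprn_ge0 ?enorm_ge0.
rewrite -EFinM lee_fin exprD (exprS (enorm x) m).
by apply: eq_ler; field; rewrite expf_neq0 ?gt_eqF.
Qed.

(** Homogeneous of degree -n and rotation invariant, hence determined by its value at one unit
    vector ([kapE]); [kap_eq0] shows that this value is 0. *)
Definition kap x : R := \int[leb m.+1]_y (pw y * Ss l x y).

Lemma finint_Ss x : x != 0 -> finint (leb m.+1) (fun y => pw y * Ss l x y).
Proof.
move=> x0; have [C C0 hC] := Ss_int_bound; rewrite /finint.
under eq_integral do rewrite normrM (ger0_norm (pw_ge0 _)).
exact: le_lt_trans (hC x x0) (ltry _).
Qed.

Lemma kap_scale (c : R) x : 0 < c -> x != 0 -> kap (c *: x) = c ^- m.+1 * kap x.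
Proof.
move=> c0 x0; rewrite /kap; have mS z := mf_Ssr z.
rewrite (@Rint_scalev _ _ c); [|exact: lt0r_neq0|by have := mS (c *: x); rewrite /pw => h; mt].
rewrite (gtr0_norm c0).
transitivity (c ^+ m.+1 * \int[leb m.+1]_y ((c ^+ (m.+1 + m))^-1 * c^-1 * (pw y * Ss l x y))).
  congr (_ * fine _); apply: eq_integral => y _; congr EFin.
  by rewrite pw_scale Ss_scale// (gtr0_norm c0); ring.
rewrite RintZ; [|by have := mS x; rewrite /pw => h; mt|exact: finint_Ss].
by rewrite mulrA exprD (exprS c m); congr (_ * _); field; rewrite expf_neq0 ?gt_eqF.
Qed.

Lemma kap_orth (A : 'M[R]_m.+1) x : orth A -> kap (x *m A) = kap x.
Proof.
move=> oA; rewrite /kap.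
have mS : mfun (fun y => pw y * Ss l (x *m A) y) by have h := mf_Ssr (x *m A); rewrite /pw; mt.
have e y : pw (y *m A) * Ss l (x *m A) (y *m A) = pw y * Ss l x y.
  by congr (_ * _); [exact: pw_orth|exact: Ss_orth].
by rewrite -(Rint_orth oA mS); apply: eq_Rintegral => y _; exact: e.
Qed.

Lemma kapE x : x != 0 -> kap x = kap (axis m 1) / enorm x ^+ m.+1.
Proof.
move=> x0; have e0 : 0 < enorm x by rewrite enorm_gt0.
have a1 : enorm (axis m 1 : V) = 1 by rewrite enorm_axis normr1.
have a0 : (axis m 1 : V) != 0 by rewrite -enorm_eq0 a1 oner_eq0.
have [A oA <-] : exists2 A, orth A & (enorm x *: axis m 1) *m A = x.
  by apply: orth_exists; rewrite enormZ a1 mulr1 gtr0_norm.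
by rewrite kap_orth// kap_scale// enorm_orth// enormZ a1 mulr1 (gtr0_norm e0) mulrC.
Qed.

End symmetric_kernel.

Lemma norm_Rint_le2 {R : realType} d (T : measurableType d) (nu : {measure set T -> \bar R})
  (f g : T -> R) : mfun f -> mfun g -> finint nu g -> (forall x, `|f x| <= g x) ->
  `|\int[nu]_x f x| <= \int[nu]_x g x.
Proof.
move=> mf mg fg h; rewrite -lee_fin; apply: (le_trans (@norm_Rint_leE R _ T nu f mf)).
rewrite RintE//; apply: ge0_int_le; [by mt|by []|by mt|].
by move=> x; rewrite lee_fin.
Qed.

Lemma Rint_subZ {R : realType} d (T : measurableType d) (nu : {measure set T -> \bar R})
  (f g : T -> R) (c : R) : mfun f -> finint nu f -> mfun g -> finint nu g ->
  \int[nu]_x (f x - c * g x) = \int[nu]_x f x - c * \int[nu]_x g x.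
Proof.
move=> mf ff mg fg; rewrite RintB//; [by rewrite RintZ|by mt|exact: finintZ].
Qed.

Lemma finint_gauss_s {R : realType} n (s : R) : 0 < s ->
  finint (leb n) (fun w : 'rV[R]_n => expR (- (s * enorm w ^+ 2))).
Proof.
move=> s0; have q0 : Num.sqrt s != 0 by rewrite gt_eqF// sqrtr_gt0.
have m3 : mfun (fun y : 'rV[R]_n => expR (- enorm y ^+ 2)) by mt.
have := finint_scalev q0 m3 (finint_gauss_space n).
by rewrite /finint; under eq_integral do rewrite enormZ exprMn real_normK ?num_real// sqr_sqrtr ?(ltW s0)//.
Qed.

(** * The symmetrized differences integrate to 0 over the whole space *)

Section gaussian_test.
Context {R : realType}.
Variables (k l : nat).
Hypothesis l_even : ~~ odd k.+2 -> l = k.+1.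
Hypothesis l_odd : odd k.+2 -> (k.+1 < l)%N.
Local Notation V := 'rV[R]_k.+2.
Implicit Types (x y e : V).

Lemma even_lt_l j : (j <= k.+1)%N -> ~~ odd j -> (j < l)%N.
Proof.
move=> jk oj; case: (boolP (odd k.+2)) => ok; first by apply: leq_ltn_trans jk (l_odd ok).
rewrite (l_even ok) ltn_neqAle jk andbT; apply: contraNN oj => /eqP ->.
by move: ok => /=; rewrite negbK.
Qed.

Lemma finint_gpot (s : R) y : 0 < s ->
  finint (leb k.+2) (fun x => expR (- (s * enorm x ^+ 2)) * (enorm (x - y))^-1).
Proof.
move=> s0; have m1 : mfun (fun x : V => expR (- (s * enorm (y + x) ^+ 2)) / enorm x) by mt.
have := finint_shiftv (- y) m1 (finint_gauss_inv y s0).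
by rewrite /finint; under eq_integral do rewrite addrCA addrN addr0.
Qed.

Definition gpot y : R := \int[leb k.+2]_x (expR (- enorm x ^+ 2) * (enorm (x - y))^-1).

Lemma gpotE y : gpot y = \int[leb k.+2]_x (expR (- enorm (y + x) ^+ 2) / enorm x).
Proof.
rewrite /gpot -[LHS](@Rint_shiftv _ _ y); last by mt.
by apply: eq_Rintegral => x _; rewrite addrK addrC.
Qed.

Lemma mf_gpot d (T : measurableType d) (f : T -> V) : mfun f -> mfun (fun t => gpot (f t)).
Proof.
move=> mf; apply: (@mf_Rint R _ _ _ _ (leb k.+2) (fun t x => expR (- enorm x ^+ 2) * (enorm (x - f t))^-1)).
by mt.
Qed.

Lemma gpotN y : gpot (- y) = gpot y.
Proof.
rewrite /gpot -[LHS]Rint_oppv; last by mt.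
by apply: eq_Rintegral => x _; rewrite enormN -opprD enormN.
Qed.

Lemma gpot4 y : \int[leb k.+2]_x (expR (- (4 * enorm x ^+ 2)) * (enorm (x - y))^-1) =
  2 ^- k.+1 * gpot (2 *: y).
Proof.
have t0 : (2 : R) != 0 by [].
rewrite /gpot [X in _ * X](@Rint_scalev _ _ 2 _ t0); last by mt.
transitivity (2 ^- k.+1 * (`|2| ^+ k.+2 * (2^-1 * \int[leb k.+2]_x (expR (- (4 * enorm x ^+ 2)) * (enorm (x - y))^-1)))).
  rewrite ger0_norm// (exprS _ k.+1) mulrA mulrC !mulrA.
  have h2 : (2 : R) ^+ k.+1 != 0 by rewrite expf_neq0.
  by move: h2; move: (2 ^+ k.+1) => b h2; field.
congr (_ * (_ * _)); rewrite -RintZ; [|by mt|exact: finint_gpot].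
apply: eq_Rintegral => x _; rewrite -scalerBr !enormZ ger0_norm// invfM exprMn.
by rewrite (_ : 2 ^+ 2 = 4); [ring|rewrite expr2; lra].
Qed.

(** The integral in x of the Gaussian against [Sy l x y]: what remains of the kernel after
    testing. *)
Definition Phi y : R := \sum_(j < l.+1) cf l j * gpot (j%:R *: y).

Lemma mf_Phi d (T : measurableType d) (f : T -> V) : mfun f -> mfun (fun t => Phi (f t)).
Proof. by move=> mf; apply: mf_sumr => j; apply: mf_mulr; [mt|apply: mf_gpot; mt]. Qed.

Lemma PhiN y : Phi (- y) = Phi y.
Proof. by apply: eq_bigr => j _; rewrite scalerN gpotN. Qed.

Let cc : R := Num.sqrt pi ^+ k / 2 ^+ k.+1.
Let wt e : R := expR (- enorm e ^+ 2) / enorm e ^+ k.+1.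
Let mwt : mfun wt. Proof. by rewrite /wt; mt. Qed.
Let fwt : finint (leb k.+2) wt. Proof. exact: finint_gauss_pow. Qed.
Let wt0 e : 0 <= wt e. Proof. by apply: mulr_ge0; [exact: expR_ge0|pos]. Qed.

(** [gauss_potential] makes each translate a superposition of cosines, and the difference in y acts
    on the frequency e through [cosum]. *)
Lemma PhiE y : bconst k * Phi y = cc * \int[leb k.+2]_e (wt e * cosum l (2 * dotv e y)).
Proof.
rewrite /Phi mulr_sumr.
transitivity (\sum_(j < l.+1) cc * (cf l j * fourier_kernel (j%:R *: y))).
  by apply: eq_bigr => j _; rewrite mulrCA gpotE gauss_potential mulrCA.
rewrite -mulr_sumr; congr (_ * _).
have fj (j : 'I_l.+1) : finint (leb k.+2) (fun e => wt e * cos (2 * dotv e (j%:R *: y))).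
  apply: (finint_le _ mwt fwt); first by mt.
  by move=> e; rewrite normrM ler_piMr// cos_le1n.
have fj' (j : 'I_l.+1) : finint (leb k.+2) (fun e => cf l j * (wt e * cos (2 * dotv e (j%:R *: y)))).
  by apply: finintZ (fj j); mt.
transitivity (\sum_(j < l.+1) \int[leb k.+2]_e (cf l j * (wt e * cos (2 * dotv e (j%:R *: y))))).
  by apply: eq_bigr => j _; rewrite RintZ//; mt.
rewrite -Rint_sum//; last by move=> j; mt.
apply: eq_Rintegral => e _; rewrite /cosum mulr_sumr; apply: eq_bigr => j _.
by rewrite dotvZr mulrCA; congr (_ * (_ * cos _)); ring.
Qed.

(** [cosum_bound] under the integral over the frequencies. The order m + 1 costs |e|^(m+1), which
    the Gaussian weight with its |e|^-m absorbs. *)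
Lemma Phi_bound : exists2 C : R, 0 <= C &
  forall y, `|Phi y| <= C /\ `|Phi y| <= C * enorm y ^+ k.+2.
Proof.
have [C C0 hC] := @cosum_bound R k.+1 l (half_lt l_even l_odd).
have b0 := @bconst_gt0 R k.
have cc0 : 0 <= cc by rewrite /cc mulr_ge0 ?invr_ge0 ?exprn_ge0// sqrtr_ge0.
pose I1 := \int[leb k.+2]_e wt e.
pose wt2 e := wt e * (2 * enorm e) ^+ k.+2.
have mwt2 : mfun wt2 by rewrite /wt2; mt.
have fwt2 : finint (leb k.+2) wt2.
  apply: (finint_le mwt2 _ (finintZ (2 ^+ k.+2) _ (@finint_gauss_s R k.+2 2^-1 _))); rewrite ?invr_gt0//; [by mt|by mt|].
  move=> e; rewrite !ger0_norm; last 2 first.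
  - by rewrite mulr_ge0 ?exprn_ge0 ?expR_ge0.
  - by apply: mulr_ge0 => //; rewrite exprn_ge0// mulr_ge0// enorm_ge0.
  rewrite /wt2 /wt exprMn mulrCA ler_wpM2l ?exprn_ge0//.
  apply: le_trans (norm_gauss_le (enorm e)); rewrite ger0_norm ?enorm_ge0//.
  have [->|e0] := eqVneq (enorm e) 0; first by rewrite (exprS _ k.+1) !mul0r mulr0.
  have : enorm e ^+ k.+1 != 0 by rewrite expf_neq0.
  by rewrite (exprS _ k.+1); move: (enorm e ^+ k.+1) => b b1; apply: eq_ler; field.
pose I2 := \int[leb k.+2]_e wt2 e.
have I10 : 0 <= I1 by apply: Rintegral_ge0 => e _.
have I20 : 0 <= I2 by apply: Rintegral_ge0 => e _; apply: mulr_ge0 => //; rewrite exprn_ge0// mulr_ge0// enorm_ge0.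
pose D := (bconst k)^-1 * cc * C * (I1 + I2).
have D0 : 0 <= D by rewrite !mulr_ge0 ?invr_ge0 ?addr_ge0// ltW.
have E y : `|Phi y| = (bconst k)^-1 * cc * `|\int[leb k.+2]_e (wt e * cosum l (2 * dotv e y))|.
  rewrite -{1}(ger0_norm cc0) -mulrA -normrM -PhiE normrM (gtr0_norm b0) mulKf// gt_eqF//.
have bc0 : 0 <= (bconst k)^-1 * cc by rewrite mulr_ge0// invr_ge0 ltW.
have mI y : mfun (fun e => wt e * cosum l (2 * dotv e y)).
  by apply: mf_mulr => //; apply: mf_cosum; mt.
exists D => // y; split; rewrite E /D.
  rewrite -[leRHS]mulrA ler_wpM2l//.
  apply: (@le_trans _ _ (C * I1)); last by rewrite ler_wpM2l// lerDl.
  rewrite -RintZ//; apply: norm_Rint_le2 => //; [by mt|exact: finintZ|].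
  by move=> e; rewrite normrM ger0_norm// mulrC ler_wpM2r//; have [] := hC (2 * dotv e y).
rewrite -!(mulrA ((bconst k)^-1 * cc)) ler_wpM2l//.
apply: (@le_trans _ _ (C * enorm y ^+ k.+2 * I2)); last first.
  by rewrite [leRHS]mulrAC ler_wpM2l ?lerDr// mulr_ge0// exprn_ge0// enorm_ge0.
rewrite -RintZ//; apply: norm_Rint_le2 => //; [by mt|exact: finintZ|].
move=> e; rewrite normrM ger0_norm// /wt2 mulrCA ler_wpM2l//.
have [_ h] := hC (2 * dotv e y); apply: le_trans h _.
rewrite -mulrA ler_wpM2l// -exprMn lerXn2r ?nnegrE ?mulr_ge0 ?enorm_ge0//.
by rewrite normrM ger0_norm// [leRHS]mulrC -mulrA ler_wpM2l// normr_dotv_le.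
Qed.

Lemma finint_pw_Phi : finint (leb k.+2) (fun y => pw y * Phi y).
Proof.
have [C C0 hC] := Phi_bound.
apply: (@finint_pw R k.+1 isT Phi C) => //; first by apply: mf_Phi; mt.
  by move=> y _; have [] := hC y.
move=> y y1; have [h _] := hC y; apply: le_trans h _.
by rewrite ler_peMr// exprn_ege1.
Qed.


(** [kap] is a multiple of |x|^-n, which a single Gaussian does not make integrable at 0. This
    difference vanishes there to second order and is positive elsewhere, so its integral against
    |x|^-n is finite and positive. *)
Let W x : R := expR (- enorm x ^+ 2) - expR (- (4 * enorm x ^+ 2)).

Let mW : mfun W. Proof. by rewrite /W; mt. Qed.

Let W_ge0 x : 0 <= W x.
Proof. by rewrite subr_ge0 ler_expR lerN2 ler_peMl ?sqr_ge0//; lra. Qed.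

Let W_le x : W x <= 3 * (expR (- enorm x ^+ 2) * enorm x ^+ 2).
Proof.
have -> : W x = expR (- enorm x ^+ 2) * (1 - expR (- (3 * enorm x ^+ 2))).
  by rewrite /W mulrBr mulr1 -expRD; congr (_ - expR _); ring.
rewrite [leRHS]mulrCA ler_wpM2l ?expR_ge0//.
by have := expR_ge1Dx (- (3 * enorm x ^+ 2)); lra.
Qed.

Let W_le1 x : W x <= expR (- enorm x ^+ 2).
Proof. by rewrite /W gerBl expR_ge0. Qed.

Let Wn x : W x / enorm x ^+ k.+2 <= 3 * (expR (- enorm x ^+ 2) / enorm x ^+ k).
Proof.
have [->|x0] := eqVneq (enorm x) 0.
  by rewrite (exprS _ k.+1) mul0r invr0 mulr0 !mulr_ge0 ?expR_ge0 ?invr_ge0 ?exprn_ge0.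
rewrite ler_pdivrMr ?exprn_gt0 ?lt0r ?x0 ?enorm_ge0//.
apply: le_trans (W_le x) _; rewrite -!mulrA ler_wpM2l// ler_wpM2l ?expR_ge0//.
by rewrite (exprD _ 2 k) mulrCA mulVf ?mulr1// expf_neq0.
Qed.

Let finint_Wn : finint (leb k.+2) (fun x => W x / enorm x ^+ k.+2).
Proof.
have m1 : mfun (fun x : V => expR (- enorm x ^+ 2) / enorm x ^+ k) by mt.
have f1 : finint (leb k.+2) (fun x : V => expR (- enorm x ^+ 2) / enorm x ^+ k).
  by apply: finint_gauss_pow; rewrite ltnS.
apply: (finint_le _ _ (finintZ 3 m1 f1)); [by mt|by mt|].
move=> x; rewrite !ger0_norm ?Wn ?mulr_ge0 ?expR_ge0 ?W_ge0 ?invr_ge0 ?exprn_ge0 ?enorm_ge0//.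
Qed.

Lemma Rint_pw_Phi2 : \int[leb k.+2]_y (pw y * Phi (2 *: y)) = 2 ^+ k.+1 * \int[leb k.+2]_y (pw y * Phi y).
Proof. by apply: Rint_pw_scale => //; [apply: mf_Phi; mt|exact: finint_pw_Phi]. Qed.

Let inner y : \int[leb k.+2]_x (W x * (pw y * Ss l x y)) = pw y * (Phi y - 2 ^- k.+1 * Phi (2 *: y)).
Proof.
have fg z : finint (leb k.+2) (fun x => expR (- enorm x ^+ 2) * (enorm (x - z))^-1).
  by have := finint_gpot z ltr01; rewrite /finint; under eq_integral do rewrite mul1r.
have fg4 z := finint_gpot z (ltr0Sn R 3).
have fW z : finint (leb k.+2) (fun x => W x * (enorm (x - z))^-1).
  apply: (finint_le _ _ (fg z)); [by mt|by mt|].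
  move=> x; rewrite !normrM ler_wpM2r//.
  by rewrite !ger0_norm ?expR_ge0.
have gW z : \int[leb k.+2]_x (W x * (enorm (x - z))^-1) = gpot z - 2 ^- k.+1 * gpot (2 *: z).
  rewrite -gpot4 /gpot -RintB//; [|by mt|by mt].
  by apply: eq_Rintegral => x _; rewrite /W mulrBl.
have gS z : \int[leb k.+2]_x (W x * Sy l x z) = Phi z - 2 ^- k.+1 * Phi (2 *: z) /\
    finint (leb k.+2) (fun x => W x * Sy l x z).
  have E x : W x * Sy l x z = \sum_(j < l.+1) cf l j * (W x * (enorm (x - j%:R *: z))^-1).
    by rewrite /Sy mulr_sumr; apply: eq_bigr => j _; rewrite mulrCA.
  have fj (j : 'I_l.+1) : finint (leb k.+2) (fun x => cf l j * (W x * (enorm (x - j%:R *: z))^-1)).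
    by apply: finintZ => //; mt.
  have mj (j : 'I_l.+1) : mfun (fun x => cf l j * (W x * (enorm (x - j%:R *: z))^-1)) by mt.
  have -> : (fun x => W x * Sy l x z) = (fun x => \sum_(j < l.+1) cf l j * (W x * (enorm (x - j%:R *: z))^-1)).
    by apply/funext => x; exact: E.
  split; last by apply: finint_sum.
  rewrite Rint_sum// /Phi mulr_sumr -sumrB; apply: eq_bigr => j _.
  rewrite RintZ//; last by mt.
  have -> : j%:R *: (2 *: z) = 2 *: (j%:R *: z) by rewrite !scalerA mulrC.
  by rewrite gW; move: (gpot _) (gpot _) => a b; ring.
have gSN z : \int[leb k.+2]_x (W x * Sy l x (- z)) = Phi z - 2 ^- k.+1 * Phi (2 *: z).
  by have [-> _] := gS (- z); rewrite scalerN !PhiN.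
have [e1 f1] := gS y; have [_ f2] := gS (- y).
have m1 z : mfun (fun x => W x * Sy l x z) by have h := mf_Sy l (@measurable_id _ V setT) (@measurable_cst _ _ V V setT z); mt.
transitivity (\int[leb k.+2]_x (pw y / 2 * (W x * Sy l x y + W x * Sy l x (- y)))).
  by apply: eq_Rintegral => x _; rewrite /Ss; ring.
have h1 := m1 y; have h2 := m1 (- y).
rewrite (RintZ _ (mf_addr h1 h2) (finintD h1 h2 f1 f2)) (RintD h1 f1 h2 f2) e1 gSN.
by move: (Phi y) (Phi _) (pw y) => a b c; field; rewrite expf_neq0.
Qed.

(** Integrate [W x * (pw y * Ss l x y)] in both orders, with m = k.+1. In x first, the wider
    Gaussian gives [pw y * Phi y] and the narrower one [2 ^- m * (pw y * Phi (2 *: y))]; these have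
    equal integrals by the scaling of [pw], so the result is 0. In y first, it is the unit value of
    [kap] times the positive integral of [W x / |x|^n]. *)
Lemma kap_eq0 x : x != 0 -> kap l x = 0.
Proof.
move=> x0; rewrite (@kapE R k.+1 l isT even_lt_l x x0).
suff -> : kap l (axis k.+1 1 : V) = 0 by rewrite mul0r.
have [C C0 hC] := @Ss_int_bound R k.+1 l isT even_lt_l.
have mF : mfun (fun u : V * V => W u.1 * (pw u.2 * Ss l u.1 u.2)).
  have h : mfun (fun u : V * V => Ss l u.1 u.2) by apply: mf_Ss; mt.
  by rewrite /pw; mt.
have mS z : mfun (fun y => Ss l z y) := @mf_Ssr R k.+1 l z.
have fF : (\int[leb k.+2]_x \int[leb k.+2]_y (`|W x * (pw y * Ss l x y)|)%:E < +oo)%E.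
  apply: (@le_lt_trans _ _ (\int[leb k.+2]_x (C * (W x / enorm x ^+ k.+2))%:E)%E).
    apply: ge0_int_le.
    - by apply: (@mf_intV R _ _ _ (fun x y => (`|W x * (pw y * Ss l x y)|)%:E)); [mt|].
    - by move=> z; apply: integral_ge0.
    - by mt.
    move=> z; have h := mS z.
    rewrite (eq_integral (fun y => (W z)%:E * (pw y * `|Ss l z y|)%:E)%E); last first.
      by move=> y _; rewrite -EFinM !normrM (ger0_norm (W_ge0 z)) (ger0_norm (pw_ge0 y)).
    rewrite ge0_intZl; [|by rewrite /pw; mt|by move=> y; rewrite lee_fin mulr_ge0 ?pw_ge0|by rewrite lee_fin].
    have [->|z0] := eqVneq z 0.
      have -> : W 0 = 0 by rewrite /W enorm0 expr0n/= mulr0 subrr.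
      by rewrite mul0e mul0r mulr0.
    rewrite mulrCA EFinM; apply: lee_wpmul2l; [by rewrite lee_fin|exact: hC].
  have := finintZ C _ finint_Wn; rewrite /finint => h.
  apply: le_lt_trans (h _); last by mt.
  apply: ge0_int_le; [by mt| |by mt|].
    by move=> z; rewrite lee_fin !mulr_ge0 ?invr_ge0 ?exprn_ge0 ?enorm_ge0.
  by move=> z; rewrite lee_fin ler_norm.
have fub := @fubini_R R _ _ _ _ (leb k.+2) (leb k.+2) (fun x y => W x * (pw y * Ss l x y)) mF fF.
have e1 : \int[leb k.+2]_y \int[leb k.+2]_x (W x * (pw y * Ss l x y)) = 0.
  have mP : mfun (@Phi) by apply: mf_Phi; mt.
  have f2 : finint (leb k.+2) (fun y => pw y * Phi (2 *: y)).
    have t0 : (2 : R) != 0 by [].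
    have m1 : mfun (fun y => pw y * Phi y) by rewrite /pw; mt.
    have := finintZ (2 ^+ (k.+2 + k.+1)) _ (finint_scalev t0 m1 finint_pw_Phi); rewrite /finint => h.
    apply: le_lt_trans (h _); last by (apply: (mf_comp m1); mt).
    rewrite le_eqVlt; apply/orP; left; apply/eqP; apply: eq_integral => y _; congr (`|_|%:E).
    have h2 : (2 : R) ^+ (k.+2 + k.+1) != 0 by rewrite expf_neq0.
    by rewrite (pw_scale 2 y) (ger0_norm (ler0n R 2)) -(mulrA (2 ^- (k.+2 + k.+1))) (mulVKf h2).
  transitivity (\int[leb k.+2]_y (pw y * Phi y - 2 ^- k.+1 * (pw y * Phi (2 *: y)))).
    by apply: eq_Rintegral => y _; rewrite inner; move: (Phi y) (Phi _) (pw y) => a b c; ring.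
  have mpw : mfun (fun y : V => pw y) by rewrite /pw; mt.
  have mP2 : mfun (fun y => Phi (2 *: y)) by apply: mf_Phi; mt.
  have m1' := mf_mulr mpw mP.
  have m2 := mf_mulr mpw mP2.
  apply: etrans (Rint_subZ (2 ^- k.+1) m1' finint_pw_Phi m2 f2) _.
  apply: etrans (congr1 (fun a => \int[leb k.+2]_y (pw y * Phi y) - 2 ^- k.+1 * a) Rint_pw_Phi2) _.
  by rewrite mulKf ?subrr// expf_neq0.
have mWn : mfun (fun x => W x / enorm x ^+ k.+2) by mt.
have e2 : \int[leb k.+2]_x \int[leb k.+2]_y (W x * (pw y * Ss l x y)) =
    kap l (axis k.+1 1 : V) * \int[leb k.+2]_x (W x / enorm x ^+ k.+2).
  apply: etrans _ (RintZ (kap l (axis k.+1 1 : V)) mWn finint_Wn).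
  apply: eq_Rintegral => z _.
  have [->|z0] := eqVneq z 0.
    have -> : W 0 = 0 by rewrite /W enorm0 expr0n/= mulr0 subrr.
    move: (kap _ _) => a; transitivity (0 : R); last by rewrite mul0r mulr0.
    transitivity (\int[leb k.+2]_(y in [set: V]) (0 : R)).
      by apply: eq_Rintegral => y _; exact: mul0r.
    by rewrite /Rintegral integral0.
  have h := mS z; have mpS : mfun (fun y => pw y * Ss l z y) by rewrite /pw; mt.
  apply: etrans (RintZ (W z) mpS (@finint_Ss R k.+1 l isT even_lt_l z z0)) _.
  rewrite -/(kap l z) (@kapE R k.+1 l isT even_lt_l z z0).
  by move: (kap l _) => a; ring.
have /eqP := etrans (esym e2) (etrans fub e1).
rewrite mulf_eq0 => /orP[/eqP//|/eqP e].
clear fub e1 e2 fF mF hC; exfalso; have : (0 < \int[leb k.+2]_x (W x / enorm x ^+ k.+2)%:E)%E.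
  apply: (@int_gt0 R k.+2 _ (axis k.+1 2) 1 mWn _ ltr01 _) => [y|y /near_axis[_]].
    by rewrite mulr_ge0 ?W_ge0// invr_ge0 exprn_ge0 ?enorm_ge0.
  rewrite ger0_norm// => /andP[y1 _].
  have y0 : 0 < enorm y by lra.
  rewrite divr_gt0 ?exprn_gt0// subr_gt0 ltr_expR ltrN2 ltr_pMl ?exprn_gt0//; lra.
by rewrite -(RintE mWn finint_Wn) e ltxx.
Qed.

End gaussian_test.

Lemma Rint_dct {R : realType} d (T : measurableType d) (nu : {measure set T -> \bar R})
  (f_ : nat -> T -> R) (f g : T -> R) : (forall n, mfun (f_ n)) -> mfun f -> mfun g ->
  finint nu g -> (forall n x, `|f_ n x| <= g x) -> (forall x, f_ n x @[n --> \oo] --> f x) ->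
  (\int[nu]_x f_ n x) @[n --> \oo] --> \int[nu]_x f x.
Proof.
move=> mf_ mf mg fg fle fcv.
have h := @dominated_cvg _ _ _ nu setT measurableT (fun n x => (f_ n x)%:E) (fun x => (f x)%:E) (fun x => (g x)%:E).
have ig : nu.-integrable setT (fun x => (g x)%:E) by exact: finint_integrable.
have {}h := h (fun n => mf_EFin (mf_ n)).
have ff : finint nu f.
  apply: (finint_le mf mg fg) => x; apply: (@le_trans _ _ (g x)); last exact: ler_norm.
  have cn : `|f_ n x| @[n --> \oo] --> `|f x| by apply: cvg_norm; exact: fcv.
  rewrite -(cvg_lim _ cn)//; apply: limr_le; first by apply/cvg_ex; exists `|f x|.
  by near=> n; exact: fle.
have fn n : finint nu (f_ n).
  by apply: (finint_le (mf_ n) mg fg) => x; apply: le_trans (fle n x) (ler_norm _).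
apply: fine_cvg.
rewrite (_ : (fine _)%:E = (\int[nu]_x (f x)%:E)%E); last by rewrite -RintE.
apply: h => [x _|x _||k x _]; [|by []|exact: ig|by rewrite lee_fin].
by apply: cvg_EFin; [near=> n|exact: fcv].
Unshelve. all: by end_near.
Qed.

(** * Decay of the kernel *)

Section kernel_K0.
Context {R : realType}.
Variables (m l : nat).
Hypothesis m0 : (0 < m)%N.
Hypothesis hl : forall k, (k <= m)%N -> ~~ odd k -> (k < l)%N.
Local Notation V := 'rV[R]_m.+1.
Implicit Types (x y : V) (a : R).

Let far y : R := (1 < enorm y)%R%:R * pw y.
Let far0 y : 0 <= far y. Proof. by rewrite mulr_ge0 ?pw_ge0. Qed.
Let mfar : mfun far. Proof. by rewrite /far /pw; mt. Qed.
Let farN y : far (- y) = far y. Proof. by rewrite /far pwN enormN. Qed.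

Definition K0 x : R := \int[leb m.+1]_y ((1 < enorm y)%R%:R * pw y * Sy l x y).

Lemma mf_K0 : mfun K0.
Proof.
apply: (@mf_Rint R _ _ _ _ (leb m.+1) (fun x y => far y * Sy l x y)).
have h : mfun (fun u : V * V => Sy l u.1 u.2) by apply: mf_Sy; mt.
by mt.
Qed.

Lemma finint_far x : x != 0 -> finint (leb m.+1) (fun y => (1 < enorm y)%R%:R * pw y * Sy l x y).
Proof.
move=> x0; have [A A0 hA] := @Kabs_bound R m l m0.
apply: le_lt_trans (le_trans _ (hA x x0)) (ltry _).
have mS := mf_Syr l x; have mA := mf_Sabsr l x.
apply: ge0_int_le; [by rewrite -/(far _); mt|by []|by rewrite -/(far _); mt|].
move=> y; rewrite lee_fin -/(far y) normrM (ger0_norm (far0 y)) ler_wpM2l//.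
exact: norm_Sy.
Qed.

Lemma K0_bound : exists2 A : R, 0 <= A & forall x, x != 0 -> `|K0 x| <= A / enorm x.
Proof.
have [A A0 hA] := @Kabs_bound R m l m0; exists A => // x x0.
have mS := mf_Syr l x; have mA := mf_Sabsr l x.
rewrite -lee_fin; apply: le_trans (hA x x0).
apply: (le_trans (@norm_Rint_leE R _ V (leb m.+1) _ (mf_mulr mfar mS))).
apply: ge0_int_le; [by mt|by []|by rewrite -/(far _); mt|].
move=> y; rewrite lee_fin -/(far y) normrM (ger0_norm (far0 y)) ler_wpM2l//.
exact: norm_Sy.
Qed.

Let K0_sym x : x != 0 -> K0 x = \int[leb m.+1]_y (far y * Ss l x y).
Proof.
move=> x0; have f1 := finint_far x0.
have mS := mf_Syr l x; have m1 := mf_mulr mfar mS.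
have m2 : mfun (fun y => far y * Sy l x (- y)).
  by have h := mf_comp mS (mf_oppv (@measurable_id _ V setT)); apply: mf_mulr.
have f2 : finint (leb m.+1) (fun y => far y * Sy l x (- y)).
  have := finint_oppv m1 f1; rewrite /finint => h; apply: le_lt_trans h.
  by apply: ge0_int_le; [by mt|by []|by mt|] => y; rewrite farN.
have e2 : \int[leb m.+1]_y (far y * Sy l x (- y)) = K0 x.
  by rewrite /K0 -(Rint_oppv m1); apply: eq_Rintegral => y _; rewrite farN.
transitivity (\int[leb m.+1]_y (2^-1 * (far y * Sy l x y + far y * Sy l x (- y)))); last first.
  by apply: eq_Rintegral => y _; rewrite /Ss; move: (Sy _ _ _) (Sy _ _ _) (far y) => a b c; ring.
apply: esym; apply: etrans (RintZ 2^-1 (mf_addr m1 m2) (finintD m1 m2 f1 f2)) _.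
apply: etrans (congr1 (fun a => 2^-1 * a) (RintD m1 f1 m2 f2)) _.
by rewrite e2 -/(K0 x); move: (K0 x) => a; field.
Qed.

(** The region |y| > 1 is symmetric, so [Ss] may replace [Sy], and as [kap] is 0, K0 is minus the
    integral over |y| <= 1. For |x| >= 1 / d, division by |x| brings these y into the range of
    [Ss_taylor]; for smaller x the bound A / |x| already implies the other one, at the cost of a
    power of d. *)
Lemma K0_decay : (forall x, x != 0 -> kap l x = 0) ->
  exists2 A : R, 0 <= A & forall x, x != 0 ->
    `|K0 x| <= A / enorm x /\ `|K0 x| <= A / enorm x ^+ m.+2.
Proof.
move=> kap0; have [A A0 hA] := K0_bound.
have [B [d [B0 d0 d1 hB]]] := @Ss_taylor R m l hl.
pose P y : R := (enorm y < 1)%R%:R / enorm y ^+ m.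
pose Q y : R := (1 <= enorm y)%R%:R / enorm y ^+ m.+2.
have P0 y : 0 <= P y by rewrite /P; pos.
have Q0 y : 0 <= Q y by rewrite /Q; pos.
have mP : mfun P by rewrite /P; mt.
have mQ : mfun Q by rewrite /Q; mt.
have fP : finint (leb m.+1) P.
  rewrite /finint; have := @rad_in R m.+1 m (ltnSn m).
  by under [X in (_ -> X < _)%E]eq_integral => z _ do rewrite (ger0_norm (P0 z)).
have fQ : finint (leb m.+1) Q.
  rewrite /finint; have := @rad_out_nat R m.+1 m.+2 (ltnSn _).
  by under [X in (_ -> X < _)%E]eq_integral => z _ do rewrite (ger0_norm (Q0 z)).
pose D := \int[leb m.+1]_y (P y + Q y).
have D0 : 0 <= D by apply: Rintegral_ge0 => y _; rewrite addr_ge0.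
pose A1 := A / d ^+ m.+1 + B * D.
have Ad : A <= A / d ^+ m.+1 by rewrite ler_peMr// invf_ge1 ?exprn_gt0// exprn_ile1// ltW.
exists (A + A1) => [|x x0].
  by rewrite /A1 !addr_ge0 ?mulr_ge0 ?invr_ge0 ?exprn_ge0// ltW.
have e0 : 0 < enorm x by rewrite enorm_gt0.
split.
  apply: le_trans (hA x x0) _; rewrite ler_wpM2r ?invr_ge0 ?(ltW e0)// lerDl.
  by rewrite /A1 addr_ge0 ?mulr_ge0 ?invr_ge0 ?exprn_ge0// ltW.
apply: (@le_trans _ _ (A1 / enorm x ^+ m.+2)); last first.
  by rewrite ler_wpM2r ?invr_ge0 ?exprn_ge0 ?(ltW e0)// lerDr.
have [xd|xd] := ltP (enorm x) d^-1.
  apply: le_trans (hA x x0) _; rewrite exprS invfM mulrA mulrAC ler_wpM2r ?invr_ge0 ?(ltW e0)//.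
  apply: (@le_trans _ _ (A / d ^+ m.+1 / enorm x ^+ m.+1)); last first.
    by rewrite ler_wpM2r ?invr_ge0 ?exprn_ge0 ?(ltW e0)// lerDl mulr_ge0.
  rewrite -mulrA ler_peMr// -invfM -exprMn invf_ge1 ?exprn_gt0 ?mulr_gt0//.
  apply: exprn_ile1; first by rewrite mulr_ge0// ltW.
  by rewrite mulrC -ler_pdivlMr// div1r ltW.
have mS := mf_Ssr l x; have mpw : mfun (fun y : V => pw y) by rewrite /pw; mt.
pose near y : R := (enorm y <= 1)%R%:R * pw y.
have mnear : mfun near by rewrite /near; mt.
have fS := finint_Ss m0 hl x0.
have le1 (b : bool) (r : R) : 0 <= r -> `|b%:R * r| <= `|r|.
  by move=> r0; case: b; rewrite ?mul1r// mul0r normr0.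
have fn : finint (leb m.+1) (fun y => near y * Ss l x y).
  apply: (finint_le (mf_mulr mnear mS) (mf_mulr mpw mS) fS) => y.
  by rewrite !normrM ler_wpM2r// -normrM le1// pw_ge0.
have ff : finint (leb m.+1) (fun y => far y * Ss l x y).
  apply: (finint_le (mf_mulr mfar mS) (mf_mulr mpw mS) fS) => y.
  by rewrite !normrM ler_wpM2r// -normrM le1// pw_ge0.
have eK : K0 x = - \int[leb m.+1]_y (near y * Ss l x y).
  have : \int[leb m.+1]_y (near y * Ss l x y + far y * Ss l x y) = 0.
    rewrite -(kap0 x x0) /kap; apply: eq_Rintegral => y _.
    rewrite -mulrDl /near /far -mulrDl; congr (_ * _).
    by rewrite leNgt; case: (1 < enorm y); rewrite /= ?add0r ?addr0 mul1r.
  have := RintD (mf_mulr mnear mS) fn (mf_mulr mfar mS) ff; rewrite (K0_sym x0).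
  by move: (\int[_]_y _) (\int[_]_y _) (\int[_]_y _) => a b c -> h; lra.
rewrite eK normrN.
apply: (@le_trans _ _ (\int[leb m.+1]_y (B / enorm x ^+ m.+2 * (P y + Q y)))).
  apply: norm_Rint_le2; [exact: mf_mulr|by mt|by apply: finintZ; [mt|exact: finintD]|].
  move=> y; rewrite normrM /near.
  have [y1|y1] := leP (enorm y) 1; last by rewrite mul0r normr0 mul0r !mulr_ge0 ?invr_ge0 ?exprn_ge0 ?(ltW e0)// addr_ge0.
  rewrite mul1r (ger0_norm (pw_ge0 y)) (Ss_dir l y x0) normrM (gtr0_norm (_ : 0 < _^-1)) ?invr_gt0//.
  have hy : enorm ((enorm x)^-1 *: y) = enorm y / enorm x.
    by rewrite enormZ gtr0_norm ?invr_gt0// mulrC.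
  have := hB _ _ ((enorm x)^-1 *: y) (unit_dir x0); rewrite hy => hB'.
  have yd : enorm y / enorm x <= d.
    rewrite ler_pdivrMr//; apply: le_trans y1 _.
    by rewrite mulrC -ler_pdivrMr// div1r.
  apply: (@le_trans _ _ (pw y * ((enorm x)^-1 * (B * (enorm y / enorm x) ^+ m.+1)))).
    by rewrite ler_wpM2l ?pw_ge0// ler_wpM2l ?invr_ge0 ?(ltW e0)// hB'.
  have -> : pw y * ((enorm x)^-1 * (B * (enorm y / enorm x) ^+ m.+1)) = B / enorm x ^+ m.+2 * (pw y * enorm y ^+ m.+1).
    by rewrite exprMn exprVn (exprS _ m.+1) invfM; move: (enorm y ^+ _) (enorm x ^+ _)^-1 (enorm x)^-1 (pw y) => a b c w; ring.
  rewrite ler_wpM2l ?mulr_ge0 ?invr_ge0 ?exprn_ge0 ?(ltW e0)//.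
  have [y0|y0] := eqVneq (enorm y) 0.
    by rewrite y0 exprS mul0r mulr0 addr_ge0.
  have -> : pw y * enorm y ^+ m.+1 = (enorm y ^+ m)^-1.
    by rewrite /pw pw_exp exprD invfM mulrAC mulVf ?mul1r// expf_neq0.
  (* The sphere |y| = 1 belongs to the near region but not to the support of P; Q covers it. *)
  rewrite /P /Q; case: (ltP (enorm y) 1) => y2 /=; first by rewrite mul1r mul0r addr0.
  have -> : enorm y = 1 by apply/eqP; rewrite eq_le y1.
  by rewrite !expr1n mul0r add0r mul1r.
have mPQ : mfun (fun y => P y + Q y) by mt.
rewrite (RintZ _ mPQ (finintD mP mQ fP fQ)) -/D /A1 mulrDl [B / _ * D]mulrAC lerDr.
by rewrite !mulr_ge0 ?invr_ge0 ?exprn_ge0// ?(ltW e0)// ltW.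
Qed.

End kernel_K0.

Lemma measurable_set0v {R : realType} n : measurable [set 0 : 'rV[R]_n].
Proof.
rewrite (_ : [set 0] = [set y : 'rV[R]_n | enorm y <= 0]); first by mt.
by apply/seteqP; split => y /=; rewrite ?le_eqVlt ltNge enorm_ge0 orbF enorm_eq0 => /eqP.
Qed.

(** * The total mass of the kernel *)

Section kernel_integral.
Context {R : realType}.
Variables (k l : nat).
Hypothesis l_even : ~~ odd k.+2 -> l = k.+1.
Hypothesis l_odd : odd k.+2 -> (k.+1 < l)%N.
Local Notation V := 'rV[R]_k.+2.
Implicit Types (x y e : V).

Let hl := even_lt_l l_even l_odd.
Let m0 : (0 < k.+1)%N := isT.

Lemma cosum0 : cosum l 0 = 0 :> R.
Proof.
rewrite -[RHS](@sum_cf_expr0 R l 0 (l_gt0 l_even l_odd)); apply: eq_bigr => j _.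
by rewrite mulr0 cos0 expr0.
Qed.

Lemma cosum_dot0 y : cosum l (2 * dotv (0 : V) y) = 0.
Proof. by rewrite /dotv big1 ?mulr0 ?cosum0// => i _; rewrite mxE mul0r. Qed.

Lemma dot_axis (s : R) y : dotv (axis k.+1 s) y = s * y 0 ord0.
Proof.
rewrite /axis dotvZl /dotv (bigD1 ord0)//= big1 ?addr0 => [|i i0]; first by rewrite mxE !eqxx mul1r.
by rewrite mxE eqxx (negPf i0) mul0r.
Qed.

(** Rotate e to the first axis and dilate by 2 |e|. The resulting power |e|^m is exactly what
    cancels the |e|^-m of the Gaussian weight in [bconst_Phi]. *)
Lemma cosum_transform e : \int[leb k.+2]_y (pw y * cosum l (2 * dotv e y)) =
   (2 * enorm e) ^+ k.+1 * Dc k.+1 l.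
Proof.
have [->|e0] := eqVneq e 0.
  rewrite enorm0 mulr0 exprS !mul0r.
  transitivity (\int[leb k.+2]_(y in [set: V]) (0 : R)); last by rewrite /Rintegral integral0.
  by apply: eq_Rintegral => y _; rewrite cosum_dot0 mulr0.
have ee : 0 < enorm e by rewrite enorm_gt0.
have [A oA eA] : exists2 A, orth A & (axis k.+1 (enorm e)) *m A = e.
  by apply: orth_exists; rewrite enorm_axis ger0_norm// enorm_ge0.
have mc : mfun (fun y => pw y * cosum l (2 * dotv e y)).
  by apply: mf_mulr; [rewrite /pw; mt|apply: mf_cosum; mt].
have mc0 : mfun (fun y : V => cosum l (y 0 ord0)) by apply: mf_cosum; mt.
have e2 : 0 < 2 * enorm e by rewrite mulr_gt0.
have fc := @finint_cosum R k.+1 l m0 l_even l_odd.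
apply: etrans (esym (Rint_orth oA mc)) _.
apply: etrans (@Rint_pw_scale R k.+1 (fun y => cosum l (y 0 ord0)) (2 * enorm e) mc0 e2 fc).
apply: eq_Rintegral => y _.
have -> : pw (y *m A) = pw y by apply: pw_orth.
by rewrite -{1}eA dotv_orth// dot_axis mulrA [X in _ = _ * cosum l X]mxE.
Qed.

(** The version with absolute values, which justifies the exchange of integrals in [bconst_Phi]. *)
Lemma abs_cosum_transform : exists2 D : R, 0 <= D & forall e,
  (\int[leb k.+2]_y (pw y * `|cosum l (2 * dotv e y)|)%:E <= ((2 * enorm e) ^+ k.+1 * D)%:E)%E.
Proof.
have mc0 : mfun (fun y : V => `|cosum l (y 0 ord0)|) by apply: mf_normr; apply: mf_cosum; mt.
have fc := @finint_cosum R k.+1 l m0 l_even l_odd.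
have mpc : mfun (fun y : V => pw y * cosum l (y 0 ord0)).
  by apply: mf_mulr; [rewrite /pw; mt|apply: mf_cosum; mt].
have mpc' : mfun (fun y : V => pw y * `|cosum l (y 0 ord0)|).
  by apply: mf_mulr; [rewrite /pw; mt|exact: mc0].
have fc' : finint (leb k.+2) (fun y : V => pw y * `|cosum l (y 0 ord0)|).
  by apply: (finint_le mpc' mpc fc) => y; rewrite !normrM normr_id.
exists (\int[leb k.+2]_y (pw y * `|cosum l (y 0 ord0)|)) => [|e].
  by apply: Rintegral_ge0 => y _; rewrite mulr_ge0 ?pw_ge0.
have [->|e0] := eqVneq e 0.
  rewrite enorm0 mulr0 exprS !mul0r (eq_integral (cst 0%E)) ?integral0// => y _.
  by rewrite cosum_dot0 normr0 mulr0.
have ee : 0 < enorm e by rewrite enorm_gt0.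
have [A oA eA] : exists2 A, orth A & (axis k.+1 (enorm e)) *m A = e.
  by apply: orth_exists; rewrite enorm_axis ger0_norm// enorm_ge0.
have e2 : 0 < 2 * enorm e by rewrite mulr_gt0.
have mc : mfun (fun y => (pw y * `|cosum l (2 * dotv e y)|)%:E).
  by apply: mf_EFin; apply: mf_mulr; [rewrite /pw; mt|apply: mf_normr; apply: mf_cosum; mt].
have c0 y : (0 <= (pw y * `|cosum l (2 * dotv e y)|)%:E)%E by rewrite lee_fin mulr_ge0 ?pw_ge0.
rewrite -(ge0_integral_orth oA mc c0).
rewrite (eq_integral (fun y => (pw y * `|cosum l (2 * enorm e * y 0 ord0)|)%:E)); last first.
  move=> y _; have -> : pw (y *m A) = pw y by apply: pw_orth.
  by rewrite -{1}eA dotv_orth// dot_axis mulrA.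
set s := 2 * enorm e.
have mcs : mfun (fun y : V => (pw y * `|cosum l (s * y 0 ord0)|)%:E).
  by apply: mf_EFin; apply: mf_mulr; [rewrite /pw; mt|apply: mf_normr; apply: mf_cosum; mt].
have s0 : s^-1 != 0 by rewrite invr_eq0 gt_eqF.
rewrite (ge0_integral_scalev s0 mcs); last by move=> y; rewrite lee_fin mulr_ge0 ?pw_ge0.
have mcs' : mfun (fun y : V => (pw (s^-1 *: y) * `|cosum l (s * (s^-1 *: y) 0 ord0)|)%:E).
  by apply: (mf_comp mcs); mt.
have cs0' y : (0 <= (pw (s^-1 *: y) * `|cosum l (s * (s^-1 *: y) 0 ord0)|)%:E)%E.
  by rewrite lee_fin mulr_ge0 ?pw_ge0.
have cy0 y : (0 <= (pw y * `|cosum l (y 0 ord0)|)%:E)%E by rewrite lee_fin mulr_ge0 ?pw_ge0.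
have sn0 : (0 <= (`|s^-1| ^+ k.+2)%:E)%E by rewrite lee_fin exprn_ge0.
have sm0 : (0 <= (s ^+ k.+1)%:E)%E by rewrite lee_fin exprn_ge0// ltW.
rewrite [in leRHS]EFinM (RintE mpc' fc') -(ge0_intZl (leb k.+2) (mf_EFin mpc') cy0 sm0).
rewrite -(ge0_intZl (leb k.+2) mcs' cs0' sn0).
rewrite le_eqVlt; apply/orP; left; apply/eqP; apply: eq_integral => y _; rewrite -!EFinM; congr EFin.
have -> : `|s^-1| = s^-1 by rewrite gtr0_norm// invr_gt0.
rewrite (pw_scale s^-1 y) mxE mulVKf ?gt_eqF// gtr0_norm ?invr_gt0// exprD !exprVn.
have h1 : s ^+ k.+2 != 0 by rewrite expf_neq0// gt_eqF.
have h2 : s ^+ k.+1 != 0 by rewrite expf_neq0// gt_eqF.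
move: h1 h2; move: (s ^+ k.+2) (s ^+ k.+1) (pw y) (`|cosum _ _|) => a b c d a0 b0.
by field; rewrite a0 b0.
Qed.

Let cc : R := Num.sqrt pi ^+ k / 2 ^+ k.+1.

(** Insert [PhiE] and integrate in y first: [cosum_transform] leaves a pure Gaussian in e, of
    integral [Num.sqrt pi ^+ k.+2]. With the [Num.sqrt pi ^+ k] of [cc] this makes [pi ^+ k.+1], and
    the powers of 2 cancel. *)
Lemma bconst_Phi : bconst k * \int[leb k.+2]_y (pw y * Phi l y) = pi ^+ k.+1 * Dc k.+1 l :> R.
Proof.
pose wt e : R := expR (- enorm e ^+ 2) / enorm e ^+ k.+1.
have wt0 e : 0 <= wt e by rewrite /wt mulr_ge0 ?expR_ge0 ?invr_ge0 ?exprn_ge0 ?enorm_ge0.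
have mwt : mfun wt by rewrite /wt; mt.
have wt_pow e : wt e * (2 * enorm e) ^+ k.+1 <= 2 ^+ k.+1 * expR (- enorm e ^+ 2).
  rewrite /wt exprMn mulrCA ler_wpM2l ?exprn_ge0//.
  have [->|e0] := eqVneq (enorm e) 0; first by rewrite (exprS _ k) !mul0r mulr0 expR_ge0.
  by rewrite divfK// expf_neq0.
pose F e y := wt e * (pw y * cosum l (2 * dotv e y)).
have mpc : mfun (fun u : V * V => pw u.2 * cosum l (2 * dotv u.1 u.2)).
  by apply: mf_mulr; [rewrite /pw; mt|apply: mf_cosum; mt].
have mF : mfun (fun u : V * V => F u.1 u.2) by apply: mf_mulr; [mt|exact: mpc].
have mpe e : mfun (fun y => pw y * cosum l (2 * dotv e y)).
  by apply: mf_mulr; [rewrite /pw; mt|apply: mf_cosum; mt].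
have [D D0 hD] := abs_cosum_transform.
have fg := finint_gauss_space k.+2 : finint (@leb R k.+2) _.
have mg : mfun (fun e : V => expR (- enorm e ^+ 2)) by mt.
have fF : (\int[leb k.+2]_e \int[leb k.+2]_y (`|F e y|)%:E < +oo)%E.
  have := finintZ (2 ^+ k.+1 * D) mg fg; rewrite /finint => h; apply: le_lt_trans h.
  apply: ge0_int_le.
  - by apply: (@mf_intV R _ _ _ (fun x y => (`|F x y|)%:E)); [mt|].
  - by move=> e; apply: integral_ge0.
  - by mt.
  move=> e; rewrite (eq_integral (fun y => (wt e)%:E * (pw y * `|cosum l (2 * dotv e y)|)%:E)%E); last first.
    by move=> y _; rewrite -EFinM /F (normrM (wt e)) (normrM (pw y)) (ger0_norm (wt0 e)) (ger0_norm (pw_ge0 y)).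
  rewrite ge0_intZl; last 3 first.
  - by apply: mf_EFin; apply: mf_mulr; [rewrite /pw; mt|apply: mf_normr; apply: mf_cosum; mt].
  - by move=> y; rewrite lee_fin mulr_ge0 ?pw_ge0.
  - by rewrite lee_fin.
  apply: le_trans (lee_wpmul2l _ (hD e)) _; first by rewrite lee_fin.
  rewrite -EFinM lee_fin ger0_norm ?mulr_ge0 ?exprn_ge0 ?expR_ge0// mulrA [leRHS]mulrAC ler_wpM2r//.
have mP : mfun (@Phi R k l) by apply: mf_Phi; mt.
have mpP := mf_mulr (@mf_pw R k.+1) mP.
apply: etrans (esym (RintZ (bconst k) mpP (finint_pw_Phi l_even l_odd))) _.
have mI : mfun (fun y => \int[leb k.+2]_e F e y).
  apply: (@mf_Rint R _ _ _ _ (leb k.+2) (fun y e => F e y)).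
  by have h := mf_comp2 mF (@measurable_snd _ _ V V) (@measurable_fst _ _ V V); exact: h.
transitivity (cc * \int[leb k.+2]_y \int[leb k.+2]_e F e y).
  have mF' : mfun (fun u : V * V => F u.2 u.1).
    exact: (mf_comp2 mF (@measurable_snd _ _ V V) (@measurable_fst _ _ V V)).
  have fF' : (\int[leb k.+2]_y \int[leb k.+2]_e (`|F e y|)%:E < +oo)%E.
    rewrite (@tonelliV R k.+2 k.+2 (fun y e => (`|F e y|)%:E)) => [//||//].
    by apply: mf_EFin; apply: mf_normr; exact: mF'.
  apply: etrans _ (RintZ cc mI (@finint_Rint R _ _ _ _ (leb k.+2) (leb k.+2) (fun y e => F e y) mF' fF')).
  apply: eq_Rintegral => y _; rewrite mulrCA (@PhiE R k l y) -/cc mulrCA; congr (_ * _).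
  have fy : finint (leb k.+2) (fun e => wt e * cosum l (2 * dotv e y)).
    have [C C0 hC] := @cosum_bound R k.+1 l (half_lt l_even l_odd).
    have fwt : finint (leb k.+2) wt by exact: finint_gauss_pow.
    apply: (finint_le _ _ (finintZ C mwt fwt)); [by apply: mf_mulr; [|apply: mf_cosum; mt]|by mt|].
    move=> e; rewrite !normrM mulrC ler_wpM2r// (ger0_norm C0).
    by have [] := hC (2 * dotv e y).
  have mwc : mfun (fun e => wt e * cosum l (2 * dotv e y)) by apply: mf_mulr => //; apply: mf_cosum; mt.
  apply: etrans (esym (RintZ (pw y) mwc fy)) _; apply: eq_Rintegral => e _; exact: mulrCA.
apply: etrans (congr1 (fun a => cc * a) (esym (@fubini_R R _ _ _ _ (leb k.+2) (leb k.+2) F mF fF))) _.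
have mexp : mfun (fun e : V => 2 ^+ k.+1 * Dc k.+1 l * expR (- enorm e ^+ 2)) by mt.
transitivity (cc * \int[leb k.+2]_e (2 ^+ k.+1 * Dc k.+1 l * expR (- enorm e ^+ 2))).
  congr (_ * _).
  apply: ae_Rint_eq => //; first exact: (@mf_Rint R _ _ _ _ (leb k.+2) F mF).
  exists [set 0]; split; [exact: measurable_set0v|exact: leb0_null|].
  move=> e /= h; apply: contrapT => e0; apply: h.
  have fe : finint (leb k.+2) (fun y => pw y * cosum l (2 * dotv e y)).
    apply: le_lt_trans (le_trans _ (hD e)) (ltry _).
    apply: ge0_int_le => //; [by apply: mf_EFin; apply: mf_normr|apply: mf_EFin; apply: mf_mulr|].
    - by rewrite /pw; mt.
    - by apply: mf_normr; apply: mf_cosum; mt.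
    - by move=> y; rewrite lee_fin normrM (ger0_norm (pw_ge0 y)).
  apply: etrans (RintZ (wt e) (mpe e) fe) _.
  rewrite cosum_transform /wt exprMn.
  have e1 : enorm e ^+ k.+1 != 0 by rewrite expf_neq0// enorm_eq0; apply/eqP.
  move: e1; move: (enorm e ^+ k.+1) (2 ^+ k.+1) (Dc _ _) (expR _) => a b c d a0.
  by field.
rewrite (RintZ _ mg fg).
have -> : \int[leb k.+2]_e expR (- enorm (e : V) ^+ 2) = Num.sqrt pi ^+ k.+2.
  have := @gauss_cos_space R k.+2 0 0.
  rewrite enorm0 expr0n/= oppr0 mul0r expR0 mulr1 cos0 mulr1 => <-.
  by apply: eq_Rintegral => e _; rewrite /dotv big1 ?addr0 ?cos0 ?mulr1// => i _; rewrite mxE mul0r.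
have -> : pi ^+ k.+1 = Num.sqrt (pi : R) ^+ k * Num.sqrt pi ^+ k.+2.
  by rewrite -exprD -{1}(sqr_sqrtr (pi_ge0 R)) -exprM; congr (_ ^+ _); rewrite mul2n -addnn !addnS addSn.
have t0 : (2 : R) ^+ k.+1 != 0 by rewrite expf_neq0.
by rewrite /cc; move: t0; move: (2 ^+ k.+1) (Dc _ _) (Num.sqrt pi ^+ k) (Num.sqrt pi ^+ k.+2) => a b c d a0; field.
Qed.


Lemma finint_K0 : finint (leb k.+2) (K0 l : V -> R).
Proof.
have [A A0 hA] := @K0_decay R k.+1 l m0 hl (@kap_eq0 R k l l_even l_odd).
pose P y : R := (enorm y < 1)%R%:R / enorm y ^+ 1.
pose Q y : R := (1 <= enorm y)%R%:R / enorm y ^+ k.+3.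
have P0 y : 0 <= P y by rewrite /P; pos.
have Q0 y : 0 <= Q y by rewrite /Q; pos.
have mP : mfun P by rewrite /P; mt.
have mQ : mfun Q by rewrite /Q; mt.
have fP : finint (leb k.+2) P.
  rewrite /finint; have := @rad_in R k.+2 1 isT.
  by under [X in (_ -> X < _)%E]eq_integral => z _ do rewrite (ger0_norm (P0 z)).
have fQ : finint (leb k.+2) Q.
  rewrite /finint; have := @rad_out_nat R k.+2 k.+3 (ltnSn _).
  by under [X in (_ -> X < _)%E]eq_integral => z _ do rewrite (ger0_norm (Q0 z)).
have mPQ := mf_addr mP mQ; have fPQ := finintZ A mPQ (finintD mP mQ fP fQ).
have mK : mfun (K0 l : V -> R) by exact: mf_K0.
apply: le_lt_trans fPQ; apply: ae_ge0_le_integral => //; [by mt|by mt|].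
exists [set 0]; split; [exact: measurable_set0v|exact: leb0_null|].
move=> x /= h; apply: contrapT => x0; apply: h => _; rewrite lee_fin.
have {}x0 : x != 0 by apply/eqP.
have [h1 h2] := hA x x0; apply: le_trans (ler_norm _).
rewrite /P /Q; case: (ltP (enorm x) 1) => x1 /=.
  by rewrite mul0r addr0 mul1r expr1.
by rewrite mul0r add0r mul1r.
Qed.

(* Testing the kernel against the Gaussian of width 1/s. *)
Lemma gauss_K0 (s : R) : 0 < s ->
  \int[leb k.+2]_x (expR (- enorm (s *: x) ^+ 2) * K0 l x) =
  \int[leb k.+2]_y ((s < enorm y)%R%:R * (pw y * Phi l y)) :> R.
Proof.
move=> s0.
pose G x : R := expR (- enorm (s *: x) ^+ 2).
have mG : mfun G by rewrite /G; mt.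
have G0 x : 0 <= G x by exact: expR_ge0.
pose far (y : V) : R := (1 < enorm y)%R%:R * pw y.
have mfar : mfun far by rewrite /far /pw; mt.
have far0 y : 0 <= far y by rewrite mulr_ge0 ?pw_ge0.
pose F x y := G x * (far y * Sy l x y).
have mS2 : mfun (fun u : V * V => Sy l u.1 u.2) by apply: mf_Sy; mt.
have mF : mfun (fun u : V * V => F u.1 u.2) by rewrite /F; mt.
have [A A0 hA] := @Kabs_bound R k.+1 l m0.
have sE (x : V) : G x = expR (- (s ^+ 2 * enorm x ^+ 2)).
  by rewrite /G enormZ exprMn real_normK ?num_real.
have s20 : 0 < s ^+ 2 by rewrite exprn_gt0.
have fGi z : finint (leb k.+2) (fun x => G x * (enorm (x - z))^-1).
  by have := finint_gpot z s20; rewrite /finint; under eq_integral do rewrite -sE.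
have fF : (\int[leb k.+2]_x \int[leb k.+2]_y (`|F x y|)%:E < +oo)%E.
  have mGi : mfun (fun x => G x * (enorm x)^-1) by mt.
  have fG0 : finint (leb k.+2) (fun x => G x * (enorm x)^-1).
    by have := fGi 0; rewrite /finint; under eq_integral do rewrite subr0.
  have := finintZ A mGi fG0; rewrite /finint => h; apply: le_lt_trans h.
  apply: ae_ge0_le_integral => //.
  - by move=> x _; apply: integral_ge0.
  - by apply: (@mf_intV R _ _ _ (fun x y => (`|F x y|)%:E)); [mt|].
  - by mt.
  exists [set 0]; split; [exact: measurable_set0v|exact: leb0_null|].
  move=> x h; apply: contrapT => x0; apply: h => _.
  have {}x0 : x != 0 by apply/eqP.
  have mS := mf_Syr l x; have mSa := mf_Sabsr l x.
  apply: (@le_trans _ _ (\int[leb k.+2]_y ((G x)%:E * ((1 < enorm y)%R%:R * pw y * Sabs l x y)%:E))%E).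
    apply: ge0_int_le; [by rewrite /F; mt|by []|by rewrite -/(far _); mt|].
    move=> y; rewrite -EFinM lee_fin /F (normrM (G x)) (ger0_norm (G0 x)) ler_wpM2l//.
    by rewrite -/(far y) normrM (ger0_norm (far0 y)) ler_wpM2l// norm_Sy.
  have mfS := mf_EFin (mf_mulr mfar mSa).
  have fS0 y : (0 <= (far y * Sabs l x y)%:E)%E by rewrite lee_fin mulr_ge0 ?Sabs_ge0.
  have GE0 : (0 <= (G x)%:E)%E by rewrite lee_fin.
  rewrite (ge0_intZl (leb k.+2) mfS fS0 GE0).
  apply: le_trans (lee_wpmul2l _ (hA x x0)) _; first by rewrite lee_fin.
  rewrite -EFinM lee_fin ger0_norm ?mulr_ge0 ?invr_ge0 ?enorm_ge0//.
  by apply: eq_ler; move: (G x) (enorm x)^-1 => a b; ring.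
have gi z : \int[leb k.+2]_x (G x * (enorm (x - z))^-1) = s ^- k.+1 * gpot (s *: z).
  have mg : mfun (fun x => expR (- enorm x ^+ 2) * (enorm (x - s *: z))^-1) by mt.
  have := Rint_scalev (lt0r_neq0 s0) mg; rewrite -/(gpot (s *: z)) => ->.
  have mGz : mfun (fun x => G x * (enorm (x - z))^-1) by mt.
  have := RintZ s^-1 mGz (fGi z).
  have -> : (fun x => s^-1 * (G x * (enorm (x - z))^-1)) = (fun x => expR (- enorm (s *: x) ^+ 2) * (enorm (s *: x - s *: z))^-1).
    by apply/funext => x; rewrite -scalerBr !enormZ (gtr0_norm s0) invfM /G enormZ (gtr0_norm s0); ring.
  move=> ->; rewrite (gtr0_norm s0) (exprS s k.+1).
  have : s ^+ k.+1 != 0 by exact: expf_neq0 (lt0r_neq0 s0).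
  by move: (lt0r_neq0 s0); move: (s ^+ k.+1) (\int[_]_x _) => a b c d; field; rewrite d c.
have gS y : \int[leb k.+2]_x (G x * Sy l x y) = s ^- k.+1 * Phi l (s *: y).
  have fj (j : 'I_l.+1) : finint (leb k.+2) (fun x => cf l j * (G x * (enorm (x - j%:R *: y))^-1)).
    by apply: finintZ => //; mt.
  have mj (j : 'I_l.+1) : mfun (fun x => cf l j * (G x * (enorm (x - j%:R *: y))^-1)) by mt.
  transitivity (\int[leb k.+2]_x (\sum_(j < l.+1) cf l j * (G x * (enorm (x - j%:R *: y))^-1))).
    by apply: eq_Rintegral => x _; rewrite /Sy mulr_sumr; apply: eq_bigr => j _; rewrite mulrCA.
  rewrite Rint_sum// /Phi mulr_sumr; apply: eq_bigr => j _.
  have mjj : mfun (fun x => G x * (enorm (x - j%:R *: y))^-1) by mt.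
  apply: etrans (RintZ (cf l j) mjj (fGi _)) _; rewrite gi mulrCA; congr (_ * (_ * gpot _)).
  by rewrite !scalerA mulrC.
have mP : mfun (@Phi R k l) by apply: mf_Phi; mt.
have mR : mfun (fun y : V => (s < enorm y)%R%:R * (pw y * Phi l y)).
  by apply: mf_mulr; [mt|exact: (mf_mulr (@mf_pw R k.+1) mP)].
have e1 := Rint_scalev (lt0r_neq0 s0) mR; apply: etrans _ (esym e1).
transitivity (\int[leb k.+2]_x \int[leb k.+2]_y F x y).
  apply: ae_Rint_eq.
  - by apply: mf_mulr => //; exact: mf_K0.
  - exact: (@mf_Rint R _ _ _ _ (leb k.+2) F mF).
  exists [set 0]; split; [exact: measurable_set0v|exact: leb0_null|].
  move=> x h; apply: contrapT => x0; apply: h.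
  have {}x0 : x != 0 by apply/eqP.
  exact: esym (RintZ (G x) (mf_mulr mfar (mf_Syr l x)) (@finint_far R k.+1 l m0 x x0)).
apply: etrans (@fubini_R R _ _ _ _ (leb k.+2) (leb k.+2) F mF fF) _.
have fin2 : finint (leb k.+2) (fun y : V => (s < enorm (s *: y))%R%:R * (pw (s *: y) * Phi l (s *: y))).
  have h : finint (leb k.+2) (fun y : V => (s < enorm y)%R%:R * (pw y * Phi l y)).
    apply: (finint_le mR (mf_mulr (@mf_pw R k.+1) mP) (finint_pw_Phi l_even l_odd)) => y.
    by case: ltP => _; rewrite ?mul1r// mul0r normr0.
  exact: finint_scalev (lt0r_neq0 s0) mR h.
have mR2 : mfun (fun y : V => (s < enorm (s *: y))%R%:R * (pw (s *: y) * Phi l (s *: y))).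
  by apply: (mf_comp mR); mt.
apply: etrans _ (RintZ _ mR2 fin2); apply: eq_Rintegral => y _.
have mGS : mfun (fun x => G x * Sy l x y).
  by have h := mf_Sy l (@measurable_id _ V setT) (@measurable_cst _ _ V V setT y); mt.
have fGS : finint (leb k.+2) (fun x => G x * Sy l x y).
  have h : finint (leb k.+2) (fun x => \sum_(j < l.+1) cf l j * (G x * (enorm (x - j%:R *: y))^-1)).
    by apply: finint_sum => j; [mt|apply: finintZ => //; mt].
  have -> : (fun x => G x * Sy l x y) = (fun x => \sum_(j < l.+1) cf l j * (G x * (enorm (x - j%:R *: y))^-1)) => //.
  by apply/funext => x; rewrite /Sy mulr_sumr; apply: eq_bigr => j _; rewrite mulrCA.
transitivity (\int[leb k.+2]_x (far y * (G x * Sy l x y))).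
  by apply: eq_Rintegral => x _; exact: mulrCA.
apply: etrans (RintZ (far y) mGS fGS) _; rewrite gS.
have -> : (s < enorm (s *: y)) = (1 < enorm y) by rewrite enormZ (gtr0_norm s0) ltr_pMr.
rewrite (pw_scale s y) (gtr0_norm s0) exprD /far.
have : s ^+ k.+1 != 0 by exact: expf_neq0 (lt0r_neq0 s0).
have : s ^+ k.+2 != 0 by exact: expf_neq0 (lt0r_neq0 s0).
move: (s ^+ k.+1) (s ^+ k.+2) (Phi l _) (pw y) (_%:R) => a b c d e a0 b0.
by field; rewrite a0 b0.
Qed.

(** The Gaussian of [gauss_K0] is flattened along s = 1 / (N + 1), by dominated convergence on both
    sides. *)
Lemma Rint_K0 : \int[leb k.+2]_x K0 l x = \int[leb k.+2]_y (pw y * Phi l y) :> R.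
Proof.
pose sq (N : nat) : R := N.+1%:R^-1.
have sq0 N : 0 < sq N by rewrite invr_gt0.
have csq : sq @ \oo --> (0 : R) by exact: cvg_harmonic.
have mK : mfun (K0 l : V -> R) by exact: mf_K0.
have mP : mfun (@Phi R k l) by apply: mf_Phi; mt.
have mpP := mf_mulr (@mf_pw R k.+1) mP.
have c1 : \int[leb k.+2]_x (expR (- enorm (sq N *: x) ^+ 2) * K0 l x) @[N --> \oo] --> \int[leb k.+2]_x K0 l x.
  apply: (@Rint_dct R _ V (leb k.+2) _ _ (fun x => `|K0 l x|)) => //; [by move=> N; mt|by mt| | |].
  - by apply: (finint_le _ mK finint_K0) => [|x]; [exact: mf_normr|rewrite normr_id].
  - move=> N x; rewrite normrM ler_piMl// ger0_norm ?expR_ge0// -expR0 ler_expR oppr_le0 sqr_ge0//.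
  move=> x; rewrite -[X in _ --> X]mul1r; apply: cvgM; last exact: cvg_cst.
  have -> : (fun N => expR (- enorm (sq N *: x) ^+ 2)) = (fun N => expR (- (sq N * sq N * enorm x ^+ 2))).
    by apply/funext => N; rewrite enormZ exprMn real_normK ?num_real// expr2.
  rewrite -[X in _ --> X]expR0; apply: continuous_cvg; first exact: continuous_expR.
  rewrite -oppr0; apply: cvgN; rewrite -(mul0r (enorm x ^+ 2)) -(mul0r 0).
  by apply: cvgM; [exact: cvgM|exact: cvg_cst].
have c2 : \int[leb k.+2]_y ((sq N < enorm y)%R%:R * (pw y * Phi l y)) @[N --> \oo] --> \int[leb k.+2]_y (pw y * Phi l y).
  apply: (@Rint_dct R _ V (leb k.+2) _ _ (fun y => `|pw y * Phi l y|)) => //.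
  - by move=> N; apply: mf_mulr; [mt|exact: mpP].
  - exact: mf_normr.
  - apply: (finint_le _ mpP (finint_pw_Phi l_even l_odd)) => [|y]; first exact: mf_normr.
    by rewrite normr_id.
  - by move=> N y; case: ltP => _; rewrite ?mul1r// mul0r normr0.
  move=> y; have [->|y0] := eqVneq y 0.
    rewrite /pw enorm0 (_ : 2 * k.+2 - 1 = k.+2 + k.+1)%N; last by rewrite mul2n -addnn subn1 addnS.
    rewrite addSn exprS !mul0r invr0 !mul0r; under eq_fun do rewrite mulr0; exact: cvg_cst.
  apply: cvg_near_cst; near=> N.
  have -> : sq N < enorm y; last by rewrite mul1r.
  near: N; apply: (cvgr_lt _ csq); by rewrite enorm_gt0.
rewrite -(cvg_lim _ c1)// -(cvg_lim _ c2)//; congr (lim (_ @ \oo)).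
by apply/funext => N; exact: gauss_K0.
Unshelve. all: by end_near.
Qed.

Lemma bconst_K0 : bconst k * \int[leb k.+2]_x K0 l x = pi ^+ k.+1 * Dc k.+1 l :> R.
Proof. by rewrite Rint_K0 bconst_Phi. Qed.

End kernel_integral.

(** * Density of Lipschitz functions in L^p *)

Section powers.
Context {R : realType}.
Implicit Types (a b t p : R).

Lemma powR_leD p a b : 0 <= p -> 0 <= a -> 0 <= b ->
  (a + b) `^ p <= 2 `^ p * (a `^ p + b `^ p).
Proof.
move=> p0 a0 b0; wlog ab : a b a0 b0 / a <= b.
  move=> h; have [ab|/ltW ba] := leP a b; first exact: h.
  by rewrite addrC [X in _ * X]addrC; exact: h.
apply: (@le_trans _ _ ((2 * b) `^ p)).
  by rewrite ge0_ler_powR ?nnegrE ?addr_ge0 ?mulr_ge0//; lra.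
by rewrite powRM// ler_wpM2l ?powR_ge0// lerDr powR_ge0.
Qed.

Lemma powR_split p t : 1 <= p -> 0 <= t -> t `^ p = t `^ (p - 1) * t.
Proof.
move=> p1; rewrite le_eqVlt => /orP[/eqP <-|t0].
  by rewrite mulr0 powR0// gt_eqF// (lt_le_trans ltr01).
rewrite -{3}(powRr1 (ltW t0)) -powRD ?subrK//.
by apply/implyP => _; rewrite gt_eqF.
Qed.

Lemma powR_lin p t B : 1 <= p -> 0 <= t <= B -> t `^ p <= B `^ (p - 1) * t.
Proof.
move=> p1 /andP[t0 tB]; rewrite powR_split// ler_wpM2r// ge0_ler_powR ?nnegrE ?subr_ge0//.
exact: le_trans tB.
Qed.

(** Trivial for t <= d; otherwise (t / d)^(p - 1) >= 1. Unlike a splitting by conjugate exponents it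
    includes p = 1. *)
Lemma young_split p t (d : R) : 1 <= p -> 0 <= t -> 0 < d -> t <= d + t `^ p / d `^ (p - 1).
Proof.
move=> p1 t0 d0; have dp : 0 < d `^ (p - 1) by rewrite powR_gt0.
have [td|dt] := leP t d; first by rewrite ler_wpDr// divr_ge0 ?powR_ge0// ltW.
rewrite ler_wpDl ?(ltW d0)// ler_pdivlMr// [leRHS]powR_split// mulrC ler_wpM2r//.
by rewrite ge0_ler_powR ?nnegrE ?subr_ge0 ?(ltW d0)// ltW.
Qed.

End powers.

Section density.
Context {R : realType} {n : nat}.
Local Notation V := 'rV[R]_n.
Implicit Types (A : set V) (x y : V).

Definition ball_err (N : R) (F g : V -> R) : \bar R :=
  (\int[leb n]_x ((enorm x < N)%R%:R * `|F x - g x|)%:E)%E.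

Definition lip01 (g : V -> R) := [/\ mfun g, forall x, 0 <= g x <= 1 &
  exists L : R, forall x y, `|g x - g y| <= L * enorm (x - y)].

(** Local L^1 distance is the right notion here: for bounded functions of bounded support it
    controls the L^p distance through [powR_lin]. *)
Definition approxF (F : V -> R) := forall N d : R, 0 < d ->
  exists2 g, lip01 g & (ball_err N F g <= d%:E)%E.

Lemma mf_indic1 A : measurable A -> mfun (\1_A : V -> R).
Proof. by move=> mA; exact: measurable_indic. Qed.

Lemma ball_err_tri N (F G g : V -> R) : mfun F -> mfun G -> mfun g ->
  (ball_err N F g <= ball_err N F G + ball_err N G g)%E.
Proof.
move=> mF mG mg; rewrite /ball_err -ge0_intD; [|by mt|by move=> x; rewrite lee_fin mulr_ge0|by mt|by move=> x; rewrite lee_fin mulr_ge0].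
apply: ge0_int_le; [by mt|by move=> x; rewrite lee_fin mulr_ge0|by mt|].
move=> x; rewrite -EFinD lee_fin -mulrDr ler_wpM2l//.
by rewrite -[F x - g x](subrKA (G x)) ler_normD.
Qed.

Lemma ball_err_unif N (F g : V -> R) (d : R) : mfun F -> mfun g -> 0 <= d ->
  (forall x, `|F x - g x| <= d) -> (ball_err N F g <= d%:E * leb n (eball n N))%E.
Proof.
move=> mF mg d0 h; rewrite -int_eballE -ge0_intZl//; try sd.
apply: ge0_int_le; [by mt|by move=> x; rewrite lee_fin mulr_ge0|by mt|].
by move=> x; rewrite -EFinM lee_fin mulrC ler_wpM2r.
Qed.

Lemma approxF_half (F : V -> R) : mfun F ->
  (forall N d : R, 0 < d -> exists G, [/\ mfun G, approxF G & (ball_err N F G <= d%:E)%E]) -> approxF F.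
Proof.
move=> mF h N d d0; have d2 : 0 < d / 2 by rewrite divr_gt0.
have [G [mG aG FG]] := h N _ d2; have [g [mg g01 gL] Gg] := aG N _ d2; exists g => //.
apply: le_trans (ball_err_tri N mF mG mg) _.
by rewrite [X in (_ <= X%:E)%E](splitr d) EFinD leeD.
Qed.

Lemma approx_cst0 : approxF (cst 0).
Proof.
move=> N d d0; exists (cst 0).
  split => [|x|]; [exact: measurable_cst|by rewrite lexx ler01|].
  by exists 0 => x y; rewrite subrr normr0 mul0r.
rewrite /ball_err (eq_integral (cst 0%E)) ?integral0 ?lee_fin ?ltW// => x _.
by rewrite subrr normr0 mulr0.
Qed.

Lemma approx_compl (F : V -> R) : approxF F -> approxF (fun x => 1 - F x).
Proof.
move=> aF N d d0; have [g [mg g01 [L gL]] e] := aF N d d0.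
exists (fun x => 1 - g x).
  split => [|x|]; [by mt|by have := g01 x; lra|].
  by exists L => x y; rewrite (_ : _ - _ = - (g x - g y)) ?normrN ?gL//; ring.
apply: le_trans e; rewrite le_eqVlt; apply/orP; left; apply/eqP; apply: eq_integral => x _.
by rewrite (_ : 1 - F x - (1 - g x) = - (F x - g x)) ?normrN//; ring.
Qed.

(** On indicators the formula is the union. As a polynomial it keeps values in [0, 1] and the
    Lipschitz property, which a sum would not. *)
Lemma approx_or (F G : V -> R) : mfun F -> mfun G -> (forall x, 0 <= F x <= 1) -> (forall x, 0 <= G x <= 1) ->
  approxF F -> approxF G -> approxF (fun x => F x + G x - F x * G x).
Proof.
have key (a b c d : R) : 0 <= b <= 1 -> 0 <= c <= 1 ->
    `|(a + b - a * b) - (c + d - c * d)| <= `|a - c| + `|b - d|.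
  move=> b01 c01; have -> : (a + b - a * b) - (c + d - c * d) = (a - c) * (1 - b) + (b - d) * (1 - c) by ring.
  apply: le_trans (ler_normD _ _) _; rewrite !normrM.
  by apply: lerD; rewrite ler_piMr// ler_norml; lra.
move=> mF mG F01 G01 aF aG N d d0; have d2 : 0 < d / 2 by rewrite divr_gt0.
have [f [mf f01 [L fL]] ef] := aF N _ d2; have [g [mg g01 [L' gL]] eg] := aG N _ d2.
exists (fun x => f x + g x - f x * g x).
  split => [|x|]; first by mt.
    by have := f01 x; have := g01 x; nra.
  exists (L + L') => x y; apply: le_trans (key _ _ _ _ (g01 x) (f01 y)) _.
  by rewrite mulrDl lerD.
apply: (@le_trans _ _ (ball_err N F f + ball_err N G g)%E); last first.
  by rewrite [X in (_ <= X%:E)%E](splitr d) EFinD leeD.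
rewrite /ball_err -ge0_intD; [|by mt|by move=> x; rewrite lee_fin mulr_ge0|by mt|by move=> x; rewrite lee_fin mulr_ge0].
apply: ge0_int_le; [by mt|by move=> x; rewrite lee_fin mulr_ge0|by mt|].
move=> x; rewrite -EFinD lee_fin -mulrDr ler_wpM2l//; exact: key.
Qed.

Lemma fin_eball (N : R) : finint (leb n) (fun x : V => (enorm x < N)%R%:R).
Proof.
have := leb_eball_lty n N; rewrite -int_eballE /finint.
by under [X in (_ -> X < _)%E]eq_integral do rewrite normr_nat.
Qed.

Lemma approx_lim (F_ : nat -> V -> R) (F : V -> R) : (forall k, mfun (F_ k)) -> mfun F ->
  (forall k x, 0 <= F_ k x <= 1) -> (forall x, 0 <= F x <= 1) ->
  (forall k, approxF (F_ k)) -> (forall x, F_ k x @[k --> \oo] --> F x) -> approxF F.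
Proof.
move=> mF_ mF F_01 F01 aF cF; apply: approxF_half => // N d d0.
pose e k x := (enorm x < N)%R%:R * `|F x - F_ k x|.
have e0 k x : 0 <= e k x by rewrite /e mulr_ge0.
have me k : mfun (e k) by rewrite /e; have := mF_ k => h; mt.
have eb k x : `|e k x| <= (enorm x < N)%R%:R.
  rewrite ger0_norm// /e ler_piMr// ler_norml; have := F01 x; have := F_01 k x; lra.
have mb : mfun (fun x : V => (enorm x < N)%R%:R : R) by mt.
have ce x : e k x @[k --> \oo] --> (0 : R).
  rewrite -(mulr0 ((enorm x < N)%R%:R)); apply: cvgM; first exact: cvg_cst.
  rewrite -(normr0 R) -(subrr (F x)); apply: cvg_norm; apply: cvgB; [exact: cvg_cst|exact: cF].
have := @Rint_dct R _ V (leb n) e (cst 0) _ me (@measurable_cst _ _ _ _ _ _) mb (fin_eball N) eb ce.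
have -> : \int[leb n]_(x in [set: V]) (cst 0 x : R) = 0 by rewrite /Rintegral integral0.
move=> /cvgr_le => /(_ d d0) [k _ hk]; have {}hk := hk k (leqnn k).
exists (F_ k); split => //; rewrite /ball_err -/(e k _).
have fe : finint (leb n) (e k) by apply: (finint_le (me k) mb (fin_eball N)) => x; rewrite [leRHS]ger0_norm.
by have := RintE (me k) fe; rewrite /e => <-; rewrite lee_fin.
Qed.

(** With q the positive part of [x 0 i - t], the functions 1 - 1 / (1 + k q) are k-Lipschitz and
    tend pointwise to the indicator of the half-space. *)
Lemma approx_ray (i : 'I_n) (t : R) : approxF \1_[set x : V | t < x 0 i].
Proof.
pose q x : R := (`|x 0 i - t| + (x 0 i - t)) / 2.
have q0 x : 0 <= q x by rewrite /q divr_ge0//; have := ler_norm (- (x 0 i - t)); rewrite normrN; lra.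
have mq : mfun q by rewrite /q; mt.
have qL x y : `|q x - q y| <= enorm (x - y).
  have h1 : `| `|x 0 i - t| - `|y 0 i - t| | <= `|x 0 i - y 0 i|.
    by apply: le_trans (ler_dist_dist _ _) _; rewrite opprB addrA subrK.
  have h2 := coord_le_enorm (x - y) i; rewrite !mxE in h2.
  apply: le_trans h2; rewrite /q.
  have -> : (`|x 0 i - t| + (x 0 i - t)) / 2 - (`|y 0 i - t| + (y 0 i - t)) / 2 =
    (`|x 0 i - t| - `|y 0 i - t|) / 2 + (x 0 i - y 0 i) / 2 by field.
  apply: le_trans (ler_normD _ _) _; rewrite !normrM (ger0_norm (_ : 0 <= 2^-1)) ?invr_ge0//; lra.
pose G (k : nat) x : R := 1 - (1 + k%:R * q x)^-1.
have d1 k x : 1 <= 1 + k%:R * q x by rewrite lerDl mulr_ge0.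
have G01 k x : 0 <= G k x <= 1.
  rewrite /G subr_ge0 lerBlDr lerDl invr_ge0 (le_trans ler01)// andbT invf_le1//.
  exact: lt_le_trans (d1 k x).
have mG k : mfun (G k) by rewrite /G; mt.
apply: (@approx_lim G) => //.
- by apply: measurable_indic; mt.
- by move=> x; rewrite indicE; case: (_ \in _); rewrite lexx ler01.
- move=> k N d d0; exists (G k); last first.
    rewrite /ball_err (eq_integral (cst 0%E)) ?integral0 ?lee_fin ?ltW// => x _.
    by rewrite subrr normr0 mulr0.
  split => //; exists k%:R => x y.
  have -> : G k x - G k y = (k%:R * (q x - q y)) / ((1 + k%:R * q x) * (1 + k%:R * q y)).
    by rewrite /G; field; rewrite !gt_eqF// (lt_le_trans ltr01).
  rewrite normrM normrM normr_nat -[leRHS]mulr1; apply: ler_pM => //.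
    by rewrite ler_wpM2l.
  rewrite ger0_norm ?invr_ge0 ?mulr_ge0 ?(le_trans ler01)//.
  by rewrite invf_le1 ?mulr_gt0 ?(lt_le_trans ltr01)// mulr_ege1.
move=> x; rewrite indicE; case: (ltP t (x 0 i)) => tx.
  rewrite mem_set// (_ : 1%:R = 1 - 0 :> R); last by rewrite subr0.
  apply: cvgB; first exact: cvg_cst.
  have qx : 0 < q x by rewrite /q gtr0_norm ?subr_gt0//; lra.
  apply/cvgrPdist_le => e e0; near=> k.
  have p1 : 0 < 1 + k%:R * q x := lt_le_trans ltr01 (d1 k x).
  rewrite sub0r normrN ger0_norm ?invr_ge0 ?(ltW p1)// -[leRHS]invrK lef_pV2 ?posrE ?invr_gt0//.
  rewrite ler_wpDl// -ler_pdivrMr//.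
  by near: k; exact: nbhs_infty_ger.
rewrite memNset/=; last by apply/negP; rewrite -leNgt.
have -> : (fun k => G k x) = cst 0; last exact: cvg_cst.
apply/funext => k; rewrite /G /q ler0_norm ?subr_le0// addNr mul0r mulr0 addr0 invr1 subrr//.
Unshelve. all: by end_near.
Qed.

Lemma ind01 A x : 0 <= (\1_A x : R) <= 1.
Proof. by rewrite indicE; case: (_ \in _); rewrite lexx ler01. Qed.

(** Complements by 1 - g, finite unions by [approx_or], countable ones as pointwise limits. Together
    with the half-spaces of [approx_ray] this reaches every Borel set. *)
Lemma approx_sigma : sigma_algebra setT [set A : set V | measurable A /\ approxF \1_A].
Proof.
split => /=.
- by split=> //; rewrite indic0; exact: approx_cst0.
- move=> A [mA aA]; split; first by rewrite setTD; exact: measurableC.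
  have -> : \1_(setT `\` A) = (fun x => 1 - \1_A x) :> (V -> R).
    apply/funext => x; rewrite !indicE setTD in_setC; case: (x \in A) => /=; [by rewrite subrr|by rewrite subr0].
  exact: approx_compl.
- move=> A_ hA; have mA k : measurable (A_ k) by have [] := hA k.
  split; first exact: bigcup_measurable.
  pose B k := \big[setU/set0]_(i < k) A_ i.
  have mB k : measurable (B k) by apply: bigsetU_measurable.
  have aB k : approxF \1_(B k).
    elim: k => [|k IH]; first by rewrite /B big_ord0 indic0; exact: approx_cst0.
    have [_ aA] := hA k.
    have -> : \1_(B k.+1) = (fun x => \1_(B k) x + \1_(A_ k) x - \1_(B k) x * \1_(A_ k) x) :> (V -> R).
      apply/funext => x; rewrite /B big_ord_recr/= -/(B k) !indicE in_setU.
      by case: (x \in B k) (x \in A_ k) => [] [] /=; lra.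
    exact: (approx_or (mf_indic1 (mB k)) (mf_indic1 (mA k)) (ind01 (B k)) (ind01 (A_ k)) IH aA).
  apply: (@approx_lim (fun k => \1_(B k))) => //.
  - by apply: mf_indic1; exact: bigcup_measurable.
  - by move=> k x; exact: ind01.
  - exact: ind01.
  move=> x; apply: cvg_near_cst.
  have [[j _ Ajx]|nx] := pselect ((\bigcup_k A_ k) x).
    near=> k; rewrite !indicE mem_set; last by rewrite /B -bigcup_mkord; exists j => //=; near: k; exact: nbhs_infty_gt.
    by rewrite mem_set//; exists j.
  apply: nearW => k; rewrite !indicE memNset ?memNset// => h; apply: nx.
  by move: h; rewrite /B -bigcup_mkord => -[j _ Ajx]; exists j.
Unshelve. all: by end_near.
Qed.

Lemma approx_set A : measurable A -> approxF \1_A.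
Proof.
have RV (i : 'I_n) (Y : set R) : measurable Y -> measurable [set x : V | Y (x 0 i)] /\ approxF \1_[set x : V | Y (x 0 i)].
  have sg : sigma_algebra setT [set Y : set R | measurable [set x : V | Y (x 0 i)] /\ approxF \1_[set x : V | Y (x 0 i)]].
    have [s0 sC sU] := approx_sigma; split => /=.
    - exact: s0.
    - by move=> Z hZ; rewrite (_ : [set x : V | _] = setT `\` [set x : V | Z (x 0 i)])//; exact: sC.
    - move=> Z hZ; rewrite (_ : [set x : V | _] = \bigcup_k [set x : V | Z k (x 0 i)])//; exact: sU.
  move=> mY0; have mY : (@RGenOInfty.G R).-sigma.-measurable Y by rewrite -RGenOInfty.measurableE.
  have := @smallest_sub _ (sigma_algebra setT) _ _ sg; apply; last exact: mY.
  move=> _ [t ->] /=; rewrite (_ : [set x : V | _] = [set x : V | t < x 0 i]).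
    by split; [mt|exact: approx_ray].
  by apply/seteqP; split => x /=; rewrite in_itv/= andbT.
move=> mA; suff : [set B : set V | measurable B /\ approxF \1_B] A by case.
have := @smallest_sub _ (sigma_algebra setT) _ _ approx_sigma; apply; last exact: mA.
rewrite -bigcup_seq; apply: bigcup_sub => i _ B [Y mY <-] /=.
rewrite setTI; exact: RV.
Qed.

Lemma step_le (K : nat) (y : R) : 0 <= y -> \sum_(i < K) (i.+1%:R <= y)%R%:R <= y.
Proof.
move=> y0; elim: K => [|K IH]; first by rewrite big_ord0.
rewrite big_ord_recr/=; case: (leP K.+1%:R y) => h; last by rewrite addr0.
apply: le_trans h; rewrite -natr1 lerD2r; apply: (@le_trans _ _ (\sum_(i < K) 1)).
  by apply: ler_sum => i _; case: (i.+1%:R <= y); rewrite ?ler01 ?lexx.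
by rewrite sumr_const card_ord.
Qed.

Lemma step_ge (K : nat) (y : R) : y <= K%:R -> y - 1 <= \sum_(i < K) (i.+1%:R <= y)%R%:R.
Proof.
elim: K => [|K IH] yK; first by rewrite big_ord0; lra.
rewrite big_ord_recr/=; have [yk|ky] := leP y K%:R.
  by apply: le_trans (IH yk) _; rewrite lerDl.
apply: (@le_trans _ _ K%:R); first by move: yK; rewrite -natr1; lra.
have -> : K%:R = \sum_(i < K) 1 :> R by rewrite sumr_const card_ord.
rewrite ler_wpDr//; apply: ler_sum => i _.
have -> // : i.+1%:R <= y; apply: le_trans (ltW ky); rewrite ler_nat; exact: ltn_ord.
Qed.

Lemma approx_avg K (F_ : 'I_K.+1 -> V -> R) : (forall i, mfun (F_ i)) -> (forall i, approxF (F_ i)) ->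
  approxF (fun x => K.+1%:R^-1 * \sum_(i < K.+1) F_ i x).
Proof.
move=> mF aF N d d0.
have /choice[g hg] : forall i : 'I_K.+1, exists g, lip01 g /\ (ball_err N (F_ i) g <= d%:E)%E.
  by move=> i; have [g h1 h2] := aF i N d d0; exists g.
have mg i : mfun (g i) by have [[]] := hg i.
have g01 i x : 0 <= g i x <= 1 by have [[_ h _] _] := hg i; exact: h.
have K0 : 0 < K.+1%:R :> R by [].
have mS (f : 'I_K.+1 -> V -> R) : (forall i, mfun (f i)) -> mfun (fun x => K.+1%:R^-1 * \sum_(i < K.+1) f i x).
  by move=> mf; apply: mf_mulr; [mt|exact: mf_sumr].
exists (fun x => K.+1%:R^-1 * \sum_(i < K.+1) g i x).
  split; first exact: mS.
    move=> x; apply/andP; split; first by rewrite mulr_ge0// sumr_ge0// => i _; have /andP[] := g01 i x.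
    rewrite mulrC ler_pdivrMr// mul1r; apply: (@le_trans _ _ (\sum_(i < K.+1) 1)).
      by apply: ler_sum => i _; have /andP[] := g01 i x.
    by rewrite sumr_const card_ord.
  have /choice[L hL] : forall i : 'I_K.+1, exists L : R, forall x y, `|g i x - g i y| <= L * enorm (x - y).
    by move=> i; have [[]] := hg i.
  exists (K.+1%:R^-1 * \sum_(i < K.+1) L i) => x y.
  rewrite -mulrBr normrM ger0_norm ?invr_ge0// -mulrA ler_wpM2l// -sumrB mulr_suml.
  by apply: le_trans (ler_norm_sum _ _ _) _; apply: ler_sum => i _; exact: hL.
pose e i x := (enorm x < N)%R%:R * `|F_ i x - g i x|.
have me i : mfun (fun x => (e i x)%:E).
  by have h1 := mF i; have h2 := mg i; rewrite /e; mt.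
have e0 i x : (0 <= (e i x)%:E)%E by rewrite lee_fin mulr_ge0.
have msum : mfun (fun x => (\sum_(i < K.+1) (e i x)%:E)%E) by apply: emeasurable_sum.
have K0E : (0 <= (K.+1%:R^-1 : R)%:E)%E by rewrite lee_fin invr_ge0.
apply: (@le_trans _ _ (\int[leb n]_x ((K.+1%:R^-1)%:E * (\sum_(i < K.+1) (e i x)%:E)))%E).
  apply: ge0_int_le.
  - by have h1 := mS _ mF; have h2 := mS _ mg; mt.
  - by move=> x; rewrite lee_fin mulr_ge0.
  - by apply: mf_muleE; [mt|exact: msum].
  move=> x; rewrite sumEFin -EFinM lee_fin -mulrBr -sumrB normrM ger0_norm ?invr_ge0//.
  rewrite mulrCA ler_wpM2l ?invr_ge0// /e -mulr_sumr ler_wpM2l//; exact: ler_norm_sum.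
rewrite ge0_intZl//; last by move=> x; apply: sume_ge0.
rewrite ge0_integral_sum//.
apply: (@le_trans _ _ ((K.+1%:R^-1)%:E * (\sum_(i < K.+1) d%:E))%E).
  by apply: lee_wpmul2l => //; apply: lee_sum => i _; have [] := hg i.
by rewrite sumEFin sumr_const card_ord -EFinM -[d *+ _]mulr_natl mulKf// gt_eqF.
Qed.

(** The average of the indicators of the level sets F >= i / (K + 1), for i = 1, ..., K + 1, differs
    from F by at most 1 / (K + 1) everywhere. *)
Lemma approx_fun (F : V -> R) : mfun F -> (forall x, 0 <= F x <= 1) -> approxF F.
Proof.
move=> mF F01.
have mset K (i : 'I_K.+1) : measurable [set x : V | (i.+1%:R <= K.+1%:R * F x)%R] by mt.
have hK (K : nat) : approxF (fun x => K.+1%:R^-1 * \sum_(i < K.+1) \1_[set x : V | (i.+1%:R <= K.+1%:R * F x)%R] x).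
  by apply: approx_avg => i; [exact: mf_indic1|exact: approx_set].
apply: approxF_half => // N d d0.
have bf : leb n (eball n N) \is a fin_num by rewrite ge0_fin_numE// leb_eball_lty.
pose b : R := fine (leb n (eball n N)).
have b0 : 0 <= b by rewrite fine_ge0.
pose K := Num.truncn (b / d).
have K0 : 0 < K.+1%:R :> R by [].
have bK : b / d <= K.+1%:R by rewrite ltW// truncnS_gt.
exists (fun x => K.+1%:R^-1 * \sum_(i < K.+1) \1_[set x : V | (i.+1%:R <= K.+1%:R * F x)%R] x).
have mS : mfun (fun x => K.+1%:R^-1 * \sum_(i < K.+1) \1_[set x : V | (i.+1%:R <= K.+1%:R * F x)%R] x : R).
  apply: mf_mulr; first by mt.
  by apply: mf_sumr => i; apply: mf_indic1; mt.
split => //.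
apply: le_trans (@ball_err_unif N F _ K.+1%:R^-1 mF mS _ _) _; first by rewrite invr_ge0.
  move=> x; have /andP[F0 F1] := F01 x.
  have -> : \sum_(i < K.+1) (\1_[set x : V | (i.+1%:R <= K.+1%:R * F x)%R] x : R) = \sum_(i < K.+1) (i.+1%:R <= K.+1%:R * F x)%R%:R.
    apply: eq_bigr => i _; rewrite indicE; case: leP => h; first by rewrite mem_set.
    by rewrite memNset//= => h'; move: h; rewrite ltNge h'.
  have y0 : 0 <= K.+1%:R * F x by rewrite mulr_ge0.
  have yK : K.+1%:R * F x <= K.+1%:R by rewrite ler_piMr.
  have := step_le K.+1 y0; have := step_ge yK.
  move: (\sum_(i < K.+1) _) => c h1 h2.
  have -> : F x - K.+1%:R^-1 * c = K.+1%:R^-1 * (K.+1%:R * F x - c) by rewrite mulrBr mulKf// gt_eqF.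
  rewrite normrM ger0_norm ?invr_ge0// ler_piMr ?invr_ge0// ler_norml; lra.
rewrite -(fineK bf) -/b -EFinM lee_fin mulrC ler_pdivrMr// mulrC -ler_pdivrMr//.
Qed.

End density.

Section Lp_density.
Context {R : realType} {n : nat}.
Local Notation V := 'rV[R]_n.
Implicit Types (x y h : V) (f g : V -> R) (p : R).

(** The p-th power of the L^p norm; without the root, [pint_leD] can serve as triangle inequality up
    to the factor 2^p. *)
Definition pint p f : \bar R := (\int[leb n]_x (`|f x| `^ p)%:E)%E.

Lemma pint_ge0 p f : (0 <= pint p f)%E.
Proof. by apply: integral_ge0 => x _; rewrite lee_fin powR_ge0. Qed.

Lemma pint_leD p f g : 0 <= p -> mfun f -> mfun g ->
  (pint p (fun x => f x + g x)%R <= (2 `^ p)%:E * (pint p f + pint p g))%E.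
Proof.
move=> p0 mf mg; rewrite /pint -ge0_intD; [|by mt|by move=> x; rewrite lee_fin powR_ge0|by mt|by move=> x; rewrite lee_fin powR_ge0].
rewrite -ge0_intZl; [|by mt|by move=> x; rewrite -EFinD lee_fin addr_ge0 ?powR_ge0|by rewrite lee_fin powR_ge0].
apply: ge0_int_le; [by mt|by move=> x; rewrite lee_fin powR_ge0|by mt|].
move=> x; rewrite -EFinD -EFinM lee_fin; apply: le_trans (powR_leD p0 (normr_ge0 _) (normr_ge0 _)).
by rewrite ge0_ler_powR ?nnegrE ?addr_ge0// ler_normD.
Qed.

Lemma pint_shift p f h : mfun f -> pint p (fun x => f (x - h)) = pint p f.
Proof.
move=> mf; rewrite /pint -(@ge0_integral_shiftv _ _ (- h) (fun x => (`|f x| `^ p)%:E))//; by mt.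
Qed.

Definition blip (M L N : R) g := [/\ mfun g, forall x, `|g x| <= M,
  forall x y, `|g x - g y| <= L * enorm (x - y) & forall x, N <= enorm x -> g x = 0].

(** The projection of a onto [0, 1]. Written with absolute values, it is visibly measurable and
    1-Lipschitz. *)
Definition clip01 (a : R) : R := (`|a| - `|a - 1| + 1) / 2.

Lemma clip01_bounds a : 0 <= clip01 a <= 1.
Proof.
rewrite /clip01; have [a0|a0] := leP 0 a; have [a1|a1] := leP 0 (a - 1);
  rewrite ?(ger0_norm a0) ?(ger0_norm a1) ?(ltr0_norm a0) ?(ltr0_norm a1); lra.
Qed.

Lemma clip01_1 a : 1 <= a -> clip01 a = 1.
Proof. by move=> a1; rewrite /clip01 !ger0_norm; lra. Qed.

Lemma clip01_0 a : a <= 0 -> clip01 a = 0.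
Proof. by move=> a1; rewrite /clip01 !ler0_norm; lra. Qed.

Lemma clip01_lip a b : `|clip01 a - clip01 b| <= `|a - b|.
Proof.
have -> : clip01 a - clip01 b = (`|a| - `|b|) / 2 + (`|b - 1| - `|a - 1|) / 2 by rewrite /clip01; field.
apply: le_trans (ler_normD _ _) _; rewrite !normrM (ger0_norm (_ : 0 <= 2^-1)) ?invr_ge0//.
have h1 : `| `|a| - `|b| | <= `|a - b| by exact: ler_dist_dist.
have h2 : `| `|b - 1| - `|a - 1| | <= `|a - b|.
  by apply: le_trans (ler_dist_dist _ _) _; rewrite opprB addrA subrK distrC.
lra.
Qed.

(** Rescale f from [-M, M] to [0, 1], approximate on the ball of radius N + 1, then cut off by
    [chi], which is 1 up to radius N and 0 from N + 1 on. *)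
Lemma approx_blip f (M N d : R) : mfun f -> 0 < M -> 0 < d -> (forall x, `|f x| <= M) ->
  (forall x, N <= enorm x -> f x = 0) ->
  exists L g, blip M L (N + 1) g /\ (\int[leb n]_x (`|f x - g x|)%:E <= d%:E)%E.
Proof.
move=> mf M0 d0 fM fN.
pose F x := (f x / M + 1) / 2.
have mF : mfun F by rewrite /F; mt.
have F01 x : 0 <= F x <= 1.
  have h : `|f x / M| <= 1 by rewrite normrM normfV (gtr0_norm M0) ler_pdivrMr// mul1r.
  by move: h; rewrite ler_norml /F; lra.
have dM : 0 < d / (2 * M) by rewrite divr_gt0 ?mulr_gt0.
have [g0 [mg0 g01 [L hL]] e0] := approx_fun mF F01 (N + 1) dM.
pose chi x := clip01 (N + 1 - enorm x).
have mchi : mfun chi by rewrite /chi /clip01; mt.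
have chi01 x : 0 <= chi x <= 1 by exact: clip01_bounds.
pose g1 x := M * (2 * g0 x - 1).
have mg1 : mfun g1 by rewrite /g1; mt.
have g1M x : `|g1 x| <= M.
  by rewrite /g1 normrM (gtr0_norm M0) ler_piMr ?(ltW M0)// ler_norml; have := g01 x; lra.
have chiL x y : `|chi x - chi y| <= enorm (x - y).
  apply: le_trans (clip01_lip _ _) _.
  rewrite (_ : N + 1 - enorm x - _ = enorm y - enorm x); last by ring.
  rewrite ler_norml; have h1 := ler_enorm_dist x y; have h2 := ler_enorm_dist y x.
  by rewrite enorm_distC in h2; lra.
exists (2 * M * L + M), (fun x => g1 x * chi x); split.
  split=> [|x|x y|x xN]; first by mt.
  - rewrite normrM; apply: le_trans (g1M x); rewrite ler_piMr// ler_norml; have := chi01 x; lra.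
  - have -> : g1 x * chi x - g1 y * chi y = (g1 x - g1 y) * chi x + g1 y * (chi x - chi y) by ring.
    apply: le_trans (ler_normD _ _) _; rewrite (normrM (g1 x - g1 y)) (normrM (g1 y)) (mulrDl (2 * M * L) M); apply: lerD.
      apply: (@le_trans _ _ `|g1 x - g1 y|); first by rewrite ler_piMr ?normr_ge0 // ler_norml; have := chi01 x; lra.
      have -> : g1 x - g1 y = 2 * M * (g0 x - g0 y) by rewrite /g1; ring.
      by rewrite normrM gtr0_norm ?mulr_gt0// -mulrA ler_wpM2l// mulr_ge0 ?ltW.
    by apply: ler_pM.
  - by rewrite /chi clip01_0 ?mulr0// subr_le0.
have dE : d = 2 * M * (d / (2 * M)) by field; rewrite gt_eqF.
have M20 : (0 <= (2 * M)%:E :> \bar R)%E by rewrite lee_fin mulr_ge0// ltW.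
apply: (@le_trans _ _ ((2 * M)%:E * ball_err (N + 1) F g0)%E); last first.
  rewrite [d in leRHS]dE (EFinM (2 * M) (d / (2 * M))); exact: lee_wpmul2l.
have mb : mfun (fun x : 'rV[R]_n => ((enorm x < N + 1)%R%:R * `|F x - g0 x|)%:E) by mt.
have b0 (x : 'rV[R]_n) : (0 <= ((enorm x < N + 1)%R%:R * `|F x - g0 x|)%:E)%E by rewrite lee_fin mulr_ge0.
rewrite /ball_err -(ge0_intZl (leb n) mb b0 M20).
apply: ge0_int_le; [by mt|by move=> x; rewrite lee_fin|by mt|].
move=> x; rewrite -EFinM lee_fin.
have fg1 : f x - g1 x = 2 * M * (F x - g0 x) by rewrite /F /g1; field; rewrite gt_eqF.
have n1 : 2 * M * `|F x - g0 x| = `|f x - g1 x|.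
  by rewrite fg1 normrM (gtr0_norm (_ : 0 < 2 * M))// mulr_gt0.
rewrite (mulrCA (2 * M)) n1; have [xN1|xN1] := ltP (enorm x) (N + 1); last first.
  by rewrite mul0r /chi clip01_0 ?subr_le0// mulr0 subr0 fN ?normr0//; lra.
rewrite mul1r; have [xN|xN] := leP N (enorm x).
  rewrite fN// !sub0r !normrN normrM ler_piMr// ler_norml; have := chi01 x; lra.
by rewrite /chi clip01_1 ?mulr1//; lra.
Qed.

(** Truncating f in space and in value costs little in L^p by dominated convergence. The truncated
    function and its approximation are bounded by M, so [t ^ p <= (2 M)^(p - 1) t] converts an L^1
    error into an L^p one. *)
Lemma Lp_density p f (d : R) : 1 <= p -> mfun f -> (pint p f < +oo)%E -> 0 < d ->
  exists g M L N, [/\ 0 < M, 0 < N, blip M L N g & (pint p (fun x => f x - g x)%R <= d%:E)%E].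
Proof.
move=> p1 mf ff d0; have p0 : 0 <= p by lra.
have pp : 0 < p by lra.
pose ind (j : nat) x : R := (enorm x < j.+1%:R)%R%:R * (`|f x| <= j.+1%:R)%R%:R.
pose fj j x := f x * ind j x.
have mfj j : mfun (fj j) by rewrite /fj /ind; mt.
have ind_le1 j x : 0 <= ind j x <= 1.
  by rewrite /ind; case: (enorm x < _); case: (`|f x| <= _); rewrite /= ?mulr1 ?mulr0 ?lexx ?ler01.
pose e j x := `|f x - fj j x| `^ p.
have me j : mfun (e j) by rewrite /e; have := mfj j => h; mt.
have e_le j x : `|e j x| <= `|f x| `^ p.
  rewrite ger0_norm ?powR_ge0// ge0_ler_powR ?nnegrE//.
  rewrite /fj -{1}(mulr1 (f x)) -mulrBr normrM ler_piMr// ler_norml; have := ind_le1 j x; lra.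
have mfp : mfun (fun x => `|f x| `^ p) by mt.
have ffp : finint (leb n) (fun x => `|f x| `^ p).
  by rewrite /finint; under eq_integral do rewrite (ger0_norm (powR_ge0 _ _)).
have ce x : e j x @[j --> \oo] --> (0 : R).
  apply: cvg_near_cst; near=> j; rewrite /e /fj /ind.
  have -> : enorm x < j.+1%:R.
    near: j; exists (Num.truncn (enorm x)) => // k /= hk.
    by apply: lt_le_trans (truncnS_gt _) _; rewrite ler_nat ltnS.
  have -> : `|f x| <= j.+1%:R.
    near: j; exists (Num.truncn `|f x|) => // k /= hk.
    by apply: le_trans (ltW (truncnS_gt _)) _; rewrite ler_nat ltnS.
  by rewrite !mulr1 subrr normr0 powR0// gt_eqF.
have := @Rint_dct R _ V (leb n) e (cst 0) _ me (@measurable_cst _ _ _ _ _ _) mfp ffp e_le ce.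
have -> : \int[leb n]_(x in [set: V]) (cst 0 x : R) = 0 by rewrite /Rintegral integral0.
pose c := 2 `^ p; have c0 : 0 < c by rewrite powR_gt0.
have d1 : 0 < d / (2 * c) by rewrite divr_gt0 ?mulr_gt0.
move=> /cvgr_le => /(_ _ d1) [j _ hj]; have {hj} := hj j (leqnn j).
have fe : finint (leb n) (e j).
  by apply: (finint_le (me j) mfp ffp) => x; rewrite [leRHS]ger0_norm ?powR_ge0.
rewrite -lee_fin (RintE (me j) fe) => ej.
pose M : R := j.+1%:R; have M0 : 0 < M by [].
have fjM x : `|fj j x| <= M.
  rewrite /fj /ind /M; case: (leP `|f x| j.+1%:R) => h; last by rewrite !mulr0 normr0.
  by case: ltP => _; rewrite ?mul1r ?mul0r ?mulr0 ?mulr1 ?normr0.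
have fjN x : M <= enorm x -> fj j x = 0.
  by move=> h; rewrite /fj /ind ltNge h/= mul0r mulr0.
pose B := (2 * M) `^ (p - 1); have B0 : 0 < B by rewrite powR_gt0// mulr_gt0.
have d2 : 0 < d / (2 * c) / B by rewrite divr_gt0.
have [L [g [bg eg]]] := approx_blip (mfj j) M0 d2 fjM fjN.
have [mg gM gL gN] := bg.
exists g, M, L, (M + 1); split => //; first by rewrite addr_gt0.
have mfg : mfun (fun x => f x - fj j x) by have := mfj j => h; mt.
have mjg : mfun (fun x => fj j x - g x) by have := mfj j => h; mt.
have -> : (fun x => f x - g x) = (fun x => (f x - fj j x) + (fj j x - g x)).
  by apply/funext => x; rewrite subrKA.
apply: le_trans (pint_leD p0 mfg mjg) _.
have h2 : (pint p (fun x => (fj j x - g x)%R) <= (d / (2 * c))%:E)%E.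
  apply: (@le_trans _ _ (B%:E * \int[leb n]_x (`|fj j x - g x|)%:E)%E).
    rewrite /pint -ge0_intZl//; [|by mt|by rewrite lee_fin ltW].
    apply: ge0_int_le; [by mt|by move=> x; rewrite lee_fin powR_ge0|by mt|].
    move=> x; rewrite -EFinM lee_fin; apply: powR_lin => //.
    rewrite normr_ge0/=; apply: le_trans (ler_normB _ _) _.
    by have := fjM x; have := gM x; lra.
  apply: le_trans (lee_wpmul2l _ eg) _; first by rewrite lee_fin ltW.
  by rewrite -EFinM lee_fin mulrC divfK// gt_eqF.
have := lee_wpmul2l (_ : (0 <= c%:E)%E) (leeD ej h2).
rewrite lee_fin (ltW c0) => /(_ isT) h; apply: le_trans h _.
rewrite -EFinD -EFinM lee_fin; apply: eq_ler; field; rewrite gt_eqF//.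
Unshelve. all: by end_near.
Qed.

Lemma translation_bound p f h : 0 <= p -> mfun f ->
  (pint p (fun x => f (x - h)%R - f x)%R <= (2 `^ p)%:E * (pint p f + pint p f))%E.
Proof.
move=> p0 mf.
have m1 : mfun (fun x => f (x - h)) by mt.
have m2 : mfun (fun x => - f x) by mt.
apply: le_trans (pint_leD p0 m1 m2) _; rewrite (pint_shift p h mf).
have e : pint p (fun x => - f x)%R = pint p f by apply: eq_integral => x _; rewrite normrN.
by rewrite e.
Qed.

Lemma translation_cts p f (d : R) : 1 <= p -> mfun f -> (pint p f < +oo)%E -> 0 < d ->
  exists2 t : R, 0 < t & forall h, enorm h < t -> (pint p (fun x => f (x - h)%R - f x)%R <= d%:E)%E.
Proof.
move=> p1 mf ff d0; have p0 : 0 <= p by lra.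
pose c := 2 `^ p; have c0 : 0 < c by rewrite powR_gt0.
pose d1 := d / (4 * c * c); have d10 : 0 < d1 by rewrite divr_gt0 ?mulr_gt0.
have [g [M [L [N [M0 N0 [mg gM gL gN] eg]]]]] := Lp_density p1 mf ff d10.
have bf : leb n (eball n (N + 1)) \is a fin_num by rewrite ge0_fin_numE// leb_eball_lty.
pose b : R := fine (leb n (eball n (N + 1))).
have b0 : 0 <= b by rewrite fine_ge0.
pose L1 := `|L| + 1; have L10 : 0 < L1 by rewrite ltr_wpDl.
(* The bound 1 confines both translates to the ball of radius N + 1, [L1^-1] makes the increment at
   most 1 so that its p-th power is no larger, and the third bound makes the integral at most
   [d / (2 * c)]. *)
pose t := Num.min 1 (Num.min L1^-1 (d / (2 * c) / (L1 * (b + 1)))).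
have t0 : 0 < t by rewrite !lt_min ltr01 invr_gt0 L10 divr_gt0 ?divr_gt0 ?mulr_gt0// ltr_wpDl.
exists t => // h ht.
have [h1 [h2 h3]] : enorm h < 1 /\ enorm h < L1^-1 /\ enorm h < d / (2 * c) / (L1 * (b + 1)).
  by move: ht; rewrite !lt_min => /andP[-> /andP[-> ->]].
pose u x := f x - g x; have mu : mfun u by rewrite /u; mt.
have m1 : mfun (fun x => u (x - h) - u x) by mt.
have m2 : mfun (fun x => g (x - h) - g x) by mt.
have -> : (fun x => f (x - h) - f x) = (fun x => (u (x - h) - u x) + (g (x - h) - g x)).
  by apply/funext => x; rewrite /u; ring.
apply: le_trans (pint_leD p0 m1 m2) _.
have e1 : (pint p (fun x => u (x - h)%R - u x)%R <= (c * (d1 + d1))%:E)%E.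
  apply: le_trans (translation_bound h p0 mu) _.
  by rewrite EFinM EFinD; apply: lee_wpmul2l; [rewrite lee_fin ltW|exact: leeD].
have Lh : L1 * enorm h <= 1 by rewrite mulrC -ler_pdivlMr// div1r ltW.
have e2 : (pint p (fun x => g (x - h)%R - g x)%R <= (L1 * enorm h * b)%:E)%E.
  apply: (@le_trans _ _ (\int[leb n]_x ((L1 * enorm h)%:E * ((enorm x < N + 1)%R%:R)%:E))%E).
    apply: ge0_int_le; [by mt|by move=> x; rewrite lee_fin powR_ge0|by mt|].
    move=> x; rewrite -EFinM lee_fin.
    have gh : `|g (x - h) - g x| <= L1 * enorm h.
      apply: le_trans (gL _ _) _; rewrite addrAC subrr add0r enormN.
      by rewrite ler_wpM2r ?enorm_ge0// /L1; have := ler_norm L; lra.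
    have [xN|xN] := ltP (enorm x) (N + 1).
      apply: le_trans (powR_lin p1 (_ : 0 <= _ <= 1)) _; first by rewrite normr_ge0 (le_trans gh).
      by rewrite powR1 mul1r mulr1.
    rewrite gN ?gN ?subrr ?normr0 ?powR0 ?mulr0//; [lra|by lra|].
    by have := ler_enorm_dist x h; lra.
  rewrite ge0_intZl; [|by mt|by move=> x; rewrite lee_fin|by rewrite lee_fin mulr_ge0 ?enorm_ge0 ?ltW].
  by rewrite int_eballE -(fineK bf) -/b -EFinM.
apply: le_trans (lee_wpmul2l _ (leeD e1 e2)) _; first by rewrite lee_fin powR_ge0.
rewrite -EFinD -EFinM lee_fin -/c.
have e3 : L1 * enorm h * b <= d / (2 * c).
  apply: (@le_trans _ _ (enorm h * (L1 * (b + 1)))).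
    by rewrite mulrAC mulrC ler_wpM2l ?enorm_ge0// ler_wpM2l ?(ltW L10)// lerDl.
  by rewrite -ler_pdivlMr ?mulr_gt0 ?ltr_wpDl// ltW.
apply: (@le_trans _ _ (c * (c * (d1 + d1) + d / (2 * c)))); first by rewrite ler_wpM2l ?(ltW c0)// lerD2l.
by apply: eq_ler; rewrite /d1; field; rewrite gt_eqF.
Qed.

End Lp_density.

(** * Approximate identities *)

Section approximate_identity.
Context {R : realType} {n : nat}.
Local Notation V := 'rV[R]_n.
Implicit Types (x y z u : V) (f g : V -> R) (p : R).

(** Convolution with the dilate of K by e, after the substitution that moves e into the argument of
    f. *)
Definition econv (K : V -> R) (e : R) f u : R := \int[leb n]_z (f (u - e *: z) * K z).

Variables (K : V -> R) (A : R).
Hypothesis mK : mfun K.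
Hypothesis fK : finint (leb n) K.
Hypothesis A0 : 0 <= A.
Hypothesis hK : forall z, z != 0 -> `|K z| <= A / enorm z /\ `|K z| <= A / enorm z ^+ n.+1.

Let c : R := \int[leb n]_z K z.
(** The added 1 makes it positive, so that it can be divided by. *)
Definition Kmass : R := \int[leb n]_z `|K z| + 1.
Let C := Kmass.

Let fKn : finint (leb n) (fun z => `|K z|).
Proof. by apply: (finint_le _ mK fK) => [|z]; [mt|rewrite normr_id]. Qed.

Lemma Kmass_gt0 : 0 < C.
Proof. by rewrite /C /Kmass ltr_wpDl//; apply: Rintegral_ge0. Qed.

Lemma Kmass_ge : (\int[leb n]_z (`|K z|)%:E <= C%:E)%E.
Proof.
have mKn : mfun (fun z => `|K z|) by mt.
by rewrite -(RintE mKn fKn) lee_fin lerDl.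
Qed.

Lemma norm_c_le : `|c| <= C.
Proof.
rewrite -lee_fin; apply: le_trans Kmass_ge; exact: norm_Rint_leE.
Qed.

(** The decay |z|^-(n+1) dilated by T: only one power of T remains after integration over R^n. *)
Lemma kernel_tail : exists2 P : R, 0 <= P & forall T, 0 < T ->
  (\int[leb n]_z ((T <= enorm z)%R%:R * `|K z|)%:E <= (P / T)%:E)%E.
Proof.
pose Q z : R := (1 <= enorm z)%R%:R / enorm z ^+ n.+1.
have Q0 z : 0 <= Q z by rewrite /Q; pos.
have mQ : mfun Q by rewrite /Q; mt.
have fQ : finint (leb n) Q.
  rewrite /finint; have := @rad_out_nat R n n.+1 (ltnSn _).
  by under [X in (_ -> X < _)%E]eq_integral => z _ do rewrite (ger0_norm (Q0 z)).
pose P := A * \int[leb n]_z Q z.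
exists P => [|T T0]; first by rewrite mulr_ge0//; apply: Rintegral_ge0.
have Tn : T^-1 != 0 by rewrite invr_eq0 gt_eqF.
apply: (@le_trans _ _ (\int[leb n]_z ((A / T ^+ n.+1)%:E * (Q (T^-1 *: z))%:E))%E).
  apply: ge0_int_le; [by mt|by move=> z; rewrite lee_fin mulr_ge0|by mt|].
  move=> z; rewrite -EFinM lee_fin /Q enormZ (gtr0_norm (_ : 0 < T^-1)) ?invr_gt0//.
  have [zT|zT] := leP T (enorm z); last by rewrite mul0r !mulr_ge0 ?invr_ge0 ?exprn_ge0 ?mulr_ge0 ?enorm_ge0 ?invr_ge0 ?(ltW T0).
  have z0 : z != 0 by rewrite -enorm_gt0 (lt_le_trans T0).
  have [_ h] := hK z0; rewrite mul1r; apply: le_trans h _.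
  have -> : 1 <= T^-1 * enorm z by rewrite mulrC ler_pdivlMr// mul1r.
  rewrite mul1r exprMn exprVn invfM invrK.
  have hT : T ^+ n.+1 != 0 by rewrite expf_neq0// gt_eqF.
  have hz : enorm z ^+ n.+1 != 0 by rewrite expf_neq0// enorm_eq0.
  by move: hT hz; move: (T ^+ _) (enorm z ^+ _) => a b a0 b0; apply: eq_ler; field; rewrite ?a0 ?b0.
have mQT : mfun (fun z => (Q (T^-1 *: z))%:E) by mt.
have AT : (0 <= (A / T ^+ n.+1)%:E)%E by rewrite lee_fin mulr_ge0// invr_ge0 exprn_ge0// ltW.
rewrite (ge0_intZl (leb n) mQT (fun z => Q0 _ : (0 <= (Q (T^-1 *: z))%:E)%E) AT).
have := @ge0_integral_scalev R n T^-1 (fun z => (Q z)%:E) Tn _ (fun z => Q0 z : (0 <= (Q z)%:E)%E).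
rewrite -(RintE mQ fQ) => e.
have {e} e : (\int[leb n]_z (Q (T^-1 *: z))%:E = (T ^+ n * \int[leb n]_z Q z)%:E)%E.
  rewrite EFinM e; last by mt.
  rewrite muleA -EFinM gtr0_norm ?invr_gt0// exprVn divff ?mul1e//.
  by rewrite expf_neq0// gt_eqF.
rewrite e -EFinM lee_fin /P; move: (\int[_]_z _) => b.
rewrite (exprS T n); have h : T ^+ n != 0 by rewrite expf_neq0// gt_eqF.
by apply: eq_ler; move: h; move: (T ^+ n) => a a0; field; rewrite a0 gt_eqF.
Qed.

Lemma split_bound p g (d : R) : 1 <= p -> mfun g -> 0 < d ->
  (\int[leb n]_z (`|g z| * `|K z|)%:E <=
   (d * C)%:E + (d `^ (p - 1))^-1%:E * \int[leb n]_z (`|g z| `^ p * `|K z|)%:E)%E.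
Proof.
move=> p1 mg d0; have dp : 0 < d `^ (p - 1) by rewrite powR_gt0.
apply: (@le_trans _ _ (\int[leb n]_z (d%:E * (`|K z|)%:E + ((d `^ (p - 1))^-1)%:E * (`|g z| `^ p * `|K z|)%:E))%E).
  apply: ge0_int_le; [by mt|by move=> z; rewrite lee_fin mulr_ge0|by mt|].
  move=> z; rewrite -!EFinM -EFinD lee_fin mulrA -mulrDl ler_wpM2r//.
  by rewrite [_^-1 * _]mulrC; exact: young_split.
have E0 z : (0 <= (`|g z| `^ p * `|K z|)%:E)%E by rewrite lee_fin mulr_ge0 ?powR_ge0.
have d0E : (0 <= d%:E)%E by rewrite lee_fin ltW.
have dpE : (0 <= ((d `^ (p - 1))^-1)%:E)%E by rewrite lee_fin invr_ge0 ltW.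
rewrite ge0_intD; [|by mt|by move=> z; rewrite mule_ge0|by mt|by move=> z; rewrite mule_ge0].
rewrite ge0_intZl//; last by mt.
rewrite ge0_intZl//; last by mt.
by apply: leeD => //; rewrite EFinM; apply: lee_wpmul2l => //; exact: Kmass_ge.
Qed.

Definition jconst p : R := (2 * C) `^ p / C.

Lemma jconst_gt0 p : 0 < jconst p.
Proof. by rewrite divr_gt0 ?powR_gt0 ?mulr_gt0 ?Kmass_gt0. Qed.

(* Jensen's inequality for the measure |K| dz, up to a constant. *)
Lemma jensen p g : 1 <= p -> mfun g ->
  ((`|\int[leb n]_z (g z * K z)| `^ p)%:E <=
   (jconst p)%:E * \int[leb n]_z (`|g z| `^ p * `|K z|)%:E)%E.
Proof.
move=> p1 mg; have C0 := Kmass_gt0.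
set X := (\int[leb n]_z (`|g z| `^ p * `|K z|)%:E)%E.
have X0 : (0 <= X)%E by apply: integral_ge0 => z _; rewrite lee_fin mulr_ge0 ?powR_ge0.
have [Xf|] := boolP (X < +oo)%E; last first.
  by rewrite ltey negbK => /eqP ->; rewrite mulry gtr0_sg ?jconst_gt0// mul1e leey.
have Xfin : X \is a fin_num by rewrite ge0_fin_numE.
set y := `|\int[leb n]_z (g z * K z)|.
have yb (d : R) : 0 < d -> y <= d * C + fine X / d `^ (p - 1).
  move=> d0; have h := split_bound p1 mg d0.
  rewrite -/X -(fineK Xfin) -EFinM -EFinD [_^-1 * _]mulrC in h.
  have mgK : mfun (fun z => g z * K z) by mt.
  rewrite -lee_fin; apply: le_trans (norm_Rint_leE (leb n) mgK) _; apply: (le_trans _ h).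
  by apply: ge0_int_le; [mt|by []|mt|] => z; rewrite normrM.
have y0 : 0 <= y by exact: normr_ge0.
rewrite -(fineK Xfin) -EFinM lee_fin.
have [ye|yn] := eqVneq y 0.
  have pn : p != 0 by rewrite gt_eqF// (lt_le_trans ltr01).
  by rewrite ye (powR0 pn); apply: mulr_ge0; [exact/ltW/jconst_gt0|exact: fine_ge0].
have yp : 0 < y by rewrite lt0r yn.
(* With this d, the term [d * C] of [split_bound] is y / 2 and can be absorbed, leaving y / 2 <= X /
   d^(p - 1). *)
pose d := y / (2 * C); have d0 : 0 < d by rewrite divr_gt0 ?mulr_gt0.
have yd : y = 2 * C * d by rewrite /d; field; rewrite gt_eqF.
have dp : 0 < d `^ (p - 1) by rewrite powR_gt0.
have h : d `^ p * C <= fine X.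
  have := yb d d0; rewrite -lerBlDl ler_pdivlMr// => h; apply: le_trans h.
  by rewrite (powR_split p1 (ltW d0)) yd; move: (d `^ (p - 1)) => a; apply: eq_ler; ring.
have C20 : 0 <= 2 * C by rewrite mulr_ge0 ?(ltW C0).
rewrite yd (powRM p C20 (ltW d0)) /jconst; move: h; move: (d `^ p) (fine X) (powR_ge0 (2 * C) p) => a b.
move: ((2 * C) `^ p) => q q0 h; rewrite -(mulrA q) ler_wpM2l//.
by rewrite mulrC ler_pdivlMr.
Qed.

Lemma jensen_finint p g : 1 <= p -> mfun g ->
  (\int[leb n]_z (`|g z| `^ p * `|K z|)%:E < +oo)%E -> finint (leb n) (fun z => g z * K z).
Proof.
move=> p1 mg Xf; have := split_bound p1 mg ltr01; rewrite powR1 invr1 mul1e => h.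
apply: le_lt_trans (le_trans _ h) _.
  by apply: ge0_int_le; [mt|by []|mt|] => z; rewrite normrM.
by rewrite lte_add_pinfty// ltry.
Qed.

Variables (f : V -> R) (p : R).
Hypothesis p1 : 1 <= p.
Hypothesis mf : mfun f.

Lemma mf_econv e : mfun (econv K e f).
Proof. by apply: (@mf_Rint R _ _ _ _ (leb n) (fun u z => f (u - e *: z) * K z)); mt. Qed.

Let mdiff e u : mfun (fun z => f (u - e *: z) - f u). Proof. by mt. Qed.

Lemma econv_sub e u : finint (leb n) (fun z => (f (u - e *: z) - f u) * K z) ->
  econv K e f u - c * f u = \int[leb n]_z ((f (u - e *: z) - f u) * K z).
Proof.
move=> fd.
have m1 : mfun (fun z => (f (u - e *: z) - f u) * K z) by mt.
have m2 : mfun (fun z => f u * K z) by mt.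
have h := RintD m1 fd m2 (finintZ (f u) mK fK).
have e1 : econv K e f u = \int[leb n]_z ((f (u - e *: z) - f u) * K z + f u * K z).
  by apply: eq_Rintegral => z _; rewrite -mulrDl subrK.
by rewrite e1 h (RintZ (f u) mK fK) -/c [c * _]mulrC addrK.
Qed.

Let X e u : \bar R := (\int[leb n]_z (`|f (u - e *: z) - f u| `^ p * `|K z|)%:E)%E.

Lemma econv_pointwise e u :
  ((`|econv K e f u - c * f u| `^ p)%:E <= (jconst p)%:E * X e u)%E.
Proof.
have [Xf|] := boolP (X e u < +oo)%E; last first.
  by rewrite ltey negbK => /eqP ->; rewrite mulry gtr0_sg ?jconst_gt0// mul1e leey.
by rewrite econv_sub; [exact: jensen|exact: jensen_finint Xf].
Qed.

Hypothesis fp : (pint p f < +oo)%E.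

(** Integrate the pointwise Jensen bound over u and exchange. Where |e z| < t the modulus d of
    translation applies; where |z| >= t / e the crude [translation_bound] is multiplied by the tail
    mass [P * (e / t)]. *)
Lemma econv_Lp_bound e (d t : R) : 0 < e -> 0 < t -> 0 <= d ->
  (forall h, enorm h < t -> (pint p (fun x => f (x - h)%R - f x)%R <= d%:E)%E) ->
  forall P, 0 <= P ->
  (forall T, 0 < T -> (\int[leb n]_z ((T <= enorm z)%R%:R * `|K z|)%:E <= (P / T)%:E)%E) ->
  (pint p (fun u => econv K e f u - c * f u)%R <=
   (jconst p * (d * C + 2 `^ p * (fine (pint p f) + fine (pint p f)) * (P * (e / t))))%:E)%E.
Proof.
move=> e0 t0 d0 hd P P0 hP.
have p0 : 0 <= p by apply: le_trans p1.
have J0 := jconst_gt0 p.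
have ffin : pint p f \is a fin_num by rewrite ge0_fin_numE// pint_ge0.
pose D := 2 `^ p * (fine (pint p f) + fine (pint p f)).
have D0 : 0 <= D by rewrite mulr_ge0 ?powR_ge0// addr_ge0// fine_ge0// pint_ge0.
have mX : mfun (fun u => X e u).
  apply: (@mf_intV R _ _ _ (fun u z => (`|f (u - e *: z) - f u| `^ p * `|K z|)%:E)); first by mt.
  by move=> u z; rewrite lee_fin mulr_ge0 ?powR_ge0.
have X0 u : (0 <= X e u)%E by apply: integral_ge0 => z _; rewrite lee_fin mulr_ge0 ?powR_ge0.
apply: (@le_trans _ _ (\int[leb n]_u ((jconst p)%:E * X e u))%E).
  apply: ge0_int_le; [|by move=> u; rewrite lee_fin powR_ge0| |exact: econv_pointwise].
    by have h := mf_econv e; mt.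
  by apply: mf_muleE; [mt|exact: mX].
rewrite ge0_intZl//; last by rewrite lee_fin ltW.
rewrite (EFinM (jconst p)); apply: lee_wpmul2l; first by rewrite lee_fin ltW.
rewrite (@tonelliV R n n (fun u z => (`|f (u - e *: z) - f u| `^ p * `|K z|)%:E)); [|by mt|]; last first.
  by move=> u z; rewrite lee_fin mulr_ge0 ?powR_ge0.
have mtail : mfun (fun z : V => ((t / e <= enorm z)%R%:R * `|K z|)%:E) by mt.
have tail0 z : (0 <= ((t / e <= enorm z)%R%:R * `|K z|)%:E)%E by rewrite lee_fin mulr_ge0.
have mKE : mfun (fun z => (`|K z|)%:E) by mt.
apply: (@le_trans _ _ (\int[leb n]_z (d%:E * (`|K z|)%:E + D%:E * ((t / e <= enorm z)%R%:R * `|K z|)%:E))%E).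
  apply: ge0_int_le.
  - apply: (@mf_intV R _ _ _ (fun z u => (`|f (u - e *: z) - f u| `^ p * `|K z|)%:E)); first by mt.
    by move=> z u; rewrite lee_fin mulr_ge0 ?powR_ge0.
  - by move=> z; apply: integral_ge0 => u _; rewrite lee_fin mulr_ge0 ?powR_ge0.
  - by mt.
  move=> z; rewrite (eq_integral (fun u => (`|K z|)%:E * (`|f (u - e *: z) - f u| `^ p)%:E)%E); last first.
    by move=> u _; rewrite -EFinM mulrC.
  rewrite ge0_intZl; [|by mt|by move=> u; rewrite lee_fin powR_ge0|by rewrite lee_fin].
  rewrite -/(pint p (fun u => f (u - e *: z) - f u)).
  have [ze|ze] := leP (t / e) (enorm z).
    apply: (@le_trans _ _ ((`|K z|)%:E * D%:E)%E).
      apply: lee_wpmul2l; first by rewrite lee_fin.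
      apply: le_trans (translation_bound (e *: z) p0 mf) _.
      by rewrite -(fineK ffin) -EFinD -EFinM.
    by rewrite mul1r -!EFinM -EFinD lee_fin [D * _]mulrC lerDr mulr_ge0.
  rewrite mul0r mule0 adde0 muleC; apply: lee_wpmul2r; first by rewrite lee_fin.
  by apply: hd; rewrite enormZ gtr0_norm// mulrC -ltr_pdivlMr.
have d0E : (0 <= d%:E)%E by rewrite lee_fin.
have D0E : (0 <= D%:E)%E by rewrite lee_fin.
rewrite ge0_intD; [|by mt|by move=> z; rewrite mule_ge0|by mt|by move=> z; rewrite mule_ge0].
rewrite ge0_intZl// ge0_intZl//.
rewrite EFinD; apply: leeD.
  by rewrite EFinM; apply: lee_wpmul2l; [rewrite lee_fin|exact: Kmass_ge].
rewrite (EFinM D); apply: lee_wpmul2l; first by rewrite lee_fin.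
apply: le_trans (hP (t / e) _) _; first by rewrite divr_gt0.
by rewrite lee_fin invf_div.
Qed.

Lemma econv_Lp : (forall e, 0 < e -> (pint p (fun u => econv K e f u - c * f u)%R < +oo)%E) /\
  forall d : R, 0 < d -> exists2 e0 : R, 0 < e0 & forall e, 0 < e < e0 ->
    (pint p (fun u => econv K e f u - c * f u)%R <= d%:E)%E.
Proof.
have [P P0 hP] := kernel_tail; have C0 := Kmass_gt0; have J0 := jconst_gt0 p.
have p0 : 0 <= p by apply: le_trans p1.
split=> [e e0|d d0].
  have [t t0 ht] := translation_cts p1 mf fp ltr01.
  exact: le_lt_trans (econv_Lp_bound e0 t0 ler01 ht P0 hP) (ltry _).
pose d1 := d / (2 * jconst p * C); have d10 : 0 < d1 by apply: divr_gt0 => //; apply: mulr_gt0 => //; apply: mulr_gt0.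
have [t t0 ht] := translation_cts p1 mf fp d10.
pose D := 2 `^ p * (fine (pint p f) + fine (pint p f)) * P / t.
have D0 : 0 <= D.
  by rewrite !mulr_ge0 ?powR_ge0 ?addr_ge0 ?fine_ge0 ?pint_ge0 ?invr_ge0 ?(ltW t0).
exists (d / (2 * jconst p * (D + 1))) => [|e /andP[e0 ee]].
  by apply: divr_gt0 => //; apply: mulr_gt0; [apply: mulr_gt0|rewrite ltr_wpDl].
apply: le_trans (econv_Lp_bound e0 t0 (ltW d10) ht P0 hP) _; rewrite lee_fin.
have h : e * (2 * jconst p * (D + 1)) <= d.
  by rewrite -ler_pdivlMr; [rewrite ltW|apply: mulr_gt0; [apply: mulr_gt0|rewrite ltr_wpDl]].
have -> : jconst p * (d1 * C + 2 `^ p * (fine (pint p f) + fine (pint p f)) * (P * (e / t))) = d / 2 + jconst p * D * e.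
  by rewrite /d1 /D; move: (fine _) (2 `^ p) => a b; field; rewrite !gt_eqF.
have : jconst p * D * e <= jconst p * (D + 1) * e.
  by rewrite ler_wpM2r ?(ltW e0)// ler_wpM2l ?(ltW J0)// lerDl.
nra.
Qed.

End approximate_identity.

(** * Uniform convergence of the convolutions *)

Section uniform_convergence.
Context {R : realType} {n : nat}.
Local Notation V := 'rV[R]_n.
Variables (K : V -> R) (A : R).
Hypothesis mK : mfun K.
Hypothesis fK : finint (leb n) K.
Hypothesis A0 : 0 <= A.
Hypothesis hK : forall z, z != 0 -> `|K z| <= A / enorm z /\ `|K z| <= A / enorm z ^+ n.+1.
Let c : R := \int[leb n]_z K z.
Let C := Kmass K.

Lemma finint_bounded (g : V -> R) (M : R) : mfun g -> (forall z, `|g z| <= M) ->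
  finint (leb n) (fun z => g z * K z).
Proof.
move=> mg gM; apply: (finint_le _ _ (finintZ M mK fK)); [by mt|by mt|].
move=> z; rewrite !normrM ler_wpM2r//; apply: le_trans (gM z) (ler_norm _).
Qed.

(** The split at |z| = t / e as in [econv_Lp_bound], with uniform continuity of f in place of
    continuity of translations in L^p. *)
Lemma econv_sup (f : V -> R) (M d : R) : mfun f -> (forall x, `|f x| <= M) ->
  (forall d, 0 < d -> exists2 t : R, 0 < t & forall x h, enorm h < t -> `|f (x - h) - f x| <= d) ->
  0 < d -> exists2 e0 : R, 0 < e0 & forall e u, 0 < e < e0 -> `|econv K e f u - c * f u| <= d.
Proof.
move=> mf fM uc d0; have C0 : 0 < C := Kmass_gt0 K.
have [P P0 hP] := kernel_tail mK A0 hK.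
have d10 : 0 < d / (2 * C) by rewrite divr_gt0 ?mulr_gt0.
have [t t0 ht] := uc _ d10.
have M0 : 0 <= M by apply: le_trans (fM 0).
pose D := 2 * M * P / t.
have D0 : 0 <= D by rewrite !mulr_ge0 ?invr_ge0 ?(ltW t0).
exists (d / (2 * (D + 1))) => [|e u /andP[e0 ee]].
  by rewrite divr_gt0 ?mulr_gt0// ltr_wpDl.
have md : mfun (fun z : V => f (u - e *: z) - f u) by mt.
have db z : `|f (u - e *: z) - f u| <= 2 * M.
  by apply: le_trans (ler_normB _ _) _; have := fM (u - e *: z); have := fM u; lra.
rewrite (econv_sub mK fK mf (finint_bounded md db)).
have mtail : mfun (fun z : V => ((t / e <= enorm z)%R%:R * `|K z|)%:E) by mt.
have tail0 z : (0 <= ((t / e <= enorm z)%R%:R * `|K z|)%:E)%E by rewrite lee_fin mulr_ge0.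
have mdK : mfun (fun z : V => (f (u - e *: z) - f u) * K z) by mt.
rewrite -lee_fin; apply: le_trans (norm_Rint_leE (leb n) mdK) _.
apply: (@le_trans _ _ (\int[leb n]_z ((d / (2 * C))%:E * (`|K z|)%:E + (2 * M)%:E * ((t / e <= enorm z)%R%:R * `|K z|)%:E))%E).
  apply: ge0_int_le; [by mt|by []|by mt|].
  move=> z; rewrite -!EFinM -EFinD lee_fin normrM.
  have [ze|ze] := leP (t / e) (enorm z).
    by rewrite mul1r -mulrDl ler_wpM2r//; apply: le_trans (db z) _; rewrite lerDr ltW.
  rewrite mul0r mulr0 addr0 ler_wpM2r//; apply: ht.
  by rewrite enormZ gtr0_norm// mulrC -ltr_pdivlMr.
have M20 : (0 <= (2 * M)%:E :> \bar R)%E by rewrite lee_fin mulr_ge0.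
have d1E : (0 <= (d / (2 * C))%:E)%E by rewrite lee_fin ltW.
have mKE : mfun (fun z => (`|K z|)%:E) by mt.
rewrite ge0_intD; [|by mt|by move=> z; rewrite mule_ge0|by mt|by move=> z; rewrite mule_ge0].
rewrite ge0_intZl// ge0_intZl//.
apply: le_trans (leeD (lee_wpmul2l d1E (Kmass_ge mK fK)) (lee_wpmul2l M20 (hP (t / e) (divr_gt0 t0 e0)))) _.
rewrite -!EFinM -EFinD lee_fin.
have h : e * (2 * (D + 1)) <= d by rewrite -ler_pdivlMr ?mulr_gt0 ?ltr_wpDl// ltW.
have -> : d / (2 * C) * Kmass K + 2 * M * (P / (t / e)) = d / 2 + D * e.
  by rewrite -/C /D; field; rewrite !gt_eqF.
nra.
Qed.

End uniform_convergence.

(** * A maximal inequality *)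

Section vitali.
Context {R : realType} {n : nat}.
Local Notation V := 'rV[R]_n.
Implicit Types (b : V * R) (s t : seq (V * R)) (x : V).

Definition inb b x : bool := enorm (x - b.1) < b.2.
Definition tripled b : V * R := (b.1, 3 * b.2).

Lemma mf_inb b : mfun (fun x : V => (inb b x)%:R : R).
Proof. by rewrite /inb; mt. Qed.

Lemma max_radius s : s != [::] -> exists2 b, b \in s & forall b', b' \in s -> b'.2 <= b.2.
Proof.
elim: s => // b [|c s] IH _.
  by exists b => [|b']; rewrite mem_seq1 // => /eqP ->.
have [b0 b0s h] := IH isT; have [hb|hb] := leP b.2 b0.2.
  by exists b0 => [|b']; rewrite in_cons ?b0s ?orbT// => /orP[/eqP ->//|/h].
exists b => [|b']; rewrite in_cons ?eqxx// => /orP[/eqP ->//|/h hb'].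
exact: le_trans hb' (ltW hb).
Qed.

(** Greedy choice: keep a ball of largest radius, discard those that meet it, and recurse. A
    discarded ball meets a kept one of no smaller radius and so lies in its triple. Disjointness is
    a bound on a sum of indicators, ready to be integrated. *)
Lemma vitali s : exists t, [/\ {subset t <= s},
  (forall x, \sum_(b <- t) (inb b x)%:R <= 1 :> R) &
  forall b x, b \in s -> inb b x -> exists2 b', b' \in t & inb (tripled b') x].
Proof.
have [N] := ubnP (size s); elim: N s => // N IH s; rewrite ltnS => sN.
have [->|s0] := eqVneq s [::].
  by exists [::]; split => // x; rewrite big_nil.
have [b0 b0s hb0] := max_radius s0.
(* The clause [b != b0] removes b0 even if its radius is not positive, so that the list always
   shrinks. *)
pose far b := (b.2 + b0.2 <= enorm (b.1 - b0.1)) && (b != b0).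
have sf : (size [seq b <- s | far b] < N)%N.
  apply: leq_trans sN; rewrite size_filter ltn_neqAle count_size andbT -all_count.
  by apply/allP => /(_ _ b0s); rewrite /far eqxx andbF.
have [t [ts t1 tc]] := IH _ sf; exists (b0 :: t); split.
- by move=> b; rewrite in_cons => /orP[/eqP ->//|/ts]; rewrite mem_filter => /andP[].
- move=> x; rewrite big_cons; have [x0|x0] := boolP (inb b0 x); last by rewrite add0r.
  rewrite big_seq big1 ?addr0// => b /ts; rewrite mem_filter => /andP[/andP[fb _] _].
  apply/eqP; rewrite pnatr_eq0 eqb0; apply/negP => xb.
  have h := ler_enormB (x - b0.1) (x - b.1).
  have e : x - b0.1 - (x - b.1) = b.1 - b0.1 by rewrite opprB addrC addrA subrK.
  by rewrite e in h; move: fb x0 xb; rewrite /inb; lra.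
- move=> b x bs xb; have [fb|] := boolP (far b).
    have [|b' b't h] := tc b x _ xb; first by rewrite mem_filter fb.
    by exists b' => //; rewrite in_cons b't orbT.
  have x0 := enorm_ge0 (x - b.1); have hb := hb0 b bs; move: xb.
  rewrite negb_and -ltNge negbK => xb /orP[nf|/eqP bb0]; exists b0; rewrite ?mem_head//.
    have h := ler_enormD (x - b.1) (b.1 - b0.1).
    by rewrite addrA subrK in h; move: xb nf h; rewrite /inb /tripled/=; lra.
  by rewrite -bb0; move: xb; rewrite /inb /tripled/=; lra.
Qed.

Lemma int_inb b : 0 < b.2 ->
  (\int[leb n]_x ((inb b x)%:R : R)%:E = (b.2 ^+ n)%:E * @leb R n (eball n 1))%E.
Proof.
move=> b0.
have m1 : mfun (fun x : V => ((enorm x < b.2)%R%:R : R)%:E) by mt.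
have p1 x : (0 <= ((enorm x < b.2)%R%:R : R)%:E)%E by rewrite lee_fin.
have bn : b.2 != 0 by rewrite gt_eqF.
apply: (etrans (ge0_integral_shiftv (- b.1) m1 p1)).
apply: (etrans (ge0_integral_scalev bn m1 p1)).
rewrite (gtr0_norm b0) -(int_eballE n 1); congr (_ * _)%E; apply: eq_integral => x _.
by rewrite enormZ (gtr0_norm b0) gtr_pMr.
Qed.

Lemma measurable_has s : measurable [set x : V | has (inb^~ x) s].
Proof.
elim: s => [|b s IH].
  by rewrite (_ : [set _ | _] = set0)//; apply/seteqP; split.
rewrite (_ : [set _ | _] = [set x | inb b x] `|` [set x | has (inb^~ x) s]); last first.
  by apply/seteqP; split => x /=; [move=> /orP|move/orP].
apply: measurableU => //.
rewrite (_ : [set _ | _] = (fun x : V => enorm (x - b.1)) @^-1` `]-oo, b.2[%classic); last first.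
  by apply/seteqP; split => x /=; rewrite /inb in_itv.
have m : mfun (fun x : V => enorm (x - b.1)) by mt.
by rewrite -[X in measurable X]setTI; apply: m.
Qed.

Lemma int_set (E : set V) : measurable E -> (forall x, E x \/ ~ E x) ->
  forall f : V -> bool, (forall x, E x <-> f x) ->
  (\int[leb n]_x ((f x)%:R : R)%:E = leb n E)%E.
Proof.
move=> mE _ f fE; rewrite -[E in RHS]setIT -integral_indic ?setIT//.
apply: eq_integral => x _; rewrite indicE; congr (_%:R)%:E; congr nat_of_bool.
by apply/idP/idP => [/fE/mem_set//|/set_mem/fE].
Qed.

Lemma mf_sum_inb t : mfun (fun x : V => \sum_(b <- t) (inb b x)%:R : R).
Proof. by apply: measurable_sum => b; exact: mf_inb. Qed.

Lemma mf_sum_trip t : mfun (fun x : V => \sum_(b <- t) (inb (tripled b) x)%:R : R).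
Proof. by apply: measurable_sum => b; exact: mf_inb. Qed.

Variables (F : V -> R) (lam : R).
Hypotheses (mF : mfun F) (F0 : forall x, 0 <= F x) (lam0 : 0 < lam).

Definition vconst : R := 3 ^+ n * fine (@leb R n (eball n 1)).

Lemma vconst_ge0 : 0 <= vconst.
Proof. by rewrite mulr_ge0 ?exprn_ge0// fine_ge0. Qed.

(** The average is normalized by r^n; the volume of the unit ball and the 3^n of the tripling are
    both in [vconst]. *)
Definition good b := 0 < b.2 /\ ((lam * b.2 ^+ n)%:E < \int[leb n]_x ((inb b x)%:R * F x)%:E)%E.

Lemma trip_le b : good b ->
  (\int[leb n]_x ((inb (tripled b) x)%:R : R)%:E <=
   (vconst / lam)%:E * \int[leb n]_x ((inb b x)%:R * F x)%:E)%E.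
Proof.
move=> [b0 h]; have v0 := vconst_ge0.
have vl : (0 <= (vconst / lam)%:E)%E by rewrite lee_fin mulr_ge0// invr_ge0 ltW.
apply: le_trans (lee_wpmul2l vl (ltW h)).
have b30 : 0 < (tripled b).2 by rewrite mulr_gt0.
rewrite (int_inb b30) -EFinM -[leb _ _]fineK; last by rewrite ge0_fin_numE// leb_eball_lty.
rewrite -EFinM lee_fin /vconst exprMn; move: (fine _) (3 ^+ n) (b.2 ^+ n) => a c d.
by apply: eq_ler; field; rewrite gt_eqF.
Qed.

Lemma sum_trip_le t : (forall b, b \in t -> good b) ->
  (\int[leb n]_x (\sum_(b <- t) (inb (tripled b) x)%:R : R)%:E <=
   (vconst / lam)%:E * \int[leb n]_x ((\sum_(b <- t) (inb b x)%:R) * F x)%:E)%E.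
Proof.
have v0 : (0 <= (vconst / lam)%:E)%E by rewrite lee_fin mulr_ge0 ?vconst_ge0// invr_ge0 ltW.
have S0 t' x : 0 <= \sum_(b <- t') (inb b x)%:R :> R by apply: sumr_ge0.
elim: t => [|b t IH] gt.
  under eq_integral do rewrite big_nil.
  rewrite integral0 mule_ge0//; apply: integral_ge0 => x _.
  by rewrite lee_fin big_nil mul0r.
have e1 : (\int[leb n]_x (\sum_(b <- b :: t) (inb (tripled b) x)%:R : R)%:E =
   \int[leb n]_x ((inb (tripled b) x)%:R : R)%:E +
   \int[leb n]_x (\sum_(b <- t) (inb (tripled b) x)%:R : R)%:E)%E.
  rewrite -ge0_intD; first by apply: eq_integral => x _; rewrite big_cons EFinD.
  - by have h := mf_inb (tripled b); mt.
  - by move=> x; rewrite lee_fin.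
  - by have h := mf_sum_trip t; mt.
  - by move=> x; rewrite lee_fin sumr_ge0.
have e2 : (\int[leb n]_x ((\sum_(b <- b :: t) (inb b x)%:R) * F x)%:E =
   \int[leb n]_x ((inb b x)%:R * F x)%:E +
   \int[leb n]_x ((\sum_(b <- t) (inb b x)%:R) * F x)%:E)%E.
  rewrite -ge0_intD; first by apply: eq_integral => x _; rewrite big_cons mulrDl EFinD.
  - by have h := mf_inb b; mt.
  - by move=> x; rewrite lee_fin mulr_ge0.
  - by have h := mf_sum_inb t; mt.
  - by move=> x; rewrite lee_fin mulr_ge0.
rewrite e1 e2 ge0_muleDr; last 2 first.
- by apply: integral_ge0 => x _; rewrite lee_fin mulr_ge0.
- by apply: integral_ge0 => x _; rewrite lee_fin mulr_ge0.
apply: leeD; first by apply/trip_le/gt; rewrite mem_head.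
by apply: IH => c ct; apply: gt; rewrite in_cons ct orbT.
Qed.

(** The triples of the selected balls cover. Each has measure at most [vconst / lam] times the
    integral of F over its own ball, and disjointness adds these up to at most the integral of F. *)
Lemma cover_le s : (forall b, b \in s -> good b) ->
  (leb n [set x : V | has (inb^~ x) s] <= (vconst / lam)%:E * \int[leb n]_x (F x)%:E)%E.
Proof.
move=> gs; have [t [ts t1 tc]] := vitali s.
have v0 : (0 <= (vconst / lam)%:E)%E by rewrite lee_fin mulr_ge0 ?vconst_ge0// invr_ge0 ltW.
have S0 x : 0 <= \sum_(b <- t) (inb b x)%:R :> R by apply: sumr_ge0.
rewrite -(int_set (measurable_has s) (fun x => EM _) (f := fun x => has (inb^~ x) s))//.
apply: (@le_trans _ _ (\int[leb n]_x (\sum_(b <- t) (inb (tripled b) x)%:R : R)%:E)%E).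
  apply: ge0_int_le.
  - have h : mfun (fun x : V => \1_[set x : V | has (inb^~ x) s] x : R) by exact: mf_indic1 (measurable_has s).
    rewrite (_ : (fun _ => _) = (fun x : V => (\1_[set x : V | has (inb^~ x) s] x : R)%:E)); first by mt.
    apply/funext => x; rewrite indicE; congr (_%:R)%:E; congr nat_of_bool.
    by apply/idP/idP => [h'|/set_mem//]; apply: mem_set.
  - by move=> x; rewrite lee_fin.
  - by have h := mf_sum_trip t; mt.
  move=> x; rewrite lee_fin; have [/hasP[b bs xb]|_] := boolP (has _ s); last by rewrite sumr_ge0.
  have [b' b't xb'] := tc b x bs xb.
  by rewrite (big_rem b')//= xb' lerDl sumr_ge0.
apply: le_trans (sum_trip_le (t := t) _) _; first by move=> b /ts/gs.
apply: lee_wpmul2l => //; apply: ge0_int_le.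
- by have h := mf_sum_inb t; mt.
- by move=> x; rewrite lee_fin mulr_ge0.
- by mt.
- by move=> x; rewrite lee_fin ler_piMl.
Qed.

(** Enumeration of the balls with rational centre and radius. A number that codes nothing yields
    radius 0, which is never [good]. Vitali for finite lists then suffices, by passing to an
    increasing union. *)
Let dec k : V * R := if @unpickle ('rV[rat]_n * rat)%type k is Some q then (map_mx ratr q.1, ratr q.2) else (0, 0).
Let gseq N := [seq b <- [seq dec k | k <- iota 0 N] | `[< good b >]].

Let gseqP N b : reflect (good b /\ exists2 k, (k < N)%N & b = dec k) (b \in gseq N).
Proof.
rewrite mem_filter; apply: (iffP andP) => -[gb].
  by move=> /mapP[k]; rewrite mem_iota add0n => /andP[_ kN] bk; split; [exact/asboolP|exists k].
by move=> [k kN bk]; split; [exact/asboolP|apply/mapP; exists k; rewrite ?mem_iota].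
Qed.

(** The weak-type inequality, with E the union of the good rational balls. Outside E, no such ball
    around u is good, and a rational ball slightly larger than a given one transfers the bound to
    every radius. *)
Lemma maximal_set : exists E : set V, [/\ measurable E,
  (leb n E <= (vconst / lam)%:E * \int[leb n]_x (F x)%:E)%E &
  forall u, ~ E u -> forall r : R, 0 < r ->
    (\int[leb n]_z ((enorm z < r)%R%:R * F (u - z))%:E <= (lam * (2 * r) ^+ n)%:E)%E].
Proof.
pose EN N := [set x : V | has (inb^~ x) (gseq N)].
have mEN N : measurable (EN N) by exact: measurable_has.
have mE : measurable (\bigcup_N EN N) by apply: bigcup_measurable.
exists (\bigcup_N EN N); split => //.
  have homo : {homo EN : N M / (N <= M)%N >-> (N <= M)%O}.
    move=> N M NM; apply/subsetPset => x /hasP[b /gseqP[gb [k kN bk]] xb]; apply/hasP; exists b => //.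
    by apply/gseqP; split => //; exists k => //; exact: leq_trans NM.
  have cv := nondecreasing_cvg_mu (mu := @leb R n) mEN mE homo.
  rewrite -(cvg_lim _ cv)//; apply: lime_le; first by apply/cvg_ex; eexists; exact: cv.
  by apply: nearW => N; apply: cover_le => b /gseqP[].
move=> u uE r r0.
(* A rational ball of radius between 3r/2 and 2r, with centre within r/2 of u, contains the ball of
   radius r around u. It contains u, so it is not good; the upper bound on its radius is the 2r of
   the conclusion. *)
have [s] := @rat_in_itvoo R (3 / 2 * r) (2 * r) ltac:(lra).
rewrite in_itv/= => /andP[s1 s2].
pose d := r / (2 * n.+1%:R); have d0 : 0 < d by rewrite divr_gt0// mulr_gt0.
have hq (i : 'I_n) : exists q : rat, ratr q \in `]u 0 i - d, u 0 i + d[.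
  by apply: rat_in_itvoo; lra.
have [q qP] := choice hq.
pose Q : 'rV[rat]_n := \row_i q i.
have uQ : enorm (u - map_mx ratr Q) < r / 2.
  have n1 : n.+1%:R != 0 :> R by rewrite pnatr_eq0.
  have -> : r / 2 = n.+1%:R * d by rewrite /d; move: (n.+1%:R : R) n1 => c c0; field; rewrite ?c0.
  apply: (cube_sub_eball (r := d)) => // i; rewrite !mxE.
  by have := qP i; rewrite in_itv/= => /andP[h1 h2]; rewrite ler_norml; lra.
have dk : dec (pickle (Q, s)) = (map_mx ratr Q, ratr s) by rewrite /dec pickleK.
have sr0 : 0 < ratr s :> R by lra.
have : ~ good (map_mx ratr Q, ratr s).
  move=> gb; apply: uE; exists (pickle (Q, s)).+1 => //; apply/hasP.
  exists (map_mx ratr Q, ratr s); last by rewrite /inb/=; lra.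
  by apply/gseqP; split => //; exists (pickle (Q, s)).
move=> /not_andP[//|/negP]; rewrite -leNgt /= => h.
have mH : mfun (fun x : V => ((enorm x < r)%R%:R * F (x + u))%:E) by mt.
have H0 (x : V) : (0 <= ((enorm x < r)%R%:R * F (x + u))%:E)%E by rewrite lee_fin mulr_ge0.
have mG : mfun (fun x : V => ((enorm (x - u) < r)%R%:R * F x)%:E) by mt.
have G0 (x : V) : (0 <= ((enorm (x - u) < r)%R%:R * F x)%:E)%E by rewrite lee_fin mulr_ge0.
have e1 := ge0_integral_oppv mH H0; have e2 := ge0_integral_shiftv u mG G0.
have e3 : (\int[leb n]_z ((enorm z < r)%R%:R * F (u - z))%:E = \int[leb n]_x ((enorm (x - u) < r)%R%:R * F x)%:E)%E.
  apply: (etrans _ (etrans e1 (etrans _ e2))); apply: eq_integral => x _; last by rewrite addrK.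
  by rewrite enormN [- x + u]addrC.
rewrite e3; apply: (@le_trans _ _ (lam * ratr s ^+ n)%:E); last first.
  by rewrite lee_fin ler_wpM2l ?(ltW lam0)// lerXn2r ?nnegrE; lra.
apply: le_trans h; apply: ge0_int_le; [exact: mG|exact: G0| |].
  by have h := mf_inb (map_mx ratr Q, ratr s); mt.
move=> x; rewrite lee_fin ler_wpM2r//.
have [xr|_] := ltP (enorm (x - u)) r; last by [].
have -> : inb (map_mx ratr Q, ratr s) x; last by [].
have := ler_enormD (x - u) (u - map_mx ratr Q); rewrite addrA subrK /inb/=; lra.
Qed.

End vitali.

(** * Maximal bound for a kernel that is singular at 0 *)

Section kernel_maximal.
Context {R : realType} {k : nat}.
Local Notation n := k.+2.
Local Notation V := 'rV[R]_n.
Local Notation L := 'rV[R]_1.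
Variables (K : V -> R) (A : R).
Hypothesis mK : mfun K.
Hypothesis A0 : 0 <= A.
Hypothesis hK : forall z, z != 0 -> `|K z| <= A / enorm z /\ `|K z| <= A / enorm z ^+ n.+1.

(** Up to constants, minus the derivative of min (1/t, 1/t^(n+1)): integrating the balls |z| < t
    against [rho t] dt dominates |K|. The radius is taken as the norm of a point of R^1, so that the
    substitution lemmas for [leb] apply. *)
Let rho (t : R) : R := (t < 1)%R%:R / t ^+ 2 + (1 <= t)%R%:R / t ^+ n.+2.
Let rho0 t : 0 <= t -> 0 <= rho t.
Proof. by move=> t0; rewrite /rho addr_ge0// mulr_ge0// invr_ge0 exprn_ge0. Qed.
Let mrho : mfun (fun w : L => rho (enorm w)). Proof. by rewrite /rho; mt. Qed.

Let sig : \bar R := (\int[leb 1]_w (((1 < enorm w)%R%:R * (enorm w < 2)%R%:R : R)%:E))%E.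
(** Integrable bound for t^n [rho t] at t = |w|: the power t^(n-2) is at most 1 for t < 1 since n >=
    2, and t^-2 is left for t >= 1. *)
Let W (w : L) : R := (enorm w < 1)%R%:R + (1 <= enorm w)%R%:R / enorm w ^+ 2.
Let W0 w : 0 <= W w.
Proof. by rewrite /W addr_ge0// mulr_ge0// invr_ge0 exprn_ge0// enorm_ge0. Qed.
Let mW : mfun W. Proof. by rewrite /W; mt. Qed.
Let S : \bar R := (\int[leb 1]_w (W w)%:E)%E.

Let S_fin : (S < +oo)%E.
Proof.
have -> : S = (\int[leb 1]_w (((enorm w < 1)%R%:R : R)%:E + ((1 <= enorm w)%R%:R / enorm w ^+ 2)%:E))%E.
  by apply: eq_integral => w _; rewrite -EFinD.
rewrite ge0_intD; [|by mt|by move=> w; rewrite lee_fin|by mt|]; last first.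
  by move=> w; rewrite lee_fin mulr_ge0// invr_ge0 exprn_ge0// enorm_ge0.
by rewrite lte_add_pinfty ?(rad_out_nat (n := 1))// int_eballE leb_eball_lty.
Qed.

Let sig_le (w : L) : 0 <= ((1 < enorm w)%R%:R * (enorm w < 2)%R%:R : R) <= (enorm w < 2)%R%:R.
Proof. by rewrite mulr_ge0//= ler_piMl//; case: (1 < _)%R. Qed.

Let sig_fin : (sig < +oo)%E.
Proof.
apply: le_lt_trans (leb_eball_lty 1 2); rewrite -int_eballE; apply: ge0_int_le; [by mt| |by mt|].
  by move=> w; rewrite lee_fin; have /andP[] := sig_le w.
by move=> w; rewrite lee_fin; have /andP[] := sig_le w.
Qed.

Let sig_gt0 : (0 < sig)%E.
Proof.
have ms : mfun (fun w : L => ((1 < enorm w)%R%:R * (enorm w < 2)%R%:R : R)) by mt.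
apply: (int_gt0 (a := axis 0 (3 / 2)) (r := 1 / 4) ms) => [w||w hw].
- by have /andP[] := sig_le w.
- by lra.
- have := ler_enorm_dist w (axis 0 (3/2)); have := ler_enorm_dist (axis 0 (3/2)) w.
  rewrite enorm_distC enorm_axis gtr0_norm; [|lra]; move=> h1 h2.
  have -> : 1 < enorm w by lra.
  have -> : enorm w < 2 by lra.
  by rewrite mul1r.
Qed.

Let Lay (z : V) : \bar R := (\int[leb 1]_w ((enorm z < enorm w)%R%:R * rho (enorm w))%:E)%E.

(** Only the layer |z| < |w| < 2 |z| is used. It has length |z| times [sig], and on it a factor
    2^(n+2) passes from |z| to |w| in either regime of [rho]. *)
Let layer z : z != 0 -> ((`|K z|)%:E * sig <= (A * 2 ^+ n.+2)%:E * Lay z)%E.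
Proof.
move=> z0; have a0 : 0 < enorm z by rewrite enorm_gt0.
have an : (enorm z)^-1 != 0 by rewrite invr_eq0 gt_eqF.
have zn : enorm z != 0 by rewrite gt_eqF.
pose B (w : L) : R := (1 < (enorm z)^-1 * enorm w)%R%:R * ((enorm z)^-1 * enorm w < 2)%R%:R.
have B0 w : 0 <= B w by rewrite mulr_ge0.
have ms : mfun (fun w : L => ((1 < enorm w)%R%:R * (enorm w < 2)%R%:R : R)%:E) by mt.
have s0 (w : L) : (0 <= ((1 < enorm w)%R%:R * (enorm w < 2)%R%:R : R)%:E)%E by rewrite lee_fin mulr_ge0.
have mB : mfun (fun w => (B w)%:E) by rewrite /B; mt.
have es : (sig = ((enorm z)^-1)%:E * \int[leb 1]_w (B w)%:E)%E.
  apply: (etrans (ge0_integral_scalev an ms s0)); rewrite expr1 gtr0_norm ?invr_gt0//.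
  by congr (_ * _)%E; apply: eq_integral => w _; rewrite /B enormZ gtr0_norm ?invr_gt0.
have kz : (0 <= (`|K z| / enorm z)%:E)%E by rewrite lee_fin divr_ge0// enorm_ge0.
have A2 : (0 <= (A * 2 ^+ n.+2)%:E)%E by rewrite lee_fin mulr_ge0// exprn_ge0.
have mr : mfun (fun w : L => ((enorm z < enorm w)%R%:R * rho (enorm w))%:E) by have h := mrho; mt.
have r0 (w : L) : (0 <= ((enorm z < enorm w)%R%:R * rho (enorm w))%:E)%E by rewrite lee_fin mulr_ge0// rho0// enorm_ge0.
rewrite es muleA -EFinM /Lay -(ge0_intZl (leb 1) mB (fun w => B0 w : (0 <= (B w)%:E)%E) kz).
rewrite -(ge0_intZl (leb 1) mr r0 A2); apply: ge0_int_le; [by mt| |by mt|].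
  by move=> w; rewrite mule_ge0// lee_fin.
move=> w; rewrite -!EFinM lee_fin /B ltr_pdivlMl// ltr_pdivrMl// mulr1.
have [wz|_] := ltP (enorm z) (enorm w); last by rewrite !mul0r !mulr0.
have [w2|_] := ltP (enorm w) (enorm z * 2); last by rewrite !mulr0 mul1r mulr_ge0 ?rho0 ?enorm_ge0// mulr_ge0// exprn_ge0.
rewrite !mulr1 mul1r; have [h1 h2] := hK z0.
move: wz w2 h1 h2 a0 zn; move: (enorm w) (enorm z) (`|K z|) => t a q wz w2 h1 h2 a0 zn.
have t0 : 0 < t by exact: lt_trans wz.
have key j : (j <= n.+2)%N -> q <= A / a ^+ j.-1 -> (0 < j)%N -> q / a <= A * 2 ^+ n.+2 * (t ^+ j)^-1.
  case: j => // j jn qj _; rewrite /= in qj.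
  apply: (@le_trans _ _ (A / a ^+ j.+1)).
    by rewrite exprSr invfM mulrA ler_wpM2r// invr_ge0 ltW.
  rewrite -mulrA ler_wpM2l// ler_pdivlMr ?exprn_gt0// mulrC ler_pdivrMr ?exprn_gt0//.
  apply: (@le_trans _ _ (2 ^+ j.+1 * a ^+ j.+1)).
    by rewrite -exprMn lerXn2r ?nnegrE; [|lra|lra|lra].
  by rewrite ler_wpM2r ?exprn_ge0 ?(ltW a0)// ler_weXn2l// ler1n.
rewrite /rho; have [t1|t1] := ltP t 1.
  by rewrite mul0r addr0 mul1r; apply: key => //; rewrite expr1.
by rewrite mul0r add0r mul1r; apply: key.
Qed.

(** Insert [layer] and integrate in z first: the ball of radius |w| contributes at most lam (2
    |w|)^n, uniformly in e because the bound on balls holds at all radii. Against [rho] this is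
    integrable by W. *)
Lemma kernel_maximal : exists2 C2 : R, 0 <= C2 & forall (F : V -> R) (lam : R) u,
  mfun F -> (forall x, 0 <= F x) -> 0 <= lam ->
  (forall r : R, 0 < r ->
    (\int[leb n]_z ((enorm z < r)%R%:R * F (u - z))%:E <= (lam * (2 * r) ^+ n)%:E)%E) ->
  forall e : R, 0 < e -> (\int[leb n]_z (F (u - e *: z) * `|K z|)%:E <= (C2 * lam)%:E)%E.
Proof.
have sf : sig \is a fin_num by rewrite ge0_fin_numE// ltW// sig_gt0.
have Sf : S \is a fin_num by rewrite ge0_fin_numE//; apply: integral_ge0 => w _; rewrite lee_fin.
have s0 : 0 < fine sig by rewrite fine_gt0// sig_gt0 sig_fin.
have S0 : 0 <= fine S by apply: fine_ge0; apply: integral_ge0 => w _; rewrite lee_fin.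
exists (A * 2 ^+ n.+2 * 2 ^+ n * fine S / fine sig).
  apply: divr_ge0 (ltW s0); apply: mulr_ge0 => //; apply: mulr_ge0; last exact: exprn_ge0.
  by apply: mulr_ge0 => //; exact: exprn_ge0.
move=> F lam u mF F0 l0 hF e e0.
have mFu : mfun (fun z : V => F (u - e *: z)) by mt.
have mFK : mfun (fun z : V => (F (u - e *: z) * `|K z|)%:E) by mt.
have FK0 z : (0 <= (F (u - e *: z) * `|K z|)%:E)%E by rewrite lee_fin mulr_ge0.
suff key : (\int[leb n]_z (F (u - e *: z) * `|K z|)%:E * sig <= (A * 2 ^+ n.+2 * (2 ^+ n * lam * fine S))%:E)%E.
  rewrite -(lee_pmul2r sf) ?sig_gt0//; apply: le_trans key _.
  rewrite -[X in (_ <= _ * X)%E](fineK sf) -EFinM lee_fin; move: s0; move: (fine sig) (fine S) (2 ^+ n) (2 ^+ n.+2) => s S1 q1 q2 s0.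
  by apply: eq_ler; field; rewrite gt_eqF.
rewrite -(ge0_intZr (leb n) mFK FK0); last exact: ltW sig_gt0.
have A2 : (0 <= (A * 2 ^+ n.+2)%:E)%E by rewrite lee_fin mulr_ge0// exprn_ge0.
pose G (z : V) (w : L) : R := F (u - e *: z) * ((enorm z < enorm w)%R%:R * rho (enorm w)).
have G0 z w : (0 <= (G z w)%:E)%E by rewrite lee_fin mulr_ge0// mulr_ge0// rho0// enorm_ge0.
have mG : mfun (fun v : V * L => (G v.1 v.2)%:E).
  have h : mfun (fun v : V * L => rho (enorm v.2)) by rewrite /rho; mt.
  by rewrite /G; mt.
have mLay : mfun (fun z => (\int[leb 1]_w (G z w)%:E)%E).
  by apply: (@mf_intV R _ V 1 (fun z w => (G z w)%:E)).
have mr (z : V) : mfun (fun w : L => ((enorm z < enorm w)%R%:R * rho (enorm w))%:E) by have h := mrho; mt.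
have r0 (z : V) (w : L) : (0 <= ((enorm z < enorm w)%R%:R * rho (enorm w))%:E)%E by rewrite lee_fin mulr_ge0// rho0// enorm_ge0.
have GE z : (\int[leb 1]_w (G z w)%:E = (F (u - e *: z))%:E * Lay z)%E.
  have FE : (0 <= (F (u - e *: z))%:E)%E by rewrite lee_fin.
  by rewrite /Lay -(ge0_intZl (leb 1) (mr z) (r0 z) FE); apply: eq_integral => w _; rewrite -EFinM.
apply: (@le_trans _ _ (\int[leb n]_z ((A * 2 ^+ n.+2)%:E * \int[leb 1]_w (G z w)%:E))%E).
  apply: ae_ge0_le_integral => //.
  - by move=> z _; rewrite mule_ge0// ltW// sig_gt0.
  - by apply: mf_muleE => //; mt.
  - by move=> z _; rewrite mule_ge0//; apply: integral_ge0.
  - by apply: mf_muleE => //; mt.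
  exists [set 0]; split; [exact: measurable_set0v|exact: leb0_null|].
  move=> z nz; apply: contrapT => z0; apply: nz => _.
  rewrite GE (EFinM (F _)) -muleA [in leRHS]muleCA; apply: lee_wpmul2l; first by rewrite lee_fin.
  by apply: layer; apply/eqP.
rewrite (ge0_intZl (leb n) mLay _ A2); last by move=> z; apply: integral_ge0.
rewrite (EFinM (A * 2 ^+ n.+2)); apply: lee_wpmul2l => //.
rewrite (@tonelliV R n 1 (fun z w => (G z w)%:E)); [|by []|by []].
have ln : (0 <= (lam * 2 ^+ n)%:E)%E by rewrite lee_fin mulr_ge0// exprn_ge0.
have mWE : mfun (fun w => (W w)%:E) by have h := mW; mt.
have WE0 w : (0 <= (W w)%:E)%E by rewrite lee_fin.
apply: (@le_trans _ _ (\int[leb 1]_w ((lam * 2 ^+ n)%:E * (W w)%:E)%E)%E); last first.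
  rewrite (ge0_intZl (leb 1) mWE WE0 ln) -/S -[S]fineK// -EFinM lee_fin.
  by apply: eq_ler; rewrite [2 ^+ n * lam]mulrC.
apply: ge0_int_le; [|by move=> w; apply: integral_ge0|by mt|].
  apply: (@mf_intV R _ L n (fun w z => (G z w)%:E)) => //.
  have h : mfun (fun v : L * V => rho (enorm v.1)) by rewrite /rho; mt.
  by rewrite /G; mt.
move=> w; have w0 := enorm_ge0 w.
have mI : mfun (fun z : V => ((enorm z < enorm w)%R%:R * F (u - e *: z))%:E) by mt.
have I0 (z : V) : (0 <= ((enorm z < enorm w)%R%:R * F (u - e *: z))%:E)%E by rewrite lee_fin mulr_ge0.
have rE : (0 <= (rho (enorm w))%:E)%E by rewrite lee_fin rho0.
have -> : (\int[leb n]_z (G z w)%:E = (rho (enorm w))%:E * \int[leb n]_z ((enorm z < enorm w)%R%:R * F (u - e *: z))%:E)%E.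
  rewrite -(ge0_intZl (leb n) mI I0 rE); apply: eq_integral => z _; rewrite -EFinM /G; congr EFin.
  by move: (rho _) (F _) => a b; ring.
have [wp|] := ltP 0 (enorm w); last first.
  move=> wn; have {wn} we : enorm w = 0 by apply/eqP; rewrite eq_le wn.
  rewrite (eq_integral (cst 0%E)); first by rewrite integral0 mule0 mule_ge0.
  by move=> z _; rewrite we ltNge enorm_ge0 mul0r.
have en : e != 0 by rewrite gt_eqF.
have mH : mfun (fun y : V => ((enorm y < e * enorm w)%R%:R * F (u - y))%:E) by mt.
have H0 (y : V) : (0 <= ((enorm y < e * enorm w)%R%:R * F (u - y))%:E)%E by rewrite lee_fin mulr_ge0.
have hI : (\int[leb n]_z ((enorm z < enorm w)%R%:R * F (u - e *: z))%:E <= (lam * (2 * enorm w) ^+ n)%:E)%E.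
  have en0 : (0 < (e ^+ n)%:E)%E by rewrite lte_fin exprn_gt0.
  rewrite -(lee_pmul2l _ en0)//; have := hF _ (mulr_gt0 e0 wp).
  rewrite (ge0_integral_scalev en mH H0) (gtr0_norm e0) -EFinM.
  have -> : e ^+ n * (lam * (2 * enorm w) ^+ n) = lam * (2 * (e * enorm w)) ^+ n.
    by rewrite mulrCA -exprMn; congr (_ * _ ^+ _); ring.
  apply: le_trans; apply: lee_wpmul2l; first exact: ltW.
  rewrite le_eqVlt; apply/orP; left; apply/eqP; apply: eq_integral => z _.
  by rewrite enormZ (gtr0_norm e0) ltr_pM2l.
apply: le_trans (lee_wpmul2l rE hI) _; rewrite -!EFinM lee_fin /rho /W exprMn.
move: wp; move: (enorm w) => t t0.
have t2 : t ^+ 2 != 0 by rewrite expf_neq0// gt_eqF.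
have tn : t ^+ n != 0 by rewrite expf_neq0// gt_eqF.
have q0 : 0 <= 2 ^+ n :> R by rewrite exprn_ge0.
have [t1|t1] := ltP t 1.
  rewrite !mul0r !addr0 mul1r mulr1 [leLHS](_ : _ = lam * 2 ^+ n * t ^+ k); last first.
    have -> : t ^+ n = t ^+ 2 * t ^+ k by rewrite -exprD.
    by move: (t ^+ k) (t ^+ 2) t2 (2 ^+ _) => a b b0 c; field.
  rewrite -[leRHS]mulr1; apply: ler_wpM2l; first exact: mulr_ge0.
  by apply: exprn_ile1; exact: ltW.
rewrite !mul0r !add0r !mul1r; have -> : t ^+ n.+2 = t ^+ n * t ^+ 2 by rewrite -exprD addn2.
by move: (t ^+ n) (t ^+ 2) (2 ^+ n) tn t2 => a b c a0 b0; apply: eq_ler; field; rewrite ?a0 ?b0.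
Qed.

End kernel_maximal.

(** A point where Q fails for all j >= k lies in every N j with j >= k, and these measures tend to
    0. The bound B / (j + 1) is not summable, so only infinitely many j are obtained; that is enough
    when Q j is a bound which improves with j. *)
Lemma ae_of_small {R : realType} n (Q : nat -> 'rV[R]_n -> Prop) (B : R) :
  (forall j, exists N, [/\ measurable N, (leb n N <= (B / j.+1%:R)%:E)%E & forall u, ~ N u -> Q j u]) ->
  {ae leb n, forall u, forall k, exists2 j, (k <= j)%N & Q j u}.
Proof.
move=> /choice[N hN].
have mN j : measurable (N j) by have [] := hN j.
have : (leb n).-negligible (\bigcup_k \bigcap_(j in [set j | (k <= j)%N]) N j).
  apply: negligible_bigcup => k.
  have mI : measurable (\bigcap_(j in [set j | (k <= j)%N]) N j) by apply: bigcap_measurable => //; exists k => /=.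
  apply/(negligibleP _ mI)/eqP; rewrite eq_le measure_ge0 andbT.
  apply/lee_addgt0Pr => d d0; rewrite add0e.
  pose j := maxn k (Num.bound (`|B| / d)).
  have [_ hj _] := hN j; apply: le_trans (le_trans _ hj) _.
    by apply: le_measure; rewrite ?inE// => x; apply; rewrite /= leq_maxl.
  rewrite lee_fin ler_pdivrMr// mulrC -ler_pdivrMr//.
  apply: (@le_trans _ _ (`|B| / d)); first by rewrite ler_wpM2r ?invr_ge0 ?(ltW d0)// ler_norm.
  apply: le_trans (ltW (archi_boundP _)) _; first by rewrite divr_ge0// ltW.
  by rewrite ler_nat leqW// leq_maxr.
apply: negligibleS => u /= nu; apply: contrapT => h; apply: nu => k.
apply: contrapT => nk; apply: h; exists k => //= j kj.
by apply: contrapT => nj; apply: nk; exists j => //; have [_ _ hQ] := hN j; exact: hQ.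
Qed.

(** * Convergence almost everywhere of the convolutions *)

Section almost_everywhere.
Context {R : realType} {k : nat}.
Local Notation n := k.+2.
Local Notation V := 'rV[R]_n.
Variables (K : V -> R) (A : R).
Hypothesis mK : mfun K.
Hypothesis fK : finint (leb n) K.
Hypothesis A0 : 0 <= A.
Hypothesis hK : forall z, z != 0 -> `|K z| <= A / enorm z /\ `|K z| <= A / enorm z ^+ n.+1.
Let c : R := \int[leb n]_z K z.
Let C := Kmass K.
Variables (f : V -> R) (p : R).
Hypothesis p1 : 1 <= p.
Hypothesis mf : mfun f.
Hypothesis fp : (pint p f < +oo)%E.

Let D_le (g : V -> R) (d : R) : mfun g -> 0 < d -> (pint p g <= (d `^ p * d)%:E)%E ->
  (leb n [set x : V | (d < `|g x|)%R] <= d%:E)%E.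
Proof.
move=> mg d0 hg; have dp : 0 < d `^ p by rewrite powR_gt0.
have p0 : 0 <= p by apply: le_trans p1.
have mD : measurable [set x : V | d < `|g x|] by mt.
have dE : (0 < (d `^ p)%:E)%E by rewrite lte_fin.
rewrite -(lee_pmul2l _ dE)// -EFinM; apply: le_trans hg.
have mi : mfun (fun x : V => (\1_[set x : V | d < `|g x|] x : R)) := mf_indic1 mD.
have miE : mfun (fun x : V => (\1_[set x : V | d < `|g x|] x : R)%:E) by mt.
rewrite -[X in leb n X]setIT -integral_indic ?setIT//.
rewrite -(ge0_intZl (leb n) miE _ (ltW dE)); last by move=> x; rewrite lee_fin.
apply: ge0_int_le; [by mt|by move=> x; rewrite mule_ge0 ?lee_fin ?(ltW dp)|by mt|].
move=> x; rewrite -EFinM lee_fin indicE; have [xD|xD] := ltP d `|g x|.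
  by rewrite mem_set// mulr1 ge0_ler_powR ?nnegrE// ?(ltW d0)// ltW.
rewrite memNset; last by rewrite /= ltNge xD.
by rewrite mulr0 powR_ge0.
Qed.

Let unif_lip (g : V -> R) (L : R) : (forall x y : V, `|g x - g y| <= L * enorm (x - y)) ->
  forall d : R, 0 < d -> exists2 t : R, 0 < t & forall x h : V, enorm h < t -> `|g (x - h) - g x| <= d.
Proof.
move=> gL d d0; have L1 : 0 < `|L| + 1 by rewrite ltr_wpDl.
exists (d / (`|L| + 1)) => [|x h]; first by rewrite divr_gt0.
rewrite ltr_pdivlMr// => hd; apply: le_trans (gL _ _) _.
rewrite addrAC subrr add0r enormN; apply: le_trans (ltW hd); rewrite mulrC ler_wpM2l ?enorm_ge0//.
by apply: le_trans (ler_norm _) _; rewrite lerDl.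
Qed.

(** Write f = g + r with g Lipschitz of bounded support and [pint p r <= d^p * d]. Away from the
    sets where |r| > d or where the maximal function of |r|^p is large, of total measure O(d), the
    convolution of r is O(d) by [split_bound] and [kernel_maximal], while g converges uniformly. The
    extra factor d in the bound on r pays for the measure. *)
Lemma small_exception : exists2 D : R, 0 <= D & forall d : R, 0 < d -> exists N,
  [/\ measurable N, (leb n N <= ((@vconst R n + 1) * d)%:E)%E &
  forall u, ~ N u -> exists2 e0 : R, 0 < e0 & forall e, 0 < e < e0 -> `|econv K e f u - c * f u| <= D * d].
Proof.
have [C2 C20 hC2] := kernel_maximal mK A0 hK; have C0 : 0 < C := Kmass_gt0 K.
(* C + C2 for the convolution of r, 1 for g, and C for the term c r. *)
exists (2 * C + C2 + 1) => [|d d0]; first by rewrite !addr_ge0// mulr_ge0// ltW.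
have dp : 0 < d `^ p by rewrite powR_gt0.
have dp1 : 0 < d `^ (p - 1) by rewrite powR_gt0.
have [g [M [L [N [M0 N0 [mg gM gL _] hg]]]]] := Lp_density p1 mf fp (mulr_gt0 dp d0).
pose r x := f x - g x.
have mr : mfun r by rewrite /r; mt.
pose F x := `|r x| `^ p.
have mF : mfun F by rewrite /F; mt.
have F0 x : 0 <= F x by exact: powR_ge0.
have [E [mE lE hE]] := maximal_set mF F0 dp.
have mD : measurable [set x : V | d < `|r x|] by mt.
exists (E `|` [set x : V | d < `|r x|]); split; first exact: measurableU.
  apply: le_trans (measureU2 _ mE mD) _; rewrite mulrDl mul1r EFinD; apply: leeD; last exact: D_le.
  have v0 : (0 <= (@vconst R n / d `^ p)%:E)%E by rewrite lee_fin divr_ge0 ?vconst_ge0// ltW.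
  apply: le_trans lE _; apply: le_trans (lee_wpmul2l v0 hg) _.
  rewrite -EFinM lee_fin; move: (vconst) => v; move: dp; move: (d `^ p) => a a0.
  by apply: eq_ler; field; rewrite gt_eqF.
move=> u /not_orP[uE /negP]; rewrite -leNgt => uD.
have h1 e : 0 < e -> (\int[leb n]_z (F (u - e *: z) * `|K z|)%:E <= (C2 * d `^ p)%:E)%E.
  by move=> e0; apply: hC2 => //; [exact: ltW|exact: hE].
have [e0 e00 he0] := econv_sup mK fK A0 hK mg gM (unif_lip gL) d0.
exists e0 => // e /[dup] ee /andP[ep _].
have mre : mfun (fun z : V => r (u - e *: z)) by mt.
have mrK : mfun (fun z : V => r (u - e *: z) * K z) by mt.
have mgK : mfun (fun z : V => g (u - e *: z) * K z) by mt.
have mge : mfun (fun z : V => g (u - e *: z)) by mt.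
have frK : finint (leb n) (fun z : V => r (u - e *: z) * K z).
  by apply: (jensen_finint mK fK p1 mre); exact: le_lt_trans (h1 e ep) (ltry _).
have fgK : finint (leb n) (fun z : V => g (u - e *: z) * K z).
  exact: (finint_bounded mK fK mge (fun z => gM _)).
have es : econv K e f u = \int[leb n]_z (r (u - e *: z) * K z) + econv K e g u.
  rewrite -(RintD mrK frK mgK fgK); apply: eq_Rintegral => z _.
  by rewrite -mulrDl /r subrK.
have b1 : `|\int[leb n]_z (r (u - e *: z) * K z)| <= (C + C2) * d.
  rewrite -lee_fin; apply: le_trans (norm_Rint_leE (leb n) mrK) _.
  have sb := split_bound mK fK p1 mre d0.
  have i0 : (0 <= ((d `^ (p - 1))^-1)%:E)%E by rewrite lee_fin invr_ge0 ltW.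
  have {}sb := le_trans sb (leeD2l _ (lee_wpmul2l i0 (h1 e ep))).
  rewrite (eq_integral (fun z : V => (`|r (u - e *: z)| * `|K z|)%:E)); last by move=> z _; rewrite normrM.
  apply: le_trans sb _; rewrite -EFinM -EFinD lee_fin (powR_split p1 (ltW d0)) -/C.
  by move: dp1; move: (d `^ (p - 1)) => a a0; apply: eq_ler; field; rewrite gt_eqF.
have b2 : `|c * r u| <= C * d.
  by rewrite normrM ler_pM//; exact: (norm_c_le mK fK).
have b3 := he0 e u ee.
have -> : econv K e f u - c * f u = \int[leb n]_z (r (u - e *: z) * K z) + (econv K e g u - c * g u) - c * r u.
  by rewrite es /r; move: (\int[_]_z _) (econv _ _ _ _) => a b; ring.
apply: le_trans (ler_normB _ _) _; apply: le_trans (lerD (ler_normD _ _) (lexx _)) _.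
apply: le_trans (lerD (lerD b1 b3) b2) _; apply: eq_ler; ring.
Qed.

Lemma econv_ae : {ae leb n, forall u, forall d : R, 0 < d ->
  exists2 e0 : R, 0 < e0 & forall e, 0 < e < e0 -> `|econv K e f u - c * f u| <= d}.
Proof.
have [D D0 hD] := small_exception.
have h : {ae leb n, forall u, forall i, exists2 j, (i <= j)%N &
   exists2 e0 : R, 0 < e0 & forall e, 0 < e < e0 -> `|econv K e f u - c * f u| <= D / j.+1%:R}.
  apply: (@ae_of_small R n (fun j u => exists2 e0 : R, 0 < e0 & forall e, 0 < e < e0 -> `|econv K e f u - c * f u| <= D / j.+1%:R) (@vconst R n + 1)) => j.
  by apply: hD; rewrite invr_gt0.
apply: filterS h => u h d d0.
have [j ij [e0 e00 he]] := h (Num.bound (D / d)).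
exists e0 => // e ee; apply: le_trans (he e ee) _.
rewrite ler_pdivrMr// mulrC -ler_pdivrMr//.
apply: le_trans (ltW (archi_boundP _)) _; first by rewrite divr_ge0// ltW.
by rewrite ler_nat; exact: leqW.
Qed.

End almost_everywhere.

(** * Continuous functions vanishing at infinity *)

Section vanishing_at_infinity.
Context {R : realType} {n : nat}.
Local Notation V := 'rV[R]_n.
Variable phi : V -> R.
Hypothesis cphi : continuous phi.
Hypothesis phi0 : forall e : R, 0 < e -> exists M : R, forall x, M < enorm x -> `|phi x| < e.

Let box (r : R) : set V := [set v : V | forall i, `[- r, r]%classic (v ord0 i)].

Let box_compact r : compact (box r).
Proof. by apply: (@rV_compact R n (fun=> `[- r, r]%classic)) => i; exact: segment_compact. Qed.

Let out_box r x : ~ box r x -> r < enorm x.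
Proof.
move=> nb; rewrite ltNge; apply/negP => xr; apply: nb => i /=; rewrite in_itv /= -ler_norml.
exact: le_trans (coord_le_enorm _ _) xr.
Qed.

Lemma C0_bounded : exists M : R, forall x, `|phi x| <= M.
Proof.
have [r hr] := phi0 ltr01.
have [M hM] : exists M : R, box r `<=` [set x | `|phi x| <= M].
  apply: (@filter_ex _ (+oo%R : set_system R)).
  suff H : forall x : V, box r x -> \forall x' \near x & M \near +oo%R, `|phi x'| <= M.
    exact: (proj1 (compact_near_coveringP _) (@box_compact r) R (+oo%R : set_system R) (fun M x => `|phi x| <= M) _ H).
  move=> x _; have /cvgrPdist_lt/(_ 1 ltr01) h := @cphi x.
  exists ([set y | `|phi x - phi y| < 1], [set M | `|phi x| + 1 <= M]) => /=.
    by split => //; exact: nbhs_pinfty_ge.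
  move=> [y M] [/= h1 h2]; have := lerB_dist (phi y) (phi x); rewrite distrC.
  by move: h1 h2; move: (`|phi x - phi y|) (`|phi y|) (`|phi x|) => a b c; lra.
exists (Num.max M 1) => x; have [bx|bx] := pselect (box r x).
  by rewrite le_max hM.
by rewrite le_max orbC ltW// hr// out_box.
Qed.

Lemma C0_unif_cont (d : R) : 0 < d ->
  exists2 t : R, 0 < t & forall x h, enorm h < t -> `|phi (x - h) - phi x| <= d.
Proof.
move=> d0; have d20 : 0 < d / 2 by rewrite divr_gt0.
have [M hM] := phi0 d20.
pose P (t : R) (x : V) := forall h, enorm h < t -> `|phi (x - h) - phi x| <= d.
(* The margin 1, together with |h| < 1, keeps x - h outside the ball of radius M when x is outside
   the box. *)
have [t [ht t0]] : exists t : R, box (M + 1) `<=` P t /\ 0 < t.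
  apply: (@filter_ex _ (0^'+ : set_system R)); apply: filterI; last exact: nbhs_right_gt.
  suff H : forall x : V, box (M + 1) x -> \forall x' \near x & t \near 0^'+, P t x'.
    exact: (proj1 (compact_near_coveringP _) (@box_compact (M + 1)) R (0^'+ : set_system R) P _ H).
  move=> x _; have /cvgrPdist_lt/(_ _ d20)/nbhs_ballP[e /= e0 he] := @cphi x.
  have e20 : 0 < e / 2 by rewrite divr_gt0.
  exists (ball x (e / 2), [set t | t < e / 2]) => /=.
    by split; [exact: nbhsx_ballx|exact: nbhs_right_lt].
  move=> [y t] [/= xy te] h hh.
  have h1 : `|phi x - phi y| < d / 2 by apply: he; apply: le_ball xy; lra.
  have h2 : `|phi x - phi (y - h)| < d / 2.
    apply: he; split=> // i j; rewrite -ball_normE /= !mxE; have := xy.2 i j; rewrite -ball_normE /= => a.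
    have b := le_lt_trans (coord_le_enorm h j) hh.
    have -> : x i j - (y i j - h i j) = (x i j - y i j) + h i j by ring.
    rewrite !ord1 in a *; apply: le_lt_trans (ler_normD _ _) _; lra.
  have -> : phi (y - h) - phi y = (phi x - phi y) - (phi x - phi (y - h)) by ring.
  by apply: le_trans (ler_normB _ _) _; lra.
exists (Num.min t 1) => [|x h]; first by rewrite lt_min t0/=.
rewrite lt_min => /andP[h1 h2]; have [bx|bx] := pselect (box (M + 1) x); first exact: ht.
have xM := out_box bx; have a1 := hM x ltac:(lra).
have xh : M < enorm (x - h) by have := ler_enorm_dist x h; lra.
have a2 := hM _ xh; apply: le_trans (ler_normB _ _) _; lra.
Qed.

End vanishing_at_infinity.

(** * Riesz potentials of L^p functions and their truncated differences *)

Section riesz_potential.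
Context {R : realType} {k : nat}.
Local Notation n := k.+2.
Local Notation V := 'rV[R]_n.
Implicit Types (psi : V -> R) (u x y z : V).

Definition goodpt psi u : Prop := (\int[leb n]_y (`|psi (u + y)| * (enorm y)^-1)%:E < +oo)%E.
Definition riesz psi u : R := \int[leb n]_y (psi (u + y) * (enorm y)^-1).

Let near_w y : R := (enorm y < 1)%R%:R / enorm y ^+ 1.

Let near_w0 y : 0 <= near_w y.
Proof. by rewrite /near_w divr_ge0// exprn_ge0// enorm_ge0. Qed.

Let mnear : mfun near_w. Proof. by rewrite /near_w; mt. Qed.

Variables (psi : V -> R) (p : R).
Hypotheses (p1 : 1 <= p) (p_lt : p < n%:R / k.+1%:R) (mpsi : mfun psi) (fp : (pint p psi < +oo)%E).

Let near_mass u : \bar R := (\int[leb n]_y (near_w y * `|psi (u + y)| `^ p)%:E)%E.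

Let young_far (a b : R) : 0 <= a -> 0 < b -> b <= 1 -> 1 < p -> a * b <= a `^ p + b `^ (p / (p - 1)).
Proof.
move=> a0 b0 b1 pp; have p10 : 0 < p - 1 by lra.
have [h|h] := leP b (a `^ (p - 1)).
  by apply: ler_wpDr; rewrite ?powR_ge0// (powR_split p1 a0) mulrC ler_wpM2r.
apply: ler_wpDl; rewrite ?powR_ge0//.
have ab : a <= b `^ (p - 1)^-1.
  have -> : a = (a `^ (p - 1)) `^ (p - 1)^-1 by rewrite -powRrM divff ?powRr1// gt_eqF.
  by apply: ge0_ler_powR; rewrite ?nnegrE ?powR_ge0 ?invr_ge0 ?(ltW p10) ?(ltW b0) ?(ltW h).
have -> : p / (p - 1) = (p - 1)^-1 + 1 by field; rewrite gt_eqF.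
rewrite powRD; last by rewrite (gt_eqF b0) implybT.
by rewrite powRr1 ?(ltW b0)// ler_wpM2r// ltW.
Qed.

(** Young's inequality with b^-1. For p = 1 there is no finite conjugate exponent, [p / (p - 1)]
    being 0 by convention; the indicator of 1 < p removes that term. *)
Let far_le (a b : R) : 0 <= a -> 1 <= b -> a / b <= a `^ p + (1 < p)%R%:R * b `^ (- (p / (p - 1))).
Proof.
move=> a0 b1; have b0 : 0 < b by lra.
have bi0 : 0 < b^-1 by rewrite invr_gt0.
have bi1 : b^-1 <= 1 by rewrite invf_le1.
have [pp|pp] := ltP 1 p.
  rewrite mul1r; apply: le_trans (young_far a0 bi0 bi1 pp) _.
  by rewrite -powR_inv1 ?(ltW b0)// -powRrM mulN1r.
have -> : p = 1 by apply/eqP; rewrite eq_le pp.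
by rewrite powRr1// mul0r addr0 ler_piMr.
Qed.

(** Near 0, [|psi| <= 1 + |psi|^p]. Far away, Young's inequality leaves |psi|^p and |y|^-p', where
    p' = p / (p - 1); the latter is integrable at infinity because p' > n, which is the hypothesis p
    < n / (n - 1). *)
Lemma goodpt_near u : (near_mass u < +oo)%E -> goodpt psi u.
Proof.
move=> hu; rewrite /goodpt.
have p0 : 0 <= p by apply: le_trans p1.
pose far y : R := (1 <= enorm y)%R%:R * enorm y `^ (- (p / (p - 1))).
have far0 y : 0 <= far y by rewrite mulr_ge0// powR_ge0.
have mfar : mfun far by rewrite /far; mt.
have mps : mfun (fun y => `|psi (u + y)| `^ p) by mt.
pose b y : R := near_w y + near_w y * `|psi (u + y)| `^ p + (`|psi (u + y)| `^ p + (1 < p)%R%:R * far y).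
apply: (@le_lt_trans _ _ (\int[leb n]_y (b y)%:E)%E).
  apply: ge0_int_le; [by mt|by move=> y; rewrite lee_fin mulr_ge0 ?invr_ge0 ?enorm_ge0|by rewrite /b; mt|].
  move=> y; rewrite lee_fin /b; have w0 := near_w0 y; have f0 := far0 y.
  have q0 := powR_ge0 `|psi (u + y)| p.
  have [y1|y1] := ltP (enorm y) 1.
    have -> : near_w y = (enorm y)^-1 by rewrite /near_w y1 expr1 mul1r.
    have i0 : 0 <= (enorm y)^-1 by rewrite invr_ge0 enorm_ge0.
    have h : `|psi (u + y)| <= 1 + `|psi (u + y)| `^ p.
      by have := young_split p1 (normr_ge0 (psi (u + y))) ltr01; rewrite powR1 divr1.
    apply: (@le_trans _ _ ((1 + `|psi (u + y)| `^ p) * (enorm y)^-1)); first by rewrite ler_wpM2r.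
    rewrite mulrDl mul1r [X in _ + X]mulrC lerDl addr_ge0// mulr_ge0//.
  apply: le_trans (far_le (normr_ge0 _) y1) _.
  by rewrite /far y1 mul1r lerDr addr_ge0// mulr_ge0.
have e : (\int[leb n]_y (b y)%:E = \int[leb n]_y (near_w y)%:E + near_mass u + (pint p psi + (1 < p)%R%:R%:E * \int[leb n]_y (far y)%:E))%E.
  have mw := mnear; have r0 : (0 <= ((1 < p)%R%:R : R)%:E)%E by rewrite lee_fin.
  have mfE : mfun (fun y => (far y)%:E) by mt.
  have fE0 y : (0 <= (far y)%:E)%E by rewrite lee_fin.
  rewrite -(ge0_intZl (leb n) mfE fE0 r0).
  have -> : (pint p psi = \int[leb n]_y (`|psi (u + y)| `^ p)%:E)%E.
    have mq : mfun (fun y => (`|psi y| `^ p)%:E) by mt.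
    have q0 y : (0 <= (`|psi y| `^ p)%:E)%E by rewrite lee_fin powR_ge0.
    rewrite /pint -(ge0_integral_shiftv u mq q0); apply: eq_integral => y _.
    by rewrite addrC.
  rewrite /near_mass -!ge0_intD.
  1: by apply: eq_integral => y _; rewrite -!EFinM -!EFinD.
  all: try by mt.
  all: try (move=> y; rewrite -?EFinM -?EFinD lee_fin; by
    repeat first [exact: near_w0 | exact: far0 | exact: powR_ge0 | exact: ler0n | apply: addr_ge0 | apply: mulr_ge0]).
rewrite e; apply: lte_add_pinfty; apply: lte_add_pinfty => //.
  exact: (rad_in (n := n)).
have [pp|pp] := ltP 1 p; last by rewrite mul0e.
rewrite mul1e; apply: rad_out.
have p10 : 0 < p - 1 by lra.
have nE : n%:R = k.+1%:R + 1 :> R by rewrite -natr1.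
rewrite ltr_pdivlMr//; move: p_lt; rewrite ltr_pdivlMr// nE; move: (k.+1%:R : R) => q.
lra.
Qed.

Let nearE : (\int[leb n]_y (near_w y)%:E < +oo)%E.
Proof. exact: (rad_in (n := n)). Qed.

(** [near_mass] convolves the integrable |psi|^p with an integrable weight, so by Tonelli it is
    finite almost everywhere. *)
Lemma goodpt_ae : {ae leb n, forall u, goodpt psi u}.
Proof.
have mm : mfun (fun v : V * V => (near_w v.2 * `|psi (v.1 + v.2)| `^ p)%:E).
  have h : mfun (fun v : V * V => near_w v.2) by rewrite /near_w; mt.
  by mt.
have m0 u y : (0 <= (near_w y * `|psi (u + y)| `^ p)%:E)%E by rewrite lee_fin mulr_ge0// powR_ge0.
have h : {ae leb n, forall u, (near_mass u < +oo)%E}.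
  apply: ae_fin; first by apply: (@mf_intV R _ V n (fun u y => (near_w y * `|psi (u + y)| `^ p)%:E)).
    by move=> u; apply: integral_ge0.
  rewrite /near_mass (@tonelliV R n n (fun u y => (near_w y * `|psi (u + y)| `^ p)%:E))//.
  have mq : mfun (fun y => (`|psi y| `^ p)%:E) by mt.
  have q0 y : (0 <= (`|psi y| `^ p)%:E)%E by rewrite lee_fin powR_ge0.
  have e y : (\int[leb n]_u (near_w y * `|psi (u + y)| `^ p)%:E = (near_w y)%:E * pint p psi)%E.
    have w0 : (0 <= (near_w y)%:E)%E by rewrite lee_fin.
    rewrite /pint -(ge0_integral_shiftv y mq q0) -ge0_intZl//; last by mt.
  have mwE : mfun (fun y => (near_w y)%:E) by have h := mnear; mt.
  under eq_integral do rewrite e.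
  rewrite (ge0_intZr (leb n) mwE (fun y => near_w0 y : (0 <= (near_w y)%:E)%E) (pint_ge0 p psi)).
  by rewrite lte_mul_pinfty// ?integral_ge0//; [move=> y _; rewrite lee_fin|rewrite ge0_fin_numE// integral_ge0// => y _; rewrite lee_fin].
by apply: filterS h => u; exact: goodpt_near.
Qed.

Lemma goodpt_bounded (B : R) : (forall x, `|psi x| <= B) -> forall u, goodpt psi u.
Proof.
move=> hB u; apply: goodpt_near; have mw := mnear.
have p0 : 0 <= p by apply: le_trans p1.
have mwE : mfun (fun y => (near_w y)%:E) by mt.
have B0 : 0 <= B by apply: le_trans (hB 0).
have BE : (0 <= (B `^ p)%:E)%E by rewrite lee_fin powR_ge0.
have mps : mfun (fun y => `|psi (u + y)| `^ p) by mt.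
apply: (@le_lt_trans _ _ (\int[leb n]_y ((B `^ p)%:E * (near_w y)%:E))%E).
  apply: ge0_int_le; [by mt|by move=> y; rewrite lee_fin mulr_ge0// powR_ge0|by mt|].
  by move=> y; rewrite -EFinM lee_fin mulrC ler_wpM2r// ge0_ler_powR ?nnegrE.
rewrite (ge0_intZl (leb n) mwE (fun y => near_w0 y : (0 <= (near_w y)%:E)%E) BE).
rewrite lte_mul_pinfty//.
Qed.

End riesz_potential.

Section total_scaling.
Context d {T : measurableType d} {R : realType} (mu : {measure set T -> \bar R}).

Lemma Rint_notfin (f : T -> R) : mfun f -> ~ finint mu f -> \int[mu]_x f x = 0.
Proof.
move=> mf nf; have h : ~~ ((\int[mu]_x (f x)%:E)%E \is a fin_num).
  apply/negP => h; apply: nf; rewrite /finint.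
  by have := integral_fin_num_abs mu measurableT mf; rewrite h.
by rewrite /Rintegral; move: h; case: (integral _ _ _).
Qed.

(** A function that is not integrable has real integral 0 by default, and for c <> 0 the multiple by
    c is not integrable either. *)
Lemma RintZ_total (c : R) (f : T -> R) : mfun f -> \int[mu]_x (c * f x) = c * \int[mu]_x f x.
Proof.
move=> mf; have [->|c0] := eqVneq c 0.
  rewrite mul0r /Rintegral (eq_integral (cst 0%E)) ?integral0//.
  by move=> x _; rewrite mul0r.
have [ff|nf] := pselect (finint mu f); first exact: RintZ.
have mcf : mfun (fun x => c * f x) by mt.
rewrite (Rint_notfin mf nf) mulr0; apply: Rint_notfin => // fc; apply: nf.
by apply: (finint_le mf _ (finintZ c^-1 mcf fc)) => [|x]; [mt|rewrite mulKf].
Qed.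

End total_scaling.

Lemma ae_affine {R : realType} n (P : 'rV[R]_n -> Prop) (u : 'rV[R]_n) (c : R) : c != 0 ->
  {ae leb n, forall x, P x} -> {ae leb n, forall y, P (u + c *: y)}.
Proof.
move=> c0 [N [mN N0 sN]].
have mh : mfun (fun y : 'rV[R]_n => u + c *: y) by mt.
have mN' : measurable ((fun y : 'rV[R]_n => u + c *: y) @^-1` N).
  by rewrite -[X in measurable X]setTI; exact: mh.
exists ((fun y => u + c *: y) @^-1` N); split => //; last by move=> y /= h; exact: sN.
have mi : mfun (fun x : 'rV[R]_n => (\1_N x : R)) := mf_indic1 mN.
have miE : mfun (fun x : 'rV[R]_n => (\1_N x : R)%:E) by mt.
have miu : mfun (fun x : 'rV[R]_n => (\1_N (x + u) : R)%:E).
  have mxu : mfun (fun x : 'rV[R]_n => x + u) by mt.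
  exact: (measurableT_comp miE mxu).
have i0 x : (0 <= ((\1_N x : R)%:E))%E by rewrite lee_fin.
have e1 : (\int[leb n]_x (\1_N x : R)%:E = 0)%E by rewrite integral_indic// setIT.
have := ge0_integral_scalev c0 miu (fun x => i0 (x + u)).
rewrite (ge0_integral_shiftv u miE i0) e1 => /esym/eqP.
rewrite mule_eq0 eqe expf_eq0 normr_eq0 (negbTE c0) andbF /= => /eqP h.
rewrite -h -[X in leb n X]setIT -integral_indic//; apply: eq_integral => y _.
by rewrite !indicE /= addrC; congr (_%:R)%:E; congr nat_of_bool; apply/idP/idP => /set_mem/mem_set.
Qed.

(** * Truncated integrals as convolutions *)

Section truncation.
Context {R : realType} {k : nat} (l : nat).
Local Notation n := k.+2.
Local Notation V := 'rV[R]_n.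
Implicit Types (u x y z : V).

Let far y : R := (1 < enorm y)%R%:R * pw y.
Let far0 y : 0 <= far y. Proof. by rewrite mulr_ge0// pw_ge0. Qed.
Let mfar : mfun far. Proof. by have h := @mf_pw R k.+1; rewrite /far; mt. Qed.

Let cf_ge1 j : (j <= l)%N -> 1 <= `|cf l j| :> R.
Proof. by move=> jl; rewrite /cf normrM normrX normrN1 expr1n mulr1 normr_nat ler1n bin_gt0. Qed.

(** The coefficients are at least 1 in absolute value, so the integrability of the sum passes to
    each term. *)
Let term_le z y j : (j <= l)%N -> (enorm (z - j%:R *: y))^-1 <= Sabs l z y.
Proof.
move=> jl; have jl1 : (j < l.+1)%N by [].
rewrite /Sabs (bigD1 (Ordinal jl1))//=.
have i0 i : 0 <= `|cf l i| * (enorm (z - i%:R *: y))^-1 :> R by rewrite mulr_ge0// invr_ge0 enorm_ge0.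
apply: ler_wpDr; first by apply: sumr_ge0.
by rewrite ler_peMl ?cf_ge1// invr_ge0 enorm_ge0.
Qed.

Let Sabs_nneg z y : 0 <= Sabs l z y :> R.
Proof. by apply: sumr_ge0 => i _; rewrite mulr_ge0// invr_ge0 enorm_ge0. Qed.

Section unit_truncation.
Variable phi : V -> R.
Hypothesis mphi : mfun phi.
Hypothesis fphi : (\int[leb n]_z (`|phi z| * (enorm z)^-1)%:E < +oo)%E.

Let H y z : R := far y * (phi z * Sy l z y).
Let Ha y z : R := far y * (phi z * Sabs l z y).

Let mfar1 : mfun (fun v : V * V => far v.1).
Proof. exact: measurableT_comp mfar measurable_fst. Qed.
Let mphi2 : mfun (fun v : V * V => phi v.2).
Proof. exact: measurableT_comp mphi measurable_snd. Qed.

Let mH : mfun (fun v : V * V => H v.1 v.2).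
Proof.
apply: mf_mulr => //; apply: mf_mulr => //; apply: mf_Sy; [exact: measurable_snd|exact: measurable_fst].
Qed.
Let mHa : mfun (fun v : V * V => Ha v.1 v.2).
Proof.
apply: mf_mulr => //; apply: mf_mulr => //; apply: mf_Sabs; [exact: measurable_snd|exact: measurable_fst].
Qed.

(** Integrating in y first gives at most [A / |z|] by [Kabs_bound], so the double integral is at
    most A times the assumed finite one. *)
Let Ha_fin : (\int[leb n]_y \int[leb n]_z (`|Ha y z|)%:E < +oo)%E.
Proof.
have mHn : mfun (fun v : V * V => (`|Ha v.1 v.2|)%:E).
  exact: mf_EFin (measurableT_comp (@normr_measurable R setT) mHa).
rewrite (@tonelliV R n n (fun y z => (`|Ha y z|)%:E))//.
have [A A0 hA] := @Kabs_bound R k.+1 l isT.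
have mpz : mfun (fun z => (`|phi z| * (enorm z)^-1)%:E) by mt.
have p0 z : (0 <= (`|phi z| * (enorm z)^-1)%:E)%E by rewrite lee_fin mulr_ge0// invr_ge0 enorm_ge0.
have AE : (0 <= A%:E)%E by rewrite lee_fin.
apply: (@le_lt_trans _ _ (\int[leb n]_z (A%:E * (`|phi z| * (enorm z)^-1)%:E))%E); last first.
  by rewrite (ge0_intZl (leb n) mpz p0 AE) lte_mul_pinfty.
have mswap : mfun (fun v : V * V => (`|Ha v.2 v.1|)%:E).
  exact: (measurableT_comp mHn (measurable_fun_pair measurable_snd measurable_fst)).
apply: ae_ge0_le_integral => //.
- by move=> z _; apply: integral_ge0.
- by apply: (@mf_intV R _ V n (fun z y => (`|Ha y z|)%:E)).
- by move=> z _; rewrite mule_ge0.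
- by apply: mf_muleE => //; mt.
exists [set 0]; split; [exact: measurable_set0v|exact: leb0_null|].
move=> z /= nz; apply: contrapT => /eqP z0; apply: nz => _.
have mK : mfun (fun y => ((1 < enorm y)%R%:R * pw y * Sabs l z y)%:E).
  exact: mf_EFin (mf_mulr mfar (mf_Sabsr l z)).
have K0' y : (0 <= ((1 < enorm y)%R%:R * pw y * Sabs l z y)%:E)%E by rewrite lee_fin (mulr_ge0 (far0 y))// Sabs_nneg.
have nE : (0 <= (`|phi z|)%:E)%E by rewrite lee_fin.
have -> : (\int[leb n]_y (`|Ha y z|)%:E = (`|phi z|)%:E * Kabs l 1 z)%E.
  rewrite /Kabs -(ge0_intZl (leb n) mK K0' nE); apply: eq_integral => y _.
  rewrite -EFinM /Ha (normrM (far y)) (normrM (phi z)) (ger0_norm (far0 y)) (ger0_norm (Sabs_nneg z y)) /far.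
  by congr EFin; move: (pw y) (Sabs l z y) `|phi z| (_%:R) => a b c d; ring.
apply: le_trans (lee_wpmul2l nE (hA z z0)) _; rewrite -!EFinM lee_fin.
by apply: eq_ler; move: (enorm z)^-1 `|phi z| => a b; ring.
Qed.

Let H_fin : (\int[leb n]_y \int[leb n]_z (`|H y z|)%:E < +oo)%E.
Proof.
have mHn : mfun (fun v : V * V => (`|H v.1 v.2|)%:E).
  exact: mf_EFin (measurableT_comp (@normr_measurable R setT) mH).
have mHan : mfun (fun v : V * V => (`|Ha v.1 v.2|)%:E).
  exact: mf_EFin (measurableT_comp (@normr_measurable R setT) mHa).
apply: le_lt_trans Ha_fin; apply: ge0_int_le.
- by apply: (@mf_intV R _ V n (fun y z => (`|H y z|)%:E)).
- by move=> y; apply: integral_ge0.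
- by apply: (@mf_intV R _ V n (fun y z => (`|Ha y z|)%:E)).
move=> y; apply: ge0_int_le => //.
- apply: mf_EFin; apply: mf_normr; apply: mf_mulr; first exact: measurable_cst.
  by apply: mf_mulr => //; apply: mf_Sy; [exact: measurable_id|exact: measurable_cst].
- apply: mf_EFin; apply: mf_normr; apply: mf_mulr; first exact: measurable_cst.
  by apply: mf_mulr => //; apply: mf_Sabs; [exact: measurable_id|exact: measurable_cst].
move=> z; rewrite lee_fin /H /Ha 2!(normrM (far y)) 2!(normrM (phi z)); apply: ler_wpM2l => //; apply: ler_wpM2l => //.
by rewrite (ger0_norm (Sabs_nneg z y)); exact: norm_Sy.
Qed.

(** The truncated integrand in the normal form u = 0, e = 1, to which [trunc_dilation] reduces the
    others. *)
Definition trunc1 y : R := far y * \sum_(j < l.+1) cf l j * \int[leb n]_w (phi (w + j%:R *: y) * (enorm w)^-1).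

Lemma mf_trunc1 : mfun trunc1.
Proof.
apply: mf_mulr => //; apply: measurable_sum => j.
have h : mfun (fun y => \int[leb n]_w (phi (w + j%:R *: y) * (enorm w)^-1)).
  by apply: (@mf_Rint R _ _ _ _ (leb n) (fun y w => phi (w + j%:R *: y) * (enorm w)^-1)); mt.
by mt.
Qed.

Let mSyr y : mfun (fun z => Sy l z y).
Proof. by apply: mf_Sy; [exact: measurable_id|exact: measurable_cst]. Qed.

Let trunc1_ae : {ae leb n, forall y, \int[leb n]_z H y z = trunc1 y}.
Proof.
apply: filterS (mf_ae_inner mHa Ha_fin) => y fHa.
have mphS : mfun (fun z => phi z * Sy l z y) by apply: mf_mulr.
have -> : \int[leb n]_z H y z = far y * \int[leb n]_z (phi z * Sy l z y) by exact: RintZ_total.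
have [f0|f0] := eqVneq (far y) 0; first by rewrite /trunc1 f0 !mul0r.
rewrite /trunc1; congr (_ * _).
have mSa : mfun (fun z => Sabs l z y) by apply: mf_Sabs; [exact: measurable_id|exact: measurable_cst].
have mHay : mfun (fun z => Ha y z) by apply: mf_mulr; [exact: measurable_cst|exact: mf_mulr].
have mt_ (j : nat) : mfun (fun z => phi z * (enorm (z - j%:R *: y))^-1) by mt.
have ft (j : 'I_l.+1) : finint (leb n) (fun z => phi z * (enorm (z - j%:R *: y))^-1).
  apply: (finint_le (mt_ j) _ (finintZ (far y)^-1 mHay fHa)); first by mt.
  move=> z; rewrite /Ha mulKf// !normrM; apply: ler_wpM2l => //.
  rewrite (ger0_norm (Sabs_nneg z y)) ger0_norm ?invr_ge0 ?enorm_ge0//.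
  by apply: term_le; rewrite -ltnS.
transitivity (\int[leb n]_z \sum_(j < l.+1) cf l j * (phi z * (enorm (z - j%:R *: y))^-1)).
  apply: eq_Rintegral => z _; rewrite /Sy mulr_sumr; apply: eq_bigr => j _; by rewrite mulrCA.
have mc (j : 'I_l.+1) : mfun (fun z => cf l j * (phi z * (enorm (z - j%:R *: y))^-1)).
  by have h := mt_ j; mt.
rewrite (Rint_sum (index_enum 'I_l.+1) mc (fun j => finintZ _ (mt_ j) (ft j))).
apply: eq_bigr => j _; rewrite (RintZ_total (leb n) (cf l j) (mt_ j)); congr (_ * _).
rewrite -(Rint_shiftv (j%:R *: y) (mt_ j)); apply: eq_Rintegral => w _.
by rewrite addrK.
Qed.

Lemma trunc1_fin : finint (leb n) trunc1.
Proof.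
apply: finint_ae trunc1_ae _; [exact: (mf_Rint (leb n) mH)|exact: mf_trunc1|exact: finint_Rint mH H_fin].
Qed.

Lemma trunc1_Rint : \int[leb n]_y trunc1 y = \int[leb n]_z (phi z * K0 l z).
Proof.
rewrite -(ae_Rint_eq (mf_Rint (leb n) mH) mf_trunc1 trunc1_ae) (fubini_R mH H_fin).
apply: eq_Rintegral => z _; rewrite /K0.
have m1 : mfun (fun y => far y * Sy l z y) by apply: mf_mulr => //; exact: mf_Syr.
rewrite -(RintZ_total (leb n) (phi z) m1); apply: eq_Rintegral => y _.
by rewrite /H /far; move: (Sy l z y) (phi z) (pw y) (_%:R) => a b c d; ring.
Qed.

End unit_truncation.

Definition trunc (psi : V -> R) e u y : R :=
  (e < enorm y)%R%:R * pw y * \sum_(j < l.+1) cf l j * riesz psi (u - j%:R *: y).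

Lemma trunc_dilation (psi : V -> R) e u : mfun psi -> 0 < e ->
  forall y, trunc psi e u (e *: y) = (e ^+ n)^-1 * trunc1 (fun z => psi (u - e *: z)) y.
Proof.
move=> mpsi e0 y; have en : e != 0 by rewrite gt_eqF.
rewrite /trunc /trunc1 pw_scale enormZ (gtr0_norm e0) ltr_pMr// exprD.
have -> : \sum_(j < l.+1) cf l j * riesz psi (u - j%:R *: (e *: y)) =
   e ^+ k.+1 * \sum_(j < l.+1) cf l j * \int[leb n]_w (psi (u - e *: (w + j%:R *: y)) * (enorm w)^-1).
  rewrite mulr_sumr; apply: eq_bigr => j _; rewrite mulrCA; congr (_ * _).
  have m1 : mfun (fun v => psi (u - j%:R *: (e *: y) + v) * (enorm v)^-1) by mt.
  (* The dilation is by -e because [riesz] integrates [psi (u + y)] and [econv] integrates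
     [psi (u - e *: z)]. *)
  have en' : - e != 0 by rewrite oppr_eq0.
  have m2 : mfun (fun w : V => psi (u - e *: (w + j%:R *: y)) * (enorm w)^-1) by mt.
  rewrite /riesz (Rint_scalev en' m1) normrN (gtr0_norm e0).
  have -> : \int[leb n]_x (psi (u - j%:R *: (e *: y) + - e *: x) * (enorm (- e *: x))^-1) =
     \int[leb n]_x (e^-1 * (psi (u - e *: (x + j%:R *: y)) * (enorm x)^-1)).
    apply: eq_Rintegral => w _; rewrite enormZ normrN (gtr0_norm e0) invfM mulrCA.
    congr (_ * (psi _ * _)); rewrite scalerDr opprD addrA addrAC scaleNr; congr (_ - _ - _).
    by rewrite !scalerA mulrC.
  rewrite (RintZ_total (leb n) e^-1 m2); move: (\int[_]_w _) => a.
  by rewrite exprSr -mulrA mulVKf.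
rewrite /far; have h1 : e ^+ k.+1 != 0 by rewrite expf_neq0.
have h2 : e ^+ n != 0 by rewrite expf_neq0.
move: h1 h2; move: (e ^+ k.+1) (e ^+ n) (\sum_(_ < _) _) (pw y) (_%:R) => a b c d f a0 b0.
by field; rewrite ?a0 ?b0.
Qed.

Lemma trunc_repr (psi : V -> R) e u : mfun psi -> 0 < e -> goodpt psi u ->
  finint (leb n) (trunc psi e u) /\ \int[leb n]_y trunc psi e u y = econv (K0 l) e psi u.
Proof.
move=> mpsi e0 gu; have en : e != 0 by rewrite gt_eqF.
have mphi : mfun (fun z => psi (u - e *: z)) by mt.
have fphi : (\int[leb n]_z (`|psi (u - e *: z)| * (enorm z)^-1)%:E < +oo)%E.
  have m1 : mfun (fun y => psi (u + y) * (enorm y)^-1) by mt.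
  have f1 : finint (leb n) (fun y => psi (u + y) * (enorm y)^-1).
    apply: le_lt_trans gu; rewrite le_eqVlt; apply/orP; left; apply/eqP; apply: eq_integral => y _.
    by rewrite normrM normfV (ger0_norm (enorm_ge0 _)).
  have en' : - e != 0 by rewrite oppr_eq0.
  have m2 : mfun (fun y => psi (u + - e *: y) * (enorm (- e *: y))^-1) by mt.
  have f2 := finintZ e m2 (finint_scalev en' m1 f1).
  apply: le_lt_trans f2; rewrite le_eqVlt; apply/orP; left; apply/eqP; apply: eq_integral => y _.
  rewrite scaleNr enormN enormZ (gtr0_norm e0) !normrM invfM normrM !normfV.
  rewrite (ger0_norm (enorm_ge0 _)) (gtr0_norm e0); congr EFin.
  by move: (`|psi _|) (enorm y)^-1 => a b; field.
have mriesz : mfun (riesz psi).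
  by apply: (@mf_Rint R _ _ _ _ (leb n) (fun x y => psi (x + y) * (enorm y)^-1)); mt.
have mT : mfun (trunc psi e u).
  have h := @mf_pw R k.+1; apply: mf_mulr; first by mt.
  apply: measurable_sum => j.
  have h2 : mfun (fun y => riesz psi (u - j%:R *: y)) by apply: (measurableT_comp mriesz); mt.
  by mt.
have m1 := mf_trunc1 mphi; have f1 := trunc1_fin mphi fphi.
have TE : (fun y => trunc psi e u (e *: y)) = (fun y => (e ^+ n)^-1 * trunc1 (fun z => psi (u - e *: z)) y).
  by apply/funext => y; exact: trunc_dilation.
split.
  have en2 : e^-1 != 0 by rewrite invr_eq0.
  have m2 : mfun (fun y => trunc psi e u (e *: y)) by rewrite TE; mt.
  have f2 : finint (leb n) (fun y => trunc psi e u (e *: y)) by rewrite TE; exact: finintZ.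
  have := finint_scalev en2 m2 f2; rewrite /finint.
  by under [X in (X < _)%E -> _]eq_integral do rewrite scalerA divff// scale1r.
rewrite (Rint_scalev en mT) (gtr0_norm e0).
under eq_Rintegral do rewrite (trunc_dilation u mpsi e0).
rewrite (RintZ_total (leb n) _ m1) mulVKf ?expf_neq0//.
exact: trunc1_Rint.
Qed.

End truncation.

(** * The reconstruction *)

Section real_transforms.
Context {R : realType}.

Definition real_radon m (f : 'rV[R]_m.+1 -> R) (x : 'rV[R]_m.+1) : R :=
  \int[leb m]_y f (pt (hd x - y) (lst x - enorm y ^+ 2)).

Definition real_back m (F : 'rV[R]_m.+1 -> R) (x : 'rV[R]_m.+1) : R :=
  pi ^- m * \int[leb m]_z (F (pt z (lst x - 2 * dotv z (hd x) + enorm z ^+ 2)) *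
     ((1 + 4 * enorm z ^+ 2) `^ (m%:R / 2))^-1).

Definition shear m (f : 'rV[R]_m.+1 -> R) (u : 'rV[R]_m.+1) : R :=
  f (pt (hd u) (lst u - enorm (hd u) ^+ 2)).

Lemma mf_hd_id m : mfun (@hd R m).
Proof.
apply: measurable_fun_rV => i.
rewrite (_ : (fun _ => _) = (fun x : 'rV[R]_m.+1 => x 0 (lift ord_max i))); first exact: measurable_coord_rV.
by apply/funext => x; rewrite mxE.
Qed.

Lemma mf_shear m (f : 'rV[R]_m.+1 -> R) : mfun f -> mfun (shear f).
Proof. by move=> mf; have h := @mf_hd_id m; rewrite /shear; mt. Qed.

Lemma mf_real_radon m (f : 'rV[R]_m.+1 -> R) : mfun f -> mfun (real_radon f).
Proof.
move=> mf; have h := @mf_hd_id m.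
by apply: (@mf_Rint R _ _ _ _ (leb m) (fun x y => f (pt (hd x - y) (lst x - enorm y ^+ 2)))); mt.
Qed.

Lemma mf_real_back m (F : 'rV[R]_m.+1 -> R) : mfun F -> mfun (real_back F).
Proof.
move=> mF; have h := @mf_hd_id m.
have h2 : mfun (fun x => \int[leb m]_z (F (pt z (lst x - 2 * dotv z (hd x) + enorm z ^+ 2)) *
     ((1 + 4 * enorm z ^+ 2) `^ (m%:R / 2))^-1)).
  apply: (@mf_Rint R _ _ _ _ (leb m) (fun x z => F (pt z (lst x - 2 * dotv z (hd x) + enorm z ^+ 2)) *
     ((1 + 4 * enorm z ^+ 2) `^ (m%:R / 2))^-1)); by mt.
by rewrite /real_back; mt.
Qed.

Section representation.
Context {k : nat}.
Local Notation n := k.+2.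
Local Notation V := 'rV[R]_n.
Local Notation W := 'rV[R]_k.+1.

(** The point over w of the hyperplane through x with normal (-2z, 1). *)
Definition cone_point (x : V) (z w : W) : V := pt w (lst x + 2 * dotv z (w - hd x)).

Lemma mf_cone_point x : mfun (fun v : W * W => cone_point x v.1 v.2).
Proof. by rewrite /cone_point; mt. Qed.

Lemma back_projection_ge0 (chi : V -> R) x : mfun chi -> (forall u, 0 <= chi u) -> goodpt chi x ->
  [/\ {ae leb k.+1, forall z, finint (leb k.+1) (fun w => chi (cone_point x z w))},
      finint (leb k.+1) (fun z => bweight k.+1 z * \int[leb k.+1]_w chi (cone_point x z w)) &
      \int[leb k.+1]_z (bweight k.+1 z * \int[leb k.+1]_w chi (cone_point x z w)) = bconst k * riesz chi x].
Proof.
move=> mchi chi0 gx.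
have mc2 : mfun (fun v : W * W => chi (cone_point x v.1 v.2)) by exact: measurableT_comp mchi (mf_cone_point x).
have mcz (z : W) : mfun (fun w => chi (cone_point x z w)).
  have hc : mfun (fun w => cone_point x z w) by rewrite /cone_point; mt.
  exact: measurableT_comp mchi hc.
have mb1 : mfun (fun v : W * W => bweight k.+1 v.1).
  by rewrite /bweight; mt.
pose Hf z w : R := bweight k.+1 z * chi (cone_point x z w).
have mHf : mfun (fun v : W * W => Hf v.1 v.2) by exact: mf_mulr.
have Hf0 z w : 0 <= Hf z w by rewrite mulr_ge0// bweight_ge0.
have mchiE : mfun (fun u => (chi u)%:E) by mt.
have chiE0 u : (0 <= (chi u)%:E)%E by rewrite lee_fin.
have bp := back_projection x mchiE chiE0.
have mczE (z : W) : mfun (fun w => (chi (cone_point x z w))%:E) by have h := mcz z; mt.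
have czE0 (z w : W) : (0 <= (chi (cone_point x z w))%:E)%E by rewrite lee_fin.
have bE (z : W) : (0 <= (bweight k.+1 z)%:E :> \bar R)%E by rewrite lee_fin bweight_ge0.
have HE (z : W) : (\int[leb k.+1]_w (Hf z w)%:E = (bweight k.+1 z)%:E * \int[leb k.+1]_w (chi (cone_point x z w))%:E)%E.
  by rewrite -(ge0_intZl (leb k.+1) (mczE z) (czE0 z) (bE z)); apply: eq_integral => w _; rewrite -EFinM.
have mrx : mfun (fun y => chi (x + y) * (enorm y)^-1) by mt.
have rx0 y : 0 <= chi (x + y) * (enorm y)^-1 by rewrite mulr_ge0// invr_ge0 enorm_ge0.
have frx : finint (leb n) (fun y => chi (x + y) * (enorm y)^-1).
  apply: le_lt_trans gx; rewrite le_eqVlt; apply/orP; left; apply/eqP; apply: eq_integral => y _.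
  by rewrite normrM normfV (ger0_norm (enorm_ge0 _)).
have bpE : (\int[leb k.+1]_z \int[leb k.+1]_w (Hf z w)%:E = (bconst k * riesz chi x)%:E)%E.
  apply: etrans (etrans _ bp) _; first by apply: eq_integral => z _; exact: HE.
  rewrite (EFinM (bconst k)); congr (_ * _)%E; apply: (etrans _ (Rint_ge0E mrx rx0 frx)); apply: eq_integral => y _.
  by rewrite ger0_norm// EFinM.
have Hn : (\int[leb k.+1]_z \int[leb k.+1]_w (`|Hf z w|)%:E = \int[leb k.+1]_z \int[leb k.+1]_w (Hf z w)%:E)%E.
  by apply: eq_integral => z _; apply: eq_integral => w _; rewrite ger0_norm.
have Hfin : (\int[leb k.+1]_z \int[leb k.+1]_w (`|Hf z w|)%:E < +oo)%E by rewrite Hn bpE ltry.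
have RH (z : W) : \int[leb k.+1]_w Hf z w = bweight k.+1 z * \int[leb k.+1]_w chi (cone_point x z w).
  exact: RintZ_total.
have aeH := mf_ae_inner mHf Hfin.
have mRH := mf_Rint (leb k.+1) mHf.
have fRH := finint_Rint mHf Hfin.
split.
- apply: filterS aeH => z fz.
  have b0 : bweight k.+1 z != 0 :> R by rewrite gt_eqF// bweight_gt0.
  have mHz : mfun (fun w => Hf z w) by have h := mcz z; rewrite /Hf; mt.
  apply: (finint_le (mcz z) _ (finintZ (bweight k.+1 z)^-1 mHz fz)); first by mt.
  by move=> w; rewrite /Hf mulKf.
- by move: fRH; rewrite /finint; under eq_integral do rewrite RH.
apply: EFin_inj; rewrite -bpE; under eq_Rintegral do rewrite -RH.
rewrite (RintE mRH fRH); apply: ae_eq_integral => //.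
- by apply: mf_EFin.
- apply: (@mf_intV R _ W k.+1 (fun z w => (Hf z w)%:E)); last by move=> z w; rewrite lee_fin.
  exact: mf_EFin.
apply: filterS aeH => z fz _.
have mHz : mfun (fun w => Hf z w) by have h := mcz z; rewrite /Hf; mt.
exact: RintE mHz fz.
Qed.

Lemma back_projection_R (psi : V -> R) x : mfun psi -> goodpt psi x ->
  \int[leb k.+1]_z (bweight k.+1 z * \int[leb k.+1]_w psi (cone_point x z w)) = bconst k * riesz psi x.
Proof.
move=> mpsi gx.
(* psi = c1 - c2 with both nonnegative and of finite potential at x, so the nonnegative case applies
   twice. *)
pose c1 u := `|psi u|; pose c2 u := `|psi u| - psi u.
have m1 : mfun c1 by rewrite /c1; mt.
have m2 : mfun c2 by rewrite /c2; mt.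
have c10 u : 0 <= c1 u by exact: normr_ge0.
have c20 u : 0 <= c2 u by rewrite subr_ge0 ler_norm.
have mrx : mfun (fun y => psi (x + y) * (enorm y)^-1) by mt.
have mr1 : mfun (fun y => c1 (x + y) * (enorm y)^-1) by mt.
have mr2 : mfun (fun y => c2 (x + y) * (enorm y)^-1) by mt.
have fr1 : finint (leb n) (fun y => c1 (x + y) * (enorm y)^-1).
  apply: le_lt_trans gx; rewrite le_eqVlt; apply/orP; left; apply/eqP; apply: eq_integral => y _.
  by rewrite normrM normfV (ger0_norm (enorm_ge0 _)) normr_id.
have fr2 : finint (leb n) (fun y => c2 (x + y) * (enorm y)^-1).
  apply: (finint_le mr2 _ (finintZ 2 mr1 fr1)); first by mt.
  move=> y; rewrite !normrM (gtr0_norm (_ : 0 < 2 :> R))// mulrA; apply: ler_wpM2r => //.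
  rewrite /c2 /c1 normr_id; apply: le_trans (ler_normB _ _) _; rewrite normr_id; lra.
have g1 : goodpt c1 x.
  by apply: le_lt_trans gx; rewrite /c1; under eq_integral do rewrite normr_id.
have g2 : goodpt c2 x.
  apply: le_lt_trans fr2; rewrite le_eqVlt; apply/orP; left; apply/eqP; apply: eq_integral => y _.
  by rewrite normrM normfV (ger0_norm (enorm_ge0 _)).
have [a1 f1 e1] := back_projection_ge0 m1 c10 g1.
have [a2 f2 e2] := back_projection_ge0 m2 c20 g2.
have mJ (chi : V -> R) : mfun chi -> mfun (fun z : W => bweight k.+1 z * \int[leb k.+1]_w chi (cone_point x z w)).
  move=> mchi; apply: mf_mulr; first by rewrite /bweight; mt.
  apply: (@mf_Rint R _ _ _ _ (leb k.+1) (fun z w => chi (cone_point x z w))).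
  exact: measurableT_comp mchi (mf_cone_point x).
have mz (chi : V -> R) z : mfun chi -> mfun (fun w : W => chi (cone_point x z w)).
  move=> mchi; have hc : mfun (fun w => cone_point x z w) by rewrite /cone_point; mt.
  exact: measurableT_comp mchi hc.
have re : riesz psi x = riesz c1 x - riesz c2 x.
  rewrite /riesz -(RintB mr1 fr1 mr2 fr2); apply: eq_Rintegral => y _.
  by rewrite -mulrBl /c2 /c1 subKr.
rewrite re mulrBr -e1 -e2 -(RintB (mJ _ m1) f1 (mJ _ m2) f2).
apply: ae_Rint_eq; first exact: mJ.
  have h1 := mJ _ m1; have h2 := mJ _ m2; exact: measurable_funB.
apply: filterS2 a1 a2 => z fz1 fz2.
rewrite -mulrBr -(RintB (mz _ z m1) fz1 (mz _ z m2) fz2); congr (_ * _).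
by apply: eq_Rintegral => w _; rewrite /c2 /c1 subKr.
Qed.

(** The term |z|^2 in the back-projection cancels that of |z - w|^2. What remains is -|w|^2, the
    shear, and a height affine in w, the hyperplane of [cone_point]. *)
Lemma real_back_riesz (f : V -> R) x : mfun f -> goodpt (shear f) x ->
  real_back (real_radon f) x = pi ^- k.+1 * bconst k * riesz (shear f) x.
Proof.
move=> mf gx; rewrite /real_back -mulrA; congr (_ * _).
rewrite -(back_projection_R (mf_shear mf) gx); apply: eq_Rintegral => z _.
rewrite [LHS]mulrC; congr (_ * _); rewrite /real_radon hd_pt lst_pt.
set T := lst x - _ + _.
pose h (w : W) : R := f (pt w (T - enorm (z - w) ^+ 2)).
have mh : mfun h by rewrite /h; mt.
have mh2 : mfun (fun w : W => h (w + z)) by mt.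
have -> : \int[leb k.+1]_y f (pt (z - y) (T - enorm y ^+ 2)) = \int[leb k.+1]_w h w.
  rewrite -(Rint_shiftv z mh) -(Rint_oppv mh2); apply: eq_Rintegral => y _.
  by rewrite /h [- y + z]addrC subKr.
apply: eq_Rintegral => w _; rewrite /h /shear /cone_point hd_pt lst_pt; congr (f (pt _ _)).
rewrite /T !enormE !(dotvDl, dotvDr, dotvNl, dotvNr) (dotvC w z).
by move: (lst x) (dotv z _) (dotv z z) (dotv z w) (dotv w w) => a b c d e; ring.
Qed.

End representation.

End real_transforms.

Section shear_invariance.
Context {R : realType} {m : nat}.
Local Notation V := 'rV[R]_m.+1.

Definition shear_map (s : R) (u : V) : V := pt (hd u) (lst u + s * enorm (hd u) ^+ 2).

Lemma mf_shear_map s : mfun (shear_map s).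
Proof. by have h := @mf_hd_id R m; rewrite /shear_map; mt. Qed.

(** On each vertical line the shear is a translation. *)
Lemma integral_shear s (F : V -> \bar R) : mfun F -> (forall u, 0 <= F u)%E ->
  (\int[leb m.+1]_u F (shear_map s u) = \int[leb m.+1]_u F u)%E.
Proof.
move=> mF F0.
have mG : mfun (fun u => F (shear_map s u)) by exact: measurableT_comp mF (mf_shear_map s).
apply: (etrans (ge0_integral_lebS mG (fun u => F0 _))).
apply: (etrans _ (esym (ge0_integral_lebS mF F0))); apply: eq_integral => z _.
have mz : mfun (fun t : R => F (pt z t)).
  have h : mfun (fun t : R => pt z t) by mt.
  exact: measurableT_comp mF h.
apply: (etrans _ (ge0_integral_shift (s * enorm z ^+ 2) mz (fun t => F0 _))).
by apply: eq_integral => t _; rewrite /shear_map hd_pt lst_pt.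
Qed.

Lemma ae_shear s (P : V -> Prop) : {ae leb m.+1, forall u, P u} -> {ae leb m.+1, forall u, P (shear_map s u)}.
Proof.
move=> [N [mN N0 sN]].
have mN' : measurable (shear_map s @^-1` N).
  by rewrite -[X in measurable X]setTI; exact: mf_shear_map.
exists (shear_map s @^-1` N); split => //; last by move=> y /= h; exact: sN.
have mi : mfun (fun x : V => (\1_N x : R)) := mf_indic1 mN.
have miE : mfun (fun x : V => (\1_N x : R)%:E) by mt.
have i0 x : (0 <= ((\1_N x : R)%:E))%E by rewrite lee_fin.
have hN : (\int[leb m.+1]_x (\1_N x : R)%:E = 0)%E by rewrite integral_indic// setIT.
rewrite -[X in leb m.+1 X]setIT -integral_indic//.
exact: etrans (integral_shear s miE i0) hN.
Qed.

End shear_invariance.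

Definition real_trunc {R : realType} {m : nat} l (g : 'rV[R]_m.+1 -> R) e u y : R :=
  (e < enorm y)%R%:R * pw y * \sum_(j < l.+1) cf l j * g (u - j%:R *: y).

Section real_reconstruction.
Context {R : realType} {k l : nat}.
Hypothesis l_even : ~~ odd k.+2 -> l = k.+1.
Hypothesis l_odd : odd k.+2 -> (k.+1 < l)%N.
Local Notation n := k.+2.
Local Notation V := 'rV[R]_n.
Variables (p : R) (f phi : V -> R).
Hypotheses (p1 : 1 <= p) (p_lt : p < n%:R / k.+1%:R).
Hypotheses (mf : mfun f) (mphi : mfun phi) (fp : (pint p phi < +oo)%E).
Hypothesis hphi : {ae leb n, forall u, shear f u = phi u}.
Let mpsi := mf_shear mf.
Let g := real_back (real_radon f).
Let mg : mfun g. Proof. exact: mf_real_back (mf_real_radon mf). Qed.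
Let kappa : R := pi ^- k.+1 * bconst k.
Let K (z : V) : R := kappa * K0 l z.

Let ae_shift (u : V) : {ae leb n, forall y, shear f (u + y) = phi (u + y)}.
Proof.
apply: filterS (ae_affine u (oner_neq0 R) hphi) => y.
by rewrite scale1r.
Qed.

(** Passing from the sheared f to its representative phi changes no potential: they agree at u + y
    for almost every y. *)
Let g_good (u : V) : goodpt phi u -> g u = kappa * riesz phi u.
Proof.
move=> gu.
have gpsi : goodpt (shear f) u.
  move: gu; rewrite /goodpt; congr (_ < _)%E; apply: ae_eq_integral => //; [by mt|by mt|].
  by apply: filterS (ae_shift u) => y -> _.
rewrite /g (real_back_riesz mf gpsi); congr (_ * _).
apply: ae_Rint_eq; [by mt|by mt|].
by apply: filterS (ae_shift u) => y ->.
Qed.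

Let mK : mfun K. Proof. by have h := @mf_K0 R k.+1 l; rewrite /K; mt. Qed.

Let fK : finint (leb n) K.
Proof. exact: finintZ (@mf_K0 R k.+1 l) (finint_K0 l_even l_odd). Qed.

Let K_decay : exists2 A : R, 0 <= A & forall z : V, z != 0 ->
  `|K z| <= A / enorm z /\ `|K z| <= A / enorm z ^+ n.+1.
Proof.
have [A A0 hA] := @K0_decay R k.+1 l isT (even_lt_l l_even l_odd) (kap_eq0 l_even l_odd).
exists (`|kappa| * A) => [|z z0]; first by rewrite mulr_ge0.
have [h1 h2] := hA z z0.
by rewrite /K normrM -!mulrA; split; apply: ler_wpM2l.
Qed.

(** The factor pi^(1-n) of the back-projection normalizes the mass of K to the constant of the
    theorem. *)
Let int_K : \int[leb n]_z K z = Dc k.+1 l.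
Proof.
rewrite /K (RintZ_total (leb n) kappa (@mf_K0 R k.+1 l)) /kappa -mulrA (@bconst_K0 R k l l_even l_odd).
by rewrite mulKf// expf_neq0// gt_eqF// pi_gt0.
Qed.

Lemma mf_real_trunc e : mfun (fun v : V * V => real_trunc l g e v.1 v.2).
Proof.
have h : mfun (fun v : V * V => pw v.2) by exact: measurableT_comp (@mf_pw R k.+1) measurable_snd.
apply: mf_mulr; first by mt.
apply: measurable_sum => j.
have h2 : mfun (fun v : V * V => g (v.1 - j%:R *: v.2)).
  have h3 : mfun (fun v : V * V => v.1 - j%:R *: v.2) by mt.
  exact: measurableT_comp mg h3.
by mt.
Qed.

Lemma mf_real_trunc_y e (u : V) : mfun (real_trunc l g e u).
Proof.
have h : mfun (fun y : V => (u, y)) by exact: (measurable_fun_pair (measurable_cst u) (@measurable_id _ V setT)).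
exact: (measurableT_comp (mf_real_trunc e) h).
Qed.

Lemma mf_real_hyper e : mfun (fun u => \int[leb n]_y real_trunc l g e u y).
Proof. exact: (@mf_Rint R _ _ _ _ (leb n) (fun u y => real_trunc l g e u y) (mf_real_trunc e)). Qed.

Lemma real_trunc_good e (u : V) : 0 < e -> goodpt phi u ->
  finint (leb n) (real_trunc l g e u) /\ \int[leb n]_y real_trunc l g e u y = econv K e phi u.
Proof.
move=> e0 gu; have [fT iT] := trunc_repr l mphi e0 gu.
have mriesz : mfun (riesz phi).
  by apply: (@mf_Rint R _ _ _ _ (leb n) (fun x y : V => phi (x + y) * (enorm y)^-1)); mt.
have mT : mfun (trunc l phi e u).
  have h := @mf_pw R k.+1; apply: mf_mulr; first by mt.
  apply: measurable_sum => j.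
  have h3 : mfun (fun y : V => u - j%:R *: y) by mt.
  have h2 := measurableT_comp mriesz h3; by mt.
have mkT : mfun (fun y => kappa * trunc l phi e u y) by mt.
have ae : {ae leb n, forall y, kappa * trunc l phi e u y = real_trunc l g e u y}.
  (* For almost every y the potential converges at all nodes u - j y at once. The node j = 0 is u
     itself, where convergence is assumed. *)
  have h : {ae leb n, forall y, forall j : nat, goodpt phi (u - j%:R *: y)}.
    apply: ae_foralln => -[|j].
      by apply: aeW => y; rewrite scale0r subr0.
    have j0 : - j.+1%:R != 0 :> R by rewrite oppr_eq0 pnatr_eq0.
    by apply: filterS (ae_affine u j0 (goodpt_ae p1 p_lt mphi fp)) => y; rewrite scaleNr.
  apply: filterS h => y hy; rewrite /trunc /real_trunc mulrCA; congr (_ * _).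
  rewrite mulr_sumr; apply: eq_bigr => j _.
  by rewrite (g_good (hy j)) mulrCA.
split; first exact: finint_ae mkT (mf_real_trunc_y e u) ae (finintZ kappa mT fT).
rewrite -(ae_Rint_eq mkT (mf_real_trunc_y e u) ae) (RintZ_total (leb n) kappa mT) iT /econv.
have m1 : mfun (fun z : V => phi (u - e *: z) * K0 l z) by have h := @mf_K0 R k.+1 l; mt.
rewrite -(RintZ_total (leb n) kappa m1); apply: eq_Rintegral => z _.
by rewrite mulrCA.
Qed.

Let pint_hyper e : 0 < e ->
  pint p (fun u => \int[leb n]_y real_trunc l g e u y - Dc k.+1 l * phi u) =
  pint p (fun u => econv K e phi u - \int[leb n]_z K z * phi u).
Proof.
move=> e0; have m1 := mf_real_hyper e; have m2 := mf_econv mK mphi e.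
rewrite int_K; apply: ae_eq_integral => //; [by mt|by mt|].
apply: filterS (goodpt_ae p1 p_lt mphi fp) => u gu _.
by have [_ ->] := real_trunc_good e0 gu.
Qed.

Lemma real_hyper_Lp :
  (forall e, 0 < e -> (pint p (fun u => \int[leb n]_y real_trunc l g e u y - Dc k.+1 l * phi u)%R < +oo)%E) /\
  forall d : R, 0 < d -> exists2 e0 : R, 0 < e0 & forall e, 0 < e < e0 ->
    (pint p (fun u => \int[leb n]_y real_trunc l g e u y - Dc k.+1 l * phi u)%R <= d%:E)%E.
Proof.
have [A A0 hA] := K_decay; have [h1 h2] := econv_Lp mK fK A0 hA p1 mphi fp.
split=> [e e0|d d0]; first by rewrite (pint_hyper e0); exact: h1.
have [e0 e00 he] := h2 d d0; exists e0; first exact: e00; move=> e /[dup] ee /andP[ep _].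
by rewrite (pint_hyper ep); exact: he.
Qed.

Lemma real_hyper_ae : {ae leb n, forall u,
  (forall e, 0 < e -> finint (leb n) (real_trunc l g e u)) /\
  forall d : R, 0 < d -> exists2 e0 : R, 0 < e0 & forall e, 0 < e < e0 ->
    `|\int[leb n]_y real_trunc l g e u y - Dc k.+1 l * phi u| <= d}.
Proof.
have [A A0 hA] := K_decay; have h := econv_ae mK fK A0 hA p1 mphi fp.
apply: filterS2 (goodpt_ae p1 p_lt mphi fp) h => u gu h.
split=> [e e0|d d0]; first by have [] := real_trunc_good e0 gu.
have [e0 e00 he] := h d d0; exists e0; first exact: e00; move=> e /[dup] ee /andP[ep _].
have [_ ->] := real_trunc_good ep gu; rewrite -int_K; exact: he.
Qed.

Lemma real_hyper_sup (M : R) : (forall x, `|phi x| <= M) ->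
  (forall d : R, 0 < d -> exists2 t : R, 0 < t & forall x h : V, enorm h < t -> `|phi (x - h) - phi x| <= d) ->
  (forall u e, 0 < e -> finint (leb n) (real_trunc l g e u)) /\
  forall d : R, 0 < d -> exists2 e0 : R, 0 < e0 & forall e u, 0 < e < e0 ->
    `|\int[leb n]_y real_trunc l g e u y - Dc k.+1 l * phi u| <= d.
Proof.
move=> hM uc; have gu := goodpt_bounded p1 p_lt mphi fp hM.
split=> [u e e0|d d0]; first by have [] := real_trunc_good e0 (gu u).
have [A A0 hA] := K_decay; have [e0 e00 he] := econv_sup mK fK A0 hA mphi hM uc d0.
exists e0; first exact: e00; move=> e u /[dup] ee /andP[ep _].
have [_ ->] := real_trunc_good ep (gu u); rewrite -int_K; exact: he.
Qed.

End real_reconstruction.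

(** * Complex values: norms and limits *)

Section complex_norms.
Context {R : realType}.
Implicit Types (z : Cplx R) (d : R).

Lemma Re_le_normC z : `|complex.Re z| <= normC z.
Proof. by case: z => a b; rewrite /normC /= -sqrtr_sqr; apply: ler_wsqrtr; rewrite lerDl sqr_ge0. Qed.

Lemma Im_le_normC z : `|complex.Im z| <= normC z.
Proof. by case: z => a b; rewrite /normC /= -sqrtr_sqr; apply: ler_wsqrtr; rewrite lerDr sqr_ge0. Qed.

Lemma normC_le z : normC z <= `|complex.Re z| + `|complex.Im z|.
Proof.
case: z => a b; rewrite /normC /=.
have s0 : 0 <= `|a| + `|b| by rewrite addr_ge0.
rewrite -[leRHS]ger0_norm// -sqrtr_sqr; apply: ler_wsqrtr.
rewrite -(real_normK (num_real a)) -(real_normK (num_real b)) sqrrD.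
by have := mulr_ge0 (normr_ge0 a) (normr_ge0 b); move: (`|a| * `|b|) (`|a| ^+ 2) (`|b| ^+ 2) => x y w; lra.
Qed.

Lemma normC_ge0 z : 0 <= normC z.
Proof. exact: le_trans (Re_le_normC z). Qed.

Lemma normrC z : `|z| = (normC z)%:C%C.
Proof. by case: z => a b; exact: normc_def. Qed.

Lemma cvg0_ereal (x : R -> \bar R) : (forall e : R, 0 < e -> (0 <= x e)%E) ->
  (forall d, 0 < d -> exists2 e0 : R, 0 < e0 & forall e, 0 < e < e0 -> (x e <= d%:E)%E) ->
  x e @[e --> 0^'+] --> 0%E.
Proof.
move=> x0 hx.
have nr (e0 : R) : 0 < e0 -> \forall e \near 0^'+, 0 < e < e0.
  move=> e00; apply: filterS2 (nbhs_right_gt (0 : R)) (nbhs_right_lt e00) => e h1 h2.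
  by rewrite h1.
apply/fine_cvgP; split.
  have [e0 e00 he] := hx 1 ltr01; apply: filterS (nr e0 e00) => e ee.
  have /andP[ep _] := ee; rewrite ge0_fin_numE ?x0//; exact: le_lt_trans (he e ee) (ltry _).
apply/cvgrPdist_le => d d0; have [e0 e00 he] := hx d d0; apply: filterS (nr e0 e00) => e ee.
have /andP[ep _] := ee; have fx : x e \is a fin_num.
  by rewrite ge0_fin_numE ?x0//; exact: le_lt_trans (he e ee) (ltry _).
by rewrite /= sub0r normrN ger0_norm ?fine_ge0 ?x0// -lee_fin fineK// he.
Qed.

Lemma cvg_complex (x : R -> Cplx R) (L : Cplx R) :
  (forall d, 0 < d -> exists2 e0 : R, 0 < e0 & forall e, 0 < e < e0 -> normC (x e - L) <= d) ->
  x e @[e --> 0^'+] --> L.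
Proof.
move=> hx; apply/cvgrPdist_le => eps eps0.
(* A positive element of the ordered field [R[i]] is real, so eps reduces to its real part. *)
have /andP[/eqP i0 r0] : (complex.Im eps == 0) && (0 < complex.Re eps).
  by have := eps0; rewrite (@ltcE R 0 eps).
have [e0 e00 he] := hx _ r0.
apply: filterS2 (nbhs_right_gt (0 : R)) (nbhs_right_lt e00) => e h1 h2.
rewrite distrC normrC (@lecE R) /= i0 eqxx /=; apply: he.
by rewrite h1.
Qed.

Context {n : nat}.
Implicit Types (F : 'rV[R]_n -> Cplx R) (p : R).

Definition Npow p F : \bar R := (\int[leb n]_x (normC (F x) `^ p)%:E)%E.

Lemma LnormCE p F : LnormC p F = (Npow p F `^ p^-1)%E.
Proof.
rewrite /LnormC unlock; congr (_ `^ _)%E; apply: eq_integral => x _.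
by rewrite abse_EFin ger0_norm ?normC_ge0// poweR_EFin.
Qed.

Lemma Npow_ge0 p F : (0 <= Npow p F)%E.
Proof. by apply: integral_ge0 => x _; rewrite lee_fin powR_ge0. Qed.

Section measurable_parts.
Variables (F : 'rV[R]_n -> Cplx R) (p : R).
Hypotheses (p1 : 1 <= p).
Hypotheses (mRe : mfun (fun x => complex.Re (F x))) (mIm : mfun (fun x => complex.Im (F x))).
Let p0 : 0 <= p. Proof. by apply: le_trans p1. Qed.
Let pn : p != 0. Proof. by rewrite gt_eqF// (lt_le_trans ltr01). Qed.

Lemma mf_normC : mfun (fun x => normC (F x)).
Proof.
rewrite (_ : (fun _ => _) = (fun x => Num.sqrt (complex.Re (F x) ^+ 2 + complex.Im (F x) ^+ 2))).
  by mt.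
by apply/funext => x; rewrite /normC; case: (F x).
Qed.

Lemma Npow_le : (Npow p F <= (2 `^ p)%:E * (pint p (fun x => complex.Re (F x)) + pint p (fun x => complex.Im (F x))))%E.
Proof.
have mN := mf_normC.
have m1 : mfun (fun x => (`|complex.Re (F x)| `^ p)%:E) by mt.
have m2 : mfun (fun x => (`|complex.Im (F x)| `^ p)%:E) by mt.
have q1 x : (0 <= (`|complex.Re (F x)| `^ p)%:E)%E by rewrite lee_fin powR_ge0.
have q2 x : (0 <= (`|complex.Im (F x)| `^ p)%:E)%E by rewrite lee_fin powR_ge0.
have t0 : (0 <= (2 `^ p : R)%:E)%E by rewrite lee_fin powR_ge0.
rewrite /pint -(ge0_intD (leb n) m1 q1 m2 q2).
rewrite -(ge0_intZl (leb n) _ _ t0); [|by mt|by move=> x; rewrite adde_ge0].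
apply: ge0_int_le; [by mt|by move=> x; rewrite lee_fin powR_ge0|by mt|].
move=> x; rewrite -EFinD -EFinM lee_fin; apply: le_trans (powR_leD p0 (normr_ge0 _) (normr_ge0 _)).
by rewrite ge0_ler_powR ?nnegrE ?normC_ge0 ?addr_ge0 ?normC_le.
Qed.

Lemma in_Lp_intro : (pint p (fun x => complex.Re (F x)) < +oo)%E ->
  (pint p (fun x => complex.Im (F x)) < +oo)%E -> in_Lp p F.
Proof.
move=> h1 h2; split; [exact: mRe|exact: mIm|]; rewrite LnormCE; apply: poweR_lty.
by apply: le_lt_trans Npow_le _; apply: lte_mul_pinfty; [by rewrite lee_fin powR_ge0|by []|exact: lte_add_pinfty].
Qed.

Lemma in_Lp_elim : in_Lp p F ->
  (pint p (fun x => complex.Re (F x)) < +oo)%E /\ (pint p (fun x => complex.Im (F x)) < +oo)%E.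
Proof.
move=> [_ _]; rewrite LnormCE => h.
have {}h : (Npow p F < +oo)%E.
  by rewrite ltey; apply/eqP => e; move: h; rewrite e poweRyr ?ltxx// invr_eq0.
have mN := mf_normC.
split; apply: le_lt_trans h; apply: ge0_int_le; try (by mt); try (by move=> x; rewrite lee_fin powR_ge0);
  move=> x; rewrite lee_fin ge0_ler_powR ?nnegrE ?normC_ge0 ?Re_le_normC ?Im_le_normC//.
Qed.

Lemma LnormC_small d : 0 < d ->
  (pint p (fun x => complex.Re (F x)) <= (d `^ p / (2 `^ p * 2))%:E)%E ->
  (pint p (fun x => complex.Im (F x)) <= (d `^ p / (2 `^ p * 2))%:E)%E -> (LnormC p F <= d%:E)%E.
Proof.
move=> d0 h1 h2; have t0 : 0 < 2 `^ p :> R by rewrite powR_gt0.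
have N1 : (Npow p F <= (d `^ p)%:E)%E.
  apply: le_trans Npow_le _.
  have tE : (0 <= (2 `^ p : R)%:E)%E by rewrite lee_fin ltW.
  apply: le_trans (lee_wpmul2l tE (leeD h1 h2)) _; rewrite -EFinD -EFinM lee_fin.
  by move: t0; move: (2 `^ p : R) (d `^ p) => a b a0; apply: eq_ler; field; rewrite gt_eqF.
have Nf : Npow p F \is a fin_num by rewrite ge0_fin_numE ?Npow_ge0//; exact: le_lt_trans N1 (ltry _).
rewrite LnormCE -(fineK Nf) poweR_EFin lee_fin.
have -> : d = (d `^ p) `^ p^-1 by rewrite -powRrM mulfV// powRr1// ltW.
rewrite ge0_ler_powR ?nnegrE ?invr_ge0 ?powR_ge0//; first by rewrite fine_ge0 ?Npow_ge0.
by rewrite -lee_fin fineK.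
Qed.

End measurable_parts.
End complex_norms.

(** * The normalizing constant as an absolutely convergent integral *)

Section normalizing_constant.
Context {R : realType} (m l : nat).
Hypotheses (m0 : (0 < m)%N) (l_even : ~~ odd m.+1 -> l = m) (l_odd : odd m.+1 -> (m < l)%N).
Local Notation V := 'rV[R]_m.+1.

Let sinsum (t : R) : R := \sum_(j < l.+1) cf l j * sin (j%:R * t).

Lemma expiX (t : R) j : (expi t : R[i]) ^+ j = expi (j%:R * t).
Proof.
elim: j => [|j IH]; first by rewrite expr0 mul0r /expi cos0 sin0.
rewrite exprS IH -natr1 mulrDl mul1r addrC /expi cosD sinD.
by rewrite [LHS]/GRing.mul /=; congr (_ +i* _)%C; ring.
Qed.

Lemma one_sub_expi (t : R) : (1 - expi t : R[i]) ^+ l = (cosum l t +i* sinsum t)%C.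
Proof.
rewrite exprDn.
have e j : (1 ^+ (l - j) * (- expi t : R[i]) ^+ j) *+ 'C(l, j) = ((cf l j * cos (j%:R * t)) +i* (cf l j * sin (j%:R * t)))%C.
  rewrite expr1n mul1r exprNn expiX -mulr_natl mulrA.
  have -> : ('C(l, j)%:R * (-1) ^+ j : R[i]) = (cf l j)%:C%C by rewrite /cf rmorphM rmorphXn rmorphN1 rmorph_nat.
  by rewrite /expi [LHS]/GRing.mul /=; congr (_ +i* _)%C; ring.
under eq_bigr do rewrite e.
rewrite /cosum /sinsum; elim/big_ind3 : _ => // a1 a2 a3 b1 b2 b3 -> ->.
by [].
Qed.

Lemma Rint_outside (e : R) (F : V -> R) :
  \int[leb m.+1]_(y in outside e) F y = \int[leb m.+1]_y ((e < enorm y)%R%:R * F y).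
Proof.
rewrite Rintegral_mkcond; apply: eq_Rintegral => y _; rewrite patchE.
have [h|h] := boolP (e < enorm y); first by rewrite mem_set// mul1r.
by rewrite memNset ?mul0r//; apply/negP.
Qed.

Lemma integrable_outside (e : R) (F : V -> R) : mfun F ->
  finint (leb m.+1) (fun y => (e < enorm y)%R%:R * F y) ->
  (leb m.+1).-integrable (outside e) (EFin \o F).
Proof.
move=> mF fF; have mo : measurable (@outside R m.+1 e) by rewrite /outside; mt.
apply/(integrable_mkcond _ mo).
have mi : mfun (fun y : V => (e < enorm y)%R%:R * F y) by mt.
rewrite (_ : _ \_ _ = EFin \o (fun y : V => (e < enorm y)%R%:R * F y)); first exact: finint_integrable.
apply/funext => y; rewrite patchE /=.
have [h|h] := boolP (e < enorm y); first by rewrite mem_set// mul1r.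
by rewrite memNset ?mul0r//; apply/negP.
Qed.

Let q (y : V) : R := pw y * cosum l (y 0 ord0).

Let mq : mfun q.
Proof. by have h1 := @mf_pw R m; have h2 := @mf_cosum R l _ _ _ (@measurable_coord_rV R m.+1 ord0); rewrite /q; mt. Qed.

Let trunc_q (d : R) : 0 < d -> exists2 e0 : R, 0 < e0 & forall e, 0 < e < e0 ->
  `|\int[leb m.+1]_y ((e < enorm y)%R%:R * q y) - Dc m l| <= d.
Proof.
move=> d0.
have cv : \int[leb m.+1]_y ((e < enorm y)%R%:R * q y) @[e --> (0:R)^'+] --> (Dc m l : R).
  apply/cvg_at_rightP => u [u0 ucv].
  have mqn : mfun (fun y => `|q y|) by mt.
  have fqn : finint (leb m.+1) (fun y => `|q y|).
    have fq : finint (leb m.+1) q by exact: finint_cosum.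
    by apply: (finint_le mqn mq fq) => y; rewrite normr_id.
  apply: (Rint_dct (f_ := fun i y => (u i < enorm y)%R%:R * q y) _ mq mqn fqn).
  - by move=> i; mt.
  - by move=> i y; rewrite normrM normr_nat ler_piMl//; case: (_ < _).
  move=> y; have [->|y0] := eqVneq y 0.
    have -> : q 0 = 0 by rewrite /q /pw pw_exp enorm0 expr0n /= invr0 mul0r.
    by under eq_cvg do rewrite mulr0; exact: cvg_cst.
  have ey : 0 < enorm y by rewrite enorm_gt0.
  apply: cvg_near_cst; have /cvgrPdist_lt/(_ _ ey) := ucv; apply: filterS => i.
  by rewrite sub0r normrN gtr0_norm ?u0// => ->; rewrite mul1r.
have /cvgrPdist_le/(_ d d0)/nbhs_ballP[e0 /= e00 h] := cv.
exists e0 => // e /andP[h1 h2]; rewrite distrC; apply: h => //=.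
by rewrite /ball/= sub0r normrN gtr0_norm.
Qed.

(** At every truncation the imaginary part is odd in y and integrates to 0. The real part is
    dominated by the integrable [pw * |cosum|], so the limit is the integral over the whole
    space. *)
Lemma dconstE : dconst m l = (Dc m l : R)%:C%C.
Proof.
apply: (@cvg_lim (Cplx R)); first exact: norm_hausdorff.
apply: cvg_complex => d d0; have [e0 e00 he] := trunc_q d0; exists e0 => // e ee.
have E (y : V) : (1 - expi (y 0 ord0)) ^+ l * ((enorm y ^+ (2 * m.+1 - 1))^-1)%:C%C =
   ((pw y * cosum l (y 0 ord0)) +i* (pw y * sinsum (y 0 ord0)))%C :> R[i].
  rewrite one_sub_expi -/(pw y) [LHS]/GRing.mul /=; congr (_ +i* _)%C; ring.
apply: le_trans (normC_le _) _; rewrite /integralC !Rint_outside.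
under eq_Rintegral do rewrite E.
under [X in (_ +i* X)%C]eq_Rintegral do rewrite E.
have -> : \int[leb m.+1]_y ((e < enorm y)%R%:R * (pw y * sinsum (y 0 ord0))) = 0.
  have ms : mfun (fun y : V => (e < enorm y)%R%:R * (pw y * sinsum (y 0 ord0))).
    have h1 := @mf_pw R m.
    have h2 : mfun (fun y : V => sinsum (y 0 ord0)).
      by apply: measurable_sum => j; mt.
    by mt.
  have h : \int[leb m.+1]_y ((e < enorm y)%R%:R * (pw y * sinsum (y 0 ord0))) =
     -1 * \int[leb m.+1]_y ((e < enorm y)%R%:R * (pw y * sinsum (y 0 ord0))).
    rewrite -{1}(Rint_oppv ms) -(RintZ_total (leb m.+1) (-1) ms); apply: eq_Rintegral => y _.
    rewrite enormN pwN !mxE.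
    have -> : sinsum (- y 0 ord0) = - sinsum (y 0 ord0).
      by rewrite /sinsum -sumrN; apply: eq_bigr => j _; rewrite mulrN sinN mulrN.
    by rewrite mulN1r !mulrN.
  by move: h; move: (\int[_]_y _) => a h; lra.
rewrite /= oppr0 addr0 normr0 addr0; exact: he.
Qed.

End normalizing_constant.

Lemma pintZ {R : realType} n (p c : R) (f : 'rV[R]_n -> R) : mfun f ->
  (pint p (fun x => (c * f x)%R) = (`|c| `^ p)%:E * pint p f)%E.
Proof.
move=> mf; have m1 : mfun (fun x => (`|f x| `^ p)%:E) by mt.
have q1 x : (0 <= (`|f x| `^ p)%:E)%E by rewrite lee_fin powR_ge0.
have c0 : (0 <= (`|c| `^ p)%:E)%E by rewrite lee_fin powR_ge0.
rewrite /pint -(ge0_intZl (leb n) m1 q1 c0); apply: eq_integral => x _.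
by rewrite normrM powRM// EFinM.
Qed.

Lemma cf_complex {R : realType} l j : ('C(l, j)%:R * (-1) ^+ j : Cplx R) = (cf l j : R)%:C%C.
Proof. by rewrite /cf rmorphM rmorphXn rmorphN1 rmorph_nat. Qed.

(* The real and imaginary parts of the transforms are treated at once: P is Re or Im. *)
Section real_part.
Context {R : realType}.
Variable P : Cplx R -> R.
Hypothesis PD : forall a b, P (a + b) = P a + P b.
Hypothesis PZ : forall (r : R) a, P (r%:C%C * a) = r * P a.
Hypothesis PI : forall n (D : set 'rV[R]_n) F, P (integralC D F) = \int[leb n]_(x in D) P (F x).

Let P0 : P 0 = 0. Proof. by have := PZ 0 0; rewrite mulr0 mul0r. Qed.

Let PN a : P (- a) = - P a.
Proof. by apply/eqP; rewrite -addr_eq0 -PD addNr P0. Qed.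

Lemma part_radon m (f : 'rV[R]_m.+1 -> Cplx R) x :
  P (parabolic_radon f x) = real_radon (fun u => P (f u)) x.
Proof. exact: PI. Qed.

Lemma part_back m (F : 'rV[R]_m.+1 -> Cplx R) x :
  P (back_transform F x) = real_back (fun u => P (F u)) x.
Proof.
rewrite /back_transform PZ PI; congr (_ * _); apply: eq_Rintegral => z _.
by rewrite mulrC PZ mulrC.
Qed.

Lemma part_findiff n l (y : 'rV[R]_n) (g : 'rV[R]_n -> Cplx R) u :
  P (findiff l y g u) = \sum_(j < l.+1) cf l j * P (g (u - j%:R *: y)).
Proof.
rewrite /findiff (big_morph P PD P0); apply: eq_bigr => j _.
by rewrite cf_complex PZ.
Qed.

Lemma part_integrand m l (g : 'rV[R]_m.+1 -> Cplx R) e u y :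
  (e < enorm y)%R%:R * P (hyper_integrand l g u y) = real_trunc l (fun x => P (g x)) e u y.
Proof.
rewrite /hyper_integrand mulrC [X in P X]mulrC PZ part_findiff /real_trunc -/(pw y) -mulrA.
by rewrite mulrC.
Qed.

Lemma part_trunc m l (g : 'rV[R]_m.+1 -> Cplx R) e u :
  P (hyper_trunc l g e u) = \int[leb m.+1]_y real_trunc l (fun x => P (g x)) e u y.
Proof. by rewrite /hyper_trunc PI Rint_outside; apply: eq_Rintegral => y _; exact: part_integrand. Qed.

Section reconstruction.
Context {k l : nat}.
Hypothesis l_even : ~~ odd k.+2 -> l = k.+1.
Hypothesis l_odd : odd k.+2 -> (k.+1 < l)%N.
Local Notation n := k.+2.
Local Notation V := 'rV[R]_n.
Variables (p : R) (f phi : V -> Cplx R).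
Hypotheses (p1 : 1 <= p) (p_lt : p < n%:R / k.+1%:R).
Hypotheses (mf : mfun (fun u => P (f u))) (mphi : mfun (fun u => P (phi u))).
Hypothesis fp : (pint p (fun u => P (phi u)) < +oo)%E.
Hypothesis hphi : {ae leb n, forall u, f (pt (hd u) (lst u - enorm (hd u) ^+ 2)) = phi u}.
Let g := back_transform (parabolic_radon f).
Let h u := dconst k.+1 l * phi u.
Let fP u := P (f u).
Let phiP u := P (phi u).
Let gP := real_back (real_radon fP).

Let hphiP : {ae leb n, forall u, shear fP u = phiP u}.
Proof. by apply: filterS hphi => u; rewrite /shear /fP /phiP => ->. Qed.

Let gPE : (fun x => P (g x)) = gP.
Proof.
apply/funext => x; rewrite /g part_back /gP; congr (real_back _ x).
by apply/funext => u; exact: part_radon.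
Qed.

Let hPE u : P (h u) = Dc k.+1 l * phiP u.
Proof.
have hD : dconst k.+1 l = (Dc k.+1 l : R)%:C%C by exact: dconstE.
by rewrite /h hD PZ.
Qed.

Let truncE e u : P (hyper_trunc l g e u) = \int[leb n]_y real_trunc l gP e u y.
Proof. by rewrite part_trunc gPE. Qed.

Let diffE e u : P (hyper_trunc l g e u - h u) = \int[leb n]_y real_trunc l gP e u y - Dc k.+1 l * phiP u.
Proof. by rewrite PD PN truncE hPE. Qed.

Lemma part_mf_trunc e : mfun (fun u => P (hyper_trunc l g e u)).
Proof.
rewrite (_ : (fun _ => _) = (fun u => \int[leb n]_y real_trunc l gP e u y)); last exact/funext/truncE.
exact: mf_real_hyper.
Qed.

Lemma part_mf_h : mfun (fun u => P (h u)).
Proof.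
by rewrite (_ : (fun _ => _) = (fun u => Dc k.+1 l * P (phi u))); [mt|apply/funext/hPE].
Qed.

Lemma part_h_fin : (pint p (fun u => P (h u)) < +oo)%E.
Proof.
rewrite (_ : (fun _ => _) = (fun u => Dc k.+1 l * P (phi u))); last exact/funext/hPE.
by rewrite pintZ// lte_mul_pinfty// lee_fin powR_ge0.
Qed.

Lemma part_diff_Lp : (forall e, 0 < e -> (pint p (fun u => P (hyper_trunc l g e u - h u)) < +oo)%E) /\
  forall d : R, 0 < d -> exists2 e0 : R, 0 < e0 & forall e, 0 < e < e0 ->
    (pint p (fun u => P (hyper_trunc l g e u - h u)) <= d%:E)%E.
Proof.
have E e : (fun u => P (hyper_trunc l g e u - h u)) = (fun u => \int[leb n]_y real_trunc l gP e u y - Dc k.+1 l * phiP u).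
  exact/funext/diffE.
have [h1 h2] := real_hyper_Lp l_even l_odd p1 p_lt mf mphi fp hphiP.
split=> [e e0|d d0]; first by rewrite E; exact: h1.
by have [e0 e00 he] := h2 d d0; exists e0; first exact: e00; move=> e ee; rewrite E; exact: he.
Qed.

Lemma part_trunc_fin e : 0 < e -> (pint p (fun u => P (hyper_trunc l g e u)) < +oo)%E.
Proof.
move=> e0; have [h1 _] := part_diff_Lp.
have p0 : 0 <= p by apply: le_trans p1.
have m1 := part_mf_trunc e; have m2 := part_mf_h.
have m3 : mfun (fun u => P (hyper_trunc l g e u - h u)).
  by rewrite (_ : (fun _ => _) = (fun u => P (hyper_trunc l g e u) - P (h u))); [mt|apply/funext => u; rewrite PD PN].
have -> : (fun u => P (hyper_trunc l g e u)) = (fun u => P (hyper_trunc l g e u - h u) + P (h u)).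
  by apply/funext => u; rewrite -PD subrK.
apply: le_lt_trans (pint_leD p0 m3 m2) _.
apply: lte_mul_pinfty; [by rewrite lee_fin powR_ge0|by []|].
by apply: lte_add_pinfty; [exact: h1|exact: part_h_fin].
Qed.

Let integrand_integrable u e : finint (leb n) (real_trunc l gP e u) ->
  (leb n).-integrable (outside e) (EFin \o (fun y => P (hyper_integrand l g u y))).
Proof.
move=> fT; have mT := mf_real_trunc_y (l := l) mf e u.
have E : (fun y => P (hyper_integrand l g u y)) = (fun y => pw y * \sum_(j < l.+1) cf l j * gP (u - j%:R *: y)).
  by apply/funext => y; rewrite /hyper_integrand mulrC PZ part_findiff -gPE.
apply: integrable_outside.
  rewrite E; have mg : mfun gP by exact: mf_real_back (mf_real_radon mf).
  apply: mf_mulr; first exact: mf_pw.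
  apply: measurable_sum => j.
  have h3 : mfun (fun y : V => u - j%:R *: y) by mt.
  have h2 := measurableT_comp mg h3; by mt.
rewrite (_ : (fun y => _) = real_trunc l gP e u)//.
by apply/funext => y; rewrite part_integrand gPE.
Qed.

Lemma part_ae : {ae leb n, forall u,
  (forall e, 0 < e -> (leb n).-integrable (outside e) (EFin \o (fun y => P (hyper_integrand l g u y)))) /\
  forall d : R, 0 < d -> exists2 e0 : R, 0 < e0 & forall e, 0 < e < e0 ->
    `|P (hyper_trunc l g e u - h u)| <= d}.
Proof.
apply: filterS (real_hyper_ae l_even l_odd p1 p_lt mf mphi fp hphiP) => u [h1 h2].
split=> [e e0|d d0]; first exact/integrand_integrable/h1.
by have [e0 e00 he] := h2 d d0; exists e0; first exact: e00; move=> e ee; rewrite diffE; exact: he.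
Qed.

Lemma part_sup (M : R) : (forall x, `|P (phi x)| <= M) ->
  (forall d : R, 0 < d -> exists2 t : R, 0 < t & forall x y : V, enorm y < t -> `|P (phi (x - y)) - P (phi x)| <= d) ->
  (forall u e, 0 < e -> (leb n).-integrable (outside e) (EFin \o (fun y => P (hyper_integrand l g u y)))) /\
  forall d : R, 0 < d -> exists2 e0 : R, 0 < e0 & forall e u, 0 < e < e0 ->
    `|P (hyper_trunc l g e u - h u)| <= d.
Proof.
move=> hM uc; have [h1 h2] := real_hyper_sup l_even l_odd p1 p_lt mf mphi fp hphiP hM uc.
split=> [u e e0|d d0]; first exact/integrand_integrable/h1.
by have [e0 e00 he] := h2 d d0; exists e0; first exact: e00; move=> e u ee; rewrite diffE; exact: he.
Qed.

End reconstruction.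
End real_part.

(** * Assembly of the real and imaginary parts *)

Section complex_reconstruction.
Context {R : realType} {k l : nat}.
Hypothesis l_even : ~~ odd k.+2 -> l = k.+1.
Hypothesis l_odd : odd k.+2 -> (k.+1 < l)%N.
Local Notation n := k.+2.
Local Notation V := 'rV[R]_n.
Local Notation Re := (@complex.Re R).
Local Notation Im := (@complex.Im R).

Let ReD (a b : Cplx R) : Re (a + b) = Re a + Re b. Proof. by case: a; case: b. Qed.
Let ImD (a b : Cplx R) : Im (a + b) = Im a + Im b. Proof. by case: a; case: b. Qed.
Let ReZ (r : R) (a : Cplx R) : Re (r%:C%C * a) = r * Re a.
Proof. by case: a => x y; rewrite [_ * _]/GRing.mul /= mul0r subr0. Qed.
Let ImZ (r : R) (a : Cplx R) : Im (r%:C%C * a) = r * Im a.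
Proof. by case: a => x y; rewrite [_ * _]/GRing.mul /= mul0r addr0. Qed.
Let ReI n' (D : set 'rV[R]_n') F : Re (integralC D F) = \int[leb n']_(x in D) Re (F x). Proof. by []. Qed.
Let ImI n' (D : set 'rV[R]_n') F : Im (integralC D F) = \int[leb n']_(x in D) Im (F x). Proof. by []. Qed.

Variables (p : R) (f phi : V -> Cplx R).
Hypotheses (p1 : 1 <= p) (p_lt : p < n%:R / k.+1%:R).
Hypotheses (f_Lp : in_Lp p f) (phi_Lp : in_Lp p phi).
Hypothesis hphi : {ae leb n, forall u, f (pt (hd u) (lst u - enorm (hd u) ^+ 2)) = phi u}.
Let g := back_transform (parabolic_radon f).
Let h u := dconst k.+1 l * phi u.

Let mfR : mfun (fun u => Re (f u)). Proof. by case: f_Lp. Qed.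
Let mfI : mfun (fun u => Im (f u)). Proof. by case: f_Lp. Qed.
Let mphR : mfun (fun u => Re (phi u)). Proof. by case: phi_Lp. Qed.
Let mphI : mfun (fun u => Im (phi u)). Proof. by case: phi_Lp. Qed.
Let fpR : (pint p (fun u => Re (phi u)) < +oo)%E. Proof. exact: (proj1 (in_Lp_elim p1 mphR mphI phi_Lp)). Qed.
Let fpI : (pint p (fun u => Im (phi u)) < +oo)%E. Proof. exact: (proj2 (in_Lp_elim p1 mphR mphI phi_Lp)). Qed.

Let mTR e : mfun (fun u => Re (hyper_trunc l g e u)).
Proof. exact: (part_mf_trunc ReD ReZ ReI). Qed.
Let mTI e : mfun (fun u => Im (hyper_trunc l g e u)).
Proof. exact: (part_mf_trunc ImD ImZ ImI). Qed.
Let mhR : mfun (fun u => Re (h u)).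
Proof. exact: (part_mf_h ReZ). Qed.
Let mhI : mfun (fun u => Im (h u)).
Proof. exact: (part_mf_h ImZ). Qed.

Lemma Lp_reconstruction : Lp_limit l p g h.
Proof.
have [R1 R2] := part_diff_Lp ReD ReZ ReI l_even l_odd p1 p_lt mfR mphR fpR hphi.
have [I1 I2] := part_diff_Lp ImD ImZ ImI l_even l_odd p1 p_lt mfI mphI fpI hphi.
split.
- apply: (in_Lp_intro p1 mhR mhI); first exact: (part_h_fin ReZ l_even l_odd mphR fpR).
  exact: (part_h_fin ImZ l_even l_odd mphI fpI).
- move=> e e0; apply: (in_Lp_intro p1 (mTR e) (mTI e)).
    exact: (part_trunc_fin ReD ReZ ReI l_even l_odd p1 p_lt mfR mphR fpR hphi e0).
  exact: (part_trunc_fin ImD ImZ ImI l_even l_odd p1 p_lt mfI mphI fpI hphi e0).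
apply: cvg0_ereal => [e _|d d0]; first exact: Lnorm_ge0.
have s0 : 0 < d `^ p / (2 `^ p * 2) by rewrite divr_gt0 ?mulr_gt0 ?powR_gt0.
have [e1 e10 h1] := R2 _ s0; have [e2 e20 h2] := I2 _ s0.
exists (Num.min e1 e2) => [|e]; first by rewrite lt_min e10.
rewrite lt_min => /and3P[e0 ee1 ee2].
have mdR : mfun (fun u => Re (hyper_trunc l g e u - h u)).
  rewrite (_ : (fun _ => _) = (fun u => Re (hyper_trunc l g e u) - Re (h u))).
    exact: measurable_funB (mTR e) mhR.
  by apply/funext => u; case: (hyper_trunc _ _ _ _) => a b; case: (h u).
have mdI : mfun (fun u => Im (hyper_trunc l g e u - h u)).
  rewrite (_ : (fun _ => _) = (fun u => Im (hyper_trunc l g e u) - Im (h u))).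
    exact: measurable_funB (mTI e) mhI.
  by apply/funext => u; case: (hyper_trunc _ _ _ _) => a b; case: (h u).
by apply: (LnormC_small p1 mdR mdI d0); [apply: h1; rewrite e0|apply: h2; rewrite e0].
Qed.

Let small_sum (x : R -> Cplx R) :
  (forall d : R, 0 < d -> exists2 e0 : R, 0 < e0 & forall e, 0 < e < e0 -> `|Re (x e)| <= d) ->
  (forall d : R, 0 < d -> exists2 e0 : R, 0 < e0 & forall e, 0 < e < e0 -> `|Im (x e)| <= d) ->
  forall d : R, 0 < d -> exists2 e0 : R, 0 < e0 & forall e, 0 < e < e0 -> normC (x e) <= d.
Proof.
move=> hR hI d d0; have d20 : 0 < d / 2 by rewrite divr_gt0.
have [e1 e10 h1] := hR _ d20; have [e2 e20 h2] := hI _ d20.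
exists (Num.min e1 e2) => [|e]; first by rewrite lt_min e10.
rewrite lt_min => /and3P[e0 ee1 ee2]; apply: le_trans (normC_le _) _.
have a := h1 e; have b := h2 e; rewrite e0 ee1 in a; rewrite e0 ee2 in b.
by have := a isT; have := b isT; lra.
Qed.

Lemma ae_reconstruction : ae_limit l g h.
Proof.
have hR := part_ae ReD ReZ ReI l_even l_odd p1 p_lt mfR mphR fpR hphi.
have hI := part_ae ImD ImZ ImI l_even l_odd p1 p_lt mfI mphI fpI hphi.
apply: filterS2 hR hI => u [R1 R2] [I1 I2]; split.
  by move=> e e0; split; [exact: R1|exact: I1].
exact: cvg_complex (small_sum R2 I2).
Qed.

(** The shear of parameter 1 undoes the one that defines phi, and [Dc_neq0] permits the division. *)
Lemma inversion_ae : {ae leb n, forall x,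
  f x = (dconst k.+1 l)^-1 * h (pt (hd x) (lst x + enorm (hd x) ^+ 2))}.
Proof.
apply: filterS (ae_shear 1 hphi) => x; rewrite /shear_map mul1r hd_pt lst_pt addrK pt_hd_lst => ->.
have hD : dconst k.+1 l = (Dc k.+1 l : R)%:C%C by exact: dconstE.
rewrite /h mulKf// hD; apply/eqP => /(congr1 Re) /= e.
by have := @Dc_neq0 R k.+1 l isT l_even l_odd; rewrite e eqxx.
Qed.

Let C0_part (P : Cplx R -> R) : (forall a b, P (a - b) = P a - P b) -> (forall a, `|P a| <= normC a) ->
  in_C0 phi -> (exists M : R, forall x, `|P (phi x)| <= M) /\
  forall d : R, 0 < d -> exists2 t : R, 0 < t & forall x y : V, enorm y < t -> `|P (phi (x - y)) - P (phi x)| <= d.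
Proof.
move=> PB Pn [cphi vphi].
have cPat (w : Cplx R) : P z @[z --> w] --> P w.
  move=> A /nbhs_ballP[d /= d0 hA]; apply/nbhs_ballP; exists (d%:C%C : Cplx R) => [|z].
    by rewrite /= (@ltcR R 0 d).
  move=> hz; have {}hz : `|w - z| < d%:C%C by exact: hz.
  rewrite normrC (@ltcR R) in hz; apply: hA.
  suff : `|P w - P z| < d by [].
  rewrite -PB; exact: le_lt_trans (Pn _) hz.
have cP : continuous (fun x => P (phi x)).
  by move=> x A hA; exact: (@cphi x (P @^-1` A) (cPat (phi x) A hA)).
have vP e : 0 < e -> exists M : R, forall x, M < enorm x -> `|P (phi x)| < e.
  move=> e0; have [M hM] := vphi e e0; exists M => x xM.
  exact: le_lt_trans (Pn _) (hM x xM).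
by split=> [|d d0]; [exact: C0_bounded cP vP|exact: C0_unif_cont cP vP d d0].
Qed.

Lemma sup_reconstruction : in_C0 phi -> sup_limit l g h.
Proof.
move=> c0.
have ReB (a b : Cplx R) : Re (a - b) = Re a - Re b by case: a; case: b.
have ImB (a b : Cplx R) : Im (a - b) = Im a - Im b by case: a; case: b.
have [[M1 b1] u1] := C0_part ReB (@Re_le_normC R) c0.
have [[M2 b2] u2] := C0_part ImB (@Im_le_normC R) c0.
have [R1 R2] := part_sup ReD ReZ ReI l_even l_odd p1 p_lt mfR mphR fpR hphi b1 u1.
have [I1 I2] := part_sup ImD ImZ ImI l_even l_odd p1 p_lt mfI mphI fpI hphi b2 u2.
split; first by move=> u e e0; split; [exact: R1|exact: I1].
apply: cvg0_ereal => [e _|d d0].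
  apply: (@le_trans _ _ (normC (hyper_trunc l g e 0 - h 0))%:E); first by rewrite lee_fin normC_ge0.
  by apply: ereal_sup_ubound; exists 0.
have d20 : 0 < d / 2 by rewrite divr_gt0.
have [e1 e10 h1] := R2 _ d20; have [e2 e20 h2] := I2 _ d20.
exists (Num.min e1 e2) => [|e]; first by rewrite lt_min e10.
rewrite lt_min => /and3P[e0 ee1 ee2]; apply: ge_ereal_sup => _ [u _ <-].
rewrite lee_fin; apply: le_trans (normC_le _) _.
have a := h1 e u; have b := h2 e u; rewrite e0 ee1 in a; rewrite e0 ee2 in b.
by have := a isT; have := b isT; lra.
Qed.

End complex_reconstruction.

Lemma in_Lp_shear {R : realType} m (p : R) (f : 'rV[R]_m.+1 -> Cplx R) : 1 <= p -> in_Lp p f ->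
  in_Lp p (fun u => f (pt (hd u) (lst u - enorm (hd u) ^+ 2))).
Proof.
move=> p1 fL; have [mR mI _] := fL; have [fR fI] := in_Lp_elim p1 mR mI fL.
have E (P : Cplx R -> R) : mfun (fun u => P (f u)) -> pint p (shear (fun u => P (f u))) = pint p (fun u => P (f u)).
  move=> mP; have mq : mfun (fun u => (`|P (f u)| `^ p)%:E) by mt.
  have q0 u : (0 <= (`|P (f u)| `^ p)%:E)%E by rewrite lee_fin powR_ge0.
  rewrite -[RHS](integral_shear (-1) mq q0); apply: eq_integral => u _.
  by rewrite /shear /shear_map mulN1r.
apply: (in_Lp_intro p1 (mf_shear mR) (mf_shear mI)).
  exact: (eq_ind_r (fun a => (a < +oo)%E) fR (E (@complex.Re R) mR)).
exact: (eq_ind_r (fun a => (a < +oo)%E) fI (E (@complex.Im R) mI)).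
Qed.

(* n = m.+1 >= 2, so m = n - 1 *)
Theorem theorem3p4 (R : realType) (m : nat) (m_gt0 : (0 < m)%N)
    (p : R) (p_ge1 : 1 <= p) (p_lt : p < m.+1%:R / m%:R)
    (l : nat) (l_even : ~~ odd m.+1 -> l = m) (l_odd : odd m.+1 -> (m < l)%N)
    (f : 'rV[R]_m.+1 -> Cplx R) (f_Lp : in_Lp p f) :
  let F := parabolic_radon f in
  let g := back_transform F in
  let psi := fun u => f (pt (hd u) (lst u - enorm (hd u) ^+ 2)) in
  let reconstructs := fun h : 'rV[R]_m.+1 -> Cplx R =>
    [/\ Lp_limit l p g h,
        ae_limit l g h &
        {ae leb m.+1, forall x,
          f x = (dconst m l)^-1 * h (pt (hd x) (lst x + enorm (hd x) ^+ 2))}] in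
  (exists h, reconstructs h) /\
  ((exists phi : 'rV[R]_m.+1 -> Cplx R,
      [/\ in_C0 phi, in_Lp p phi & {ae leb m.+1, forall u, psi u = phi u}]) ->
   exists h, reconstructs h /\ sup_limit l g h).
Proof.
case: m m_gt0 p_lt l_even l_odd f f_Lp => // k _ p_lt l_even l_odd f f_Lp F g psi reconstructs.
have recon phi : in_Lp p phi -> {ae leb k.+2, forall u, psi u = phi u} ->
    reconstructs (fun u => dconst k.+1 l * phi u).
  move=> phi_Lp hphi; split.
  - exact: (Lp_reconstruction l_even l_odd p_ge1 p_lt f_Lp phi_Lp hphi).
  - exact: (ae_reconstruction l_even l_odd p_ge1 p_lt f_Lp phi_Lp hphi).
  - exact: (inversion_ae l_even l_odd hphi).
split.
  (* The sheared function is its own representative here; the second claim uses the continuous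
     one. *)
  by eexists; apply: (recon psi); [exact: in_Lp_shear|exact: aeW].
move=> [phi [phi_C0 phi_Lp hphi]]; eexists; split; first exact: (recon phi).
exact: (sup_reconstruction l_even l_odd p_ge1 p_lt f_Lp phi_Lp hphi phi_C0).
Qed.
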